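(* Under the standing assumptions below, let $\bar A$ be the constant matrix $\bar A=(\bar a_{mn})$ defined below. Then there exists a unique constant $\bar g\in\mathbb R$ such that $u^\varepsilon\to\bar u$ uniformly on $\overline{\Sigma^1}$ as $\varepsilon\to0$, where $\bar u$ is the unique affine function solving $$\operatorname{Tr}(\bar A D^2\bar u)=0 \text{ in } \Sigma^1,\qquad \bar u=0 \text{ on } \Sigma_1,\qquad \partial_n\bar u=\bar g \text{ on } \Sigma_0.$$
   Context: Let $d\ge1$ and let $n\in\mathbb R^{d+1}$ be a unit vector which is an irrational direction (not a real multiple of any vector of $\mathbb Z^{d+1}$). For $r>0$ let $\Sigma^r=\{x\in\mathbb R^{d+1}:0<x\cdot n<r\}$, $\Sigma_r=\{x: x\cdot n=r\}$, $\Sigma_0=\{x:x\cdot n=0\}$; $\partial_n=n\cdot\nabla$. Fix $\gamma\in(0,1)$ and $0<\lambda\le\Lambda$. $A:\mathbb R^{d+1}\to$ symmetric $(d+1)\times(d+1)$ matrices is $\mathbb Z^{d+1}$-periodic, $C^\gamma$, with $\lambda I\le A(x)\le\Lambda I$; $B:\mathbb R^{d+1}\to\mathbb R^{d+1}$ and $g:\mathbb R^{d+1}\to\mathbb R$ are $\mathbb Z^{d+1}$-periodic and $C^\gamma$. Let $L\phi(y)=\operatorname{Tr}(A(y)D^2\phi(y))+B(y)\cdot\nabla\phi(y)$. Let $m\in L^2([0,1]^{d+1})$ be the unique $\mathbb Z^{d+1}$-periodic function with $m>0$, $\int_{[0,1]^{d+1}}m=1$, and $\int_{[0,1]^{d+1}}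 m\,L\phi\,dy=0$ for all periodic $\phi\in C^2\cap L^\infty$ (the invariant measure). Assume the centering condition $\int_{[0,1]^{d+1}}B(y)m(y)\,dy=0$. For $l=1,\dots,d+1$, let $\chi^l$ be a periodic solution of $L\chi^l=-B^l$, and define $$\bar a_{mn}=\int_{[0,1]^{d+1}}\Big(A_{mn}+A_{pm}\partial_{y_p}\chi^n+A_{pn}\partial_{y_p}\chi^m+\tfrac12(B^m\chi^n+B^n\chi^m)\Big)m\,dy$$ (summation over $p$). For $\varepsilon>0$, $u^\varepsilon$ is the unique bounded classical solution of $\operatorname{Tr}(A(x/\varepsilon)D^2u^\varepsilon)+\frac1\varepsilon B(x/\varepsilon)\cdot\nabla u^\varepsilon=0$ in $\Sigma^1$, $u^\varepsilon=0$ on $\Sigma_1$, $\partial_nu^\varepsilon(x)=g(x/\varepsilon)$ on $\Sigma_0$. *)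

(* Defs.v *)
From HB Require Import structures.
From mathcomp Require Import all_boot all_order all_algebra.
From mathcomp Require Import all_classical all_reals all_analysis.
Set Implicit Arguments. Unset Strict Implicit. Unset Printing Implicit Defensive.
Import Order.TTheory GRing.Theory Num.Theory.
Import numFieldNormedType.Exports.
Local Open Scope classical_set_scope.
Local Open Scope ring_scope.

Section Defs.
Variables (R : realType) (N : nat).
Notation V := 'rV[R]_N.

Definition evec (i : 'I_N) : V := delta_mx 0 i.

Definition dot (x y : V) : R := \sum_(i < N) x 0 i * y 0 i.

Definition RnB := g_sigma_algebraType (@open V).

Definition box (a b : V) : set V := [set x | forall i, a 0 i <= x 0 i <= b 0 i].

Definition cube : set V := box 0 (const_mx 1).

(** [lebm] is (d+1)-dimensional Lebesgue measure on the Borel sets: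
    it gives every closed box its volume (this determines it uniquely). *)
Definition is_lebesgue (lebm : {measure set RnB -> \bar R}) : Prop :=
  forall a b : V, (forall i, a 0 i <= b 0 i) ->
    lebm (box a b : set RnB) = (\prod_(i < N) (b 0 i - a 0 i))%:E.

Definition zperiodic (T : Type) (f : V -> T) : Prop :=
  forall x i, f (x + evec i) = f x.

Definition holder (gam : R) (f : V -> R) : Prop :=
  exists C : R, forall x y, `|f x - f y| <= C * (`|x - y| `^ gam).

Definition pd (i : 'I_N) (f : V -> R) : V -> R := fun x => 'D_(evec i) f x.

Definition C2_on (U : set V) (f : V -> R) : Prop :=
  (forall x, U x -> differentiable f x /\ forall i, differentiable (pd i f) x) /\
  (forall i j, {within U, continuous (pd j (pd i f))}).

Definition Lop (A : V -> 'M[R]_N) (B : V -> V) (phi : V -> R) : V -> R :=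
  fun y => \sum_(i < N) \sum_(j < N) A y i j * pd i (pd j phi) y
           + \sum_(i < N) B y 0 i * pd i phi y.

Definition normal_deriv_eq (n : V) (f : V -> R) (x : V) (v : R) : Prop :=
  (fun t : R => (f (x + t *: n) - f x) / t) @ at_right 0 --> v.

Definition slab (n : V) (r : R) : set V := [set x | 0 < dot x n < r].
Definition cslab (n : V) (r : R) : set V := [set x | 0 <= dot x n <= r].
Definition hplane (n : V) (r : R) : set V := [set x | dot x n = r].

Definition bdd_classical_sol (n : V) (Ae : V -> 'M[R]_N) (Be : V -> V)
    (ge : V -> R) (u : V -> R) : Prop :=
  C2_on (slab n 1) u /\
  {within cslab n 1, continuous u} /\
  (exists M : R, forall x, cslab n 1 x -> `|u x| <= M) /\
  (forall x, slab n 1 x -> Lop Ae Be u x = 0) /\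
  (forall x, hplane n 1 x -> u x = 0) /\
  (forall x, hplane n 0 x -> normal_deriv_eq n u x (ge x)).

Definition affine (f : V -> R) : Prop :=
  exists (c : R) (p : V), forall x, f x = c + dot p x.

End Defs.

(* Main.v *)
Require Import Defs.
From HB Require Import structures.
From mathcomp Require Import all_boot all_order all_algebra.
From mathcomp Require Import all_classical all_reals all_analysis.
From mathcomp Require Import zify ring lra.
Import Order.TTheory GRing.Theory Num.Theory.
Import numFieldNormedType.Exports.
Local Open Scope classical_set_scope.
Local Open Scope ring_scope.

(** Set [w_r y := r * u (1/r) (y / r)]: the coefficients and [g] now live at unit scale, on the
    strip [0 <= y.n <= r], and since the limit is affine it suffices to find [c] with
    [w_r y = c (r - y.n) + o(r)].  The correctors give functions [X l] with [L (X l) = 0] at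
    bounded distance from the coordinates, hence a solution [h] at bounded distance from [y.n]; the
    maximum principle with barriers built on [h] compares different scales and reduces everything
    to one claim: the oscillation of [w_r] over the hyperplane [y.n = 0] is [o(r)] along a sequence
    of scales [r].

    As [n] is irrational, Dirichlet's theorem provides [T] arbitrarily large such that every vector
    is within [C T] of an integer vector [k] whose excess height is positive and at most [C / T].
    Let [r = N T].
    - Translation by such a nearly tangential [k] changes [w_r] by at most [eta r]: perturb
      [w (. + k) - w] by a small multiple of [w^2] and look at a contact point on the hyperplane;
      the Harnack inequality bounds the oscillation of [w] around it by a smaller power of [r],
      and boundary regularity then shows that the normal derivative of [w (. + k) - w] there is
      small, which contradicts the slope of the barrier.
    - At height comparable to [T], an interior estimate for the increments [w (. + j) - w], [j]
      integer, absorbs the remaining displacement [O(T)].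
    The regularity estimates (Lipschitz, Harnack, boundary [C^1]) are obtained from the maximum
    principle alone, by doubling and quadrupling of variables. *)

(** * Euclidean structure and quadratic forms *)

(** The delicate point is the translation by [k]. Its height is of order [1 / r] while [|w|] is of
    order [r], so boundary regularity of the gradient with Hölder exponent [al] leaves a normal
    derivative of size [r ^ (1 - al)] at that height. The term in [w ^ 2] improves this: its
    coefficient is of order [1 / r], Harnack bounds [(w - w y0) ^ 2 / r] by [r ^ (1 - al)], hence
    the oscillation of [w] near the contact point by [r ^ (1 - al / 2)], and a second use of
    boundary regularity leaves [r ^ (1 - 3 al / 2)], which tends to 0 only if [al > 2 / 3]. This is
    why the boundary estimate is proved with exponent [3 / 4], by means of the concave penalty
    [|z| ^ (7 / 8)], and why [z = r ^ (1 / 8)] is used: the successive sizes are then [z ^ 8],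
    [z ^ 2], [z ^ 5] and [1 / z]. Additive constants in the comparisons are harmless since
    everything is measured against [r]; hence a solution [h] at bounded distance from the height can
    replace the height. The equation is used only through pointwise second-order expansions. *)

Section DotProduct.
Context {R : realType} {D : nat}.
Local Notation V := 'rV[R]_D.
Implicit Types (x y z : V) (a : R).

Lemma dotC x y : dot x y = dot y x.
Proof. by apply: eq_bigr => i _; rewrite mulrC. Qed.

Lemma dotDl x y z : dot (x + y) z = dot x z + dot y z.
Proof. by rewrite -big_split; apply: eq_bigr => i _; rewrite mxE mulrDl. Qed.

Lemma dotZl a x y : dot (a *: x) y = a * dot x y.
Proof. by rewrite mulr_sumr; apply: eq_bigr => i _; rewrite mxE mulrA. Qed.

Lemma dotNl x y : dot (- x) y = - dot x y.
Proof. by rewrite -scaleN1r dotZl mulN1r. Qed.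

Lemma dotDr x y z : dot x (y + z) = dot x y + dot x z.
Proof. by rewrite dotC dotDl !(dotC x). Qed.

Lemma dotZr a x y : dot x (a *: y) = a * dot x y.
Proof. by rewrite dotC dotZl dotC. Qed.

Lemma dotNr x y : dot x (- y) = - dot x y.
Proof. by rewrite dotC dotNl dotC. Qed.

Lemma dot0l x : dot 0 x = 0.
Proof. by rewrite -(scale0r x) dotZl mul0r. Qed.

Lemma dot0r x : dot x 0 = 0.
Proof. by rewrite dotC dot0l. Qed.

Definition dotE := (dotDl, dotDr, dotZl, dotZr, dotNl, dotNr, dot0l, dot0r).

Lemma dotxx_ge0 x : 0 <= dot x x.
Proof. by apply: sumr_ge0 => i _; rewrite -expr2 sqr_ge0. Qed.

Lemma dotxx_eq0 x : dot x x = 0 -> x = 0.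
Proof.
move=> /eqP; rewrite psumr_eq0; last by move=> i _; rewrite -expr2 sqr_ge0.
move=> /allP h; apply/rowP => i; rewrite mxE.
by have := h i (mem_index_enum i); rewrite /= -expr2 sqrf_eq0 => /eqP.
Qed.

Lemma dot_CS x y : dot x y ^+ 2 <= dot x x * dot y y.
Proof.
have [y0|y0] := eqVneq (dot y y) 0.
  by rewrite y0 (dotxx_eq0 _ y0) dot0r expr0n mulr0.
have yp : 0 < dot y y by rewrite lt_def y0 dotxx_ge0.
have := dotxx_ge0 (dot y y *: x - dot x y *: y).
rewrite !dotE (dotC y x) => h.
have : 0 <= dot y y * (dot x x * dot y y - dot x y ^+ 2) by nra.
by rewrite pmulr_rge0 // subr_ge0.
Qed.

Lemma dot_evec x (i : 'I_D) : dot x (evec R i) = x 0 i.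
Proof.
rewrite /dot (bigD1 i) //= big1 ?addr0; first by rewrite !mxE !eqxx mulr1.
by move=> j ji; rewrite !mxE (negbTE ji) andbF mulr0.
Qed.

Lemma evec_unit (i : 'I_D) : dot (evec R i) (evec R i) = 1.
Proof. by rewrite dot_evec !mxE !eqxx. Qed.

Lemma rV_sum_evec x : x = \sum_(i < D) x 0 i *: evec R i.
Proof. exact: row_sum_delta. Qed.

(** The norm available on row vectors is the maximum norm, whereas ellipticity and radial functions
    call for the Euclidean one; [norm_le_en] and [en_le_norm] convert. *)
Definition en x : R := Num.sqrt (dot x x).

Lemma en_ge0 x : 0 <= en x.
Proof. exact: sqrtr_ge0. Qed.

Lemma en_sq x : en x ^+ 2 = dot x x.
Proof. by rewrite sqr_sqrtr ?dotxx_ge0. Qed.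

Lemma en0 : en 0 = 0.
Proof. by rewrite /en dot0l sqrtr0. Qed.

Lemma en_eq0 x : en x = 0 -> x = 0.
Proof. by move=> h; apply: dotxx_eq0; rewrite -en_sq h expr0n. Qed.

Lemma enZ a x : en (a *: x) = `|a| * en x.
Proof. by rewrite /en !dotE mulrA -expr2 sqrtrM ?sqr_ge0 // sqrtr_sqr. Qed.

Lemma enN x : en (- x) = en x.
Proof. by rewrite /en !dotE opprK. Qed.

Lemma en_subC x y : en (x - y) = en (y - x).
Proof. by rewrite -enN opprB. Qed.

Lemma dot_le_en x y : `|dot x y| <= en x * en y.
Proof.
rewrite -(@ler_pXn2r _ 2) ?nnegrE ?normr_ge0 ?mulr_ge0 ?en_ge0 //.
by rewrite real_normK ?num_real // exprMn !en_sq dot_CS.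
Qed.

Lemma en_triangle x y : en (x + y) <= en x + en y.
Proof.
rewrite -(@ler_pXn2r _ 2) ?nnegrE ?addr_ge0 ?en_ge0 //.
rewrite en_sq !dotE sqrrD !en_sq (dotC y x).
have := le_trans (ler_norm _) (dot_le_en x y); lra.
Qed.

Lemma en_sub_triangle x y z : en (x - z) <= en (x - y) + en (y - z).
Proof. by have := en_triangle (x - y) (y - z); rewrite addrA subrK. Qed.

Lemma ler_en_dist x y : `|en x - en y| <= en (x - y).
Proof.
rewrite ler_norml; apply/andP; split.
  have := en_triangle (y - x) x; rewrite subrK en_subC; lra.
have := en_triangle (x - y) y; rewrite subrK; lra.
Qed.

Lemma en_lt x a : 0 <= a -> (en x < a) = (dot x x < a ^+ 2).
Proof. by move=> a0; rewrite -en_sq ltr_pXn2r ?nnegrE ?en_ge0. Qed.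

Lemma en_le x a : 0 <= a -> (en x <= a) = (dot x x <= a ^+ 2).
Proof. by move=> a0; rewrite -en_sq ler_pXn2r ?nnegrE ?en_ge0. Qed.

Lemma coord_le_en x (i : 'I_D) : `|x 0 i| <= en x.
Proof.
by have := dot_le_en x (evec R i); rewrite dot_evec {2}/en evec_unit sqrtr1 mulr1.
Qed.

Lemma norm_le_en x : `|x| <= en x.
Proof.
have [h0|] := boolP (mx_norm x == 0); first by rewrite [leLHS](eqP h0) en_ge0.
move=> /mx_norm_neq0 [[i j] h].
have {h}-> : `|x| = `|x i j| := h.
by rewrite (ord1 i) coord_le_en.
Qed.

Lemma coord_le_norm x (i : 'I_D) : `|x 0 i| <= `|x|.
Proof.
have -> : `|x| = mx_norm x by []. 
by rewrite mx_normrE; apply/bigmax_geP; right => /=; exists (0, i).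
Qed.

Lemma en_le_norm x : en x <= D%:R * `|x|.
Proof.
rewrite en_le ?mulr_ge0 //; apply: (@le_trans _ _ (\sum_(i < D) `|x| ^+ 2)).
  apply: ler_sum => i _; rewrite -expr2 -real_normK ?num_real //.
  by rewrite ler_pXn2r ?nnegrE ?normr_ge0 // coord_le_norm.
rewrite sumr_const card_ord -[leLHS]mulr_natl exprMn ler_wpM2r ?sqr_ge0 //.
by rewrite -natrX ler_nat; case: (D) => // k; rewrite expnS leq_pmulr.
Qed.

Definition qf (H : 'M[R]_D) (z : V) : R := (z *m H *m z^T) 0 0.
(** This is [Tr(A^T H)], so [Tr(A H)] for symmetric [A]. On [A = z^T z] it becomes [qf H z], which
    reduces trace estimates to estimates on single vectors. *)
Definition tr2 (A H : 'M[R]_D) : R := \sum_(i < D) \sum_(j < D) A i j * H i j.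

Lemma dot_mul x y : dot x y = (x *m y^T) 0 0.
Proof. by rewrite mxE; apply: eq_bigr => i _; rewrite !mxE. Qed.

Lemma qfE H z : qf H z = \sum_(i < D) \sum_(j < D) H i j * (z 0 i * z 0 j).
Proof.
rewrite /qf -mulmxA mxE; apply: eq_bigr => i _; rewrite mxE mulr_sumr.
by apply: eq_bigr => j _; rewrite !mxE; ring.
Qed.

Lemma tr2_outer z H : tr2 (z^T *m z) H = qf H z.
Proof.
rewrite qfE; apply: eq_bigr => i _; apply: eq_bigr => j _.
by rewrite mxE big_ord1 !mxE mulrC.
Qed.

Lemma tr2Dl A1 A2 H : tr2 (A1 + A2) H = tr2 A1 H + tr2 A2 H.
Proof.
rewrite -big_split; apply: eq_bigr => i _; rewrite -big_split.
by apply: eq_bigr => j _; rewrite mxE mulrDl.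
Qed.

Lemma tr2C A H : tr2 A H = tr2 H A.
Proof. by apply: eq_bigr => i _; apply: eq_bigr => j _; rewrite mulrC. Qed.

Lemma tr2Zl a A H : tr2 (a *: A) H = a * tr2 A H.
Proof.
rewrite mulr_sumr; apply: eq_bigr => i _; rewrite mulr_sumr.
by apply: eq_bigr => j _; rewrite mxE mulrA.
Qed.

Lemma tr2Dr A H1 H2 : tr2 A (H1 + H2) = tr2 A H1 + tr2 A H2.
Proof. by rewrite tr2C tr2Dl !(tr2C A). Qed.

Lemma tr2Zr a A H : tr2 A (a *: H) = a * tr2 A H.
Proof. by rewrite tr2C tr2Zl tr2C. Qed.

Lemma tr2Nl A H : tr2 (- A) H = - tr2 A H.
Proof. by rewrite -scaleN1r tr2Zl mulN1r. Qed.

Lemma tr2Nr A H : tr2 A (- H) = - tr2 A H.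
Proof. by rewrite tr2C tr2Nl tr2C. Qed.

Lemma tr20r A : tr2 A 0 = 0.
Proof. by rewrite -(scale0r A) tr2Zr mul0r. Qed.

Lemma tr20l A : tr2 0 A = 0.
Proof. by rewrite tr2C tr20r. Qed.

Lemma qfDl H1 H2 z : qf (H1 + H2) z = qf H1 z + qf H2 z.
Proof. by rewrite -!tr2_outer tr2Dr. Qed.

Lemma qfZl a H z : qf (a *: H) z = a * qf H z.
Proof. by rewrite -!tr2_outer tr2Zr. Qed.

Lemma qfNl H z : qf (- H) z = - qf H z.
Proof. by rewrite -!tr2_outer tr2Nr. Qed.

Lemma qf0l z : qf 0 z = 0.
Proof. by rewrite -!tr2_outer tr20r. Qed.

Definition qflE := (qfDl, qfZl, qfNl, qf0l).

Lemma qfZ H a z : qf H (a *: z) = a ^+ 2 * qf H z.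
Proof.
by rewrite /qf -!scalemxAl linearZ /= -!scalemxAr scalerA mxE expr2.
Qed.

Lemma qfN H z : qf H (- z) = qf H z.
Proof. by rewrite -scaleN1r qfZ sqrrN expr1n mul1r. Qed.

Lemma qf1 z : qf 1%:M z = dot z z.
Proof. by rewrite /qf mulmx1 dot_mul. Qed.

Lemma qf_outer x z : qf (x^T *m x) z = dot x z ^+ 2.
Proof.
by rewrite /qf mulmxA -mulmxA mxE big_ord1 -!dot_mul dotC expr2.
Qed.

Lemma qf_evec H (i : 'I_D) : qf H (evec R i) = H i i.
Proof.
rewrite qfE (bigD1 i) //= [X in _ + X]big1 ?addr0; last first.
  by move=> k ki; rewrite big1 // => j _; rewrite !mxE (negbTE ki) andbF mul0r mulr0.
rewrite (bigD1 i) //= big1 ?addr0; first by rewrite !mxE !eqxx !mulr1.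
by move=> k ki; rewrite !mxE (negbTE ki) andbF !mulr0.
Qed.

End DotProduct.

(** Cholesky decomposition by induction on the dimension: a multiple of the outer square of the
    first row clears the first row and column, and the Schur complement that remains is again
    positive definite. *)
Lemma sum_outer_pd {R : realType} {D : nat} (A : 'M[R]_D) :
  A^T = A -> (forall z, z != 0 -> 0 < qf A z) ->
  exists l : seq 'rV[R]_D, A = \sum_(z <- l) z^T *m z.
Proof.
elim: D A => [|D IH] A symA pdA.
  by exists [::]; apply/matrixP => - [].
pose B : 'M[R]_(1 + D) := A.
have pdB (z : 'rV[R]_(1 + D)) : z != 0 -> 0 < qf B z := pdA z.
have symB i j : B i j = B j i by rewrite -[in LHS](symA : B^T = B) mxE.
pose i0 : 'I_(1 + D) := lshift D 0.
pose a := B i0 i0; pose r : 'rV[R]_(1 + D) := row i0 B.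
have a0 : 0 < a.
  have := pdB (evec R i0); rewrite (qf_evec B i0); apply.
  by apply/eqP => /rowP /(_ i0); rewrite !mxE !eqxx /= => /eqP; rewrite oner_eq0.
pose B' : 'M[R]_(1 + D) := B - a^-1 *: (r^T *m r).
have B'E i j : B' i j = B i j - a^-1 * (B i0 i * B i0 j).
  by rewrite !mxE big_ord1 !mxE.
have B'0 j : B' i0 j = 0.
  by rewrite B'E mulrA mulVf ?gt_eqF // mul1r subrr.
have symB' i j : B' i j = B' j i by rewrite !B'E symB [_ * B i0 j]mulrC.
have qfBB' z : qf B' z = qf B z - a^-1 * dot r z ^+ 2.
  by rewrite /B' !qflE qf_outer.
have BB' : a^-1 *: (r^T *m r) + B' = B by rewrite /B' addrC subrK.
clearbody B'; clear B'E.
pose C := drsubmx B'.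
have B'C : B' = block_mx 0 0 0 C.
  rewrite -[LHS]submxK; congr block_mx; apply/matrixP => i j.
  - by rewrite 3!mxE (ord1 i) (_ : lshift D 0 = i0) // B'0.
  - by rewrite 3!mxE (ord1 i) (_ : lshift D 0 = i0) // B'0.
  - by rewrite 3!mxE (ord1 j) (_ : lshift D 0 = i0) // symB' B'0.
have qfB' t (y : 'rV_D) : qf B' (row_mx t y) = qf C y.
  rewrite B'C /qf mul_row_block !mulmx0 addr0 add0r tr_row_mx mul_row_col.
  by rewrite mul0mx !add0r.
have [l lE] : exists l : seq 'rV[R]_D, C = \sum_(z <- l) z^T *m z.
  apply: IH => [|y y0].
    by apply/matrixP => i j; rewrite !mxE symB'.
  (* This first coordinate makes [row_mx t y] orthogonal to [r], so the forms of [B'] and [B] agree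
     on it and positivity is inherited. *)
  pose t : 'rV[R]_1 := (- a^-1 * \sum_(j < D) B i0 (rshift 1 j) * y 0 j)%:M.
  rewrite -(qfB' t) qfBB'.
  have -> : dot r (row_mx t y) = 0.
    rewrite /dot big_split_ord /= big_ord1 row_mxEl !mxE eqxx mulr1n.
    rewrite (_ : lshift D ord0 = i0) //.
    under eq_bigr => j _ do rewrite row_mxEr mxE.
    by rewrite mulrA mulrN mulfV ?gt_eqF // mulN1r addNr.
  rewrite expr0n mulr0 subr0; apply: pdB; apply: contra y0 => /eqP ty0.
  by have := congr1 rsubmx ty0; rewrite row_mxKr => ->; rewrite linear0.
exists ((Num.sqrt a^-1 *: r) :: [seq row_mx 0 z | z <- l]).
have trZ (c : R) : (c *: r)^T = c *: r^T by apply/matrixP => i j; rewrite !mxE.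
rewrite big_cons trZ -scalemxAr -scalemxAl scalerA -expr2.
rewrite sqr_sqrtr ?invr_ge0 ?(ltW a0) // big_map.
rewrite [X in _ + X](_ : _ = B') ?BB' //.
have outer0 (z : 'rV[R]_D) : (row_mx 0 z : 'rV[R]_(1 + D))^T *m row_mx 0 z =
    block_mx 0 0 0 (z^T *m z).
  by rewrite tr_row_mx trmx0 mul_col_row !mul0mx !mulmx0.
rewrite B'C lE; elim: (l) => [|z l' IHl].
  by rewrite !big_nil; apply/esym; exact: block_mx0.
rewrite !big_cons IHl; transitivity (block_mx 0 0 0 (z^T *m z) +
    block_mx 0 0 0 (\sum_(j <- l') j^T *m j) : 'M[R]_(1 + D)).
  by congr (_ + _); exact: outer0.
by rewrite add_block_mx !addr0.
Qed.

Section EllipticMatrix.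
Set Implicit Arguments.
Context {R : realType} {D : nat}.
Variables (lam Lam : R).

Definition elliptic (A : 'M[R]_D) := A^T = A /\
  forall z, lam * dot z z <= qf A z <= Lam * dot z z.

Lemma tr2_sum_outer (l : seq 'rV[R]_D) (H : 'M[R]_D) :
  tr2 (\sum_(z <- l) z^T *m z) H = \sum_(z <- l) qf H z.
Proof.
elim: l => [|z l IH]; first by rewrite !big_nil tr20l.
by rewrite !big_cons tr2Dl tr2_outer IH.
Qed.

Lemma tr2_1r (A : 'M[R]_D) : tr2 A 1%:M = \sum_(i < D) qf A (evec R i).
Proof.
apply: eq_bigr => i _; rewrite qf_evec (bigD1 i) //= big1 ?addr0.
  by rewrite mxE eqxx mulr1.
by move=> j ji; rewrite mxE eq_sym (negbTE ji) mulr0.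
Qed.

Lemma tr2_1r_le (A : 'M[R]_D) a : (forall z, qf A z <= a * dot z z) ->
  tr2 A 1%:M <= D%:R * a.
Proof.
move=> h; rewrite tr2_1r; apply: (@le_trans _ _ (\sum_(i < D) a)).
  by apply: ler_sum => i _; rewrite (le_trans (h _)) // evec_unit mulr1.
by rewrite sumr_const card_ord mulr_natl.
Qed.

Lemma sum_outer_dot (l : seq 'rV[R]_D) (A : 'M[R]_D) :
  A = \sum_(z <- l) z^T *m z -> \sum_(z <- l) dot z z = tr2 A 1%:M.
Proof. by move=> ->; rewrite tr2_sum_outer; apply: eq_bigr => z _; rewrite qf1. Qed.

(** The total squared length is the trace of [A]. Its bound turns an inequality for [qf H z] on each
    vector into one for [tr2 A H] whose constant depends on the ellipticity only. *)
Lemma elliptic_sum_outer (A : 'M[R]_D) : 0 < lam -> elliptic A ->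
  exists2 l : seq 'rV[R]_D, A = \sum_(z <- l) z^T *m z &
    \sum_(z <- l) dot z z <= D%:R * Lam.
Proof.
move=> lam0 [sA eA].
have [|l lE] := sum_outer_pd A sA.
  move=> z z0; apply: lt_le_trans (proj1 (andP (eA z))).
  rewrite mulr_gt0 // lt_def dotxx_ge0 andbT.
  by apply: contra z0 => /eqP /dotxx_eq0 ->.
exists l => //; rewrite (sum_outer_dot lE).
by apply: tr2_1r_le => z; case/andP: (eA z).
Qed.

End EllipticMatrix.

(** * Second-order expansions *)

Section Jets.
Context {R : realType}.
Set Implicit Arguments.

(** Second-order Taylor expansion at the single point [x], with first derivative [a] and second
    derivative [b]. *)
Definition peano (f : R -> R) (x a b : R) := forall e : R, 0 < e ->
  exists2 dl : R, 0 < dl &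
    forall t, `|t| < dl -> `|f (x + t) - f x - a * t - b / 2 * t ^+ 2| <= e * t ^+ 2.

(** The remainder has derivative [f' (x + v) - f' x - b v], which is small compared with [t] because
    [f'] is differentiable at [x]; one mean value theorem then gives the quadratic error. *)
Lemma peano_derive (f f' : R -> R) (x b r : R) : 0 < r ->
  (forall y, `|y - x| < r -> is_derive y 1 f (f' y)) ->
  is_derive x 1 f' b -> peano f x (f' x) b.
Proof.
move=> r0 df df' e e0.
have := @ex_derive _ _ _ _ _ _ _ df'; rewrite /derivable => dv.
have hb : 'D_1 f' x = b by apply: derive_val.
have := dv; rewrite /derive in hb; rewrite hb => /cvgrPdist_le /(_ e e0).
rewrite near_withinE near_nbhs => /nbhs_ballP [dl /= dl0 hdl].
have key t : `|t| < dl -> `|f' (x + t) - f' x - b * t| <= e * `|t|.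
  move=> tdl; have [->|t0] := eqVneq t 0.
    by rewrite addr0 mulr0 normr0 mulr0 subrr subr0 normr0.
  have : ball 0 dl t by rewrite /ball /= sub0r normrN.
  move=> /hdl /(_ t0); rewrite /= [_ *: 1]mulr1.
  move=> h; rewrite -(@ler_pM2r _ `|t|^-1) ?invr_gt0 ?normr_gt0 //.
  rewrite mulfK ?normr_eq0 // -normfV -normrM; apply: le_trans h.
  rewrite -normrN le_eqVlt; apply/orP; left; apply/eqP; congr `|_|.
  by rewrite (addrC x t) /GRing.scale /=; field.
have main t : 0 < `|t| -> `|t| < Num.min dl r -> `|f (x + t) - f x - f' x * t - b / 2 * t ^+ 2|
    <= e * t ^+ 2.
  rewrite lt_min => t0 /andP[tdl tr].
  pose q (v : R) := f (x + v) - f' x * v - b / 2 * v ^+ 2.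
  have dq (v : R) : `|v| <= `|t| -> is_derive v 1 q (f' (x + v) - f' x - b * v).
    move=> vt; have h : is_derive (x + v) 1 f (f' (x + v)).
      by apply: df; rewrite addrC addKr (le_lt_trans vt).
    have hs : is_derive v 1 (fun v => x + v) (0 + 1).
      exact: (@is_deriveD _ _ _ (cst x) id v 1).
    have h1 : is_derive v 1 (fun v => f (x + v)) (f' (x + v) * (0 + 1)).
      exact: (@is_derive1_comp _ f (fun v => x + v) v _ _ h hs).
    rewrite /q; apply: is_derive_eq.
    by rewrite /GRing.scale /=; lra.
  have dqb (v : R) : `|v| <= `|t| -> `|f' (x + v) - f' x - b * v| <= e * `|t|.
    move=> vt; apply: le_trans (key _ (le_lt_trans vt tdl)) _.
    by rewrite ler_wpM2l // ltW.
  have E : f (x + t) - f x - f' x * t - b / 2 * t ^+ 2 = q t - q 0.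
    by rewrite /q addr0; ring.
  have cq (u1 u2 : R) : `|u1| <= `|t| -> `|u2| <= `|t| ->
      {within `[u1, u2], continuous q}.
    rewrite !ler_norml => /andP[h1 h2] /andP[h3 h4].
    apply: derivable_within_continuous => v; rewrite in_itv /= => /andP[h5 h6].
    by apply: ex_derive; apply: dq; rewrite ler_norml; apply/andP; split; lra.
  have dq' (u1 u2 : R) : `|u1| <= `|t| -> `|u2| <= `|t| ->
      forall v, v \in `]u1, u2[%R -> is_derive v 1 q (f' (x + v) - f' x - b * v).
    rewrite !ler_norml => /andP[h1 h2] /andP[h3 h4] v.
    rewrite in_itv /= => /andP[h5 h6].
    by apply: dq; rewrite ler_norml; apply/andP; split; lra.
  have n0 : `|0 : R| <= `|t| by rewrite normr0 normr_ge0.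
  rewrite E; have [tp|tn] := leP 0 t.
    have tp' : 0 < t by move: t0; rewrite ger0_norm.
    have [c] := MVT tp' (dq' _ _ n0 (lexx _)) (cq _ _ n0 (lexx _)).
    rewrite in_itv /= => /andP[c0 ct] ->.
    rewrite normrM subr0 -(real_normK (num_real t)) expr2 mulrA ler_wpM2r ?normr_ge0 //.
    by rewrite (le_trans (dqb c _)) ?ger0_norm ?(ltW c0) ?(ltW ct).
  have [c] := MVT tn (dq' _ _ (lexx _) n0) (cq _ _ (lexx _) n0).
  rewrite in_itv /= => /andP[c0 ct] h.
  rewrite -normrN opprB h normrM sub0r normrN.
  rewrite -(real_normK (num_real t)) expr2 mulrA ler_wpM2r ?normr_ge0 //.
  by rewrite (le_trans (dqb c _)) // !ltr0_norm // lerN2 ltW.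
exists (Num.min dl r); first by rewrite lt_min dl0 r0.
move=> t tm; have [->|t0] := eqVneq t 0; last by apply: main; rewrite ?normr_gt0.
by rewrite addr0 expr0n /= !mulr0 subrr !subr0 normr0.
Qed.

Lemma peano_powR (a x : R) : 0 < x ->
  peano (fun t => t `^ a) x (a * x `^ (a - 1)) (a * (a - 1) * x `^ (a - 2)).
Proof.
move=> x0; apply: (@peano_derive _ (fun t => a * t `^ (a - 1)) _ _ x) => //.
  move=> y yx; apply: is_derive1_powR; move: yx; rewrite ltr_norml; lra.
have h := is_derive1_powR (a - 1) x0.
apply: is_derive_eq; rewrite /GRing.scale /=.
rewrite (_ : a - 1 - 1 = a - 2); last by lra.
by ring.
Qed.

Lemma peano_expR (k x : R) :
  peano (fun t => expR (k * t)) x (k * expR (k * x)) (k ^+ 2 * expR (k * x)).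
Proof.
apply: (@peano_derive _ (fun t => k * expR (k * t)) _ _ 1) => //.
  move=> y _; apply: is_derive_eq; rewrite /GRing.scale /=; ring.
apply: is_derive_eq; rewrite /GRing.scale /=; ring.
Qed.

Lemma peano_sqr (x : R) : peano (fun t => t ^+ 2) x (2 * x) 2.
Proof.
move=> e e0; exists 1 => // t _.
rewrite (_ : _ - _ = 0); first by rewrite normr0 mulr_ge0 ?sqr_ge0 // ltW.
by field.
Qed.

Context {D : nat}.
Local Notation V := 'rV[R]_D.
Implicit Types (w v : V -> R) (x p z : V) (H : 'M[R]_D).

(** Gradient [p] and Hessian [H] at one point. [H] need not be symmetric: paired with symmetric
    matrices, only its quadratic form counts. *)
Definition jet w x p H := forall e : R, 0 < e ->
  exists2 dl : R, 0 < dl & forall z, en z < dl ->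
    `|w (x + z) - w x - dot p z - qf H z / 2| <= e * dot z z.

Lemma qf_bound H : exists2 C : R, 0 <= C & forall z, `|qf H z| <= C * dot z z.
Proof.
exists (\sum_(i < D) \sum_(j < D) `|H i j|).
  by apply: sumr_ge0 => i _; apply: sumr_ge0 => j _.
move=> z; rewrite qfE mulr_suml (le_trans (ler_norm_sum _ _ _)) //.
apply: ler_sum => i _; rewrite mulr_suml (le_trans (ler_norm_sum _ _ _)) //.
apply: ler_sum => j _; rewrite normrM ler_wpM2l // -en_sq normrM expr2.
by rewrite ler_pM // coord_le_en.
Qed.

Lemma jetD w v x p H p' H' : jet w x p H -> jet v x p' H' ->
  jet (fun y => w y + v y) x (p + p') (H + H').
Proof.
move=> hw hv e e0; have e2 : 0 < e / 2 by lra.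
have [d1 d10 h1] := hw _ e2; have [d2 d20 h2] := hv _ e2.
exists (Num.min d1 d2); first by rewrite lt_min d10.
move=> z; rewrite lt_min => /andP[/h1 + /h2].
rewrite !dotE qfDl !ler_norml => /andP[? ?] /andP[? ?].
by apply/andP; split; lra.
Qed.

Lemma jetZ c w x p H : jet w x p H -> jet (fun y => c * w y) x (c *: p) (c *: H).
Proof.
move=> hw e e0; have k0 : 0 < `|c| + 1 by rewrite ltr_wpDl.
have [d1 d10 h1] := hw (e / (`|c| + 1)) (divr_gt0 e0 k0).
exists d1 => // z /h1 h; rewrite dotZl qfZl.
rewrite (_ : _ - _ = c * (w (x + z) - w x - dot p z - qf H z / 2)); last by ring.
rewrite normrM (le_trans (ler_wpM2l (normr_ge0 c) h)) // mulrA.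
rewrite ler_wpM2r ?dotxx_ge0 // mulrA ler_pdivrMr //; nra.
Qed.

Lemma jetB w v x p H p' H' : jet w x p H -> jet v x p' H' ->
  jet (fun y => w y - v y) x (p - p') (H - H').
Proof.
move=> hw hv; have := jetD hw (jetZ (-1) hv); rewrite !scaleN1r.
by under [X in jet X]eq_fun do rewrite mulN1r.
Qed.

Lemma jet_cst c x : jet (fun=> c) x 0 0.
Proof.
move=> e e0; exists 1 => // z _.
rewrite (_ : _ - _ = 0); last by rewrite dot0l qf0l; ring.
by rewrite normr0 mulr_ge0 ?dotxx_ge0 // ltW.
Qed.

Lemma jet_dot p x : jet (dot p) x p 0.
Proof.
move=> e e0; exists 1 => // z _.
rewrite (_ : _ - _ = 0); last by rewrite dotDr qf0l; ring.
by rewrite normr0 mulr_ge0 ?dotxx_ge0 // ltW.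
Qed.

Lemma jet_sqdist y x : jet (fun x => dot (x - y) (x - y)) x (2 *: (x - y)) (2 *: 1%:M).
Proof.
move=> e e0; exists 1 => // z _.
rewrite (_ : _ - _ = 0); first by rewrite normr0 mulr_ge0 ?dotxx_ge0 // ltW.
rewrite qfZl qf1 !dotE (dotC z x) (dotC y x) (dotC z y); lra.
Qed.

Lemma jet_subst w a (c : R) x p H : jet w (a + c *: x) p H ->
  jet (fun x => w (a + c *: x)) x (c *: p) (c ^+ 2 *: H).
Proof.
move=> hw e e0; have k0 : 0 < c ^+ 2 + 1 by rewrite ltr_wpDl ?sqr_ge0.
have [d1 d10 h1] := hw (e / (c ^+ 2 + 1)) (divr_gt0 e0 k0).
have k1 : 0 < `|c| + 1 by rewrite ltr_wpDl.
exists (d1 / (`|c| + 1)); first by rewrite divr_gt0.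
move=> z; rewrite ltr_pdivlMr // => hz.
have hs : en (c *: z) < d1 by rewrite enZ; have := en_ge0 z; nra.
rewrite (_ : _ - _ = w (a + c *: x + c *: z) - w (a + c *: x) - dot p (c *: z)
  - qf H (c *: z) / 2); last by rewrite !dotE qfZ qfZl scalerDr addrA.
rewrite (le_trans (h1 _ hs)) // !dotE.
rewrite (_ : e / (c ^+ 2 + 1) * (c * (c * dot z z)) =
  e * (dot z z * (c ^+ 2 / (c ^+ 2 + 1)))); last by ring.
rewrite ler_pM2l // ler_piMr ?dotxx_ge0 // ler_pdivrMr //; lra.
Qed.

(** Chain rule. The error has three sources, each given a third of [e]: the expansion of [f] at the
    increment [t] of [v], the expansion of [v] itself, and the replacement of [t ^+ 2] by
    [dot p z ^+ 2]. *)
Lemma jet_comp v f x p H a b : jet v x p H -> peano f (v x) a b ->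
  jet (fun y => f (v y)) x (a *: p) (a *: H + b *: (p^T *m p)).
Proof.
move=> hv hf e e0; have [C C0 hC] := qf_bound H.
pose K := en p + C + 1; have K0 : 1 <= K by rewrite ler_wpDl // addr_ge0 ?en_ge0.
have a0 : 0 < `|a| + 1 by rewrite ltr_wpDl.
have b0 : 0 < `|b| * K ^+ 2 + 1 by rewrite ltr_wpDl // mulr_ge0 ?sqr_ge0.
pose e1 := Num.min 1 (e / 3 / (`|a| + 1)).
have e10 : 0 < e1 by rewrite lt_min ltr01 !divr_gt0.
have e1a : `|a| * e1 <= e / 3.
  rewrite (@le_trans _ _ ((`|a| + 1) * e1)) ?ler_wpM2r ?(ltW e10) ?lerDl //.
  by rewrite mulrC -ler_pdivlMr // ge_min lexx orbT.
have e11 : e1 <= 1 by rewrite ge_min lexx.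
have [d1 d10 h1] := hv _ e10.
have KK : 0 < K ^+ 2 by nra.
have [d2 d20 h2] := hf (e / 3 / K ^+ 2) (divr_gt0 (divr_gt0 e0 (ltr0Sn R 2)) KK).
pose dl := Num.min (Num.min 1 d1) (Num.min (d2 / K) (e / 3 / (`|b| * K ^+ 2 + 1))).
exists dl; first by rewrite !lt_min ltr01 d10 !divr_gt0 //; lra.
move=> z; rewrite !lt_min => /andP[/andP[z1 zd1] /andP[zd2 zb]].
have := h1 _ zd1; set t := v (x + z) - v x; set r := en z in z1 zd1 zd2 zb *.
have r0 : 0 <= r := en_ge0 z.
have zz : dot z z = r ^+ 2 by rewrite en_sq.
have pz : `|dot p z| <= en p * r := dot_le_en p z.
have qz := hC z; rewrite zz in qz *; move=> ht.
have ht2 : `|t - dot p z| <= (C + 1) * r ^+ 2.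
  have : `|t - dot p z| <= `|t - dot p z - qf H z / 2| + `|qf H z / 2|.
    by rewrite -{1}(subrK (qf H z / 2) (t - dot p z)) ler_normD.
  rewrite normrM (_ : `|2^-1| = 2^-1 :> R); last by rewrite ger0_norm ?invr_ge0.
  move=> h.
  have : 0 <= r ^+ 2 by rewrite sqr_ge0.
  nra.
have rr : r ^+ 2 <= r by rewrite expr2 ler_piMr // ltW.
have C1 : 0 <= C + 1 by lra.
have htK : `|t| <= K * r.
  have : `|t| <= `|t - dot p z| + `|dot p z|.
    by rewrite -{1}(subrK (dot p z) t) ler_normD.
  rewrite /K; nra.
have htK2 : `|t + dot p z| <= 2 * K * r.
  have : `|t + dot p z| <= `|t| + `|dot p z| by rewrite ler_normD.
  rewrite /K; rewrite /K in htK; nra.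
have td2 : `|t| < d2.
  apply: le_lt_trans htK _; rewrite mulrC -ltr_pdivlMr //; lra.
have := h2 _ td2; rewrite [v x + t]addrC /t subrK -/t => hft.
have t2 : t ^+ 2 <= K ^+ 2 * r ^+ 2.
  by rewrite -real_normK ?num_real // -exprMn ler_pXn2r ?nnegrE // mulr_ge0 //; lra.
have B1 : e / 3 / K ^+ 2 * t ^+ 2 <= e / 3 * r ^+ 2.
  rewrite (@le_trans _ _ (e / 3 / K ^+ 2 * (K ^+ 2 * r ^+ 2))) //.
    by rewrite ler_wpM2l // !divr_ge0 // ltW.
  by rewrite mulrA divfK // gt_eqF.
have B2 : `|a * (t - dot p z - qf H z / 2)| <= e / 3 * r ^+ 2.
  rewrite normrM (@le_trans _ _ (`|a| * (e1 * r ^+ 2))) ?ler_wpM2l //.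
  by rewrite mulrA ler_wpM2r ?sqr_ge0.
have B3 : `|b / 2 * (t ^+ 2 - dot p z ^+ 2)| <= e / 3 * r ^+ 2.
  rewrite subr_sqr !normrM (_ : `|2^-1| = 2^-1 :> R); last by rewrite ger0_norm ?invr_ge0.
  have h : `|t - dot p z| * `|t + dot p z| <= 2 * K ^+ 2 * r ^+ 2 * r.
    apply: (@le_trans _ _ ((C + 1) * r ^+ 2 * (2 * K * r))); first by rewrite ler_pM.
    have CK : C + 1 <= K by rewrite /K; have := en_ge0 p; lra.
    have : 0 <= 2 * K * r ^+ 2 * r by rewrite !mulr_ge0 ?sqr_ge0 //; lra.
    nra.
  have hb : (`|b| * K ^+ 2 + 1) * r <= e / 3 by rewrite mulrC -ler_pdivlMr // ltW.
  have h3 : `|b| * K ^+ 2 * r * r ^+ 2 <= e / 3 * r ^+ 2.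
    by rewrite ler_wpM2r ?sqr_ge0 //; move: hb; clear -r0; lra.
  have b2 : 0 <= `|b| / 2 by rewrite divr_ge0.
  by have := ler_wpM2l b2 h; move: h3; clear; lra.
rewrite dotZl !qflE qf_outer -/t.
rewrite !ler_norml in hft B2 B3 *.
by move: hft B1 B2 B3; clear => /andP[? ?] ? /andP[? ?] /andP[? ?]; apply/andP; split; lra.
Qed.

Lemma jet_d1 w x p H z : jet w x p H -> exists2 C : R, 0 < C &
  exists2 dl : R, 0 < dl & forall t, `|t| < dl ->
    `|w (x + t *: z) - w x - t * dot p z| <= C * t ^+ 2.
Proof.
move=> hw; have [C C0 hC] := qf_bound H.
have [d1 d10 h1] := hw 1 ltr01.
have k0 : 0 < en z + 1 by rewrite ltr_wpDl ?en_ge0.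
exists ((C + 1) * dot z z + 1).
  by rewrite ltr_wpDl // mulr_ge0 ?dotxx_ge0 // addr_ge0.
exists (d1 / (en z + 1)); first by rewrite divr_gt0.
move=> t; rewrite ltr_pdivlMr // => ht.
have := h1 (t *: z); rewrite enZ dotZr qfZ !dotE => h.
have {}h := h (_ : _ < _); have {}h := h ltac:(have := en_ge0 z; have := normr_ge0 t; nra).
have := hC z; have := dotxx_ge0 z; have := sqr_ge0 t.
move: h; rewrite !ler_norml => /andP[h2 h3] t0 z0 /andP[h4 h5].
have h6 : 0 <= t ^+ 2 * (C * dot z z - qf H z) by rewrite mulr_ge0 //; lra.
have h7 : 0 <= t ^+ 2 * (C * dot z z + qf H z) by rewrite mulr_ge0 //; lra.
by apply/andP; split; nra.
Qed.

Lemma jet_sd w x p H z : jet w x p H -> forall e : R, 0 < e ->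
  exists2 dl : R, 0 < dl & forall t, `|t| < dl ->
    `|w (x + t *: z) + w (x - t *: z) - 2 * w x - t ^+ 2 * qf H z| <= e * t ^+ 2.
Proof.
move=> hw e e0; have k : 0 < 2 * dot z z + 1.
  by have := dotxx_ge0 z; lra.
have [d1 d10 h1] := hw (e / (2 * dot z z + 1)) (divr_gt0 e0 k).
have k0 : 0 < en z + 1 by rewrite ltr_wpDl ?en_ge0.
exists (d1 / (en z + 1)); first by rewrite divr_gt0.
move=> t; rewrite ltr_pdivlMr // => ht.
have hs : `|t| * en z < d1 by have := en_ge0 z; have := normr_ge0 t; nra.
have := h1 (- (t *: z)); have := h1 (t *: z).
rewrite enN enZ qfN qfZ !dotE => /(_ hs) A /(_ hs) B.
have E : e / (2 * dot z z + 1) * (t * (t * dot z z)) * 2 <= e * t ^+ 2.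
  rewrite (_ : _ * 2 = e * (t ^+ 2 * (2 * dot z z / (2 * dot z z + 1)))); last by ring.
  rewrite ler_wpM2l ?(ltW e0) // ler_piMr ?sqr_ge0 // ler_pdivrMr //; lra.
move: A B; rewrite opprK !ler_norml => /andP[? ?] /andP[? ?].
by apply/andP; split; lra.
Qed.

End Jets.

Section Compactness.
Context {R : realType}.
Set Implicit Arguments.

Definition ctn {T : topologicalType} (S : set T) (F : T -> R) :=
  forall x, S x -> F @ within S (nbhs x) --> F x.

Lemma ctnP (T : topologicalType) (S : set T) F : {within S, continuous F} <-> ctn S F.
Proof. by split => [/subspace_continuousP | h]; last exact/subspace_continuousP. Qed.

Lemma ctnD (T : topologicalType) (S : set T) F G :
  ctn S F -> ctn S G -> ctn S (fun x => F x + G x).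
Proof. by move=> hF hG x Sx; apply: cvgD; [exact: hF | exact: hG]. Qed.

Lemma ctnB (T : topologicalType) (S : set T) F G :
  ctn S F -> ctn S G -> ctn S (fun x => F x - G x).
Proof. by move=> hF hG x Sx; apply: cvgB; [exact: hF | exact: hG]. Qed.

Lemma ctnM (T : topologicalType) (S : set T) F G :
  ctn S F -> ctn S G -> ctn S (fun x => F x * G x).
Proof. by move=> hF hG x Sx; apply: cvgM; [exact: hF | exact: hG]. Qed.

Lemma ctn_cst (T : topologicalType) (S : set T) c : ctn S (fun=> c).
Proof. by move=> x Sx; exact: cvg_cst. Qed.

Lemma ctn_continuous (T : topologicalType) (S : set T) F : continuous F -> ctn S F.
Proof. by move=> hF x Sx; apply: cvg_trans (hF x); apply: cvg_app; exact: cvg_within. Qed.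

Lemma ctn_comp (T : topologicalType) (S : set T) F (f : R -> R) :
  continuous f -> ctn S F -> ctn S (fun x => f (F x)).
Proof. by move=> hf hF x Sx; exact: (@cvg_comp _ _ _ F f _ _ _ (hF x Sx) (hf (F x))). Qed.

Lemma ctn_sub (T : topologicalType) (S S' : set T) F :
  S `<=` S' -> ctn S' F -> ctn S F.
Proof.
move=> SS hF x Sx; apply: cvg_trans (hF x (SS _ Sx)); apply: cvg_app.
exact: within_subset.
Qed.

Lemma ctn_pre (T U : topologicalType) (S : set T) (S' : set U) (f : T -> U) F :
  continuous f -> (forall x, S x -> S' (f x)) -> ctn S' F -> ctn S (fun x => F (f x)).
Proof.
move=> cf SS hF x Sx; apply: cvg_comp (hF _ (SS _ Sx)) => P.
rewrite /nbhs /= /within /= => hP; have := cf x _ hP; rewrite /nbhs /=.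
by apply: filterS => y h /SS; exact: h.
Qed.

Lemma ctn_max (T : topologicalType) (S : set T) F :
  compact S -> S !=set0 -> ctn S F -> exists2 c, S c & forall y, S y -> F y <= F c.
Proof.
move=> cS S0 /ctnP cF; have [c cS' h] := compact_EVT_max S0 cS cF.
by exists c; [exact/set_mem | move=> y Sy; apply: h; exact/mem_set].
Qed.

Context {D : nat}.
Local Notation V := 'rV[R]_D.
Implicit Types (x y z p : V) (w : V -> R).

Lemma nbhs_enP (P : set V) x :
  nbhs x P <-> exists2 dl : R, 0 < dl & forall y, en (y - x) < dl -> P y.
Proof.
split=> [/nbhs_ballP [dl dl0 h] | [dl dl0 h]].
  exists dl => // y yx; apply: h.
  by rewrite -ball_normE /= distrC (le_lt_trans (norm_le_en _)).
apply/nbhs_ballP; have k : 0 < D%:R + 1 :> R by rewrite ltr_wpDl.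
exists (dl / (D%:R + 1)); first by rewrite /= divr_gt0.
move=> y; rewrite -ball_normE /= distrC ltr_pdivlMr // => hy; apply: h.
have := en_le_norm (y - x); have := normr_ge0 (y - x); nra.
Qed.

Lemma ctn_eps (S : set V) w : ctn S w <->
  forall x, S x -> forall e : R, 0 < e -> exists2 dl : R, 0 < dl &
    forall y, S y -> en (y - x) < dl -> `|w y - w x| <= e.
Proof.
split=> h x Sx.
  move=> e e0; have /cvgrPdist_le /(_ e e0) := h x Sx.
  rewrite near_withinE => /nbhs_enP [dl dl0 hd].
  by exists dl => // y Sy /hd; rewrite distrC; exact.
apply/cvgrPdist_le => e e0; have [dl dl0 hd] := h x Sx e e0.
by rewrite near_withinE; apply/nbhs_enP; exists dl => // y /hd; rewrite distrC => h1 /h1.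
Qed.

Lemma continuous_eps w : (forall x (e : R), 0 < e -> exists2 dl : R, 0 < dl &
    forall y, en (y - x) < dl -> `|w y - w x| <= e) -> continuous w.
Proof.
move=> h; apply/continuous_subspace_setT/ctnP/ctn_eps => x _ e e0.
by have [dl dl0 hd] := h x e e0; exists dl => // y _; exact: hd.
Qed.

Lemma en_continuous : continuous (@en R D).
Proof.
apply: continuous_eps => x e e0; exists e => // y yx.
by rewrite (le_trans (ler_en_dist _ _)) // ltW.
Qed.

Lemma dot_continuous p : continuous (dot p).
Proof.
apply: continuous_eps => x e e0.
have k : 0 < en p + 1 by rewrite ltr_wpDl ?en_ge0.
exists (e / (en p + 1)); first by rewrite divr_gt0.
move=> y; rewrite ltr_pdivlMr // => hy.
rewrite -dotNr -dotDr (le_trans (dot_le_en _ _)) //; have := en_ge0 (y - x); nra.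
Qed.

Lemma compact_closed_en (S : set V) y r :
  closed S -> (forall x, S x -> en (x - y) <= r) -> compact S.
Proof.
move=> cS bS; apply: bounded_closed_compact => //.
exists (r + `|y|); split; first exact: num_real.
move=> M hM x /bS h /=; rewrite -(subrK y x) (le_trans (ler_normD _ _)) //.
by rewrite (le_trans _ (ltW hM)) // lerD2r (le_trans (norm_le_en _)).
Qed.

Lemma closed_le_ctn (F G : V -> R) : continuous F -> continuous G ->
  closed [set x | F x <= G x].
Proof.
move=> cF cG; rewrite (_ : mkset _ = (fun x => G x - F x) @^-1` [set t | 0 <= t]).
  apply: closed_comp; last exact: closed_ge.
  by move=> x _; exact: (continuousB (cG x) (cF x)).
by apply/seteqP; split => x /=; rewrite subr_ge0.
Qed.

End Compactness.

Section JetOfDifferentiable.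
Context {R : realType} {D : nat}.
Set Implicit Arguments.
Local Notation V := 'rV[R]_D.
Implicit Types (w f : V -> R) (x y z : V).

Definition grad f x : V := \row_i pd i f x.

Lemma derive_grad f x z : differentiable f x -> 'D_z f x = dot (grad f x) z.
Proof.
move=> df; rewrite deriveE // {1}(rV_sum_evec z) linear_sum; apply: eq_bigr => i _.
by rewrite linearZ /= mxE /pd deriveE // mulrC.
Qed.

Lemma differentiable_eps f x : differentiable f x -> forall e : R, 0 < e ->
  exists2 dl : R, 0 < dl &
    forall z, en z < dl -> `|f (x + z) - f x - dot (grad f x) z| <= e * en z.
Proof.
move=> df e e0; have /diff_locally/eqaddoP/(_ e e0) := df.
move=> /nbhs_enP [dl dl0 h]; exists dl => // z zd.
have := h z; rewrite subr0 => /(_ zd) /=.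
rewrite -derive_grad // deriveE // !fctE /= [z + x]addrC => hz.
rewrite -addrA -opprD (le_trans hz) // ler_pM2l //; exact: norm_le_en.
Qed.

Lemma is_derive_line w x z (t : R) : differentiable w (x + t *: z) ->
  is_derive t 1 (fun t => w (x + t *: z)) (dot (grad w (x + t *: z)) z).
Proof.
move=> dw.
have E : (fun h : R => h^-1 *: ((fun t => w (x + t *: z)) (h *: 1 + t) - w (x + t *: z))) =
         (fun h => h^-1 *: ((w \o shift (x + t *: z)) (h *: z) - w (x + t *: z))).
  apply/funext => h; rewrite /= /shift; congr (_ *: (w _ - _)).
  by rewrite [h *: 1]mulr1 scalerDl addrCA [x + _]addrC addrA.
have [dv dvE] : derivable w (x + t *: z) z /\ 'D_z w (x + t *: z) =
    dot (grad w (x + t *: z)) z.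
  by split; [exact: diff_derivable | exact: derive_grad].
by apply: DeriveDef; rewrite /derivable /derive /= -?dvE /derive E.
Qed.

(** One mean value theorem along the segment leads to the gradient at an intermediate point, where
    differentiability of the partial derivatives at [x] supplies the second order. *)
Lemma jet_differentiable w x (r : R) : 0 < r ->
  (forall y, en (y - x) < r -> differentiable w y) ->
  (forall i, differentiable (pd i w) x) ->
  jet w x (grad w x) (\matrix_(i, j) pd j (pd i w) x).
Proof.
move=> r0 dw dp e e0; set H := \matrix_(i, j) _.
have k0 : 0 < D%:R + 1 :> R by rewrite ltr_wpDl.
have hi (i : 'I_D) : exists2 dl : R, 0 < dl & forall z, en z < dl ->
    `|pd i w (x + z) - pd i w x - dot (grad (pd i w) x) z| <= e / (D%:R + 1) * en z.
  by apply: differentiable_eps => //; rewrite divr_gt0.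
have [dl dl0 hdl] : exists2 dl : R, 0 < dl & forall i z, en z < dl ->
    `|pd i w (x + z) - pd i w x - dot (grad (pd i w) x) z| <= e / (D%:R + 1) * en z.
  have hi' i : exists dl : R, 0 < dl /\ forall z, en z < dl ->
    `|pd i w (x + z) - pd i w x - dot (grad (pd i w) x) z| <= e / (D%:R + 1) * en z.
    by have [dl ? ?] := hi i; exists dl.
  have [dl hdl] := choice hi'.
  exists (\big[Num.min/1]_i dl i).
    by elim/big_ind: _ => // [a b a0 b0|i _]; [rewrite lt_min a0 | case: (hdl i)].
  move=> i z zd; apply: (hdl i).2; apply: lt_le_trans zd _.
  exact: bigmin_le.
exists (Num.min dl r); first by rewrite lt_min dl0.
move=> z; rewrite lt_min => /andP[zd zr].
pose q (t : R) := w (x + t *: z) - t * dot (grad w x) z - t ^+ 2 * (qf H z / 2).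
pose dq (t : R) := dot (grad w (x + t *: z)) z - dot (grad w x) z - t * qf H z.
have t1 (t : R) : 0 <= t <= 1 -> en (t *: z) <= en z.
  move=> /andP[t0 t1]; rewrite enZ ger0_norm // ler_piMl ?en_ge0 //.
have hq (t : R) : 0 <= t <= 1 -> is_derive t 1 q (dq t).
  move=> ht; have h1 : is_derive t 1 (fun t => w (x + t *: z)) (dot (grad w (x + t *: z)) z).
    by apply: is_derive_line; apply: dw; rewrite addrC addKr (le_lt_trans (t1 _ ht)).
  by rewrite /q /dq; apply: is_derive_eq; rewrite /GRing.scale /=; lra.
have hq' (t : R) : t \in `]0, 1[%R -> is_derive t 1 q (dq t).
  by rewrite in_itv /= => /andP[h1 h2]; apply: hq; rewrite (ltW h1) (ltW h2).
have cq : {within `[0, 1], continuous q}.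
  apply: derivable_within_continuous => t; rewrite in_itv /= => ht.
  by apply: ex_derive; apply: hq.
have [c c01 hc] := MVT ltr01 hq' cq.
have {}c01 : 0 <= c <= 1 by move: c01; rewrite in_itv /= => /andP[/ltW -> /ltW ->].
have E : w (x + z) - w x - dot (grad w x) z - qf H z / 2 = dq c.
  have := hc; rewrite /q scale1r scale0r addr0 subr0 mulr1 => <-; lra.
rewrite E /dq.
have -> : dot (grad w (x + c *: z)) z - dot (grad w x) z - c * qf H z =
   \sum_(i < D) (pd i w (x + c *: z) - pd i w x - dot (grad (pd i w) x) (c *: z)) * z 0 i.
  rewrite qfE mulr_sumr -!sumrB; apply: eq_bigr => i _.
  rewrite !mxE !mulrBl; congr (_ - _); rewrite dotZr -mulrA; congr (_ * _).
  rewrite mulr_suml; apply: eq_bigr => j _; rewrite !mxE; ring.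
rewrite (le_trans (ler_norm_sum _ _ _)) //.
apply: (@le_trans _ _ (\sum_(i < D) e / (D%:R + 1) * dot z z)).
  apply: ler_sum => i _; rewrite normrM -en_sq expr2 mulrA.
  rewrite ler_pM ?coord_le_en // (le_trans (hdl i _ _)) //.
    by rewrite (le_lt_trans (t1 _ c01)).
  by rewrite ler_wpM2l ?t1 // divr_ge0 // ltW.
rewrite sumr_const card_ord -[leLHS]mulr_natl mulrA ler_wpM2r ?dotxx_ge0 //.
by rewrite [leLHS]mulrA ler_pdivrMr // mulrC ler_pM2l // lerDl.
Qed.

End JetOfDifferentiable.

(** * The operator and the maximum principle on strips *)

Section Generator.
Context {R : realType} {D : nat}.
Set Implicit Arguments. Unset Strict Implicit.
Local Notation V := 'rV[R]_D.
Variables (A : V -> 'M[R]_D) (B : V -> V).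
Implicit Types (w v : V -> R) (x y z p : V).

(* [L w x = c], read off a second-order expansion of [w] at [x]. *)
Definition genL w x (c : R) :=
  exists p H, jet w x p H /\ tr2 (A x) H + dot (B x) p = c.

Lemma genLD w v x c c' : genL w x c -> genL v x c' -> genL (fun y => w y + v y) x (c + c').
Proof.
move=> [p [H [j <-]]] [p' [H' [j' <-]]]; exists (p + p'), (H + H').
by split; [exact: jetD | rewrite tr2Dr dotDr addrACA].
Qed.

Lemma genLZ a w x c : genL w x c -> genL (fun y => a * w y) x (a * c).
Proof.
move=> [p [H [j <-]]]; exists (a *: p), (a *: H).
by split; [exact: jetZ | rewrite tr2Zr dotZr mulrDr].
Qed.

Lemma genLB w v x c c' : genL w x c -> genL v x c' -> genL (fun y => w y - v y) x (c - c').
Proof.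
move=> [p [H [j <-]]] [p' [H' [j' <-]]]; exists (p - p'), (H - H').
by split; [exact: jetB | rewrite tr2Dr tr2Nr dotDr dotNr addrACA opprD].
Qed.

Lemma genL_cst a x : genL (fun=> a) x 0.
Proof. by exists 0, 0; split; [exact: jet_cst | rewrite tr20r dot0r addr0]. Qed.

Lemma jet_max w x p H (r : R) : 0 < r -> (forall z, en z < r -> w (x + z) <= w x) ->
  jet w x p H -> p = 0 /\ forall z, qf H z <= 0.
Proof.
move=> r0 mx jw; split.
  apply: dotxx_eq0; apply/eqP; rewrite eq_le dotxx_ge0 andbT leNgt; apply/negP => pp.
  have [C C0 [dl dl0 h]] := jet_d1 p jw.
  have k0 : 0 < en p + 1 by rewrite ltr_wpDl ?en_ge0.
  pose t := Num.min (dl / 2) (Num.min (r / (en p + 1)) (dot p p / C / 2)).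
  have t0 : 0 < t by rewrite !lt_min !divr_gt0.
  have [td tr tc] : [/\ t < dl, t * (en p + 1) <= r & t * C * 2 <= dot p p].
    split; first by rewrite (@le_lt_trans _ _ (dl / 2)) ?ge_min ?lexx //; lra.
      by rewrite -ler_pdivlMr // ge_min [X in _ || X]ge_min lexx orbT.
    by rewrite -mulrA -ler_pdivlMr ?mulr_gt0 // invfM mulrA !ge_min lexx !orbT.
  have := h t; rewrite gtr0_norm // => /(_ td); rewrite ler_norml => /andP[h1 _].
  have := mx (t *: p); rewrite enZ gtr0_norm // => h2.
  have {}h2 := h2 ltac:(nra); nra.
move=> z; rewrite leNgt; apply/negP => qz.
have [dl dl0 h] := jet_sd z jw _ (divr_gt0 qz (ltr0Sn R 1)).
have k0 : 0 < en z + 1 by rewrite ltr_wpDl ?en_ge0.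
pose t := Num.min (dl / 2) (r / (en z + 1)).
have t0 : 0 < t by rewrite !lt_min !divr_gt0.
have [td tr] : t < dl /\ t * (en z + 1) <= r.
  split; first by rewrite (@le_lt_trans _ _ (dl / 2)) ?ge_min ?lexx //; lra.
  by rewrite -ler_pdivlMr // ge_min lexx orbT.
have := h t; rewrite gtr0_norm // => /(_ td); rewrite ler_norml => /andP[h1 _].
have tz : en (t *: z) < r by rewrite enZ gtr0_norm //; nra.
have := mx (- (t *: z)); have := mx (t *: z); rewrite enN => /(_ tz) h2 /(_ tz) h3.
have : 0 < t ^+ 2 by rewrite exprn_gt0.
nra.
Qed.

(** At a local maximum the gradient vanishes and the Hessian form is nonpositive; with [A x] written
    as a sum of outer squares, the trace is a sum of nonpositive values. *)
Lemma genL_max w x c (r : R) (lam Lam : R) : 0 < lam -> elliptic lam Lam (A x) ->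
  0 < r -> (forall z, en z < r -> w (x + z) <= w x) -> genL w x c -> c <= 0.
Proof.
move=> lam0 eA r0 mx [p [H [jw <-]]].
have [-> qH] := jet_max r0 mx jw.
have [l -> _] := elliptic_sum_outer lam0 eA.
rewrite dot0r addr0 tr2_sum_outer big_seq_cond.
by apply: sumr_le0 => z _.
Qed.

End Generator.

Section StripComparison.
Context {R : realType} {D : nat}.
Set Implicit Arguments. Unset Strict Implicit.
Local Notation V := 'rV[R]_D.
Variables (n : V) (lam Lam CB : R).
Hypotheses (n1 : dot n n = 1) (lam0 : 0 < lam) (CB0 : 0 <= CB).

Definition coefs (A : V -> 'M[R]_D) (B : V -> V) :=
  forall x, elliptic lam Lam (A x) /\ en (B x) <= CB.

(** Chosen so that [k lam - CB = 1]: the operator applied to [exp (k (n.y))] is then at least [k]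
    times this function, for every drift of size at most [CB]. *)
Definition layer_rate := (CB + 1) / lam.
Local Notation k := layer_rate.

Lemma layer_rate_gt0 : 0 < k. Proof. by rewrite divr_gt0 // ltr_wpDl. Qed.

Definition expn_layer (y : V) := expR (k * dot n y).
Local Notation E := expn_layer.

Lemma en_n : en n = 1.
Proof. by rewrite /en n1 sqrtr1. Qed.

Section WithCoefs.
Variables (A : V -> 'M[R]_D) (B : V -> V).
Hypothesis cAB : coefs A B.

Lemma Lam_ge0 : 0 <= Lam.
Proof. by have [[_ e] _] := cAB 0; have /andP[h1 h2] := e n; rewrite n1 in h1 h2; have l := lam0; lra. Qed.

Lemma genL_layer x : exists2 c, k * E x <= c & genL A B E x c.
Proof.
have [[_ eA] bB] := cAB x; have Ex0 : 0 < E x := expR_gt0 _.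
have k0 := layer_rate_gt0; have kE : 0 <= k * E x by rewrite mulr_ge0 // ltW.
exists (k ^+ 2 * E x * qf (A x) n + k * E x * dot (B x) n).
  have /andP[q1 _] := eA n; rewrite n1 mulr1 in q1.
  have b1 : - CB <= dot (B x) n.
    have := dot_le_en (B x) n; rewrite en_n mulr1 ler_norml => /andP[h _]; lra.
  have kl : k * lam = CB + 1 by rewrite /layer_rate divfK // gt_eqF.
  rewrite (_ : _ + _ = (k * E x) * (k * qf (A x) n + dot (B x) n)); last by ring.
  rewrite ler_peMr //.
  have : 0 <= k * (qf (A x) n - lam) by rewrite mulr_ge0 ?subr_ge0 // ltW.
  by move=> h; lra.
exists (k * E x *: n), (k * E x *: 0 + k ^+ 2 * E x *: (n^T *m n)); split.
  exact: (jet_comp (jet_dot n x) (peano_expR k (dot n x))).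
by rewrite scaler0 add0r tr2Zr dotZr tr2C tr2_outer.
Qed.

(** Smooth substitute [sqrt (1 + |y|^2)] for [|y|], 1-Lipschitz and with [L bump] bounded above; a
    small multiple of it makes suprema over the unbounded strip attained. *)
Definition bump (y : V) := (1 + dot y y) `^ (2^-1).

Lemma bumpE y : bump y = Num.sqrt (1 + dot y y).
Proof. by rewrite /bump powR12_sqrt // addr_ge0 ?dotxx_ge0. Qed.

Lemma bump_ge y : en y <= bump y.
Proof. by rewrite bumpE ler_wsqrtr // lerDr. Qed.

Lemma bump_sq y : bump y ^+ 2 = 1 + dot y y.
Proof. by rewrite bumpE sqr_sqrtr // addr_ge0 ?dotxx_ge0. Qed.

Lemma bump_gt0 y : 0 < bump y.
Proof. by rewrite bumpE sqrtr_gt0 ltr_pwDl ?dotxx_ge0. Qed.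

Lemma bump_lip y z : bump y - bump z <= en (y - z).
Proof.
have := ler_en_dist y z; rewrite ler_norml => /andP[_ h].
have := bump_sq y; have := bump_sq z; rewrite -!en_sq => hz hy.
have := bump_ge y; have := bump_ge z; have := en_ge0 y; have := en_ge0 z.
have := bump_gt0 y; have := bump_gt0 z; have := en_ge0 (y - z) => e0 z0 y0 ez ey h1 h2.
rewrite leNgt; apply/negP => lt.
have : (bump y - bump z) * (bump y + bump z) = (en y - en z) * (en y + en z) by nra.
have : (en y - en z) * (en y + en z) <= en (y - z) * (bump y + bump z).
  apply: (@le_trans _ _ (en (y - z) * (en y + en z))).
    by rewrite ler_wpM2r // addr_ge0.
  by rewrite ler_wpM2l // lerD.
have : en (y - z) * (bump y + bump z) < (bump y - bump z) * (bump y + bump z).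
  by rewrite ltr_pM2r // addr_gt0.
lra.
Qed.

Lemma genL_bump x : exists2 c, c <= D%:R * Lam + CB & genL A B bump x c.
Proof.
have [[sA eA] bB] := cAB x.
have q0 : 0 < 1 + dot x x by rewrite ltr_pwDl ?dotxx_ge0.
set a := 2^-1 * (1 + dot x x) `^ (2^-1 - 1).
set b := 2^-1 * (2^-1 - 1) * (1 + dot x x) `^ (2^-1 - 2).
have j1 : jet (fun y => 1 + dot y y) x (2 *: x) (2 *: 1%:M).
  have := jetD (jet_cst 1 x) (jet_sqdist 0 x); rewrite !add0r !subr0.
  by under [X in jet X]eq_fun do rewrite subr0.
have j := jet_comp j1 (peano_powR 2^-1 _ q0).
rewrite -/a -/b in j.
exists (tr2 (A x) (a *: (2 *: 1%:M) + b *: ((2 *: x)^T *m (2 *: x))) + dot (B x) (a *: (2 *: x)));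
  last by exists (a *: (2 *: x)), (a *: (2 *: 1%:M) + b *: ((2 *: x)^T *m (2 *: x))).
have b0 : b <= 0 by rewrite mulr_le0_ge0 ?powR_ge0 //; lra.
have ab : 2 * a * bump x = 1.
  rewrite /a mulrA mulfV // mul1r /bump -powRD; last by rewrite (gt_eqF q0) /= implybT.
  by rewrite (_ : 2^-1 - 1 + 2^-1 = 0) ?powRr0 //; lra.
have a0 : 0 < 2 * a by have := bump_gt0 x; nra.
have a1 : 2 * a <= 1.
  have : 1 <= bump x by rewrite bumpE -{1}sqrtr1 ler_wsqrtr // lerDl dotxx_ge0.
  nra.
rewrite tr2Dr !tr2Zr !dotZr [tr2 _ (_ *m _)]tr2C tr2_outer.
have : b * qf (A x) (2 *: x) <= 0.
  rewrite mulr_le0_ge0 //; have /andP[h _] := eA (2 *: x).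
  by rewrite (le_trans _ h) // mulr_ge0 ?dotxx_ge0 // ltW.
have : tr2 (A x) 1%:M <= D%:R * Lam by apply: tr2_1r_le => z; case/andP: (eA z).
have : 0 <= D%:R * Lam by rewrite mulr_ge0 ?Lam_ge0.
have : dot (B x) x <= CB * bump x.
  have := dot_le_en (B x) x; rewrite ler_norml => /andP[_ h]; apply: le_trans h _.
  by rewrite ler_pM ?en_ge0 // bump_ge.
move=> h1 h2 h3 h4.
have : 2 * a * dot (B x) x <= CB.
  by rewrite (le_trans (ler_wpM2l (ltW a0) h1)) // mulrCA ab mulr1.
have : 2 * a * tr2 (A x) 1%:M <= D%:R * Lam.
  by rewrite (le_trans (ler_wpM2l (ltW a0) h3)) // ler_piMl.
lra.
Qed.

End WithCoefs.
End StripComparison.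

Section Contact.
Context {R : realType} {D : nat}.
Set Implicit Arguments. Unset Strict Implicit.
Local Notation V := 'rV[R]_D.
Variables (n : V) (lam Lam CB : R) (A : V -> 'M[R]_D) (B : V -> V) (h : V -> R) (ch : R).
Hypotheses (n1 : dot n n = 1) (lam0 : 0 < lam) (CB0 : 0 <= CB).
Hypotheses (cAB : coefs lam Lam CB A B) (ch0 : 0 <= ch) (hc : continuous h)
  (hL : forall x, genL A B h x 0) (hs : forall x, `|h x - dot x n| <= ch).

Local Ltac clr := clear - n1 lam0 CB0 cAB ch0 hc hL hs.

Local Notation k := (layer_rate lam CB).
Local Notation E := (expn_layer n lam CB).
Local Notation bump := (@bump R D).

Lemma layer_continuous : continuous E.
Proof.
move=> x; apply: (@continuous_comp _ _ _ (fun y => k * dot n y) expR).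
  apply: continuousM; [exact: cst_continuous | exact: dot_continuous].
exact: continuous_expR.
Qed.

Lemma bump_continuous : continuous bump.
Proof.
apply: continuous_eps => x e e0; exists e => // y yx.
have := bump_lip x y; have := bump_lip y x; rewrite (en_subC x y) ler_norml => h1 h2.
by apply/andP; split; lra.
Qed.

Lemma layerE y : E y = expR (k * dot y n).
Proof. by rewrite /expn_layer dotC. Qed.

Lemma dot_lip (y z : V) : `|dot y n - dot z n| <= en (y - z).
Proof.
by have := dot_le_en (y - z) n; rewrite dotDl dotNl (en_n n1) mulr1.
Qed.

(* The barrier is the minimum of [psi1], strictly decreasing in the inner normal
   direction but badly behaved far away, and of [psi2], an exact solution of slope
   close to [-c]: [psi1] is the smaller one for [dot y n <= S0] and [psi2] from
   [dot y n = S] on. *)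
Lemma contact_or_bound (S0 : R) : 0 <= S0 ->
  exists C1 c : R, [/\ 0 <= C1, 0 <= c & forall (r m m0 tau : R) (Z : V -> R),
    0 < r -> 0 < tau -> ctn (cslab n r) Z -> (forall x, cslab n r x -> Z x <= m0) ->
    (forall x, slab n r x -> exists2 a, 0 <= a & genL A B Z x a) ->
    (forall x, dot x n = r -> Z x <= m) ->
    (forall x, cslab n r x -> Z x <= m + tau * (C1 + c * (r - dot x n))) \/
    (forall e0 : R, 0 < e0 -> exists y0, [/\ dot y0 n = 0, m < Z y0,
       forall y, cslab n r y -> dot y n <= S0 -> Z y <= Z y0 + e0 * en (y - y0) &
       exists2 t0 : R, 0 < t0 &
         forall t : R, 0 < t < t0 -> Z (y0 + t *: n) <= Z y0 - tau * t])].
Proof.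
move=> S00.
have k0 : 0 < k := layer_rate_gt0 lam0 CB0.
have L0 : 0 <= Lam := Lam_ge0 n1 lam0 cAB.
(* With these constants [psi2 >= 1 > 0 >= psi1] up to height [S0], while at height [S] one has
   [psi2 <= 1 - c < 2 - c <= psi1]. The [2 ch] in [S] pays for the distance between [h] and the
   height. *)
pose S := S0 + 2 * ch + 1.
have S1 : 0 < S by have := ch0; rewrite /S; lra.
pose c := (expR (k * S) - 1) / k + 2.
have eS : 1 <= expR (k * S).
  by have := expR_ge1Dx (k * S); have : 0 < k * S by [rewrite mulr_gt0]; lra.
have cS : (expR (k * S) - 1) / k = c - 2 by rewrite /c addrK.
have c2 : 2 <= c by rewrite /c lerDr divr_ge0 ?(ltW k0) // subr_ge0.
pose C0 := c * S0 + 1.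
have cp : 0 <= c by lra.
have SE : S = S0 + 2 * ch + 1 by [].
have CE : C0 = c * S0 + 1 by [].
clearbody S C0 c.
have C00 : 1 <= C0 by rewrite CE lerDr mulr_ge0.
have cch : 0 <= c * ch by rewrite mulr_ge0.
exists (C0 + 2 * c * ch + c), c; split; [by lra|by lra|].
move=> r m m0 tau Z r0 tau0 cZ bZ LZ mZ.
have [|] := pselect (forall x, cslab n r x ->
  Z x <= m + tau * (C0 + 2 * c * ch + c + c * (r - dot x n))); first by left.
move=> /existsNP [x /not_implyP [xr /negP]]; rewrite -ltNge => gapx.
right => e0 e00.
(* [K k] exceeds the bound of [L bump] by one, so that [pert] satisfies [L pert <= -1] and still
   grows at infinity inside the strip. *)
pose K := (D%:R * Lam + CB + 1) / k.
have K0 : 0 < K.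
  by rewrite divr_gt0 // ltr_wpDl // addr_ge0 // mulr_ge0.
have Kk : K * k = D%:R * Lam + CB + 1 by rewrite /K divfK // gt_eqF.
pose psi1 y := - k^-1 * (E y - 1).
pose psi2 y := (C0 + c * ch) - c * h y.
pose pert y := bump y - K * E y.
pose M := K * expR (k * r).
have M0 : 0 < M by rewrite mulr_gt0 ?expR_gt0.
pose gap := Z x - (m + tau * (C0 + 2 * c * ch + c + c * (r - dot x n))).
have gap0 : 0 < gap by rewrite subr_gt0.
have bx := bump_gt0 x.
(* The bound by [e0] yields the linear estimate around the contact point; the other one keeps the
   perturbation below half of the gap at [x]. *)
pose eps := Num.min e0 (gap / 2 / (bump x + M)).
have eps0 : 0 < eps by rewrite lt_min e00 !divr_gt0 // addr_gt0.
have epse : eps <= e0 by rewrite ge_min lexx.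
have epsg : eps * (bump x + M) <= gap / 2.
  by rewrite -ler_pdivlMr ?addr_gt0 // ge_min lexx orbT.
have E1 y : 0 <= dot y n -> 1 <= E y.
  move=> y0; rewrite layerE; have := expR_ge1Dx (k * dot y n).
  by have : 0 <= k * dot y n by [rewrite mulr_ge0 // ltW]; lra.
have Er y : dot y n <= r -> E y <= expR (k * r).
  by move=> yr; rewrite layerE ler_expR ler_pM2l.
have p1S y : dot y n <= S -> - (c - 2) <= psi1 y.
  move=> yS; rewrite /psi1 mulNr lerN2 mulrC -cS ler_pM2r ?invr_gt0 // lerD2r.
  by rewrite layerE ler_expR ler_pM2l.
have p10 y : 0 <= dot y n -> psi1 y <= 0.
  by move=> /E1 h1; rewrite /psi1 mulNr oppr_le0 mulr_ge0 ?subr_ge0 // invr_ge0 ltW.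
have p2b y : C0 - c * dot y n <= psi2 y <= C0 + 2 * c * ch - c * dot y n.
  have := hs y; rewrite ler_norml => /andP[h1 h2]; rewrite /psi2.
  have : 0 <= c * (ch + (h y - dot y n)) by rewrite mulr_ge0 //; lra.
  have : 0 <= c * (ch - (h y - dot y n)) by rewrite mulr_ge0 //; lra.
  by clr => h3 h4; apply/andP; split; lra.
have pertb y : dot y n <= r -> en y - M <= pert y.
  move=> yr; rewrite /pert lerD ?bump_ge // lerN2 /M ler_pM2l //; exact: Er.
pose G1 y := Z y - tau * psi1 y - eps * pert y.
pose G2 y := Z y - tau * psi2 y - eps * pert y.
have G2x : m + tau * (c + c * r) + eps * M < G2 x.
  have /andP[_ h1] := p2b x.
  have h2 : tau * psi2 x <= tau * (C0 + 2 * c * ch - c * dot x n) by rewrite ler_pM2l.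
  have h3 : eps * pert x <= eps * bump x.
    rewrite ler_pM2l // /pert lerBlDr lerDl mulr_ge0 ?(ltW K0) //.
    by rewrite (le_trans ler01) // E1 //; case/andP: xr.
  have := gap0; move: epsg h2 h3; rewrite /G2 /gap; clr; lra.
have GB Y y : cslab n r y -> - (c + c * r) <= Y ->
    Z y - tau * Y - eps * pert y <= m0 + tau * (c + c * r) + eps * M - eps * en y.
  move=> yr Yc; have := bZ _ yr; case/andP: yr => _ /pertb h1.
  have h2 : eps * (en y - M) <= eps * pert y by rewrite ler_pM2l.
  have h3 : tau * - (c + c * r) <= tau * Y by rewrite ler_pM2l.
  by move: h2 h3; clr; lra.
have cr0 : 0 <= c * r by rewrite mulr_ge0 // ltW.
have G1b y : cslab n r y -> dot y n <= S ->
    G1 y <= m0 + tau * (c + c * r) + eps * M - eps * en y.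
  by move=> yr yS; apply: GB => //; have := p1S _ yS; move: cr0; clr; lra.
have p2r y : dot y n <= r -> - (c + c * r) <= psi2 y.
  move=> yr; have /andP[h1 _] := p2b y.
  have h2 : 0 <= c * (r - dot y n) by rewrite mulr_ge0 // subr_ge0.
  by move: h1 h2 C00 cp; clr; lra.
have G2b y : cslab n r y -> G2 y <= m0 + tau * (c + c * r) + eps * M - eps * en y.
  by move=> yr; apply: GB => //; apply: p2r; case/andP: yr.
(* Beyond this radius the growth of [eps pert] keeps [G1] and [G2] below [G2 x], so the maxima may
   be taken on compact sets. *)
pose rho := Num.max (en x) ((m0 + tau * (c + c * r) + eps * M - G2 x) / eps).
have out y : rho < en y -> m0 + tau * (c + c * r) + eps * M - eps * en y < G2 x.
  rewrite gt_max => /andP[_]; rewrite ltr_pdivrMr //; clr; lra.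
pose K2 := cslab n r `&` [set y | en y <= rho].
pose K1 := K2 `&` [set y | dot y n <= S].
have cdot : continuous (fun y : V => dot y n).
  by rewrite (_ : (fun y => _) = dot n); [exact: dot_continuous | apply/funext => y; exact: dotC].
have clK2 : closed K2.
  apply: closedI; last by apply: closed_le_ctn; [exact: en_continuous | exact: cst_continuous].
  rewrite (_ : cslab n r = [set y | 0 <= dot y n] `&` [set y | dot y n <= r]).
    by apply: closedI; apply: closed_le_ctn => //; exact: cst_continuous.
  by apply/seteqP; split => [y /andP[]|y [h1 h2]] //; apply/andP.
have cK2 : compact K2.
  by apply: (@compact_closed_en _ _ _ 0 rho) => // y [_]; rewrite subr0.
have cK1 : compact K1.
  apply: (@compact_closed_en _ _ _ 0 rho) => [|y [[_]]]; last by rewrite subr0.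
  by apply: closedI => //; apply: closed_le_ctn => //; exact: cst_continuous.
have ctnZ : ctn K2 Z by apply: ctn_sub cZ => y [].
have ctnp : ctn K2 pert.
  apply: ctnB; first by apply: ctn_continuous; exact: bump_continuous.
  by apply: ctnM; [exact: ctn_cst | apply: ctn_continuous; exact: layer_continuous].
have ctnG1 : ctn K1 G1.
  apply: ctn_sub (_ : K1 `<=` K2) _; first by move=> y [].
  apply: ctnB; last by apply: ctnM => //; exact: ctn_cst.
  apply: ctnB => //; apply: ctnM; first exact: ctn_cst.
  apply: ctnM; first exact: ctn_cst.
  by apply: ctnB; [apply: ctn_continuous; exact: layer_continuous | exact: ctn_cst].
have ctnG2 : ctn K2 G2.
  apply: ctnB; last by apply: ctnM => //; exact: ctn_cst.
  apply: ctnB => //; apply: ctnM; first exact: ctn_cst.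
  by apply: ctnB; [exact: ctn_cst | apply: ctnM; [exact: ctn_cst | exact: ctn_continuous]].
have K2x : K2 x by split=> //=; rewrite le_max lexx.
have K10 : K1 0.
  split; last by rewrite /= dot0l ltW.
  split; first by rewrite /cslab /= dot0l lexx ltW.
  by rewrite /= en0 le_max en_ge0.
have [y1 [[y1r _] y1S] max1] := ctn_max cK1 (ex_intro _ _ K10) ctnG1.
have [y2 [y2r _] max2] := ctn_max cK2 (ex_intro _ _ K2x) ctnG2.
have {}max2 y : cslab n r y -> G2 y <= G2 y2.
  move=> yr; have [yrho|/out lt] := leP (en y) rho; first exact: max2.
  by rewrite (le_trans (G2b _ yr)) // (le_trans (ltW lt)) // max2.
have xy2 : G2 x <= G2 y2 by exact: max2.
have {}max1 y : cslab n r y -> dot y n <= S -> G1 y <= Num.max (G1 y1) (G2 y2).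
  move=> yr yS; rewrite le_max; have [yrho|/out lt] := leP (en y) rho.
    by rewrite max1.
  by apply/orP; right; apply: le_trans (G1b _ yr yS) _; exact: le_trans (ltW lt) _.
have Lp y : 0 <= dot y n -> exists2 a, a <= -1 & genL A B pert y a.
  move=> /E1 Ey; have [b bb Lb] := genL_bump n1 lam0 cAB y.
  have [a ab La] := genL_layer n1 lam0 CB0 cAB y.
  exists (b - K * a); last by apply: genLB => //; exact: genLZ.
  have : K * (k * E y) <= K * a by rewrite ler_pM2l.
  have : 0 <= D%:R * Lam + CB by rewrite addr_ge0 // mulr_ge0.
  rewrite mulrA Kk; move: Ey bb; set T := _ + CB; set e := E y.
  by move: K0; clr => *; nra.
have interior G b y (rr : R) : slab n r y -> 0 < rr -> 0 <= b ->
    (forall z, en z < rr -> Z (y + z) - tau * G (y + z) - eps * pert (y + z) <=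
       Z y - tau * G y - eps * pert y) -> genL A B G y (- b) -> False.
  move=> yr rr0 b0 mx LG.
  have y0 : 0 <= dot y n by case/andP: yr => /ltW.
  have [a a0 La] := LZ _ yr; have [a' a'0 La'] := Lp _ y0.
  have := genLB (genLB La (genLZ tau LG)) (genLZ eps La').
  move=> /(genL_max lam0 (proj1 (cAB y)) rr0 mx).
  have : 0 <= tau * b by rewrite mulr_ge0 // ltW.
  have : 0 <= eps * (-1 - a') by rewrite mulr_ge0 ?subr_ge0 // ltW.
  by move: eps0 a0; clr; lra.
have near y (z : V) (rr : R) : en z < rr -> - rr < dot (y + z) n - dot y n < rr.
  move=> zr; rewrite -ltr_norml; apply: le_lt_trans (dot_lip _ _) _.
  by rewrite addrC addKr.
have top y Y : dot y n = r -> - (c + c * r) <= Y ->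
    Z y - tau * Y - eps * pert y <= m + tau * (c + c * r) + eps * M.
  move=> yr Yc; have h1 := mZ _ yr.
  have h2 : tau * - (c + c * r) <= tau * Y by rewrite ler_pM2l.
  have h3 : eps * (- M) <= eps * pert y.
    by rewrite ler_pM2l // (le_trans _ (pertb _ _)) ?yr // lerDr en_ge0.
  by move: h1 h2 h3; clr; lra.
have inside y : cslab n r y -> dot y n != 0 -> dot y n != r -> slab n r y.
  by case/andP=> h1 h2 h3 h4; apply/andP; rewrite !lt_neqAle h1 h2 h4 eq_sym h3.
have ball y (z : V) : slab n r y -> en z < Num.min (dot y n) (r - dot y n) ->
    cslab n r (y + z).
  move=> _ zr; have /andP[] := near y z _ zr.
  rewrite ltrNl !lt_min => /andP[h1 h2] /andP[h3 h4].
  by move: h1 h2 h3 h4; clr => *; apply/andP; split; lra.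
have y2S : dot y2 n != 0 -> slab n r y2.
  move=> y20; apply: inside => //; apply/eqP => y2e.
  have y2r' : dot y2 n <= r by rewrite y2e.
  have := top _ _ y2e (p2r _ y2r'); rewrite -/(G2 y2); move: xy2 G2x; clr; lra.
(* If the maximum of [G2] is the larger one, its point is either interior, against the maximum
   principle, or on the hyperplane, where [psi1] is strictly smaller than [psi2]. So the maximum of
   [G1] is larger; its point is not at height [S] by the order of the barriers, nor at the top
   because of the gap, nor interior, hence lies on the hyperplane. *)
have [lt12|le12] := ltP (G2 y2) (G1 y1); last first.
  have [y20|/y2S y2i] := eqVneq (dot y2 n) 0.
    have : G1 y2 <= Num.max (G1 y1) (G2 y2) by apply: max1 => //; rewrite y20 ltW.
    rewrite max_r // /G1 /G2 => h1.
    have : psi1 y2 <= 0 by apply: p10; rewrite y20.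
    have /andP[+ _] := p2b y2; rewrite y20 mulr0 subr0 => h2 h3.
    have : 0 < tau * (psi2 y2 - psi1 y2).
      by rewrite mulr_gt0 //; move: h2 h3 C00; clr; lra.
    move: h1; clr; lra.
  exfalso; apply: (interior psi2 0 y2 (Num.min (dot y2 n) (r - dot y2 n))) => //.
  - by case/andP: y2i => h1 h2; rewrite lt_min h1 subr_gt0.
  - by move=> z zr; apply: max2; exact: ball.
  rewrite oppr0 -(subr0 0); apply: genLB; first exact: genL_cst.
  by rewrite -(mulr0 c); exact: genLZ.
have {}max1 y : cslab n r y -> dot y n <= S -> G1 y <= G1 y1.
  by move=> yr yS; have := max1 y yr yS; rewrite max_l // ltW.
have y1lt : dot y1 n < S.
  rewrite lt_neqAle y1S andbT; apply/eqP => y1e.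
  have := max2 _ y1r; have := p1S _ y1S; have /andP[_ +] := p2b y1.
  rewrite y1e => h1 h2 h3.
  have : psi2 y1 < psi1 y1.
    apply: le_lt_trans h1 _; apply: lt_le_trans h2; rewrite CE SE; clr; lra.
  rewrite -(ltr_pM2l tau0); move: lt12 h3; rewrite /G1 /G2; clr; lra.
have y1nr : dot y1 n != r.
  apply/eqP => y1e; have := top y1 (psi1 y1) y1e; rewrite -/(G1 y1) => h1.
  have := p1S _ y1S => h2; have {}h1 := h1 ltac:(by move: h2 cr0; clr; lra).
  move: h1 xy2 lt12 G2x; clr; lra.
have [y10|y1n0] := eqVneq (dot y1 n) 0; last first.
  have y1i := inside _ y1r y1n0 y1nr.
  have [a ak La] := genL_layer n1 lam0 CB0 cAB y1.
  have a0 : 0 <= a.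
    rewrite (le_trans _ ak) // mulr_ge0 ?(ltW k0) // (le_trans ler01) // E1 //.
    by case/andP: y1r.
  exfalso; apply: (interior psi1 (k^-1 * a) y1
    (Num.min (S - dot y1 n) (Num.min (dot y1 n) (r - dot y1 n)))) => //.
  - by case/andP: y1i => h1 h2; rewrite !lt_min h1 !subr_gt0 h2 y1lt.
  - by rewrite mulr_ge0 // invr_ge0 ltW.
  - move=> z; rewrite lt_min => /andP[zS /(ball _ _ y1i) zr]; apply: max1 => //.
    by case/andP: (near y1 z _ zS) => _; clr; lra.
  rewrite -mulNr -(subr0 a); apply: genLZ; apply: genLB => //; exact: genL_cst.
have psi10 : psi1 y1 = 0.
  by rewrite /psi1 layerE y10 mulr0 expR0 subrr mulr0.
have Ey1 : E y1 = 1 by rewrite layerE y10 mulr0 expR0.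
have S0S : S0 <= S by rewrite SE -addrA lerDl addr_ge0 // mulr_ge0.
exists y1; split => //.
    have h1 : eps * (- M) <= eps * pert y1.
      rewrite ler_pM2l // (le_trans _ (pertb _ _)) ?lerDr ?en_ge0 //.
      by case/andP: y1r.
    have h2 : 0 <= tau * (c + c * r) by rewrite mulr_ge0 ?addr_ge0 // ltW.
    move: h1 h2 xy2 lt12 G2x; rewrite /G1 psi10; clr; lra.
  move=> y yr yS; have y0 : 0 <= dot y n by case/andP: yr.
  have := max1 y yr (le_trans yS S0S); rewrite /G1 psi10 /pert Ey1.
  have h1 : tau * psi1 y <= 0 by rewrite mulr_ge0_le0 ?p10 ?(ltW tau0).
  have h2 : eps * (bump y - bump y1) <= e0 * en (y - y1).
    apply: (@le_trans _ _ (eps * en (y - y1))); first by rewrite ler_pM2l // bump_lip.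
    by rewrite ler_wpM2r ?en_ge0.
  have h3 : 0 <= eps * (K * (E y - 1)).
    by rewrite mulr_ge0 ?(ltW eps0) // mulr_ge0 ?(ltW K0) // subr_ge0 E1.
  move: h1 h2 h3; clr; lra.
exists (Num.min (Num.min S r) (K * k)).
  by rewrite !lt_min S1 r0 mulr_gt0.
move=> t; rewrite !lt_min => /andP[t0 /andP[/andP[tS tr] tK]].
have tn : dot (y1 + t *: n) n = t by rewrite dotDl dotZl n1 y10 add0r mulr1.
have := max1 (y1 + t *: n); rewrite /cslab /= tn => h1.
have {}h1 := h1 ltac:(by rewrite !ltW) (ltW tS).
have ekt : 1 + k * t <= E (y1 + t *: n).
  by rewrite layerE tn expR_ge1Dx.
have h2 : tau * psi1 (y1 + t *: n) <= tau * - t.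
  rewrite ler_pM2l // /psi1 mulNr lerN2 mulrC ler_pdivlMr //; move: ekt; clr; lra.
(* On the hyperplane [bump] has no slope along [n]: its increase is quadratic, and for [t <= K k]
   the linear decrease of [- K E] absorbs it. *)
have h3 : bump (y1 + t *: n) - bump y1 <= t ^+ 2.
  have := bump_sq (y1 + t *: n); have := bump_sq y1.
  rewrite !dotDl !dotZl !dotDr !dotZr (dotC n y1) n1 y10 => b1 b2.
  have := bump_gt0 (y1 + t *: n); have : 1 <= bump y1.
    by rewrite bumpE -{1}sqrtr1 ler_wsqrtr // lerDl dotxx_ge0.
  rewrite leNgt => b3 b4; apply/negP => b5; move: b1 b2 b3 b4 b5; clr; nra.
have h4 : bump (y1 + t *: n) - bump y1 - K * (E (y1 + t *: n) - 1) <= 0.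
  have : K * (k * t) <= K * (E (y1 + t *: n) - 1).
    by rewrite ler_pM2l // lerBrDr addrC.
  have : t * t <= t * (K * k) by rewrite ler_pM2l // ltW.
  move: h3; clr; lra.
have h5 : eps * (bump (y1 + t *: n) - bump y1 - K * (E (y1 + t *: n) - 1)) <= 0.
  by rewrite mulr_ge0_le0 // ltW.
move: h1 h2 h5; rewrite /G1 psi10 /pert Ey1; clr; lra.
Qed.
End Contact.

Section Comparison.
Context {R : realType} {D : nat}.
Set Implicit Arguments. Unset Strict Implicit.
Local Notation V := 'rV[R]_D.
Variables (n : V) (lam Lam CB : R) (A : V -> 'M[R]_D) (B : V -> V) (h : V -> R) (ch : R).
Hypotheses (n1 : dot n n = 1) (lam0 : 0 < lam) (CB0 : 0 <= CB).
Hypotheses (cAB : coefs lam Lam CB A B) (ch0 : 0 <= ch) (hc : continuous h)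
  (hL : forall x, genL A B h x 0) (hs : forall x, `|h x - dot x n| <= ch).

Definition nderiv_ge (Z : V -> R) (y : V) (a : R) := forall e : R, 0 < e ->
  exists2 dl : R, 0 < dl & forall t : R, 0 < t < dl -> Z y + (a - e) * t <= Z (y + t *: n).

(** For a slope [tau > b], the contact point offered by [contact_or_bound] contradicts the lower
    bound [- b] on the normal derivative, so the barrier bound holds; then [tau] tends to [b]. *)
Lemma strip_comparison : exists C1 c : R, [/\ 0 <= C1, 0 <= c &
  forall (r m m0 b : R) (Z : V -> R), 0 < r -> 0 <= b ->
    ctn (cslab n r) Z -> (forall x, cslab n r x -> Z x <= m0) ->
    (forall x, slab n r x -> exists2 a, 0 <= a & genL A B Z x a) ->
    (forall x, dot x n = r -> Z x <= m) ->
    (forall x, dot x n = 0 -> Z x <= m \/ nderiv_ge Z x (- b)) ->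
    forall x, cslab n r x -> Z x <= m + b * (C1 + c * (r - dot x n))].
Proof.
have [C1 [c [C10 c0 H]]] := contact_or_bound n1 lam0 CB0 cAB ch0 hc hL hs (lexx 0).
exists C1, c; split => // r m m0 b Z r0 b0 cZ bZ LZ mZ nZ x xr.
have W0 : 0 <= C1 + c * (r - dot x n).
  by case/andP: (xr) => _ h2; rewrite addr_ge0 // mulr_ge0 // subr_ge0.
have key tau : b < tau -> Z x <= m + tau * (C1 + c * (r - dot x n)).
  move=> bt; have tau0 : 0 < tau by exact: le_lt_trans bt.
  have [|H2] := H r m m0 tau Z r0 tau0 cZ bZ LZ mZ; first exact.
  have [y0 [y00 my0 _ [t0 t00 ht]]] := H2 1 ltr01.
  have [Zm|] := nZ _ y00; first by rewrite ltNge Zm in my0.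
  have e0 : 0 < (tau - b) / 2 by rewrite divr_gt0 // subr_gt0.
  move=> /(_ _ e0) [dl dl0 hd].
  pose t := Num.min t0 dl / 2.
  have tp : 0 < t by rewrite divr_gt0 // lt_min t00.
  have tlt : t < Num.min t0 dl by rewrite ltr_pdivrMr // ltr_pMr ?ltr1n // lt_min t00.
  have {}ht := ht t ltac:(by move: tlt; rewrite tp lt_min => /andP[]).
  have {}hd := hd t ltac:(by move: tlt; rewrite tp lt_min => /andP[]).
  have : 0 < (tau - b) / 2 * t by rewrite mulr_gt0.
  move: ht hd; clear - n1 lam0 CB0 cAB ch0 hc hL hs; lra.
rewrite leNgt; apply/negP => lt.
pose gap := Z x - (m + b * (C1 + c * (r - dot x n))).
have gap0 : 0 < gap by rewrite subr_gt0.
have W1 : 0 < C1 + c * (r - dot x n) + 1 by rewrite ltr_wpDl.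
have := key (b + gap / (C1 + c * (r - dot x n) + 1) / 2).
rewrite ltrDl !divr_gt0 // => /(_ isT).
have : gap / (C1 + c * (r - dot x n) + 1) / 2 * (C1 + c * (r - dot x n)) <= gap / 2.
  rewrite mulrAC ler_pM2r ?invr_gt0 // mulrAC ler_pdivrMr //; by rewrite ler_pM2l // lerDl.
move: gap0; rewrite /gap; set W := _ + _ * (_ - _); clear - n1 lam0 CB0 cAB ch0 hc hL hs; lra.
Qed.

End Comparison.

(** * Doubling of variables and Lipschitz estimates *)

Section SecondDifferences.
Context {R : realType} {D : nat}.
Set Implicit Arguments. Unset Strict Implicit.
Local Notation V := 'rV[R]_D.
Implicit Types (g : R -> R) (w : V -> R) (x y z p : V) (H : 'M[R]_D).

(** Second derivative at 0 read off symmetric differences. For a function of several points it is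
    taken along a line of the product space, which spares a jet in all the variables together. *)
Definition sdiff g (c : R) := forall e : R, 0 < e -> exists2 dl : R, 0 < dl &
  forall t : R, `|t| < dl -> `|g t + g (- t) - 2 * g 0 - c * t ^+ 2| <= e * t ^+ 2.

Lemma sdiff_jet w x p H z : jet w x p H -> sdiff (fun t => w (x + t *: z)) (qf H z).
Proof.
move=> jw e e0; have [dl dl0 h] := jet_sd z jw _ e0; exists dl => // t /h.
by rewrite scaleNr scale0r addr0 (mulrC (qf H z)).
Qed.

Lemma sdiffD g g' c c' : sdiff g c -> sdiff g' c' -> sdiff (fun t => g t + g' t) (c + c').
Proof.
move=> hg hg' e e0; have e2 : 0 < e / 2 by rewrite divr_gt0.
have [d d0 h] := hg _ e2; have [d' d'0 h'] := hg' _ e2.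
exists (Num.min d d'); first by rewrite lt_min d0.
move=> t; rewrite lt_min => /andP[/h + /h']; rewrite !ler_norml.
by move=> /andP[? ?] /andP[? ?]; apply/andP; split; lra.
Qed.

Lemma sdiffN g c : sdiff g c -> sdiff (fun t => - g t) (- c).
Proof.
move=> hg e e0; have [d d0 h] := hg _ e0; exists d => // t /h.
by rewrite !ler_norml => /andP[? ?]; apply/andP; split; lra.
Qed.

Lemma sdiffB g g' c c' : sdiff g c -> sdiff g' c' -> sdiff (fun t => g t - g' t) (c - c').
Proof. by move=> h /sdiffN; exact: sdiffD. Qed.

Lemma sdiff_max g c (r : R) : 0 < r -> (forall t, `|t| < r -> g t <= g 0) ->
  sdiff g c -> c <= 0.
Proof.
move=> r0 mx hg; rewrite leNgt; apply/negP => c0.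
have [d d0 h] := hg (c / 2) (divr_gt0 c0 (ltr0Sn R 1)).
pose t := Num.min d r / 2.
have m0 : 0 < Num.min d r by rewrite lt_min d0.
have t0 : 0 < t by rewrite divr_gt0.
have tlt : t < Num.min d r by rewrite ltr_pdivrMr // ltr_pMr ?ltr1n.
move: tlt; rewrite lt_min => /andP[td tr].
have := h t; rewrite gtr0_norm // => /(_ td); rewrite ler_norml => /andP[h1 _].
have := mx t; rewrite gtr0_norm // => /(_ tr) h2.
have := mx (- t); rewrite normrN gtr0_norm // => /(_ tr) h3.
have : 0 < c * t ^+ 2 by rewrite mulr_gt0 ?exprn_gt0.
lra.
Qed.

Lemma jet_shift w y x p H : jet w (x - y) p H -> jet (fun x => w (x - y)) x p H.
Proof.
move=> jw; have := @jet_subst _ _ w (- y) 1 x p H.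
rewrite scale1r addrC => /(_ jw); rewrite expr1n !scale1r.
by under [X in jet X]eq_fun do rewrite scale1r addrC.
Qed.

Lemma jet_shift_opp w y x p H : jet w (y - x) p H -> jet (fun x => w (y - x)) x (- p) H.
Proof.
move=> jw; have := @jet_subst _ _ w y (-1) x p H.
rewrite scaleN1r => /(_ jw); rewrite sqrrN expr1n scaleN1r scale1r.
by under [X in jet X]eq_fun do rewrite scaleN1r.
Qed.

(** The first-order conditions come from freezing one of the two points, the second-order one from
    moving both points at once along [z] and [z']. *)
Lemma two_point_max w v f x y (r : R) p H p' H' pz Hz : 0 < r ->
  (forall z z', en z < r -> en z' < r ->
     w (x + z) - v (y + z') - f (x + z - (y + z')) <= w x - v y - f (x - y)) ->
  jet w x p H -> jet v y p' H' -> jet f (x - y) pz Hz ->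
  [/\ p = pz, p' = pz & forall z z', qf H z - qf H' z' <= qf Hz (z - z')].
Proof.
move=> r0 mx jw jv jf.
have e0r : en (0 : V) < r by rewrite en0.
split.
- have := jetB jw (jet_shift jf) => j.
  have /(jet_max r0) /(_ j) [/eqP] : forall z, en z < r -> w (x + z) - f (x + z - y) <= w x - f (x - y).
    by move=> z zr; have := mx z 0 zr e0r; rewrite addr0; lra.
  by rewrite subr_eq0 => /eqP.
- have := jetB (jetZ (-1) jv) (jet_shift_opp jf) => j.
  have /(jet_max r0) /(_ j) [/eqP] : forall z, en z < r ->
      -1 * v (y + z) - f (x - (y + z)) <= -1 * v y - f (x - y).
    by move=> z zr; have := mx 0 z e0r zr; rewrite addr0; lra.
  by rewrite scaleN1r opprK addrC subr_eq0 => /eqP.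
move=> z z'; rewrite -subr_le0.
have s := sdiffB (sdiffB (sdiff_jet z jw) (sdiff_jet z' jv)) (sdiff_jet (z - z') jf).
have k0 : 0 < en z + en z' + 1 by rewrite ltr_wpDl ?addr_ge0 ?en_ge0.
apply: sdiff_max (divr_gt0 r0 k0) _ s => t; rewrite ltr_pdivlMr // => ht.
have [n0 n1 n2] : [/\ 0 <= `|t|, 0 <= en z & 0 <= en z'] by rewrite !en_ge0.
have h1 : en (t *: z) < r by rewrite enZ; nra.
have h2 : en (t *: z') < r by rewrite enZ; nra.
have := mx _ _ h1 h2; rewrite !scale0r !addr0 scalerBr.
by rewrite (_ : x - y + (t *: z - t *: z') = x + t *: z - (y + t *: z')) // addrACA opprD.
Qed.

End SecondDifferences.

Section Radial.
Context {R : realType} {D : nat}.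
Set Implicit Arguments. Unset Strict Implicit.
Local Notation V := 'rV[R]_D.

Lemma jet_eq (w v : V -> R) x p p' H H' : jet w x p H -> w =1 v -> p = p' -> H = H' ->
  jet v x p' H'.
Proof. by move=> j /funext <- <- <-. Qed.

Lemma jet_radial (a : R) (z : V) : 0 < en z ->
  jet (fun z => en z `^ a) z ((a * en z `^ a / dot z z) *: z)
    ((a * en z `^ a / dot z z) *: 1%:M +
     (a * (a - 2) * en z `^ a / dot z z ^+ 2) *: (z^T *m z)).
Proof.
move=> z0; have q0 : 0 < dot z z by rewrite -en_sq exprn_gt0.
have eE (y : V) : en y `^ a = dot y y `^ (a / 2).
  by rewrite /en -powR12_sqrt ?dotxx_ge0 // -powRrM mulrC.
have j1 : jet (fun y : V => dot y y) z (2 *: z) (2 *: 1%:M).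
  have := jet_sqdist 0 z; rewrite subr0.
  by under [X in jet X]eq_fun do rewrite subr0.
have := jet_comp j1 (peano_powR (a / 2) _ q0).
under [X in jet X]eq_fun do rewrite -eE.
rewrite !(powRB (x := dot z z)) ?(gt_eqF q0) ?implybT // powRr1 ?(ltW q0) //.
rewrite (powR_mulrn 2) ?(ltW q0) // -!eE.
rewrite (_ : (2 *: z)^T = 2 *: z^T); last by apply/matrixP => i j; rewrite !mxE.
rewrite -!scalemxAr -!scalemxAl !scalerA.
move=> j; refine (jet_eq j _ _ _) => //; first by congr (_ *: _); field; rewrite gt_eqF.
by congr (_ *: _ + _ *: _); field; rewrite gt_eqF.
Qed.

Lemma powR_le2 (g r rho : R) : 0 < g < 1 -> 0 < r <= 2 * rho -> r `^ g <= 2 * rho `^ g.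
Proof.
move=> /andP[g0 g1] /andP[r0 r2]; have rho0 : 0 < rho by lra.
apply: (@le_trans _ _ ((2 * rho) `^ g)).
  by apply: ge0_ler_powR => //; rewrite ?nnegrE ?ltW //; lra.
rewrite powRM ?(ltW rho0) // ler_wpM2r ?powR_ge0 //.
by apply: ler1_powR; [lra | exact: ltW].
Qed.

Lemma powR_ge_lin (g r rho : R) : 0 < g < 1 -> 0 < r <= 2 * rho ->
  rho `^ g * r <= 2 * rho * r `^ g.
Proof.
move=> /andP[g0 g1] /andP[r0 r2]; have rho0 : 0 < rho by lra.
have u : 0 < r / (2 * rho) <= 1.
  by rewrite divr_gt0 ?mulr_gt0 //= ler_pdivrMr ?mulr_gt0 // mul1r.
have := ger1_powR u (ltW g1).
rewrite ler_pdivrMr ?mulr_gt0 // => h.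
apply: (@le_trans _ _ ((2 * rho) `^ g * r)).
  rewrite ler_wpM2r ?(ltW r0) //; apply: ge0_ler_powR; rewrite ?nnegrE ?(ltW g0) //; lra.
apply: (@le_trans _ _ ((2 * rho) `^ g * ((r / (2 * rho)) `^ g * (2 * rho)))).
  by rewrite ler_wpM2l ?powR_ge0.
have h1 : 0 <= 2 * rho by lra.
have h2 : 0 <= r / (2 * rho) by rewrite divr_ge0 // ltW.
rewrite mulrA -powRM // [2 * rho * (_ / _)]mulrC divfK 1?[leLHS]mulrC //.
by rewrite gt_eqF // mulr_gt0.
Qed.

(** A concave modulus lying between 0 and [|z|] for [|z| <= 2 rho]. The exponent is the Hölder
    exponent of [A]: the radial second derivative, of order [- |z| ^ (g - 1)], has to match the
    error [|z| ^ g] of the coefficients times the tangential curvature, at most [1 / |z|]. *)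
Definition cone (g rho : R) (z : V) := en z - 16^-1 / rho `^ g * en z `^ (1 + g).

Lemma powR1D (g r : R) : 0 < r -> r `^ (1 + g) = r * r `^ g.
Proof. by move=> r0; rewrite powRD ?(gt_eqF r0) ?implybT // powRr1 // ltW. Qed.

Lemma cone_bounds (g rho : R) (z : V) : 0 < g < 1 -> 0 < rho -> en z <= 2 * rho ->
  0 <= cone g rho z <= en z.
Proof.
move=> g01 rho0 zr; have Q0 : 0 < rho `^ g by apply: powR_gt0.
rewrite /cone; have := en_ge0 z; rewrite le_eqVlt => /orP[/eqP <-|z0].
  by rewrite powR0 ?mulr0 ?subrr ?lexx // gt_eqF //; case/andP: g01; lra.
have hP := @powR_le2 g (en z) rho g01; rewrite z0 zr in hP; have {}hP := hP isT.
rewrite powR1D //; have P0 := powR_ge0 (en z) g.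
have h : 0 <= 16^-1 / rho `^ g * (en z * en z `^ g) <= en z.
  rewrite !mulr_ge0 ?invr_ge0 ?(ltW Q0) ?(ltW z0) //=.
  rewrite [leLHS](_ : _ = (en z * en z `^ g) / (16 * rho `^ g)); last first.
    by field; rewrite gt_eqF.
  rewrite ler_pdivrMr ?mulr_gt0 // ler_pM2l //; lra.
by apply/andP; split; lra.
Qed.

(** Here [d] is the tangential curvature, [d |z|] the slope and [d + b |z|^2] the radial second
    derivative. *)
Lemma jet_cone (g rho : R) (z : V) : 0 < g < 1 -> 0 < en z <= 2 * rho ->
  exists d b : R, [/\ jet (cone g rho) z (d *: z) (d *: 1%:M + b *: (z^T *m z)),
    b <= 0, 0 <= d * en z <= 1 &
    d + b * dot z z <= - (g / 16) * (en z `^ g / (en z * rho `^ g))].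
Proof.
move=> g01 /andP[z0 zr]; have rho0 : 0 < rho by lra.
have Q0 : 0 < rho `^ g by apply: powR_gt0.
have hP := @powR_le2 g (en z) rho g01; rewrite z0 zr in hP; have {}hP := hP isT.
have P0 : 0 < en z `^ g by apply: powR_gt0.
have j := jetB (jet_radial 1 z0) (jetZ (16^-1 / rho `^ g) (jet_radial (1 + g) z0)).
case/andP: g01 => g0 g1.
move: j; rewrite powRr1 ?en_ge0 // powR1D // -en_sq.
set r := en z in z0 zr hP P0 *; set P := r `^ g in hP P0 *; set Q := rho `^ g in Q0 hP *.
set d1 := 1 * r / _; set b1 := _ * r / _; set d2 := (1 + g) * _ / _.
set b2 := (1 + g) * _ * _ / _; move=> j.
exists (d1 - 16^-1 / Q * d2), (b1 - 16^-1 / Q * b2); split.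
- refine (jet_eq j _ _ _).
  + by move=> y; rewrite powRr1 ?en_ge0.
  + by rewrite scalerA -scalerBl.
  + by rewrite scalerDr !scalerA opprD addrACA -!scalerBl.
- have -> : b1 - 16^-1 / Q * b2 =
      - (1 - (1 + g) * (1 - g) * P / (16 * Q)) / r ^+ 3.
    by rewrite /b1 /b2; field; rewrite !gt_eqF.
  rewrite mulNr oppr_le0 divr_ge0 ?exprn_ge0 ?(ltW z0) // subr_ge0.
  rewrite ler_pdivrMr ?mulr_gt0 // mul1r.
  have : (1 + g) * (1 - g) * P <= 2 * P by rewrite ler_wpM2r ?(ltW P0) //; nra.
  lra.
- have -> : (d1 - 16^-1 / Q * d2) * r = 1 - (1 + g) * P / (16 * Q).
    by rewrite /d1 /d2; field; rewrite !gt_eqF.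
  have h : (1 + g) * P / (16 * Q) <= 1.
    rewrite ler_pdivrMr ?mulr_gt0 // mul1r.
    have : (1 + g) * P <= 2 * P by rewrite ler_wpM2r ?(ltW P0) //; lra.
    lra.
  have h' : 0 <= (1 + g) * P / (16 * Q).
    by rewrite divr_ge0 ?mulr_ge0 ?(ltW P0) ?(ltW Q0) //; lra.
  by apply/andP; split; lra.
rewrite [leLHS](_ : _ = - (g / 16) * ((1 + g) * (P / (r * Q)))).
  rewrite !mulNr lerN2 ler_wpM2l ?divr_ge0 ?(ltW g0) //.
  rewrite ler_peMl ?divr_ge0 ?mulr_ge0 ?ltW //; lra.
by rewrite /d1 /d2 /b1 /b2; field; rewrite !gt_eqF.
Qed.

End Radial.

Section LipschitzEstimate.
Context {R : realType} {D : nat}.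
Set Implicit Arguments. Unset Strict Implicit.
Local Notation V := 'rV[R]_D.
Implicit Types (w v : V -> R) (x y z p : V).

Lemma jet_eps w x p H : jet w x p H -> forall e : R, 0 < e ->
  exists2 dl : R, 0 < dl & forall y, en (y - x) < dl -> `|w y - w x| <= e.
Proof.
move=> jw e e0; have [C C0 hC] := qf_bound H.
have [d d0 h] := jw 1 ltr01.
have k0 : 0 < en p + C + 1 by rewrite ltr_wpDl // addr_ge0 ?en_ge0.
exists (Num.min (Num.min 1 d) (e / (en p + C + 1))).
  by rewrite !lt_min ltr01 d0 divr_gt0.
move=> y; rewrite !lt_min => /andP[/andP[z1 zd] ze].
have := h _ zd; rewrite (addrC x) subrK; set z := y - x in z1 zd ze *.
have := dot_le_en p z; have := hC z; rewrite -en_sq; have := en_ge0 z.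
move: ze; rewrite ltr_pdivlMr // !ler_norml.
move=> ze z0 /andP[q1 q2] /andP[p1 p2] /andP[h1 h2].
have zz : en z ^+ 2 <= en z by rewrite expr2 ler_piMr // ltW.
have Cz : C * en z ^+ 2 <= C * en z by rewrite ler_wpM2l.
by apply/andP; split; nra.
Qed.

Lemma cone_continuous (g rho : R) : 0 < g < 1 -> 0 < rho -> continuous (@cone R D g rho).
Proof.
move=> g01 rho0; apply: continuous_eps => x e e0.
have [/eqP|x0] := boolP (en x == 0).
  move=> /en_eq0 ->; have c00 : cone g rho (0 : V) = 0.
    have := @cone_bounds _ _ g rho (0 : V) g01 rho0; rewrite en0.
    by move=> /(_ _) h; apply/eqP; rewrite eq_le andbC h // mulr_ge0 // ltW.
  exists (Num.min e (2 * rho)); first by rewrite lt_min e0 mulr_gt0.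
  move=> y; rewrite subr0 c00 subr0 lt_min => /andP[ye /ltW yr].
  have /andP[h1 h2] := cone_bounds g01 rho0 yr.
  by rewrite ger0_norm // (le_trans h2) // ltW.
have {}x0 : 0 < en x by rewrite lt_neqAle eq_sym x0 en_ge0.
have xr : 0 < en x <= 2 * (en x + rho) by rewrite x0 /=; lra.
have j1 := jet_radial 1 x0; have j2 := jetZ (16^-1 / rho `^ g) (jet_radial (1 + g) x0).
have [dl dl0 h] := jet_eps (jetB j1 j2) e0; exists dl => // y /h.
by rewrite /cone !powRr1 ?en_ge0.
Qed.

Definition hball (n y0 : V) (rho : R) : set V :=
  [set x | en (x - y0) <= rho /\ 0 <= dot x n].

Lemma dotl_continuous (n : V) : continuous (fun y : V => dot y n).
Proof.
rewrite (_ : (fun y => _) = dot n); first exact: dot_continuous.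
by apply/funext => y; exact: dotC.
Qed.

Lemma hball_closed n y0 rho : closed (hball n y0 rho).
Proof.
apply: (@closedI _ [set x | en (x - y0) <= rho] [set x | 0 <= dot x n]);
  apply: closed_le_ctn; try exact: cst_continuous; last exact: dotl_continuous.
apply: continuous_eps => x e e0; exists e => // y yx.
by rewrite (le_trans (ler_en_dist _ _)) // opprB addrA subrK ltW.
Qed.

Lemma compact_hball n y0 rho : compact (hball n y0 rho).
Proof.
by apply: (@compact_closed_en _ _ _ y0 rho) => [|x []] //; exact: hball_closed.
Qed.

(** The Hölder bound on [A] is stated for quadratic forms, since differences of [A] are only tested
    on vectors; exchanging [x] and [y] gives the other side. *)
Definition hcoefs (lam Lam CB CA gam : R) (A : V -> 'M[R]_D) (B : V -> V) :=
  coefs lam Lam CB A B /\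
  forall x y z, qf (A x) z - qf (A y) z <= CA * en (x - y) `^ gam * dot z z.

(** A bound on one-sided difference quotients that does not presuppose a normal derivative; it also
    serves at points above the hyperplane. *)
Definition nderiv_le (n : V) w x (G : R) := forall e : R, 0 < e ->
  exists2 dl : R, 0 < dl &
    forall t : R, 0 < t < dl -> `|w (x + t *: n) - w x| <= (G + e) * t.

(* [F] bounds the right-hand side, [G] the normal derivative on the flat boundary. *)
Definition lsol (n : V) (A : V -> 'M[R]_D) (B : V -> V) w y0 (rho F G : R) :=
  [/\ ctn (hball n y0 rho) w,
      forall x, en (x - y0) < rho -> 0 < dot x n ->
        exists2 a, `|a| <= F & genL A B w x a &
      forall x, en (x - y0) < rho -> dot x n = 0 -> nderiv_le n w x G].

(** Reflection coupling. On the common part [M] of [A] and [A'] both points move together, where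
    [Phi 0 <= 0]; along [e], with weight [lam / 4], they move in opposite directions and collect the
    concavity [c2]; the rest of each matrix has size [th] and is estimated crudely by [c1]. *)
Lemma reflection_trace (lam Lam th : R) (A A' : 'M[R]_D) (H H' : 'M[R]_D)
    (e : V) (Phi : V -> R) (c1 c2 L : R) :
  0 < lam -> 0 < th -> 2 * th <= lam / 2 -> dot e e = 1 ->
  elliptic lam Lam A -> elliptic lam Lam A' ->
  (forall z, qf A z - qf A' z <= th * dot z z) ->
  (forall z, qf A' z - qf A z <= th * dot z z) ->
  0 <= c1 -> 0 <= L ->
  (forall z z', qf H z - qf H' z' <= Phi (z - z') + L * (dot z z + dot z' z')) ->
  Phi 0 <= 0 -> (forall z, Phi z <= c1 * dot z z) -> Phi (2 *: e) <= c2 ->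
  tr2 A H - tr2 A' H' <= lam / 4 * c2 + 5 * D%:R * th * c1 +
    L * (2 * D%:R * Lam + lam + 5 * D%:R * th).
Proof.
move=> lam0 th0 thl e1 [sA eA] [sA' eA'] d1 d2 c10 L0 hq P0 Pc Pe.
have symE (C : 'M[R]_D) : C^T = C -> forall i j, C i j = C j i.
  by move=> sC i j; rewrite -{1}sC mxE.
have q00 (C : 'M[R]_D) : qf C 0 = 0 by rewrite /qf !mul0mx mxE.
have ee z : dot e z ^+ 2 <= dot z z by have := dot_CS e z; rewrite e1 mul1r.
pose M := A' - (2 * th) *: 1%:M - (lam / 4) *: (e^T *m e).
have eM : elliptic (lam / 4) Lam M.
  split=> [|z].
    apply/matrixP => i j; rewrite !mxE !big_ord1 !mxE eq_sym (symE A' sA' j i); ring.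
  have /andP[h1 h2] := eA' z; rewrite /M !qflE qf1 qf_outer.
  have := ee z; have := dotxx_ge0 z; have := sqr_ge0 (dot e z) => s0 z0 ez.
  have h3 : lam / 4 * dot e z ^+ 2 <= lam / 4 * dot z z by rewrite ler_wpM2l //; lra.
  have h4 : 2 * th * dot z z <= lam / 2 * dot z z by rewrite ler_wpM2r.
  have h5 : 0 <= lam / 4 * dot e z ^+ 2 by rewrite mulr_ge0 //; lra.
  have h6 : 0 <= 2 * th * dot z z by rewrite mulr_ge0 //; lra.
  by apply/andP; split; lra.
pose N := A - A' + (2 * th) *: 1%:M.
have eN : elliptic th (3 * th) N.
  split=> [|z].
    by apply/matrixP => i j; rewrite !mxE eq_sym (symE A sA j i) (symE A' sA' j i).
  have := d1 z; have := d2 z; rewrite /N !qflE qf1 => h1 h2.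
  by apply/andP; split; lra.
have lam4 : 0 < lam / 4 by rewrite divr_gt0.
have [lM ME trM] := elliptic_sum_outer lam4 eM.
have [lN NE trN] := elliptic_sum_outer th0 eN.
have AE : tr2 A H = tr2 M H + tr2 N H + lam / 4 * qf H e.
  rewrite -tr2_outer -tr2Zl -!tr2Dl; congr (tr2 _ H).
  by apply/matrixP => i j; rewrite !mxE; ring.
have A'E : tr2 A' H' = tr2 M H' + 2 * th * tr2 1%:M H' + lam / 4 * qf H' e.
  rewrite -tr2_outer -!tr2Zl -!tr2Dl; congr (tr2 _ H').
  by apply/matrixP => i j; rewrite !mxE; ring.
have B1 : tr2 M H - tr2 M H' <= 2 * L * (D%:R * Lam).
  rewrite ME !tr2_sum_outer -sumrB.
  apply: (@le_trans _ _ (\sum_(z <- lM) 2 * L * dot z z)).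
    apply: ler_sum => z _; have := hq z z; rewrite subrr; move: P0; clear; lra.
  by rewrite -mulr_sumr ler_wpM2l // mulr_ge0.
have B2 : tr2 N H <= (c1 + L) * (3 * D%:R * th).
  rewrite NE tr2_sum_outer.
  apply: (@le_trans _ _ (\sum_(z <- lN) (c1 + L) * dot z z)).
    apply: ler_sum => z _; have := hq z 0; have := Pc z.
    rewrite subr0 dot0l addr0 q00; clear; lra.
  rewrite -mulr_sumr ler_wpM2l ?addr_ge0 //.
  by rewrite (le_trans trN) // mulrCA mulrA.
have B3 : - (2 * th * tr2 1%:M H') <= 2 * th * (D%:R * (c1 + L)).
  rewrite -mulrN ler_pM2l ?mulr_gt0 // tr2C -tr2Nl tr2_1r.
  apply: (@le_trans _ _ (\sum_(i < D) (c1 + L))); last first.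
    by rewrite sumr_const card_ord mulr_natl.
  apply: ler_sum => i _; have := hq 0 (evec R i); have := Pc (- evec R i).
  rewrite sub0r dot0l dotNl dotNr opprK evec_unit qfNl q00; clear; lra.
have B4 : lam / 4 * (qf H e - qf H' e) <= lam / 4 * (c2 + 2 * L).
  have E2 : e - - e = 2 *: e by rewrite opprK scaler_nat mulr2n.
  rewrite ler_pM2l //; have := hq e (- e).
  rewrite E2 qfN dotNl dotNr opprK e1; move: Pe; clear; lra.
have B5 : 0 <= lam * L by rewrite mulr_ge0 // ltW.
rewrite AE A'E; clear - B1 B2 B3 B4 B5; lra.
Qed.

End LipschitzEstimate.

Section LipschitzEstimate2.
Context {R : realType} {D : nat}.
Set Implicit Arguments. Unset Strict Implicit.
Local Notation V := 'rV[R]_D.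
Implicit Types (w v : V -> R) (x y z p : V).

Lemma nonneg_taylor (a C dl : R) : 0 < dl -> 0 <= C ->
  (forall t : R, 0 < t < dl -> a * t <= C * t ^+ 2) -> a <= 0.
Proof.
move=> dl0 C0 h; rewrite leNgt; apply/negP => a0.
pose t := Num.min dl (a / (C + 1)) / 2.
have C1 : 0 < C + 1 by rewrite ltr_wpDl.
have m0 : 0 < Num.min dl (a / (C + 1)) by rewrite lt_min dl0 divr_gt0.
have t0 : 0 < t by rewrite divr_gt0.
have : t < Num.min dl (a / (C + 1)) by rewrite ltr_pdivrMr // ltr_pMr ?ltr1n.
rewrite lt_min ltr_pdivlMr // => /andP[td ta].
have := h t; rewrite t0 td => /(_ isT); rewrite expr2 mulrA ler_pM2r // => h1.
move: h1 ta t0; clear; nra.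
Qed.

(** At an interior maximum of the doubled function, the gain [K lam gam] due to the concavity of the
    cone cannot exceed the noise from the right-hand side, the localization [Lp] and the tilt [2 G].
    Smallness of [rho] lets the gain absorb the Hölder error and the drift acting on the cone. *)
Lemma lipschitz_interior (n y0 : V) (lam Lam CB CA gam rho F G Lp K : R)
    (A : V -> 'M[R]_D) (B : V -> V) w x y (r : R) :
  dot n n = 1 -> 0 < lam -> 0 <= Lam -> 0 <= CB -> 0 < CA -> 0 < gam < 1 ->
  0 < rho <= 1 -> 0 <= F -> 0 < G -> 0 <= Lp -> 0 < K ->
  rho `^ gam <= lam * gam / (320 * (D%:R + 1) * CA) -> rho <= lam * gam / (256 * (CB + 1)) ->
  hcoefs lam Lam CB CA gam A B ->
  en (x - y0) <= rho -> en (y - y0) <= rho -> 0 < en (x - y) ->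
  (exists2 a, `|a| <= F & genL A B w x a) -> (exists2 a, `|a| <= F & genL A B w y a) ->
  0 < r ->
  (forall z z', en z < r -> en z' < r ->
    (w (x + z) - (Lp * dot (x + z - y0) (x + z - y0) - 2 * G * dot n (x + z)))
    - (w (y + z') + (Lp * dot (y + z' - y0) (y + z' - y0) - 2 * G * dot n (y + z')))
    - K * cone gam rho (x + z - (y + z')) <=
    (w x - (Lp * dot (x - y0) (x - y0) - 2 * G * dot n x))
    - (w y + (Lp * dot (y - y0) (y - y0) - 2 * G * dot n y)) - K * cone gam rho (x - y)) ->
  K * (lam * gam) <=
    64 * rho * (2 * F + Lp * (4 * D%:R * Lam + 2 * lam + 4 * D%:R * lam + 4 * CB) + 4 * CB * G).
Proof.
move=> n1 lam0 Lam0 CB0 CA0 g01 /andP[rho0 rho1] F0 G0 Lp0 K0 hQ hB [cAB hol] xr yr xy0.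
move=> [a aF [p [H [jw aE]]]] [a' a'F [p' [H' [jw' a'E]]]] r0 mx.
have g0 : 0 < gam by case/andP: g01.
set z0 := x - y in xy0 mx *.
have z0r : 0 < en z0 <= 2 * rho.
  rewrite xy0 /=; have := en_sub_triangle x y0 y; rewrite -/z0 (en_subC y0 y); lra.
have [d [b [jc b0 /andP[d0 d1] db]]] := jet_cone g01 z0r.
have j1 : jet (fun x => w x - (Lp * dot (x - y0) (x - y0) - 2 * G * dot n x)) x
    (p - (Lp *: (2 *: (x - y0)) - (2 * G) *: n)) (H - (Lp *: (2 *: 1%:M) - (2 * G) *: 0)).
  by apply: jetB => //; apply: jetB; apply: jetZ; [exact: jet_sqdist | exact: jet_dot].
have j2 : jet (fun x => w x + (Lp * dot (x - y0) (x - y0) - 2 * G * dot n x)) y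
    (p' + (Lp *: (2 *: (y - y0)) - (2 * G) *: n)) (H' + (Lp *: (2 *: 1%:M) - (2 * G) *: 0)).
  by apply: jetD => //; apply: jetB; apply: jetZ; [exact: jet_sqdist | exact: jet_dot].
have [pE p'E hq] := two_point_max r0 mx j1 j2 (jetZ K jc).
have Q0 : 0 < rho `^ gam by apply: powR_gt0.
have P0 : 0 < en z0 `^ gam by apply: powR_gt0.
have hP := powR_le2 g01 z0r; have hPl := powR_ge_lin g01 z0r.
set P := en z0 `^ gam in P0 hP hPl db; set Q := rho `^ gam in Q0 hQ hP hPl db.
set e0 := en z0 in z0r d0 d1 hPl db xy0.
have k1 : 0 < 320 * (D%:R + 1) * CA :> R by rewrite !mulr_gt0 ?ltr_wpDl.
have k2 : 0 < 256 * (CB + 1) by rewrite mulr_gt0 // ltr_wpDl.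
have hQ' : 320 * (D%:R + 1) * CA * Q <= lam * gam by rewrite mulrC -ler_pdivlMr.
have hB' : 256 * (CB + 1) * rho <= lam * gam by rewrite mulrC -ler_pdivlMr.
have lg : lam * gam <= lam by rewrite ler_piMr ?(ltW lam0) //; case/andP: g01 => _ /ltW.
have D0 : 0 <= D%:R :> R by [].
have CQ : 0 < CA * Q by rewrite mulr_gt0.
have DCQ : 0 <= D%:R * (CA * Q) by rewrite mulr_ge0 // ltW.
have th0 : 0 < CA * P by rewrite mulr_gt0.
have thP : CA * P <= 2 * (CA * Q) by rewrite mulrCA ler_pM2l.
have thl : 2 * (CA * P) <= lam / 2.
  by move: hQ' thP lg CQ DCQ; clear; lra.
have Dth : 5 * D%:R * (CA * P) <= 2 * D%:R * lam.
  have : D%:R * (CA * P) <= D%:R * (lam / 4).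
    by rewrite ler_wpM2l //; move: thl; clear; lra.
  have : 0 <= D%:R * lam by rewrite mulr_ge0 // ltW.
  by clear; lra.
have symd : en (y - x) = en z0 by rewrite en_subC.
pose e := e0^-1 *: z0.
have zz : dot z0 z0 = e0 ^+ 2 by rewrite -en_sq.
have ee : dot e e = 1.
  by rewrite /e dotZl dotZr zz; field; rewrite gt_eqF.
have ze : dot z0 (2 *: e) = 2 * e0.
  by rewrite /e !dotZr zz; field; rewrite gt_eqF.
have [[eA bB] [eA' bB']] := (cAB x, cAB y).
have S := @reflection_trace R D lam Lam (CA * P) (A x) (A y) H H' e
  (fun z => K * (d * dot z z + b * dot z0 z ^+ 2)) (K * d) (4 * K * (d + b * dot z0 z0)) (2 * Lp)
  lam0 th0 thl ee eA eA'.
have {S} S : tr2 (A x) H - tr2 (A y) H' <= lam / 4 * (4 * K * (d + b * dot z0 z0)) +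
    5 * D%:R * (CA * P) * (K * d) + 2 * Lp * (2 * D%:R * Lam + lam + 5 * D%:R * (CA * P)).
  have dd : 0 <= d by move: d0; rewrite pmulr_lge0.
  apply: S.
  - by move=> z; exact: hol.
  - by move=> z; have := hol y x z; rewrite symd.
  - by rewrite mulr_ge0 // ltW.
  - by rewrite mulr_ge0.
  - move=> z z'; have := hq z z'; rewrite !qflE !qf1 qf_outer.
    by clear; lra.
  - by rewrite !dot0r expr0n /= !mulr0 addr0 mulr0.
  - by move=> z; rewrite -mulrA ler_pM2l // gerDl mulr_le0_ge0 // sqr_ge0.
  by rewrite /= ze dotZl dotZr ee zz; clear; lra.
have PB : dot (B x) p - dot (B y) p' <= 2 * CB * K + 4 * CB * Lp * rho + 4 * CB * G.
  have -> : dot (B x) p = K * (d * dot (B x) z0) +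
      (Lp * (2 * dot (B x) (x - y0)) - 2 * G * dot (B x) n).
    have -> : p = K *: (d *: z0) + (Lp *: (2 *: (x - y0)) - (2 * G) *: n) by rewrite -pE subrK.
    rewrite (dotDr (B x) (K *: (d *: z0))) (dotDr (B x) (Lp *: (2 *: (x - y0)))).
    by rewrite (dotNr (B x) ((2 * G) *: n)) !(dotZr _ (B x)).
  have -> : dot (B y) p' = K * (d * dot (B y) z0) -
      (Lp * (2 * dot (B y) (y - y0)) - 2 * G * dot (B y) n).
    have -> : p' = K *: (d *: z0) - (Lp *: (2 *: (y - y0)) - (2 * G) *: n).
      by rewrite -p'E addrK.
    rewrite (dotDr (B y) (K *: (d *: z0))) (dotNr (B y) (Lp *: _ - _)).
    rewrite (dotDr (B y) (Lp *: (2 *: (y - y0)))).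
    by rewrite (dotNr (B y) ((2 * G) *: n)) !(dotZr _ (B y)).
  have bnd (u q : V) (m : R) : en u <= CB -> en q <= m -> `|dot u q| <= CB * m.
    by move=> h1 h2; rewrite (le_trans (dot_le_en _ _)) // ler_pM ?en_ge0.
  have bz (u : V) : en u <= CB -> `|dot u z0| <= CB * e0 by move=> h; exact: bnd.
  have en1 : en n <= 1 by rewrite (en_n n1).
  have := bnd _ _ _ bB xr; have := bnd _ _ _ bB' yr.
  have := bnd _ _ _ bB en1; have := bnd _ _ _ bB' en1.
  have := bz _ bB; have := bz _ bB'.
  rewrite !ler_norml => /andP[u1 u2] /andP[v1 v2] /andP[q1 q2] /andP[q3 q4] /andP[q5 q6] /andP[q7 q8].
  have Kd : K * d * (dot (B x) z0 - dot (B y) z0) <= 2 * CB * K.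
    apply: (@le_trans _ _ (K * d * (2 * CB * e0))).
      rewrite ler_wpM2l //; last by move: u1 v2; clear; lra.
      by rewrite mulr_ge0 ?(ltW K0) //; move: d0; rewrite pmulr_lge0.
    rewrite (_ : _ * _ = 2 * CB * K * (d * e0)); last by ring.
    by rewrite ler_piMr // !mulr_ge0 // ltW.
  have h1 : 2 * Lp * (dot (B x) (x - y0) + dot (B y) (y - y0)) <= 2 * Lp * (2 * (CB * rho)).
    rewrite ler_wpM2l ?mulr_ge0 //; move: q6 q8; clear; lra.
  have h2 : 2 * G * (- dot (B x) n - dot (B y) n) <= 2 * G * (2 * CB).
    rewrite ler_wpM2l ?mulr_ge0 ?(ltW G0) //; move: q1 q3; clear; lra.
  by move: Kd h1 h2; clear; lra.
have T0 : 0 < P / (e0 * Q) by rewrite divr_gt0 // mulr_gt0.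
set T := P / (e0 * Q) in T0 db.
(* [T] is the order of the radial concavity and is at least [1 / (2 rho)]: terms that do not depend
   on [|z0|] are compared with it at the price of a factor [rho]. *)
have TT : 1 <= 2 * rho * T.
  rewrite /T mulrA ler_pdivlMr ?mulr_gt0 // mul1r; move: hPl; clear; lra.
have dT : CA * P * d <= CA * Q * T.
  have -> : CA * P * d = (CA * Q * T) * (d * e0).
    by rewrite /T; field; rewrite !gt_eqF.
  by rewrite ler_piMr // mulr_ge0 // ltW.
clearbody T.
have main : K * (lam * (d + b * dot z0 z0) + 5 * (D%:R * (CA * P * d)) + 2 * CB) <=
    - K * (lam * gam / 32 * T).
  rewrite mulNr -mulrN ler_pM2l //.
  have h1 : lam * (d + b * dot z0 z0) <= lam * (- (gam / 16) * T) by rewrite ler_pM2l.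
  have h2 : D%:R * (CA * P * d) <= D%:R * (CA * Q * T) by rewrite ler_wpM2l.
  have h3 : 5 * (D%:R * (CA * Q * T)) <= lam * gam / 64 * T.
    rewrite !mulrA ler_pM2r //; move: hQ' CQ; clear; lra.
  have h4 : 2 * CB <= lam * gam / 64 * T.
    have : 2 * CB <= 2 * CB * (2 * rho * T) by rewrite ler_peMr // mulr_ge0.
    have : 256 * CB * rho * T <= lam * gam * T.
      rewrite ler_pM2r //; move: hB' rho0; clear; lra.
    clear; lra.
  by move: h1 h2 h3 h4; clear; lra.
have F1 : - (2 * F) <= a - a'.
  move: aF a'F; rewrite !ler_norml => /andP[h1 h2] /andP[h3 h4]; move: h1 h4; clear; lra.
have LpD : Lp * (10 * D%:R * (CA * P)) <= Lp * (4 * D%:R * lam).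
  by rewrite ler_wpM2l //; move: Dth; clear; lra.
have Lprho : CB * Lp * rho <= CB * Lp by rewrite ler_piMr // mulr_ge0.
have fin : K * (lam * gam / 32 * T) <=
    2 * F + Lp * (4 * D%:R * Lam + 2 * lam + 4 * D%:R * lam + 4 * CB) + 4 * CB * G.
  by move: F1 S PB main LpD Lprho; rewrite -aE -a'E; clear; lra.
have KT : K * (lam * gam) <= 64 * rho * (K * (lam * gam / 32 * T)).
  have : K * (lam * gam) * 1 <= K * (lam * gam) * (2 * rho * T).
    by rewrite ler_pM2l // !mulr_gt0.
  by clear; lra.
by apply: le_trans KT _; rewrite ler_pM2l // mulr_gt0.
Qed.

End LipschitzEstimate2.

Section LipschitzEstimate3.
Context {R : realType} {D : nat}.
Set Implicit Arguments. Unset Strict Implicit.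
Local Notation V := 'rV[R]_D.
Implicit Types (w v : V -> R) (x y z p : V).

Lemma fst_ctn (T U : topologicalType) : continuous (@fst T U).
Proof. by move=> x; exact: cvg_fst. Qed.

Lemma snd_ctn (T U : topologicalType) : continuous (@snd T U).
Proof. by move=> x; exact: cvg_snd. Qed.

Lemma sqdist_continuous (y0 : V) : continuous (fun x : V => dot (x - y0) (x - y0)).
Proof.
apply: continuous_eps => x e e0; have [dl dl0 h] := jet_eps (jet_sqdist y0 x) e0.
by exists dl.
Qed.

Lemma jet_ub w x p H z : jet w x p H -> exists C dl : R, [/\ 0 < C, 0 < dl &
  forall t : R, `|t| < dl -> `|w (x + t *: z) - w x - t * dot p z| <= C * t ^+ 2].
Proof. by move=> /(@jet_d1 _ _ _ _ _ _ z) [C C0 [dl dl0 h]]; exists C, dl. Qed.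

(** A maximum with one point on the hyperplane is impossible: when this point moves inwards by [t],
    the tilt gains [2 G t] and [w] loses at most [3 G t / 2], while cone and localization lose
    nothing at first order because the other point and [y0] lie in the half space. The sign [s]
    covers both points of the pair. *)
Lemma lipschitz_boundary (n y0 : V) (gam rho G Lp K r : R) w (x y : V) (s : R) :
  dot n n = 1 -> 0 < gam < 1 -> 0 < G -> 0 <= Lp -> 0 < K -> 0 < r ->
  dot x n = 0 -> 0 <= dot y n -> 0 <= dot y0 n -> 0 < en (x - y) <= 2 * rho ->
  s = 1 \/ s = -1 ->
  nderiv_le n w x G ->
  (forall t : R, 0 < t < r ->
    s * w (x + t *: n) - (Lp * dot (x + t *: n - y0) (x + t *: n - y0) - 2 * G * dot n (x + t *: n))
    - K * cone gam rho (x + t *: n - y) <=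
    s * w x - (Lp * dot (x - y0) (x - y0) - 2 * G * dot n x) - K * cone gam rho (x - y)) ->
  False.
Proof.
move=> n1 g01 G0 Lp0 K0 r0 x0 y0' y00 xy s1 nw mx.
have [d [b [jc _ /andP[d0 _] _]]] := jet_cone g01 xy.
have dd : 0 <= d by move: d0; rewrite pmulr_lge0 //; case/andP: xy.
have [C [d1 [C0 d10 hc]]] := jet_ub n jc.
have [d2 d20 hw] := nw (G / 2) (divr_gt0 G0 (ltr0Sn R 1)).
have xn : dot n x = 0 by rewrite dotC.
pose dl := Num.min r (Num.min d1 d2).
have dl0 : 0 < dl by rewrite !lt_min r0 d10.
suff : G / 2 <= 0 by rewrite leNgt divr_gt0.
apply: (@nonneg_taylor _ _ (Lp + K * C) dl) => //.
  by rewrite addr_ge0 // mulr_ge0 ?ltW.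
move=> t; rewrite !lt_min => /andP[t0 /andP[tr /andP[td1 td2]]].
have := mx t; rewrite t0 tr => /(_ isT).
have := hw t; rewrite t0 td2 => /(_ isT).
have := hc t; rewrite gtr0_norm // => /(_ td1).
rewrite (_ : x - y + t *: n = x + t *: n - y); last by rewrite addrAC.
have -> : dot (x + t *: n - y0) (x + t *: n - y0) =
    dot (x - y0) (x - y0) - 2 * t * dot y0 n + t ^+ 2.
  rewrite !dotE (dotC n y0) (dotC y0 x) (dotC n x) x0 n1; ring.
have -> : dot n (x + t *: n) = t by rewrite !dotE xn n1; ring.
have zn : dot (d *: (x - y)) n = - (d * dot y n) by rewrite !dotE x0; ring.
rewrite zn xn; set c1 := cone _ _ (x + _ - y); set c0 := cone _ _ (x - y).
have yd : 0 <= t * (d * dot y n) by rewrite !mulr_ge0 // ltW.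
have Lt : 0 <= Lp * (2 * t * dot y0 n) by rewrite !mulr_ge0 // ltW.
rewrite ler_norml => /andP[_ h1]; rewrite ler_norml => /andP[h2 h3].
have Kc : K * (c1 - c0) <= K * (C * t ^+ 2).
  rewrite ler_pM2l //; move: h1 yd; clear; lra.
case: s1 => ->; move: Kc h2 h3 Lt; clear; lra.
Qed.

(** Doubling of variables with the cone as modulus. The localization keeps the two points off the
    sphere and the tilt keeps them off the hyperplane; the tilt is what costs the additive term
    [6 G rho]. *)
Lemma lipschitz_estimate (n : V) (lam Lam CB CA gam : R) :
  dot n n = 1 -> 0 < lam -> 0 <= Lam -> 0 <= CB -> 0 < CA -> 0 < gam < 1 ->
  exists rho0 C : R, [/\ 0 < rho0, rho0 <= 1, 0 < C &
    forall A B w y0 (rho F G W : R), hcoefs lam Lam CB CA gam A B ->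
      0 < rho <= rho0 -> 0 <= F -> 0 < G -> 0 <= W -> 0 <= dot y0 n ->
      lsol n A B w y0 rho F G ->
      (forall x y, hball n y0 rho x -> hball n y0 rho y -> w x - w y <= 2 * W) ->
      forall x, hball n y0 rho x ->
        w x - w y0 <= C * (W / rho + F * rho + G * rho) * en (x - y0) + 6 * G * rho].
Proof.
move=> n1 lam0 Lam0 CB0 CA0 g01; have g0 : 0 < gam by case/andP: g01.
have lg : 0 < lam * gam by rewrite mulr_gt0.
have k1 : 0 < 320 * (D%:R + 1) * CA :> R.
  by apply: mulr_gt0; [apply: mulr_gt0; rewrite ?ltr0n // ltr_wpDl|].
pose q := lam * gam / (320 * (D%:R + 1) * CA).
have q0 : 0 < q by rewrite divr_gt0.
have k2 : 0 < 256 * (CB + 1) by apply: mulr_gt0; rewrite ?ltr0n // ltr_wpDl.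
pose rho0 := Num.min 1 (Num.min (q `^ gam^-1) (lam * gam / (256 * (CB + 1)))).
pose C2 := 4 * D%:R * Lam + 2 * lam + 4 * D%:R * lam + 4 * CB.
have C20 : 0 <= C2 by rewrite !addr_ge0 ?mulr_ge0 // ltW.
pose C := 64 / (lam * gam) * (2 + 2 * C2 + 4 * CB + 1) + 2.
exists rho0, C; split.
- by rewrite !lt_min ltr01 powR_gt0 // divr_gt0.
- by rewrite ge_min lexx.
- by rewrite ltr_wpDl // mulr_ge0 ?divr_ge0 ?(ltW lg) // !addr_ge0 // mulr_ge0.
move=> A B w y0 rho F G W hAB /andP[rho_gt0]; rewrite !le_min => /andP[rho1 /andP[rhoq rhoB]].
move=> F0 G0 W0 y00 [cw Lw nw] oscw x xb.
have rhoQ : rho `^ gam <= q.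
  rewrite -(powRr1 (ltW q0)) -(@mulVf _ gam) ?gt_eqF // powRrM.
  apply: ge0_ler_powR; rewrite ?nnegrE ?(ltW g0) ?(ltW rho_gt0) ?powR_ge0 //.
(* Normalized by [Lp rho^2 = 2 W]: a point on the sphere would pay the whole oscillation. *)
have [Lp LpE] : exists Lp, Lp = 2 * W / rho ^+ 2 by eexists.
have Lp0 : 0 <= Lp by rewrite LpE divr_ge0 ?mulr_ge0 ?exprn_ge0 // ltW.
have Lpr : Lp * rho ^+ 2 = 2 * W by rewrite LpE divfK // gt_eqF // exprn_gt0.
(* Just above the bound of [lipschitz_interior]; the extra [G] makes the contradiction strict. *)
have [K KE] : exists K, K = 64 / (lam * gam) * rho * (2 * F + Lp * C2 + 4 * CB * G + G) by eexists.
have K0 : 0 < K.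
  have c0 : 0 < 64 / (lam * gam) * rho by rewrite !mulr_gt0 ?invr_gt0.
  rewrite KE; apply: mulr_gt0 => //.
  have h1 : 0 <= Lp * C2 by apply: mulr_ge0.
  have h2 : 0 <= CB * G by apply: mulr_ge0; rewrite // ltW.
  by move: h1 h2 G0 F0; clear; lra.
pose loc (x : V) := Lp * dot (x - y0) (x - y0) - 2 * G * dot n x.
pose Phi (z : V * V) := (w z.1 - loc z.1) - (w z.2 + loc z.2) - K * cone gam rho (z.1 - z.2).
pose S := hball n y0 rho `*` hball n y0 rho.
have cS : compact S by apply: compact_setX; exact: compact_hball.
have cloc : continuous loc.
  move=> u; apply: (@continuousB _ _ _ (fun x => Lp * dot (x - y0) (x - y0)) (fun x => 2 * G * dot n x)).
    by apply: continuousM; [exact: cst_continuous | exact: sqdist_continuous].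
  by apply: continuousM; [exact: cst_continuous | exact: dot_continuous].
have cPhi : ctn S Phi.
  apply: ctnB; first apply: ctnB.
  - apply: (@ctn_pre _ _ _ S (hball n y0 rho) fst (fun x => w x - loc x)).
    + exact: fst_ctn.
    + by move=> z [].
    + by apply: ctnB => //; exact: ctn_continuous.
  - apply: (@ctn_pre _ _ _ S (hball n y0 rho) snd (fun x => w x + loc x)).
    + exact: snd_ctn.
    + by move=> z [].
    + by apply: ctnD => //; exact: ctn_continuous.
  apply: ctnM; first exact: ctn_cst.
  apply: ctn_continuous => z.
  apply: (@continuous_comp _ _ _ (fun z : V * V => z.1 - z.2) (cone gam rho)).
    by apply: continuousB; [exact: fst_ctn | exact: snd_ctn].
  exact: cone_continuous.
have y0b : hball n y0 rho y0 by split; rewrite // subrr en0 ltW.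
have [[a b] [/= ab bb] mx] := ctn_max cS (ex_intro _ (y0, y0) (conj y0b y0b)) cPhi.
have bound : Phi (a, b) <= 4 * G * rho - 0 + 4 * G * dot y0 n.
  rewrite leNgt; apply/negP => gt.
  have sab (u : V) : hball n y0 rho u -> dot n u - dot y0 n <= rho.
    move=> [ur _]; rewrite dotC -dotNl -dotDl (le_trans (ler_norm _)) //.
    by rewrite (le_trans (dot_le_en _ _)) // (en_n n1) mulr1.
  have cab : 0 <= cone gam rho (a - b) <= en (a - b).
    apply: cone_bounds => //; have := en_sub_triangle a y0 b; rewrite (en_subC y0 b).
    by case: ab bb => + _ [+ _]; lra.
  have locE (u : V) : hball n y0 rho u ->
      - loc u <= - (Lp * en (u - y0) ^+ 2) + 2 * G * rho + 2 * G * dot y0 n.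
    move=> /sab hu; rewrite /loc en_sq.
    have : 2 * G * (dot n u - dot y0 n) <= 2 * G * rho by rewrite ler_pM2l // mulr_gt0.
    by clear; lra.
  have la := locE _ ab; have lb := locE _ bb.
  have Lpa : 0 <= Lp * en (a - y0) ^+ 2 by rewrite mulr_ge0 // sqr_ge0.
  have Lpb : 0 <= Lp * en (b - y0) ^+ 2 by rewrite mulr_ge0 // sqr_ge0.
  have Kc : 0 <= K * cone gam rho (a - b) by apply: mulr_ge0; [exact: (ltW K0) | case/andP: cab].
  have sq (u : V) : hball n y0 rho u -> rho <= en (u - y0) -> Lp * en (u - y0) ^+ 2 = 2 * W.
    by move=> [h1 _] h2; rewrite -Lpr; congr (_ * _ ^+ 2); apply/eqP; rewrite eq_le h1.
  have oab := oscw _ _ ab bb.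
  have ain : en (a - y0) < rho.
    rewrite ltNge; apply/negP => /(sq _ ab) h.
    by move: gt la lb Lpb Kc oab; rewrite /Phi /= h; clear; lra.
  have bin : en (b - y0) < rho.
    rewrite ltNge; apply/negP => /(sq _ bb) h.
    by move: gt la lb Lpa Kc oab; rewrite /Phi /= h; clear; lra.
  have ab0 : 0 < en (a - b).
    rewrite lt_neqAle en_ge0 andbT eq_sym; apply/eqP => /en_eq0/eqP.
    rewrite subr_eq0 => /eqP ebb; move: gt la lb Lpa Lpb Kc.
    by rewrite /Phi /= ebb; clear; lra.
  have ab2 : 0 < en (a - b) <= 2 * rho.
    rewrite ab0 /=; have := en_sub_triangle a y0 b; rewrite (en_subC y0 b).
    by move: ain bin; clear; lra.
  have stay (u : V) : en (u - y0) < rho -> exists2 r : R, 0 < r &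
      forall z, en z < r -> en (u + z - y0) <= rho.
    move=> hu; exists (rho - en (u - y0)); first by rewrite subr_gt0.
    move=> z zr; rewrite addrAC (le_trans (en_triangle _ _)) //; move: zr; clear; lra.
  have [ra ra0 ha] := stay _ ain; have [rb rb0 hb] := stay _ bin.
  have tn1 (t r : R) : 0 < t < r -> en (t *: n) < r.
    by move=> /andP[t0 tr]; rewrite enZ (en_n n1) mulr1 gtr0_norm.
  have apos : 0 < dot a n.
    rewrite lt_neqAle; case: (ab) => _ ->; rewrite andbT; apply/eqP => a0.
    apply: (@lipschitz_boundary n y0 gam rho G Lp K ra w a b 1 n1 g01 G0 Lp0 K0 ra0 (esym a0) (proj2 bb) y00 ab2
      (or_introl (erefl _)) (nw _ ain (esym a0))).
    move=> t tr; have ht := ha _ (tn1 _ _ tr); case/andP: tr => t0 tr.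
    have h : hball n y0 rho (a + t *: n).
      by split => //; rewrite dotDl dotZl n1 -a0 add0r mulr1 ltW.
    have := mx (a + t *: n, b) (conj h bb); rewrite /Phi /= /loc !mul1r.
    set c1 := cone _ _ _; set c2 := cone _ _ _; clearbody c1 c2; by clear; lra.
  have bpos : 0 < dot b n.
    rewrite lt_neqAle; case: (bb) => _ ->; rewrite andbT; apply/eqP => b0.
    apply: (@lipschitz_boundary n y0 gam rho G Lp K rb w b a (-1) n1 g01 G0 Lp0 K0 rb0 (esym b0) (proj2 ab) y00 _
      (or_intror (erefl _)) (nw _ bin (esym b0))); first by rewrite en_subC.
    move=> t tr; have ht := hb _ (tn1 _ _ tr); case/andP: tr => t0 tr.
    have h : hball n y0 rho (b + t *: n).
      by split => //; rewrite dotDl dotZl n1 -b0 add0r mulr1 ltW.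
    have := mx (a, b + t *: n) (conj ab h); rewrite /Phi /= /loc !mulN1r.
    have coneN (u v : V) : cone gam rho (u - v) = cone gam rho (v - u).
      by rewrite /cone en_subC.
    by rewrite (coneN (b + t *: n)) (coneN b); set c1 := cone _ _ _; set c2 := cone _ _ _; clearbody c1 c2; clear; lra.
  pose r := Num.min (Num.min ra rb) (Num.min (dot a n) (dot b n)).
  have r0 : 0 < r by rewrite !lt_min ra0 rb0 apos.
  have rho01 : 0 < rho <= 1 by rewrite rho_gt0.
  have := @lipschitz_interior _ _ n y0 lam Lam CB CA gam rho F G Lp K A B w a b r
    n1 lam0 Lam0 CB0 CA0 g01 rho01 F0 G0 Lp0 K0 rhoQ rhoB hAB (ltW ain) (ltW bin) ab0
    (Lw _ ain apos) (Lw _ bin bpos) r0.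
  have near (u z : V) : en z < dot u n -> 0 <= dot (u + z) n.
    rewrite dotDl => h; have := dot_le_en z n; rewrite (en_n n1) mulr1 ler_norml.
    by move=> /andP[h1 _]; move: h h1; clear; lra.
  rewrite -/C2 => hi.
  have : ~~ (K * (lam * gam) <= 64 * rho * (2 * F + Lp * C2 + 4 * CB * G)).
    rewrite -ltNge KE.
    have -> : 64 / (lam * gam) * rho * (2 * F + Lp * C2 + 4 * CB * G + G) * (lam * gam) =
       64 * rho * (2 * F + Lp * C2 + 4 * CB * G + G) by field; rewrite !gt_eqF.
    by rewrite ltr_pM2l ?mulr_gt0 // ltrDl.
  move=> /negP; apply; apply: hi => z z'; rewrite !lt_min => /andP[/andP[z1 z2] /andP[z3 z4]] /andP[/andP[z5 z6] /andP[z7 z8]].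
  have h1 : hball n y0 rho (a + z) by split; [exact: ha | exact: near].
  have h2 : hball n y0 rho (b + z') by split; [exact: hb | exact: near].
  by have := mx (a + z, b + z') (conj h1 h2); rewrite /Phi /=.
have := le_trans (mx (x, y0) (conj xb y0b)) bound; rewrite /Phi /= /loc.
case: xb => xr x0; have := cone_bounds g01 rho_gt0 (_ : en (x - y0) <= 2 * rho).
case/(_ _)/andP; first by move: xr rho_gt0; clear; lra.
move=> _ cx; rewrite subrr !dot0l mulr0 -en_sq.
have K1 : K * cone gam rho (x - y0) <= K * en (x - y0) by rewrite ler_pM2l.
have Lp1 : Lp * en (x - y0) ^+ 2 <= 2 * W / rho * en (x - y0).
  rewrite (_ : 2 * W / rho = Lp * rho); last by rewrite LpE; field; rewrite gt_eqF.
  by rewrite expr2 mulrA ler_wpM2r ?en_ge0 // ler_wpM2l.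
have sx : dot n x <= dot y0 n + rho.
  have := dot_le_en (x - y0) n; rewrite (en_n n1) mulr1 dotDl dotNl ler_norml (dotC n x).
  by case/andP => _ ?; lra.
have sG : 0 <= 2 * G * (dot n x - dot n y0 + rho).
  rewrite mulr_ge0 ?mulr_ge0 ?(ltW G0) //.
  have := dot_le_en (x - y0) n; rewrite (en_n n1) mulr1 dotDl dotNl ler_norml !(dotC n).
  by case/andP => ? _; lra.
have KC : K + 2 * W / rho <= C * (W / rho + F * rho + G * rho).
  have -> : K = 64 / (lam * gam) * (2 * (F * rho) + 2 * C2 * (W / rho) + (4 * CB + 1) * (G * rho)).
    by rewrite KE LpE; field; rewrite !gt_eqF.
  have [w0 f0 gg0] : [/\ 0 <= W / rho, 0 <= F * rho & 0 <= G * rho].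
    by rewrite !mulr_ge0 ?invr_ge0 // ltW.
  have c0 : 0 <= 64 / (lam * gam) by rewrite divr_ge0 // ltW.
  rewrite /C [X in _ <= X]mulrDl -[X in _ <= X + _]mulrA; apply: lerD.
    rewrite ler_wpM2l //.
    have [m1 m2 m3] : [/\ 0 <= C2 * (F * rho), 0 <= C2 * (G * rho) & 0 <= CB * (F * rho)].
      by split; apply: mulr_ge0.
    have m4 : 0 <= CB * (W / rho) by apply: mulr_ge0.
    move: m1 m2 m3 m4 w0 f0 gg0; clear; lra.
  by move: w0 f0 gg0; clear; lra.
have KC' := ler_wpM2r (en_ge0 (x - y0)) KC.
move: K1 Lp1 sG KC'; rewrite (dotC y0 n); set X := W / rho; clear.
move=> *; lra.
Qed.

End LipschitzEstimate3.

(** * Harnack inequality *)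

Ltac nng := repeat first [assumption | apply: ltW; assumption | exact: ler01 | exact: ler0n
  | exact: en_ge0 | exact: normr_ge0 | apply: addr_ge0 | apply: divr_ge0 | apply: mulr_ge0
  | rewrite invr_ge0
  | apply: exprn_ge0 | apply: expR_ge0 | apply: powR_ge0].
Ltac pos := repeat first [assumption | exact: ltr01 | exact: ltr0Sn
  | apply: divr_gt0 | apply: mulr_gt0 | rewrite invr_gt0 | apply: exprn_gt0 | apply: expR_gt0
  | apply: addr_gt0].

Section Spread.
Context {R : realType} {D : nat}.
Set Implicit Arguments. Unset Strict Implicit.
Local Notation V := 'rV[R]_D.
Implicit Types (w v : V -> R) (x y z p : V).

Lemma inv_power_pos (m : nat) (r : R) : 0 < r -> r `^ (- m%:R) = (r ^+ m)^-1.
Proof. by move=> r0; rewrite powRN powR_mulrn // ltW. Qed.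

(** Up to a common factor the second derivatives of [|z| ^ (- m)] are [m (m + 1)] radially and [- m]
    tangentially, so for large [m] ellipticity along the radius beats the trace and the drift. *)
Lemma genL_inv_power (lam Lam CB rho : R) (m : nat) (A : V -> 'M[R]_D) (B : V -> V) z y :
  0 <= lam -> 0 <= CB -> D%:R * Lam + CB * rho <= m%:R * lam ->
  coefs lam Lam CB A B -> 0 < en (y - z) <= rho ->
  exists2 a, 0 <= a & genL A B (fun y => en (y - z) `^ (- m%:R)) y a.
Proof.
move=> lam0 CB0 hm cAB /andP[r0 r1].
have [[sA eA] bB] := cAB y.
have j := jet_shift (jet_radial (- m%:R) r0).
set P := en (y - z) `^ _ in j; have P0 : 0 < P by apply: powR_gt0.
refine (ex_intro2 _ _ _ _ (ex_intro _ _ (ex_intro _ _ (conj j erefl)))).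
have trA : tr2 (A y) 1%:M <= D%:R * Lam.
  by apply: tr2_1r_le => x; case/andP: (eA x).
have Bz : dot (B y) (y - z) <= CB * rho.
  apply: (le_trans (ler_norm _)); apply: (le_trans (dot_le_en _ _)).
  by apply: ler_pM; rewrite ?en_ge0.
have qA : lam * dot (y - z) (y - z) <= qf (A y) (y - z) by case/andP: (eA (y - z)).
rewrite tr2Dr !tr2Zr (tr2C (A y) ((y - z)^T *m (y - z))) tr2_outer dotZr.
have d0 : 0 < dot (y - z) (y - z) by rewrite -en_sq exprn_gt0.
set T := tr2 _ _ in trA *; set Bd := dot (B y) _ in Bz *; set q := qf _ _ in qA *.
set d := dot _ _ in d0 qA *.
have -> : - m%:R * P / d * T + - m%:R * (- m%:R - 2) * P / d ^+ 2 * q + - m%:R * P / d * Bd =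
   m%:R * P / d ^+ 2 * ((m%:R + 2) * q - (T + Bd) * d) by field; rewrite gt_eqF.
rewrite mulr_ge0 ?divr_ge0 ?mulr_ge0 ?exprn_ge0 ?(ltW P0) ?(ltW d0) // subr_ge0.
have h : (T + Bd) * d <= m%:R * lam * d.
  by rewrite ler_pM2r //; move: hm trA Bz; clear; lra.
apply: (le_trans h); rewrite -mulrA.
have m0 : 0 <= m%:R :> R by [].
have q0 : 0 <= q by apply: le_trans qA; rewrite mulr_ge0 // ltW.
have : m%:R * (lam * d) <= m%:R * q by rewrite ler_wpM2l.
by move: q0; clear; lra.
Qed.

Lemma genL_maxS (A : V -> 'M[R]_D) (B : V -> V) w x c (r lam Lam : R) : 0 < lam ->
  elliptic lam Lam (A x) -> 0 < r -> (forall y, en (y - x) < r -> w y <= w x) ->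
  genL A B w x c -> c <= 0.
Proof.
move=> lam0 eA r0 h; apply: (genL_max lam0 eA r0) => z zr.
by apply: h; rewrite addrAC subrr add0r.
Qed.

(* Barrier: a multiple of [|x - z| ^ (- p)], a subsolution for [p] large. *)
Lemma spread (n : V) (lam Lam CB rho : R) : dot n n = 1 -> 0 < lam -> 0 <= Lam ->
  0 <= CB -> 0 < rho ->
  exists (p : nat) (c C : R), [/\ (0 < p)%N, 0 < c, 0 < C & forall A B U z (tau m G : R),
    coefs lam Lam CB A B -> 0 < tau <= rho -> tau <= dot z n -> 0 <= m -> 0 < G ->
    lsol n A B U z rho 0 G -> (forall x, hball n z rho x -> 0 <= U x) ->
    (forall x, en (x - z) <= tau -> m <= U x) ->
    forall x, en (x - z) <= rho / 2 -> 0 <= dot x n -> c * m * tau ^+ p <= U x + C * G].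
Proof.
move=> n1 lam0 Lam0 CB0 rho0.
have k0 := layer_rate_gt0 lam0 CB0; set k := layer_rate lam CB in k0.
have [p0 hp0] : exists p : nat, D%:R * Lam + CB * rho <= p%:R * lam.
  exists (Num.bound ((D%:R * Lam + CB * rho) / lam)).
  rewrite -ler_pdivrMr //; apply: ltW.
  by apply: archi_boundP; rewrite divr_ge0 ?addr_ge0 ?mulr_ge0 // ltW.
pose p := p0.+1.
have hp : D%:R * Lam + CB * rho <= p%:R * lam.
  by apply: (le_trans hp0); rewrite ler_wpM2r ?(ltW lam0) // ler_nat.
have rp0 : 0 < rho ^+ p by rewrite exprn_gt0.
have c10 : 0 < 2 / k by rewrite divr_gt0.
pose C1 := 2 / k * expR (k * (2 * rho)).
exists p, (rho ^+ p)^-1, C1; split; [by [] | by rewrite invr_gt0 | by rewrite mulr_gt0 ?expR_gt0 |].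
move=> A B U z tau m G cAB /andP[tau0 taur] tz m0 G0 [cU LU nU] U0 Um x xr xs.
(* [Kf] answers the Neumann error: where the ball meets the hyperplane, [f = 1] and its slope there
   is [-2]. For a higher centre, [f] only keeps the layer bounded independently of the height of
   [z]. *)
have [f [f0 f1 fE]] : exists f : R, [/\ 0 < f, (dot z n <= rho -> f = 1) &
    f * expR (k * (dot z n + rho)) <= expR (k * (2 * rho))].
  case: (lerP (dot z n) rho) => h.
    by exists 1; split=> //; rewrite mul1r ler_expR ler_pM2l //; lra.
  exists (expR (- (k * (dot z n - rho)))); split; rewrite ?expR_gt0 //.
  rewrite -expRD ler_expR; lra.
pose Kf y := C1 - 2 / k * f * expn_layer n lam CB y.
pose b y := en (y - z) `^ (- p%:R).
pose q := m * tau ^+ p.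
have q0 : 0 <= q by rewrite mulr_ge0 // exprn_ge0 // ltW.
pose W y := q * (b y - (rho ^+ p)^-1) - U y - G * Kf y.
pose S := hball n z rho `&` [set y | tau <= en (y - z)].
have Kf0 y : hball n z rho y -> 0 <= Kf y.
  move=> [yr _]; rewrite subr_ge0 /C1 -mulrA ler_pM2l //; apply: le_trans fE.
  rewrite ler_pM2l // /expn_layer ler_expR -/k ler_pM2l // dotC.
  have := dot_le_en (y - z) n; rewrite (en_n n1) mulr1 dotDl dotNl ler_norml.
  by move=> /andP[_ h]; move: h yr; clear; lra.
have Spos y : S y -> 0 < en (y - z) <= rho.
  by move=> [[yr _] /=] ty; rewrite yr (lt_le_trans tau0).
have jb y : 0 < en (y - z) -> exists H, jet b y
    ((- p%:R * en (y - z) `^ (- p%:R) / dot (y - z) (y - z)) *: (y - z)) H.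
  by move=> h; eexists; exact: jet_shift (jet_radial (- p%:R) h).
have bctn : ctn S b.
  apply/ctn_eps => y /Spos /andP[y0 _] e e0.
  have [H j] := jb _ y0; have [dl dl0 h] := jet_eps j e0.
  by exists dl => // y' _; exact: h.
have cW : ctn S W.
  apply: ctnB; first apply: ctnB.
  - by apply: ctnM; [exact: ctn_cst | apply: ctnB => //; exact: ctn_cst].
  - by apply: (@ctn_sub _ _ _ (hball n z rho)) => // y [].
  apply: ctnM; first exact: ctn_cst.
  apply: ctnB; first exact: ctn_cst.
  apply: ctnM; first exact: ctn_cst.
  by apply: ctn_continuous; exact: layer_continuous.
have cS : compact S.
  apply: (@compact_closed_en _ _ _ z rho) => [|y [[]]] //.
  apply: closedI; first exact: hball_closed.
  apply: closed_le_ctn; first exact: cst_continuous.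
  move=> y; apply: (@continuous_comp _ _ _ (fun y => y - z) (@en R D)); last exact: en_continuous.
  by apply: continuousB; [exact: cvg_id | exact: cst_continuous].
case: (lerP (en (x - z)) tau) => [xt|xt].
  apply: (@le_trans _ _ m).
    rewrite mulrAC ler_piMl // ler_pdivrMl // mulr1.
    by rewrite lerXn2r ?nnegrE // ltW.
  apply: (le_trans (Um _ xt)); rewrite lerDl mulr_ge0 ?(ltW G0) //.
  by rewrite mulr_ge0 ?(ltW c10) // expR_ge0.
have Sx : S x by split; [split => //; move: xr rho0; clear; lra | exact: ltW].
have [y Sy my] := ctn_max cS (ex_intro _ x Sx) cW.
have Wy : W y <= 0.
  rewrite leNgt; apply/negP => Wy0; have [yr ty] := Sy.
  have /andP[y0 yr'] := Spos _ Sy.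
  have y1 : en (y - z) < rho.
    rewrite lt_neqAle yr' andbT; apply/eqP => ye.
    move: Wy0; rewrite /W /b inv_power_pos // ye subrr mulr0 sub0r.
    have := U0 _ yr; have := mulr_ge0 (ltW G0) (Kf0 _ yr); clear; lra.
  have y2 : tau < en (y - z).
    rewrite lt_neqAle andbC; apply/andP; split => //; apply/eqP => ye.
    have h1 := Um y; rewrite -ye lexx in h1; have {}h1 := h1 isT.
    move: Wy0; rewrite /W /b inv_power_pos // -ye mulrBr /q mulfK ?gt_eqF ?exprn_gt0 //.
    have h2 : 0 <= q / rho ^+ p by rewrite divr_ge0 // ltW.
    have := mulr_ge0 (ltW G0) (Kf0 _ yr); move: h1 h2; rewrite /q; clear; lra.
  have [r rE] : exists r, r = Num.min (en (y - z) - tau) (rho - en (y - z)) by eexists.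
  have r0 : 0 < r by rewrite rE lt_min !subr_gt0 y2.
  have rS y' : en (y' - y) < r -> 0 <= dot y' n -> S y'.
    rewrite rE lt_min => /andP[h1 h2] s0; split; first split => //.
      by have := en_sub_triangle y' y z; move: h2; clear; lra.
    by rewrite /=; have := en_sub_triangle y y' z; rewrite (en_subC y y'); move: h1; clear; lra.
  have [y00|y00] := eqVneq (dot y n) 0.
    have [H j] := jb _ y0; have [Cb [d1 [Cb0 d10 hb]]] := jet_ub n j.
    have [d2 d20 hU] := nU y y1 y00 _ (divr_gt0 G0 (ltr0Sn R 1)).
    have f1' : f = 1.
      apply: f1; have := dot_le_en (z - y) n; rewrite (en_n n1) mulr1 dotDl dotNl y00 ler_norml.
      by rewrite en_subC => /andP[_ h]; move: h y1; clear; lra.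
    suff : G / 2 <= 0 by rewrite leNgt divr_gt0.
    apply: (@nonneg_taylor _ _ (q * Cb) (Num.min r (Num.min d1 d2))).
    - by rewrite !lt_min r0 d10.
    - by rewrite mulr_ge0 // ltW.
    move=> t; rewrite !lt_min => /andP[t0 /andP[tr /andP[td1 td2]]].
    have St : S (y + t *: n).
      apply: rS; last by rewrite dotDl dotZl y00 n1 add0r mulr1 ltW.
      by rewrite addrAC subrr add0r enZ (en_n n1) mulr1 gtr0_norm.
    have := hb t; rewrite gtr0_norm // => /(_ td1).
    rewrite dotZl ler_norml => /andP[h1 _].
    have := my _ St; have := hU t; rewrite t0 td2 => /(_ isT).
    rewrite /W /Kf /expn_layer !dotE !(dotC n y) y00 n1 add0r mulr0 mulr1 expR0 -/k f1' mulr1.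
    rewrite !ler_norml => /andP[_ h2] h3.
    have h4 : 2 / k * (1 + k * t) <= 2 / k * expR (k * t) by rewrite ler_pM2l // expR_ge1Dx.
    have h4' : G * (2 / k * (1 + k * t)) <= G * (2 / k * expR (k * t)) by rewrite ler_pM2l.
    have h5 : 2 / k * (1 + k * t) = 2 / k + 2 * t by field; rewrite gt_eqF.
    rewrite h5 in h4'.
    (* The centre lies above the hyperplane, so moving up from [y] decreases the distance to [z] and
       [b] increases at first order. *)
    have h6 : 0 <= t * (- p%:R * en (y - z) `^ (- p%:R) / dot (y - z) (y - z) *
        dot (y - z) n).
      have -> : dot (y - z) n = - dot z n by rewrite dotDl dotNl y00 sub0r.
      rewrite mulrN !mulNr opprK mulr_ge0 ?(ltW t0) // mulr_ge0 ?divr_ge0 ?mulr_ge0 ?powR_ge0 ?dotxx_ge0 //.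
      by apply: le_trans tz; exact: ltW.
    have h7 : q * (b (y + t *: n) - b y) >= q * (- (Cb * t ^+ 2)).
      rewrite ler_wpM2l //; move: h1 h6; set X := t * _; clear; lra.
    move: h2 h3 h4' h7; clear; lra.
  have ypos : 0 < dot y n by rewrite lt_neqAle eq_sym y00; case: yr.
  have [aE aE0 LE] := genL_layer n1 lam0 CB0 cAB y.
  have [ab ab0 Lb] := genL_inv_power (ltW lam0) CB0 hp cAB (Spos _ Sy).
  have [aU aU0 LaU] := LU _ y1 ypos.
  have aUE : aU = 0 by apply/eqP; rewrite -normr_le0.
  have LW := genLB (genLB (genLZ q (genLB Lb (genL_cst A B (rho ^+ p)^-1 y))) LaU)
    (genLZ G (genLB (genL_cst A B C1 y) (genLZ (2 / k * f) LE))).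
  have [eA _] := cAB y.
  have r'0 : 0 < Num.min r (dot y n) by rewrite lt_min r0.
  have := genL_maxS lam0 eA r'0 _ LW.
  have hmax y' : en (y' - y) < Num.min r (dot y n) -> W y' <= W y.
    rewrite lt_min => /andP[h1 h2]; apply: my; apply: rS => //.
    have := dot_le_en (y - y') n; rewrite (en_n n1) mulr1 en_subC dotDl dotNl ler_norml.
    by move=> /andP[_ h]; move: h h2; clear; lra.
  move=> /(_ hmax); rewrite aUE !subr0 sub0r mulrN opprK; apply/negP; rewrite -ltNge.
  apply: ltr_wpDl; first exact: mulr_ge0.
  apply: mulr_gt0 => //; apply: mulr_gt0; first exact: mulr_gt0.
  by apply: lt_le_trans aE0; rewrite mulr_gt0 // expR_gt0.
have := le_trans (my _ Sx) Wy; rewrite /W /Kf /b inv_power_pos; last exact: lt_trans xt.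
(* At half the radius [b] is at least [2 ^ p] times its value on the sphere; since [p > 0], one such
   value is left after the subtraction. *)
have h1 : (2 ^+ p / rho ^+ p) <= (en (x - z) ^+ p)^-1.
  rewrite -expr_div_n -exprVn lerXn2r ?nnegrE ?invr_ge0 ?en_ge0 ?divr_ge0 ?(ltW rho0) //.
  rewrite -[2 / rho]invf_div lef_pV2 ?posrE ?divr_gt0 //; last exact: lt_trans xt.
have h2 : q * (2 * (rho ^+ p)^-1) <= q * (en (x - z) ^+ p)^-1.
  rewrite ler_wpM2l //; apply: le_trans h1; rewrite ler_wpM2r ?invr_ge0 ?(ltW rp0) //.
  by rewrite /p exprS ler_peMr // exprn_ege1 // ler1n.
have h3 : 0 <= G * (2 / k * f * expn_layer n lam CB x).
  by rewrite !mulr_ge0 ?invr_ge0 ?(ltW G0) ?(ltW k0) ?(ltW f0) ?expR_ge0.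
have -> : (rho ^+ p)^-1 * m * tau ^+ p = q * (rho ^+ p)^-1 by rewrite /q; ring.
move: h2 h3; clear; lra.
Qed.
End Spread.

Section Harnack.
Context {R : realType} {D : nat}.
Set Implicit Arguments. Unset Strict Implicit.
Local Notation V := 'rV[R]_D.
Implicit Types (w v : V -> R) (x y z p : V).

Lemma hball_sub (n y z : V) (r rho : R) : en (z - y) + r <= rho ->
  hball n z r `<=` hball n y rho.
Proof.
move=> h x [xr s0]; split => //; apply: le_trans h.
by rewrite (le_trans (en_sub_triangle x z y)) // addrC lerD2l.
Qed.

Lemma lsol_sub (n : V) A B U y z (r rho F G : R) : en (z - y) + r <= rho ->
  lsol n A B U y rho F G -> lsol n A B U z r F G.
Proof.
move=> h [c1 c2 c3].
have lt x : en (x - z) < r -> en (x - y) < rho.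
  by have := en_sub_triangle x z y; move: h; clear; lra.
split=> [|x /lt|x /lt]; last 2 first; first exact: c2; first exact: c3.
by apply: ctn_sub c1; exact: hball_sub.
Qed.

Lemma lsolN (n : V) A B U y (rho F G : R) :
  lsol n A B U y rho F G -> lsol n A B (fun x => - U x) y rho F G.
Proof.
move=> [c1 c2 c3]; split.
- by move=> x hx; apply: cvgN; exact: c1.
- move=> x h1 h2; have [a aF La] := c2 x h1 h2; exists (-1 * a); first by rewrite mulN1r normrN.
  have [p [H [j e]]] := genLZ (-1) La; exists p, H; split => //.
  by refine (jet_eq j _ _ _) => // z; rewrite mulN1r.
move=> x h1 h2 e e0; have [dl dl0 h] := c3 x h1 h2 e e0; exists dl => // t ht.
by rewrite -opprD normrN; exact: h.
Qed.

Lemma bernoulli_half (p : nat) (a : R) : 0 <= a -> a <= 1 -> p%:R * a <= 1 / 2 ->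
  1 / 2 <= (1 - a) ^+ p.
Proof.
move=> a0 a1 h; apply: (@le_trans _ _ (1 - p%:R * a)); first by move: h; clear; lra.
elim: p {h} => [|p IH]; first by rewrite mul0r subr0 expr0.
rewrite exprS; apply: (@le_trans _ _ ((1 - a) * (1 - p%:R * a))).
  have : 0 <= p%:R * a * a by rewrite !mulr_ge0.
  by rewrite -natr1; clear; lra.
by rewrite ler_wpM2l // subr_ge0.
Qed.

(* Maximize [U x * (R1 + 1 - |x - y0|) ^ p]: the Lipschitz estimate keeps [U] large on a ball
   around the maximum point, and [spread] carries this back to [y0]. *)
Lemma harnack (n : V) (lam Lam CB CA gam R1 : R) : dot n n = 1 -> 0 < lam -> 0 <= Lam ->
  0 <= CB -> 0 < CA -> 0 < gam < 1 -> 0 < R1 ->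
  exists R0 C : R, [/\ R1 <= R0, 0 < C & forall A B U y0 (G : R),
    hcoefs lam Lam CB CA gam A B -> 0 <= dot y0 n -> 0 < G ->
    lsol n A B U y0 R0 0 G -> (forall x, hball n y0 R0 x -> 0 <= U x) ->
    forall x, hball n y0 R1 x -> U x <= C * (U y0 + G)].
Proof.
move=> n1 lam0 Lam0 CB0 CA0 g01 R10.
pose R2 := R1 + 1; have R20 : 0 < R2 by rewrite addr_gt0.
pose rs := 2 * (R2 + 1); have rs0 : 0 < rs by rewrite mulr_gt0 // addr_gt0.
have [p [c [Cs [p_gt0 c0 Cs0 hs]]]] := spread n1 lam0 Lam0 CB0 rs0.
have [rho0 [CL [rho00 rho01 CL0 hL]]] := lipschitz_estimate n1 lam0 Lam0 CB0 CA0 g01.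
(* Moving by the fraction [sg] of the distance to the sphere changes the weight by at most a factor
   2, so [U <= 2 U xs] on that ball; the second bound makes its radius admissible for the Lipschitz
   estimate. *)
pose sg := Num.min (1 / (2 * (p%:R + 1))) (rho0 / R2).
have p1 : 0 < p%:R + 1 :> R by rewrite ltr_wpDl.
have sg0 : 0 < sg by rewrite lt_min !divr_gt0 // mulr_gt0.
have sg1 : p%:R * sg <= 1 / 2 /\ sg <= 1.
  have h : sg <= 1 / (2 * (p%:R + 1)) by rewrite ge_min lexx.
  have h' : sg * (2 * (p%:R + 1)) <= 1 by rewrite -ler_pdivlMr // mulr_gt0.
  have h2 : 0 <= p%:R * sg by rewrite mulr_ge0 // ltW.
  by split; move: h' h2 sg0; clear; lra.
have sg2 : sg * R2 <= rho0 by rewrite -ler_pdivlMr // ge_min lexx orbT.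
case: sg1 => sgp sg1.
(* On the fraction [th] of this ball the Lipschitz estimate loses at most half of [U xs]. *)
pose th := Num.min (1 / (8 * CL)) (1 / 2).
have th0 : 0 < th by rewrite lt_min !divr_gt0 // mulr_gt0.
have th1 : CL * th <= 1 / 8.
  have h : th <= 1 / (8 * CL) by rewrite ge_min lexx.
  have : th * (8 * CL) <= 1 by rewrite -ler_pdivlMr // mulr_gt0.
  by clear; lra.
have th2 : th <= 1 / 2 by rewrite ge_min lexx orbT.
pose Q := (2 / c) * (4 / (th * sg)) ^+ p.
have Q0 : 0 < Q by rewrite mulr_gt0 ?divr_gt0 // exprn_gt0 // divr_gt0 // mulr_gt0.
have R2p : 0 < R2 ^+ p by rewrite exprn_gt0.
exists (3 * (R2 + 1)), (32 * R2 ^+ p + Q * (1 + Cs)); split.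
- by rewrite /R2; move: R10; clear; lra.
- by apply: addr_gt0; apply: mulr_gt0 => //; rewrite addr_gt0.
move=> A B U y0 G hAB y00 G0 lU U0 x xb.
have cAB : coefs lam Lam CB A B by case: hAB.
pose d y := R2 - en (y - y0).
(* The exponent is that of [spread]: the ball where [U] stays large has radius proportional to
   [d xs], so the factor [tau ^+ p] rebuilds exactly a multiple of [Phi xs]. *)
pose Phi y := U y * d y ^+ p.
have sub2 : hball n y0 R2 `<=` hball n y0 (3 * (R2 + 1)).
  by apply: hball_sub; rewrite subrr en0; move: R20; clear; lra.
have cPhi : ctn (hball n y0 R2) Phi.
  apply: ctnM; first by case: lU => cU _ _; exact: ctn_sub sub2 cU.
  apply: (@ctn_comp _ _ _ d (fun t => t ^+ p)); first exact: exprn_continuous.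
  apply: ctnB; first exact: ctn_cst.
  apply: ctn_continuous => y; apply: (@continuous_comp _ _ _ (fun y => y - y0) (@en R D)).
    by apply: continuousB; [exact: cvg_id | exact: cst_continuous].
  exact: en_continuous.
have xb2 : hball n y0 R2 x by apply: hball_sub xb; rewrite subrr en0 add0r lerDl.
have [xs xsb mx] := ctn_max (@compact_hball _ _ n y0 R2) (ex_intro _ x xb2) cPhi.
have UE : 0 <= U y0.
  by apply: U0; split; rewrite // subrr en0; move: R20; clear; lra.
suff Phis : Phi xs <= (32 * R2 ^+ p + Q * (1 + Cs)) * (U y0 + G).
  apply: le_trans Phis; apply: le_trans (mx _ xb2).
  rewrite ler_peMr ?(U0 _ (sub2 _ xb2)) // exprn_ege1 //.
  by rewrite /d /R2; case: xb; clear; lra.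
have [xsr xss] := xsb.
have d0' : 0 <= d xs by rewrite subr_ge0.
have dR : d xs <= R2 by rewrite gerBl en_ge0.
have M0 : 0 <= U xs by apply: U0; exact: sub2.
(* If the maximum value is comparable with [G], the claim is immediate; otherwise the Neumann error
   is negligible in the Lipschitz estimate. *)
have [h16|h16] := leP (U xs) (32 * G).
  apply: (@le_trans _ _ (32 * G * R2 ^+ p)).
    by apply: ler_pM => //; [exact: exprn_ge0 | rewrite lerXn2r // nnegrE // ltW].
  have h1 : 0 <= R2 ^+ p * U y0 by rewrite mulr_ge0 // ltW.
  have h2 : 0 <= Q * (1 + Cs) * (U y0 + G).
    by nng.
  by rewrite mulrDl; move: h1 h2; clear; lra.
have M1 : 0 < U xs by apply: le_lt_trans h16; rewrite mulr_ge0 // ltW.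
move: d0'; rewrite le_eqVlt => /orP[/eqP de|d0].
  rewrite /Phi -de expr0n eqn0Ngt p_gt0 mulr0.
  by nng.
have [rho rhoE] : exists rho, rho = sg * d xs by eexists.
have rho_gt0 : 0 < rho by rewrite rhoE mulr_gt0.
have rho_le : rho <= rho0 by rewrite rhoE (le_trans _ sg2) // ler_pM2l.
have rho1 : rho <= 1 by apply: le_trans rho01.
have subr : hball n xs rho `<=` hball n y0 (3 * (R2 + 1)).
  by apply: hball_sub; move: xsr rho1 R20; clear; lra.
have U2 y : hball n xs rho y -> U y <= 2 * U xs.
  move=> yb; have dy : (1 - sg) * d xs <= d y.
    case: yb => yr _; rewrite mulrBl mul1r -rhoE /d.
    by have := en_sub_triangle y xs y0; move: yr; clear; lra.
  have yb2 : hball n y0 R2 y.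
    case: yb => yr ys; split => //; rewrite -subr_ge0.
    by apply: le_trans dy; rewrite mulr_ge0 ?subr_ge0 // ltW.
  have h1 := mx _ yb2; have Uy := U0 _ (sub2 _ yb2).
  have h2 : U y * ((1 - sg) ^+ p * d xs ^+ p) <= U xs * d xs ^+ p.
    apply: le_trans h1; rewrite -exprMn ler_wpM2l // lerXn2r // nnegrE.
      by rewrite mulr_ge0 ?subr_ge0 // ltW.
    by apply: le_trans dy; rewrite mulr_ge0 ?subr_ge0 // ltW.
  rewrite mulrA ler_pM2r ?exprn_gt0 // in h2.
  have := bernoulli_half (ltW sg0) sg1 sgp.
  move: h2 Uy M1; move: (_ ^+ p) => X; clear; nra.
have lower y : hball n xs (th * rho) y -> U xs / 2 <= U y.
  move=> yb; have yb1 : hball n xs rho y.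
    case: yb => yr ys; split => //; apply: (le_trans yr).
    by rewrite ler_piMl ?(ltW rho_gt0) //; move: th2; clear; lra.
  have lV : lsol n A B (fun y => - U y) xs rho 0 G.
    apply: lsolN; apply: lsol_sub lU; move: xsr rho1 R20; clear; lra.
  have osc : forall x y, hball n xs rho x -> hball n xs rho y -> - U x - - U y <= 2 * U xs.
    move=> a b ab bb; have := U2 _ bb; have := U0 _ (subr _ ab); clear; lra.
  have rr : 0 < rho <= rho0 by rewrite rho_gt0.
  have := hL A B (fun y => - U y) xs rho 0 G (U xs) hAB rr (lexx _) G0 (ltW M1) xss lV osc y yb1.
  rewrite mul0r addr0 => h.
  have h1 : CL * (U xs / rho + G * rho) * en (y - xs) <= CL * (U xs / rho + G * rho) * (th * rho).
    case: yb => yr _; rewrite ler_wpM2l //; nng.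
  have h2 : CL * (U xs / rho + G * rho) * (th * rho) = CL * th * (U xs + G * rho ^+ 2).
    by field; rewrite gt_eqF.
  have h3 : CL * th * (U xs + G * rho ^+ 2) <= 1 / 8 * (U xs + G * rho ^+ 2).
    by rewrite ler_wpM2r //; nng.
  have h4 : G * rho ^+ 2 <= G by rewrite ler_piMr ?(ltW G0) // exprn_ile1 // ltW.
  have h5 : G * rho <= G by rewrite ler_piMr ?(ltW G0).
  move: h h1 h2 h3 h4 h5 h16 G0; clear; lra.
pose tau := th * rho / 4; have tau0 : 0 < tau by rewrite !mulr_gt0.
have thr : th * rho <= 1 / 2 by move: th2 rho1 th0 rho_gt0; clear; nra.
(* [xs] may lie on the hyperplane, whereas [spread] starts from a ball inside the half space; hence
   the centre is raised. *)
pose z := xs + (th * rho / 2) *: n.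
have zn : dot z n = dot xs n + th * rho / 2 by rewrite /z dotDl dotZl n1 mulr1.
have zx : en (z - xs) = th * rho / 2.
  by rewrite /z addrAC subrr add0r enZ (en_n n1) mulr1 gtr0_norm // !mulr_gt0.
have zy : en (z - y0) <= R2 + 1.
  by have := en_sub_triangle z xs y0; rewrite zx; move: thr xsr; clear; lra.
have zsub : en (z - y0) + rs <= 3 * (R2 + 1) by rewrite /rs; move: zy; clear; lra.
have trs : 0 < tau <= rs.
  by rewrite tau0 /rs /tau; move: thr R20; clear; lra.
have tz : tau <= dot z n.
  by rewrite zn /tau; move: xss tau0; rewrite /tau; clear; lra.
have M2 : 0 <= U xs / 2 by rewrite divr_ge0 // ltW.
have Um y : en (y - z) <= tau -> U xs / 2 <= U y.
  move=> yt; apply: lower; split.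
    by have := en_sub_triangle y z xs; rewrite zx; move: yt tau0; rewrite /tau; clear; lra.
  have := dot_le_en (z - y) n; rewrite (en_n n1) mulr1 en_subC dotDl dotNl ler_norml => /andP[_].
  by rewrite zn; move: yt xss tau0; rewrite /tau; clear; lra.
have y0z : en (y0 - z) <= rs / 2.
  by rewrite en_subC /rs; move: zy; clear; lra.
have := hs A B U z tau (U xs / 2) G cAB trs tz M2 G0 (lsol_sub zsub lU)
  (fun x hx => U0 x (hball_sub zsub hx)) Um y0 y0z y00 => hfin.
have PhiE : Phi xs = Q * (c * (U xs / 2) * tau ^+ p).
  have td : d xs = 4 / (th * sg) * tau by rewrite /tau rhoE; field; rewrite !gt_eqF.
  rewrite /Phi td exprMn /Q; field; rewrite !gt_eqF //.
rewrite PhiE; apply: (@le_trans _ _ (Q * (U y0 + Cs * G))); first by rewrite ler_pM2l.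
have h1 : 0 <= R2 ^+ p * (U y0 + G) by nng.
have h2 : 0 <= Q * (Cs * U y0 + G) by nng.
by move: h1 h2; clear; lra.
Qed.
End Harnack.

(** * Boundary regularity by a four-point argument *)

Section FourPointTools.
Context {R : realType} {D : nat}.
Set Implicit Arguments. Unset Strict Implicit.
Local Notation V := 'rV[R]_D.
Implicit Types (w v : V -> R) (x y z p : V).

Lemma sdiff_exact (g : R -> R) (c : R) :
  (forall t, g t + g (- t) - 2 * g 0 = c * t ^+ 2) -> sdiff g c.
Proof.
move=> h e e0; exists 1 => // t _; rewrite h subrr normr0 mulr_ge0 // ?sqr_ge0 //.
exact: ltW.
Qed.

Lemma sdiffZ a (g : R -> R) c : sdiff g c -> sdiff (fun t => a * g t) (a * c).
Proof.
move=> h e e0; have a0 : 0 < `|a| + 1 by rewrite ltr_wpDl.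
have [dl dl0 hd] := h _ (divr_gt0 e0 a0); exists dl => // t /hd ht.
have -> : a * g t + a * g (- t) - 2 * (a * g 0) - a * c * t ^+ 2 =
  a * (g t + g (- t) - 2 * g 0 - c * t ^+ 2) by ring.
rewrite normrM; apply: (@le_trans _ _ ((`|a| + 1) * (e / (`|a| + 1) * t ^+ 2))).
  by apply: ler_pM => //; rewrite lerDl.
have -> // : (`|a| + 1) * (e / (`|a| + 1) * t ^+ 2) = e * t ^+ 2.
by field; rewrite gt_eqF.
Qed.

Lemma sdiff_sq u z : sdiff (fun t : R => dot (u + t *: z) (u + t *: z)) (2 * dot z z).
Proof. by apply: sdiff_exact => t; rewrite !dotE (dotC z u); ring. Qed.

Lemma sdiff_lin n u z : sdiff (fun t : R => dot n (u + t *: z)) 0.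
Proof. by apply: sdiff_exact => t; rewrite !dotE; ring. Qed.

(** Moving inwards, the test function decreases faster than [th t], and [w] varies by at most [th t]
    at first order, so the difference would increase. *)
Lemma flat_excluded (n : V) w Q x p H (th r s : R) : dot p n < - th -> 0 < r ->
  s = 1 \/ s = -1 -> nderiv_le n w x th -> jet Q x p H ->
  (forall t : R, 0 < t < r -> s * w (x + t *: n) - Q (x + t *: n) <= s * w x - Q x) ->
  False.
Proof.
move=> pn r0 s1 nw jQ mx.
pose b := - th - dot p n; have b0 : 0 < b by rewrite subr_gt0.
have [C [d1 [C0 d10 hc]]] := jet_ub n jQ.
have [d2 d20 hw] := nw (b / 2) (divr_gt0 b0 (ltr0Sn R 1)).
suff : b / 2 <= 0 by rewrite leNgt divr_gt0.
apply: (@nonneg_taylor _ _ C (Num.min r (Num.min d1 d2))).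
- by rewrite !lt_min r0 d10.
- exact: ltW.
move=> t; rewrite !lt_min => /andP[t0 /andP[tr /andP[td1 td2]]].
have := mx t; rewrite t0 tr => /(_ isT).
have := hw t; rewrite t0 td2 => /(_ isT).
have := hc t; rewrite gtr0_norm // => /(_ td1).
rewrite !ler_norml => /andP[_ h1] /andP[h2 h3].
have : (th + b / 2) * t + t * dot p n = - (b / 2 * t) by rewrite /b; field.
by case: s1 => ->; move: h1 h2 h3; clear; lra.
Qed.

Lemma max_grad w Q x p H p' H' (r s : R) : 0 < r -> s = 1 \/ s = -1 ->
  jet w x p' H' -> jet Q x p H ->
  (forall z, en z < r -> s * w (x + z) - Q (x + z) <= s * w x - Q x) -> en p' = en p.
Proof.
move=> r0 s1 jw jQ mx; have [/eqP + _] := jet_max r0 mx (jetB (jetZ s jw) jQ).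
rewrite subr_eq0 => /eqP <-.
by case: s1 => ->; rewrite ?scale1r // scaleN1r enN.
Qed.

(** Coupling for two pairs: on [M] all four points move together, along [e] the two pairs move in
    opposite directions, and the deviation of each matrix from [A0] is tested on one point alone.
    The large link penalty [P] thus enters only with the small factor [th]. *)
Lemma four_point_trace (lam Lam th : R) (A0 A1 A2 A3 A4 : 'M[R]_D)
    (X1 Y1 X2 Y2 : 'M[R]_D) (e : V) (Psi : V -> R) (c1 c2 P L : R) :
  0 < lam -> 0 < th -> 2 * th <= lam / 2 -> dot e e = 1 ->
  elliptic lam Lam A0 ->
  (forall A, A \in [:: A1; A2; A3; A4] -> A^T = A /\
     forall z, `|qf A z - qf A0 z| <= th * dot z z) ->
  0 <= P -> 0 <= L -> 0 <= c1 ->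
  (forall a b c d, qf X1 a - qf Y1 b - qf X2 c + qf Y2 d <=
     Psi (b - d) + P * (dot (a - b) (a - b) + dot (c - d) (c - d)) +
     L * (dot b b + dot d d)) ->
  Psi 0 <= 0 -> (forall z, Psi z <= c1 * dot z z) -> Psi (2 *: e) <= - (4 * c2) ->
  tr2 A1 X1 - tr2 A2 Y1 - tr2 A3 X2 + tr2 A4 Y2 <=
    2 * L * (D%:R * Lam) - lam * c2 + lam * L / 2 + 12 * P * th * D%:R
    + 6 * (c1 + L) * th * D%:R.
Proof.
move=> lam0 th0 thl e1 [sA eA] hA P0 L0 c10 hq Psi0 Pc Pe.
have symE (C : 'M[R]_D) : C^T = C -> forall i j, C i j = C j i.
  by move=> sC i j; rewrite -{1}sC mxE.
have q00 (C : 'M[R]_D) : qf C 0 = 0 by rewrite /qf !mul0mx mxE.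
have ee z : dot e z ^+ 2 <= dot z z by have := dot_CS e z; rewrite e1 mul1r.
pose M := A0 - (2 * th) *: 1%:M - (lam / 4) *: (e^T *m e).
have eM : elliptic (lam / 4) Lam M.
  split=> [|z].
    apply/matrixP => i j; rewrite !mxE !big_ord1 !mxE eq_sym (symE A0 sA j i); ring.
  have /andP[h1 h2] := eA z; rewrite /M !qflE qf1 qf_outer.
  have := ee z; have := dotxx_ge0 z; have := sqr_ge0 (dot e z) => s0 z0 ez.
  have h3 : lam / 4 * dot e z ^+ 2 <= lam / 4 * dot z z by rewrite ler_wpM2l //; lra.
  have h4 : 2 * th * dot z z <= lam / 2 * dot z z by rewrite ler_wpM2r.
  have h5 : 0 <= lam / 4 * dot e z ^+ 2 by rewrite mulr_ge0 //; lra.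
  have h6 : 0 <= 2 * th * dot z z by rewrite mulr_ge0 //; lra.
  by apply/andP; split; lra.
pose N A := A - A0 + (2 * th) *: 1%:M.
have eN A : A \in [:: A1; A2; A3; A4] -> elliptic th (3 * th) (N A).
  move=> /hA [sA' dA]; split=> [|z].
    by apply/matrixP => i j; rewrite !mxE eq_sym (symE A sA' j i) (symE A0 sA j i).
  have := dA z; rewrite ler_norml /N !qflE qf1 => /andP[h1 h2].
  by apply/andP; split; lra.
have lam4 : 0 < lam / 4 by rewrite divr_gt0.
have [lM ME trM] := elliptic_sum_outer lam4 eM.
have AE A H : tr2 A H = tr2 M H + tr2 (N A) H + lam / 4 * qf H e.
  rewrite -tr2_outer -tr2Zl -!tr2Dl; congr (tr2 _ H).
  by apply/matrixP => i j; rewrite !mxE; ring.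
have NB A H (s k : R) : A \in [:: A1; A2; A3; A4] -> 0 <= k ->
    (forall z, s * qf H z <= k * dot z z) -> s * tr2 (N A) H <= k * (3 * th * D%:R).
  move=> /eN /(elliptic_sum_outer th0) [l NE tr] k0 h.
  rewrite NE tr2_sum_outer mulr_sumr.
  apply: (@le_trans _ _ (\sum_(z <- l) k * dot z z)); first by apply: ler_sum => z _.
  by rewrite -mulr_sumr ler_wpM2l // mulrC.
have B0 : tr2 M X1 - tr2 M Y1 - tr2 M X2 + tr2 M Y2 <= 2 * L * (D%:R * Lam).
  rewrite ME !tr2_sum_outer -!sumrB -big_split /=.
  apply: (@le_trans _ _ (\sum_(z <- lM) 2 * L * dot z z)).
    apply: ler_sum => z _; have := hq z z z z; rewrite subrr dot0l; move: Psi0; clear; lra.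
  by rewrite -mulr_sumr ler_wpM2l // mulr_ge0.
have c1L : 0 <= P + c1 + L by nng.
have B1 : 1 * tr2 (N A1) X1 <= P * (3 * th * D%:R).
  apply: NB; rewrite ?inE ?eqxx // => z; have := hq z 0 0 0.
  rewrite !subr0 !q00 !dot0l; move: Psi0; clear; lra.
have B2 : -1 * tr2 (N A2) Y1 <= (P + c1 + L) * (3 * th * D%:R).
  apply: NB; rewrite ?inE ?eqxx ?orbT // => z; have := hq 0 z 0 0; have := Pc z.
  rewrite !subr0 !sub0r dotNl dotNr opprK !q00 !dot0l; move: Psi0; clear; lra.
have B3 : -1 * tr2 (N A3) X2 <= P * (3 * th * D%:R).
  apply: NB; rewrite ?inE ?eqxx ?orbT // => z; have := hq 0 0 z 0.
  rewrite !subr0 !q00 !dot0l; move: Psi0; clear; lra.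
have B4 : 1 * tr2 (N A4) Y2 <= (P + c1 + L) * (3 * th * D%:R).
  apply: NB; rewrite ?inE ?eqxx ?orbT // => z; have := hq 0 0 0 z; have := Pc (- z).
  rewrite !subr0 !sub0r !dotNl !dotNr !opprK !q00 !dot0l; move: Psi0; clear; lra.
have B5 : lam / 4 * (qf X1 e - qf Y1 e - qf X2 e + qf Y2 e) <= lam / 4 * (- (4 * c2) + 2 * L).
  have E2 : e - - e = 2 *: e by rewrite opprK scaler_nat mulr2n.
  rewrite ler_pM2l //; have := hq e e (- e) (- e).
  rewrite E2 !qfN !subrr dot0l dotNl dotNr opprK e1; move: Pe; clear; lra.
rewrite (AE A1) (AE A2) (AE A3) (AE A4).
by move: B0 B1 B2 B3 B4 B5; clear; lra.
Qed.

Lemma four_point_second w f (x1 y1 x2 y2 h c n : V) (P L k r : R)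
    p1 X1 q1 Y1 p2 X2 q2 Y2 pf Hf : 0 < r ->
  jet w x1 p1 X1 -> jet w y1 q1 Y1 -> jet w x2 p2 X2 -> jet w y2 q2 Y2 ->
  jet f (y1 - y2) pf Hf ->
  (let Phi a b a' b' := w a - w b - w a' + w b' - f (b - b')
     - P * (dot (a - b - h) (a - b - h) + dot (a' - b' - h) (a' - b' - h))
     - L * (dot (b - c) (b - c) + dot (b' - c) (b' - c))
     + k * dot n (a + b + a' + b') in
   forall z1 z2 z3 z4, en z1 < r -> en z2 < r -> en z3 < r -> en z4 < r ->
     Phi (x1 + z1) (y1 + z2) (x2 + z3) (y2 + z4) <= Phi x1 y1 x2 y2) ->
  forall a b a' b', qf X1 a - qf Y1 b - qf X2 a' + qf Y2 b' <=
     qf Hf (b - b') + 2 * P * (dot (a - b) (a - b) + dot (a' - b') (a' - b')) +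
     2 * L * (dot b b + dot b' b').
Proof.
move=> r0 j1 j2 j3 j4 jf mx a b a' b'.
have s := sdiffD (sdiffB (sdiffB (sdiffB (sdiffD (sdiffB (sdiffB (sdiff_jet a j1)
   (sdiff_jet b j2)) (sdiff_jet a' j3)) (sdiff_jet b' j4)) (sdiff_jet (b - b') jf))
   (sdiffZ P (sdiffD (sdiff_sq (x1 - y1 - h) (a - b)) (sdiff_sq (x2 - y2 - h) (a' - b')))))
   (sdiffZ L (sdiffD (sdiff_sq (y1 - c) b) (sdiff_sq (y2 - c) b'))))
   (sdiffZ k (sdiff_lin n (x1 + y1 + x2 + y2) (a + b + a' + b'))).
have k0 : 0 < en a + en b + en a' + en b' + 1 by rewrite ltr_wpDl ?addr_ge0 ?en_ge0.
suff : qf X1 a - qf Y1 b - qf X2 a' + qf Y2 b' - qf Hf (b - b') -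
  P * (2 * dot (a - b) (a - b) + 2 * dot (a' - b') (a' - b')) -
  L * (2 * dot b b + 2 * dot b' b') + k * 0 <= 0 by clear; lra.
apply: (sdiff_max (divr_gt0 r0 k0) _ s) => t.
rewrite ltr_pdivlMr // => ht.
have [n0 [n1 [n2 [n3 n4]]]] : 0 <= `|t| /\ 0 <= en a /\ 0 <= en b /\ 0 <= en a' /\ 0 <= en b'.
  by rewrite !en_ge0.
have sm (z : V) : en z <= en a + en b + en a' + en b' -> en (t *: z) < r.
  move=> hz; rewrite enZ; apply: le_lt_trans ht; rewrite ler_wpM2l //; move: hz; clear; lra.
have := mx (t *: a) (t *: b) (t *: a') (t *: b').
rewrite !sm; try (move: n1 n2 n3 n4; clear; lra).
move=> /(_ isT isT isT isT) /=; rewrite !scale0r !addr0.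
have E1 (u v z z' : V) : u + t *: z - (v + t *: z') = u - v + t *: (z - z').
  by rewrite scalerBr opprD addrACA.
rewrite !E1 ![_ + t *: _ - _]addrAC.
have -> : x1 + t *: a + (y1 + t *: b) + (x2 + t *: a') + (y2 + t *: b') =
   x1 + y1 + x2 + y2 + t *: (a + b + a' + b').
  by apply/rowP => i; rewrite !mxE; ring.
by [].
Qed.
End FourPointTools.

Section FourPoint.
Context {R : realType} {D : nat}.
Set Implicit Arguments. Unset Strict Implicit.
Local Notation V := 'rV[R]_D.
Implicit Types (w v : V -> R) (x y z p : V).

Lemma en_powR_continuous (a : R) : 0 < a -> continuous (fun z : V => en z `^ a).
Proof.
move=> a0; apply: continuous_eps => x e e0.
have [/eqP|x0] := boolP (en x == 0).
  move=> /en_eq0 ->; exists (e `^ a^-1); first exact: powR_gt0.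
  move=> y; rewrite subr0 en0 powR0 ?gt_eqF // subr0 ger0_norm ?powR_ge0 // => /ltW h.
  have : (en y) `^ a <= (e `^ a^-1) `^ a.
    by apply: ge0_ler_powR; rewrite ?nnegrE ?en_ge0 ?powR_ge0 // ltW.
  by rewrite -powRrM mulVf ?gt_eqF // powRr1 // ltW.
have {}x0 : 0 < en x by rewrite lt_neqAle eq_sym x0 en_ge0.
have [dl dl0 h] := jet_eps (jet_radial a x0) e0; by exists dl.
Qed.

Lemma sub_continuous (T : topologicalType) (f g : T -> V) :
  continuous f -> continuous g -> continuous (fun x : T => f x - g x).
Proof. by move=> hf hg x; apply: continuousB; [exact: hf | exact: hg]. Qed.

Lemma comp_continuous (T U W : topologicalType) (f : T -> U) (g : U -> W) :
  continuous f -> continuous g -> continuous (fun x : T => g (f x)).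
Proof. by move=> hf hg x; apply: continuous_comp; [exact: hf | exact: hg]. Qed.

Lemma sq_continuous : continuous (fun x : V => dot x x).
Proof.
have -> : (fun x : V => dot x x) = (fun x => dot (x - 0) (x - 0)).
  by apply/funext => x; rewrite subr0.
exact: sqdist_continuous.
Qed.

(** Close pairs are treated by [lipschitz_estimate] on a small ball, pairs at distance more than
    [rho] by [|w| <= 1]. *)
Lemma unit_lipschitz (n : V) (lam Lam CB CA gam : R) :
  dot n n = 1 -> 0 < lam -> 0 <= Lam -> 0 <= CB -> 0 < CA -> 0 < gam < 1 ->
  exists2 L : R, 0 < L & forall A B w (th : R), hcoefs lam Lam CB CA gam A B ->
    0 < th <= 1 -> lsol n A B w 0 1 th th -> (forall x, hball n 0 1 x -> `|w x| <= 1) ->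
    forall x y, hball n 0 1 x -> hball n 0 (1 / 2) y -> w x - w y <= L * en (x - y) + 6 * th.
Proof.
move=> n1 lam0 Lam0 CB0 CA0 g01.
have [rho0 [CL [rho00 rho01 CL0 hL]]] := lipschitz_estimate n1 lam0 Lam0 CB0 CA0 g01.
have [rho [rho_gt0 rhor rhoh]] : exists rho : R, [/\ 0 < rho, rho <= rho0 & rho <= 1 / 2].
  exists (Num.min rho0 (1 / 2)); rewrite lt_min rho00 divr_gt0 // !ge_min !lexx orbT.
  by split.
exists (CL * (1 / rho + 2) + 2 / rho); first by pos.
move=> A B w th hAB /andP[th0 th1] lw w1 x y xb yb.
have wle z : hball n 0 1 z -> -1 <= w z <= 1 by move=> /w1; rewrite ler_norml.
have sub12 : hball n (0 : V) (1 / 2) `<=` hball n 0 1.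
  by apply: hball_sub; rewrite subrr en0; clear; lra.
have [xy|xy] := leP (en (x - y)) rho; last first.
  have := wle _ xb; have := wle _ (sub12 _ yb).
  have h1 : 2 <= 2 / rho * en (x - y) by rewrite mulrAC ler_pdivlMr // ler_pM2l // ltW.
  have h2 : 0 <= CL * (1 / rho + 2) * en (x - y) by nng.
  by move: h1 h2 th0; clear => ? ? ? /andP[? ?] /andP[? ?]; rewrite mulrDl; lra.
have ysub : hball n y rho `<=` hball n 0 1.
  apply: hball_sub; case: yb => yr _; move: yr rhoh; clear; lra.
have lwy : lsol n A B w y rho th th.
  by apply: lsol_sub lw; case: yb => yr _; move: yr rhoh; clear; lra.
have osc : forall x z, hball n y rho x -> hball n y rho z -> w x - w z <= 2 * 1.
  move=> a b /ysub /wle /andP[_ h1] /ysub /wle /andP[h2 _]; move: h1 h2; clear; lra.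
have rr : 0 < rho <= rho0 by rewrite rho_gt0.
have xb' : hball n y rho x by case: xb => _ xs; split.
have := hL A B w y rho th th 1 hAB rr (ltW th0) th0 ler01 (proj2 yb) lwy osc x xb'.
have h1 : th * rho <= 1 by move: th0 th1 rho_gt0 rhoh; clear; nra.
have h2 : CL * (1 / rho + th * rho + th * rho) * en (x - y) <=
   CL * (1 / rho + 2) * en (x - y).
  rewrite ler_wpM2r ?en_ge0 // ler_pM2l //; move: h1; clear; lra.
have h3 : 0 <= 2 / rho * en (x - y) by nng.
have h4 : 6 * th * rho <= 6 * th.
  by rewrite ler_piMr //; [nng | move: rhoh; clear; lra].
by move: h2 h3 h4; rewrite [X in _ -> _ -> _ -> _ -> _ <= X]addrC mulrDl; clear; lra.
Qed.

(** All sizes are expressed by [c2], the opposite of the radial second derivative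
    [- (7 / 8) (1 / 8) K |z| ^ (7 / 8 - 2)]: the tangential curvature is [8 c2], and so is a bound
    for the slope as [|z| <= 1]. *)
Lemma radial_penalty (K : R) (z : V) : 0 < K -> 0 < en z <= 1 ->
  exists (d c2 : R) Hf, [/\ jet (fun z => K * en z `^ (7 / 8)) z (d *: z) Hf, 0 <= d,
    en (d *: z) <= 8 * c2, K * (7 / 64) <= c2 &
    [/\ forall x, qf Hf x <= 8 * c2 * dot x x &
        exists2 e, dot e e = 1 & qf Hf (2 *: e) <= - (4 * c2)]].
Proof.
move=> K0 /andP[z0 z1].
have j := jetZ K (jet_radial (7 / 8) z0).
set P := en z `^ (7 / 8) in j; have P0 : 0 < P by apply: powR_gt0.
have d0 : 0 < dot z z by rewrite -en_sq exprn_gt0.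
have dz : dot z z <= en z by rewrite -en_sq expr2 ler_piMl ?en_ge0.
have zP : en z <= P by apply: ger1_powR; [rewrite z0 | lra].
pose q := P / dot z z.
have q0 : 0 < q by rewrite divr_gt0.
have q1 : 1 <= q by rewrite ler_pdivlMr // mul1r (le_trans dz).
exists (K * (7 / 8 * q)), (K * (7 / 64) * q); eexists; split.
- refine (jet_eq j _ _ _) => //; first by rewrite scalerA /q !mulrA.
- by nng.
- rewrite enZ ger0_norm; last by nng.
  have -> : 8 * (K * (7 / 64) * q) = K * (7 / 8 * q) * 1 by field.
  rewrite ler_pM2l //; pos.
- by rewrite ler_peMr //; nng.
have HE x : qf (K *: ((7 / 8 * P / dot z z) *: 1%:M + (7 / 8 * (7 / 8 - 2) * P / dot z z ^+ 2)
    *: (z^T *m z))) x = K * (7 / 8 * q * dot x x - 63 / 64 * q / dot z z * dot z x ^+ 2).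
  by rewrite !qflE qf1 qf_outer /q; field; rewrite gt_eqF.
split=> [x|].
  rewrite HE; have : 0 <= K * (63 / 64 * q / dot z z * dot z x ^+ 2).
    by apply: mulr_ge0; [exact: ltW | apply: mulr_ge0; [nng | exact: sqr_ge0]].
  by clear; lra.
exists ((en z)^-1 *: z).
  by rewrite dotZl dotZr -en_sq; field; rewrite gt_eqF.
rewrite HE !dotZl !dotZr -en_sq le_eqVlt; apply/orP; left; apply/eqP.
by field; rewrite gt_eqF.
Qed.
End FourPoint.

Section FourPointMain.
Context {R : realType} {D : nat}.
Set Implicit Arguments. Unset Strict Implicit.
Local Notation V := 'rV[R]_D.
Implicit Types (w v : V -> R) (x y z p : V).

(* Numerical end of the argument: [c2] is the concavity gain, everything else is noise. *)
Lemma four_point_numeric (lam Lam th r K La P c2 Dr tr g : R) :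
  0 < lam -> 0 <= Lam -> 0 < r -> 0 < th -> 0 <= La -> 0 <= P -> 0 <= Dr -> th <= 1 ->
  0 < c2 ->
  K * r * (7 / 64) <= c2 ->
  tr <= 2 * (2 * (r * La)) * (Dr * Lam) - lam * c2 + lam * (2 * (r * La)) / 2
     + 12 * (2 * P) * th * Dr + 6 * (8 * c2 + 2 * (r * La)) * th * Dr ->
  - tr <= 4 * th + th * g ->
  g <= 4 * P + 16 * c2 + 4 * (r * La) + 8 ->
  th * (48 * Dr + 16) <= lam / 2 ->
  th * (4 + 4 * P + 8 + 24 * P * Dr) <= r ->
  lam * (7 / 64) / 2 * K <= 1 + La * (4 * Dr * Lam + lam + 12 * Dr + 4).
Proof.
move=> lam0 Lam0 r0 th0 La0 P0 D0 th1 c20 hK h1 h2 h3 h4 h5.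
rewrite -(ler_pM2r r0).
have e1 : th * g <= th * (4 * P + 16 * c2 + 4 * (r * La) + 8) by rewrite ler_pM2l.
have rL : 0 <= r * La by nng.
have e2 : c2 * (th * (48 * Dr + 16)) <= c2 * (lam / 2) by rewrite ler_pM2l.
have e3 : th * (r * La) <= r * La by rewrite ler_piMl.
have e4 : th * (r * La * Dr) <= r * La * Dr by rewrite ler_piMl //; nng.
have e5 : lam * (K * r * (7 / 64)) <= lam * c2 by rewrite ler_pM2l.
move: h1 h2 e1 e2 e3 e4 h5 e5; clear; lra.
Qed.

Lemma flat_side_excluded (n : V) w Q x p H (th s : R) (S : set V) (r : R) :
  dot n n = 1 -> 0 < r -> (forall z, en z < r -> 0 <= dot (x + z) n -> S (x + z)) ->
  dot x n = 0 -> dot p n < - th -> s = 1 \/ s = -1 -> nderiv_le n w x th -> jet Q x p H ->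
  (forall y, S y -> s * w y - Q y <= s * w x - Q x) -> False.
Proof.
move=> n1 r0 hS xn pn s1 nw jQ mx.
apply: (flat_excluded pn r0 s1 nw jQ) => t /andP[t0 tr]; apply: mx; apply: hS.
  by rewrite enZ (en_n n1) mulr1 gtr0_norm.
by rewrite dotDl dotZl xn n1 add0r mulr1 ltW.
Qed.

(* Tangential difference quotients are almost constant: maximize
   [w x1 - w y1 - w x2 + w y2] penalized by the concave [|y1 - y2| ^ (7 / 8)]. *)
Lemma four_point (n : V) (lam Lam CB CA gam : R) :
  dot n n = 1 -> 0 < lam -> 0 <= Lam -> 0 <= CB -> 0 < CA -> 0 < gam < 1 ->
  exists K r1 : R, [/\ 0 < K, 0 < r1, r1 <= 1 / 8 & forall r : R, 0 < r <= r1 ->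
    exists2 th0 : R, 0 < th0 <= 1 & forall A B w (A0 : 'M[R]_D) (th : R),
      0 < th <= th0 ->
      hcoefs lam Lam CB CA gam A B -> elliptic lam Lam A0 ->
      (forall x, hball n 0 1 x -> en (B x) <= th /\
         forall z, `|qf (A x) z - qf A0 z| <= th * dot z z) ->
      lsol n A B w 0 1 th th -> (forall x, hball n 0 1 x -> `|w x| <= 1) ->
      forall h c y, dot h n = 0 -> en h <= r -> hball n 0 (1 / 8) c -> hball n 0 (1 / 8) y ->
        w (y + h) - w y - (w (c + h) - w c) <= K * r * (en (y - c) `^ (7 / 8) + r ^+ 2)].
Proof.
move=> n1 lam0 Lam0 CB0 CA0 g01.
have [L L0 hL] := unit_lipschitz n1 lam0 Lam0 CB0 CA0 g01.
(* At the maximum point the penalties will sum to at most [r C3]. The factor 65 in [La] then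
   confines [y1] and [y2] to distance less than [1 / 8] from [c]. *)
have [C3 C3E] : exists C3, C3 = 2 * L + 2 * L ^+ 2 + 1 by eexists.
have C30 : 0 < C3 by rewrite C3E; pos.
have [La LaE] : exists La, La = 65 * C3 by eexists.
have La0 : 0 < La by rewrite LaE; pos.
have Dr0 : 0 <= D%:R :> R by [].
have [K KE] : exists K, K = 2 / (lam * (7 / 64) / 2) *
    (2 + La * (4 * D%:R * Lam + lam + 12 * D%:R + 4)) by eexists.
have K0 : 0 < K.
  rewrite KE; apply: mulr_gt0; first by pos.
  by apply: ltr_wpDr; [nng | pos].
have KE' : lam * (7 / 64) / 2 * K > 1 + La * (4 * D%:R * Lam + lam + 12 * D%:R + 4).
  have -> : lam * (7 / 64) / 2 * K = 2 * (2 + La * (4 * D%:R * Lam + lam + 12 * D%:R + 4)).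
    by rewrite KE; field; rewrite gt_eqF.
  have : 0 <= La * (4 * D%:R * Lam + lam + 12 * D%:R + 4) by nng.
  by clear; lra.
pose r1 := Num.min (1 / 8) (1 / (16 * (C3 + 1))).
have r10 : 0 < r1 by rewrite lt_min; apply/andP; split; pos.
have r18 : r1 <= 1 / 8 by rewrite ge_min lexx.
have r1C : r1 * (16 * (C3 + 1)) <= 1.
  by rewrite -ler_pdivlMr; [rewrite ge_min lexx orbT | pos].
exists (K + La + L ^+ 2 + 1), r1; split => //; first by pos.
move=> r /andP[r0 rr1].
have r8 : r <= 1 / 8 by apply: le_trans r18.
have rC : r * (16 * (C3 + 1)) <= 1.
  by apply: le_trans r1C; rewrite ler_pM2r //; pos.
have r30 : 0 < r ^+ 3 by rewrite exprn_gt0.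
(* A stiff link between [x - y] and [h]: by the arithmetic-geometric inequality a deviation [e]
   gains at most [L e <= L^2 r^3 + P e^2 / 2], an error of higher order than [r]. *)
have [P PE] : exists P, P = (2 * r ^+ 3)^-1 by eexists.
have P0 : 0 < P by rewrite PE invr_gt0; pos.
have Pr3 : 2 * P * r ^+ 3 = 1 by rewrite PE; field; rewrite gt_eqF.
(* Chosen after [r], hence after [P], because the stiffness multiplies [th] in the error terms. *)
pose th0 := Num.min (lam / 2 / (48 * D%:R + 16 + 4)) (Num.min (r / (4 + 4 * P + 8 + 24 * P * D%:R))
    (Num.min (r ^+ 3 / 16) 1)).
have th00 : 0 < th0.
  have q1 : 0 < 48 * D%:R + 16 + 4 :> R by apply: ltr_wpDl; [nng | pos].
  have q2 : 0 < 4 + 4 * P + 8 + 24 * P * D%:R by apply: ltr_wpDr; [nng | pos].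
  by rewrite !lt_min ltr01 andbT; apply/and3P; split; pos.
exists th0; first by rewrite th00 !ge_min lexx !orbT.
move=> A B w A0 th /andP[t0 tth] hAB eA0 hA0 lw w1 h c y hn hr cb yb.
have [th1 th2 th3 th4] : [/\ th * (48 * D%:R + 16) <= lam / 2 /\ 2 * th <= lam / 2,
    th * (4 + 4 * P + 8 + 24 * P * D%:R) <= r, th <= r ^+ 3 / 16 & th <= 1].
  move: tth; rewrite !le_min => /andP[a1 /andP[a2 /andP[a3 a4]]]; split => //.
    have q1 : 0 < 48 * D%:R + 16 + 4 :> R by apply: ltr_wpDl; [nng | pos].
    move: a1; rewrite ler_pdivlMr // => a1.
    have : 0 <= th * D%:R by nng.
    by split; move: a1 t0 H; clear; lra.
  by rewrite -ler_pdivlMr //; apply: ltr_wpDr; [nng | pos].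
case: th1 => th1 th1'.
have th01 : 0 < th <= 1 by rewrite t0.
have {}hL := hL A B w th hAB th01 lw w1.

(* The penalized function of four points and its continuity *)
pose S := hball n (0 : V) (1 / 2).
have S1 : S `<=` hball n 0 1 by apply: hball_sub; rewrite subrr en0; clear; lra.
pose f z := K * r * en z `^ (7 / 8).
pose sq (u : V) := dot u u.
pose T (z : V * V) := w z.1 - w z.2 - P * sq (z.1 - z.2 - h) - r * La * sq (z.2 - c)
   + 2 * th * dot n (z.1 + z.2).
pose T' (z : V * V) := w z.1 - w z.2 + P * sq (z.1 - z.2 - h) + r * La * sq (z.2 - c)
   - 2 * th * dot n (z.1 + z.2).
pose Phi (z : (V * V) * (V * V)) := T z.1 - T' z.2 - f (z.1.2 - z.2.2).
pose SS := (S `*` S) `*` (S `*` S).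
have cS : compact SS by do 2!apply: compact_setX; exact: compact_hball.
have cw : ctn S w by case: lw => cw _ _; exact: ctn_sub S1 cw.
have ct (s : R) : ctn (S `*` S) (fun z : V * V => w z.1 - w z.2).
  apply: ctnB.
  - by apply: (@ctn_pre _ _ _ (S `*` S) S fst w) => //; [exact: fst_ctn | move=> z []].
  - by apply: (@ctn_pre _ _ _ (S `*` S) S snd w) => //; [exact: snd_ctn | move=> z []].
have csq : continuous (fun z : V * V => P * sq (z.1 - z.2 - h)).
  move=> z; apply: (@continuousM _ _ (fun=> P) (fun z : V * V => sq (z.1 - z.2 - h))).
    exact: cst_continuous.
  move: z; apply: (@comp_continuous _ _ _ (fun z : V * V => z.1 - z.2 - h) sq); last exact: sq_continuous.
  apply: sub_continuous; last exact: cst_continuous.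
  by apply: sub_continuous; [exact: fst_ctn | exact: snd_ctn].
have csq2 : continuous (fun z : V * V => r * La * sq (z.2 - c)).
  move=> z; apply: (@continuousM _ _ (fun=> r * La) (fun z : V * V => sq (z.2 - c))).
    exact: cst_continuous.
  move: z; apply: (@comp_continuous _ _ _ (fun z : V * V => z.2 - c) sq); last exact: sq_continuous.
  by apply: sub_continuous; [exact: snd_ctn | exact: cst_continuous].
have cn : continuous (fun z : V * V => 2 * th * dot n (z.1 + z.2)).
  move=> z; apply: (@continuousM _ _ (fun=> 2 * th) (fun z : V * V => dot n (z.1 + z.2))).
    exact: cst_continuous.
  move: z; apply: (@comp_continuous _ _ _ (fun z : V * V => z.1 + z.2) (dot n)); last exact: dot_continuous.
  by move=> z; apply: continuousD; [exact: fst_ctn | exact: snd_ctn].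
have cT : ctn (S `*` S) T.
  apply: ctnD; last exact: ctn_continuous.
  by do 2!(apply: ctnB; last exact: ctn_continuous); exact: ct.
have cT' : ctn (S `*` S) T'.
  apply: ctnB; last exact: ctn_continuous.
  by do 2!(apply: ctnD; last exact: ctn_continuous); exact: ct.
have cPhi : ctn SS Phi.
  apply: ctnB; first apply: ctnB.
  - by apply: (@ctn_pre _ _ _ SS (S `*` S) fst T) => //; [exact: fst_ctn | move=> z []].
  - by apply: (@ctn_pre _ _ _ SS (S `*` S) snd T') => //; [exact: snd_ctn | move=> z []].
  apply: ctn_continuous.
  apply: (@comp_continuous _ _ _ (fun z : (V * V) * (V * V) => z.1.2 - z.2.2) f).
    by apply: sub_continuous; apply: (@comp_continuous _ _ _ _ snd); [exact: fst_ctn|exact: snd_ctn|exact: snd_ctn|exact: snd_ctn].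
  move=> z; apply: (@continuousM _ _ (fun=> K * r) (fun z : V => en z `^ (7 / 8))).
    exact: cst_continuous.
  by apply: en_powR_continuous; clear; lra.
have fN z : f (- z) = f z by rewrite /f enN.
have f0 z : 0 <= f z by rewrite /f; nng.
have dS z : S z -> 0 <= dot n z <= 1 / 2.
  move=> [zr zs]; rewrite (dotC n) zs /=; have := dot_le_en z n.
  rewrite (en_n n1) mulr1 ler_norml => /andP[_]; rewrite subr0 in zr; move: zr; clear; lra.
have cS' : S c by apply: hball_sub cb; rewrite subrr en0; clear; lra.
have yS' : S y by apply: hball_sub yb; rewrite subrr en0; clear; lra.
have shS z : hball n 0 (1 / 8) z -> S (z + h).
  move=> [zr zs]; split; last by rewrite dotDl hn addr0.
  rewrite subr0 in zr; rewrite subr0; have := en_triangle z h; move: zr hr r8; clear; lra.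
(* The bound is evaluated at [((y + h, y), (c + h, c))], where both links vanish and the tilt is
   nonnegative. *)
suff bound : forall q, SS q -> Phi q <= (L ^+ 2 + 1) * r ^+ 3.
  have := bound ((y + h, y), (c + h, c)) (conj (conj (shS _ yb) yS') (conj (shS _ cb) cS')).
  have E0 u : u + h - u - h = 0 by rewrite addrAC addrK subrr.
  rewrite /Phi /T /T' /= !E0 subrr /sq dot0l !mulr0 !subr0 !addr0.
  have h1 : dot (y - c) (y - c) <= en (y - c) `^ (7 / 8).
    have [|e0] := leP (en (y - c)) 0.
      move=> h0; have : en (y - c) = 0 by apply/eqP; rewrite eq_le h0 en_ge0.
      by move=> /en_eq0 ->; rewrite dot0l powR_ge0.
    have e1 : en (y - c) <= 1.
      case: yb cb => [yr _] [cr _]; rewrite !subr0 in yr cr.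
      by have := en_triangle y (- c); rewrite enN; move: yr cr; clear; lra.
    apply: (@le_trans _ _ (en (y - c))); first by rewrite -en_sq expr2 ler_piMl // ltW.
    by apply: ger1_powR; [rewrite e0 | clear; lra].
  have h2 : 0 <= 2 * th * dot n (y + h + y) + 2 * th * dot n (c + h + c).
    have := dS _ (shS _ yb); have := dS _ (shS _ cb); have := dS _ cS'; have := dS _ yS'.
    rewrite !(dotDr n (_ + h)) => /andP[? _] /andP[? _] /andP[? _] /andP[? _].
    by nng; apply: addr_ge0.
  have h3 : r * La * dot (y - c) (y - c) <= r * La * en (y - c) `^ (7 / 8).
    by rewrite ler_pM2l //; pos.
  have h4 : 0 <= r * (L ^+ 2 + 1) * en (y - c) `^ (7 / 8) by nng.
  have h5 : 0 <= (K + La) * r ^+ 3 by nng.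
  rewrite /f; move: h2 h3 h4 h5; set q := en _ `^ _; set N1 := dot n _; set N2 := dot n _.
  by move: (w _) (w _) (w _) (w _); clear => *; rewrite !mulrDl !mulrDr; lra.
have S0 : S 0 by split; rewrite ?subrr ?en0 ?dot0l //; lra.
have [[[x1 y1] [x2 y2]] [[/= x1S y1S] [/= x2S y2S]] mx] :=
  ctn_max cS (ex_intro _ ((0, 0), (0, 0)) (conj (conj S0 S0) (conj S0 S0))) cPhi.
suff gt : Phi ((x1, y1), (x2, y2)) <= (L ^+ 2 + 1) * r ^+ 3.
  by move=> z /mx h1; apply: le_trans gt.
rewrite leNgt; apply/negP => gt.

(* Localization of the maximum point *)
have r3r : r ^+ 3 <= r / 64.
  have -> : r / 64 = r * (1 / 8) ^+ 2 by field.
  by rewrite exprS ler_pM2l // lerXn2r // ?nnegrE ?ltW // divr_gt0.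
have sub1 (u v : V) : S u -> S v -> w u - w v <= L * (en (u - v - h) + r) + 6 * th.
  move=> /S1 uS vS; apply: (le_trans (hL _ _ uS vS)); rewrite lerD2r ler_pM2l //.
  have := en_triangle (u - v - h) h; rewrite subrK; move: hr; clear; lra.
have sub2 (u v : V) : S u -> S v -> w v - w u <= L * (en (u - v - h) + r) + 6 * th.
  move=> uS /S1 vS; apply: (le_trans (hL _ _ vS uS)); rewrite lerD2r ler_pM2l // en_subC.
  have := en_triangle (u - v - h) h; rewrite subrK; move: hr; clear; lra.
have amgm (t : R) : L * t <= L ^+ 2 * r ^+ 3 + P / 2 * t ^+ 2.
  have : 0 <= P / 2 * (t - 2 * L * r ^+ 3) ^+ 2 by rewrite mulr_ge0 ?sqr_ge0 //; nng.
  have -> : P / 2 * (t - 2 * L * r ^+ 3) ^+ 2 =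
    P / 2 * t ^+ 2 - (2 * P * r ^+ 3) * L * t + (2 * P * r ^+ 3) * (L ^+ 2 * r ^+ 3) by field.
  by rewrite Pr3; clear; lra.
have PhiE : Phi ((x1, y1), (x2, y2)) = (w x1 - w y1) + (w y2 - w x2)
   - P * (en (x1 - y1 - h) ^+ 2 + en (x2 - y2 - h) ^+ 2)
   - r * La * (en (y1 - c) ^+ 2 + en (y2 - c) ^+ 2)
   + 2 * th * (dot n x1 + dot n y1 + dot n x2 + dot n y2) - f (y1 - y2).
  by rewrite /Phi /T /T' /sq /= !en_sq !dotDr; ring.
have tilt : 2 * th * (dot n x1 + dot n y1 + dot n x2 + dot n y2) <= 4 * th.
  have := dS _ x1S; have := dS _ y1S; have := dS _ x2S; have := dS _ y2S.
  move=> /andP[_ i1] /andP[_ i2] /andP[_ i3] /andP[_ i4].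
  have -> : 4 * th = 2 * th * 2 by ring.
  by rewrite ler_pM2l; [move: i1 i2 i3 i4; clear; lra | pos].
have [e1 [e1E e10]] : exists e1, e1 = en (x1 - y1 - h) /\ 0 <= e1.
  by eexists; split; [reflexivity | exact: en_ge0].
have [e2 [e2E e20]] : exists e2, e2 = en (x2 - y2 - h) /\ 0 <= e2.
  by eexists; split; [reflexivity | exact: en_ge0].
have a1 := sub1 _ _ x1S y1S; have a2 := sub2 _ _ x2S y2S.
rewrite -e1E -e2E in PhiE a1 a2.
have budget : P / 2 * (e1 ^+ 2 + e2 ^+ 2) + r * La * (en (y1 - c) ^+ 2 + en (y2 - c) ^+ 2)
    <= r * C3.
  have b1 := amgm e1; have b2 := amgm e2; have b3 := f0 (y1 - y2).
  have b4 : 2 * L ^+ 2 * r ^+ 3 <= 2 * L ^+ 2 * r.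
    by apply: ler_wpM2l; [nng | move: r3r r0; clear; lra].
  have b5 : 0 <= (L ^+ 2 + 1) * r ^+ 3 by nng.
  move: gt; rewrite PhiE C3E; move: a1 a2 tilt th3 r3r r0 b1 b2 b3 b4 b5; clear; lra.
have nn1 : 0 <= P / 2 * e1 ^+ 2 by nng.
have nn2 : 0 <= P / 2 * e2 ^+ 2 by nng.
have nn3 : 0 <= r * La * en (y1 - c) ^+ 2 by nng.
have nn4 : 0 <= r * La * en (y2 - c) ^+ 2 by nng.
have near8 (u : V) : r * La * en (u - c) ^+ 2 <= r * C3 -> en (u - c) < 1 / 8.
  rewrite -mulrA ler_pM2l // LaE -mulrA mulrCA -{2}[C3]mulr1 ler_pM2l // => h1.
  rewrite ltNge; apply/negP => h2; have : (1 / 8) ^+ 2 <= en (u - c) ^+ 2.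
    by rewrite lerXn2r ?nnegrE ?en_ge0 //; nng.
  by move: h1; clear; lra.
have ye1 : en (y1 - c) < 1 / 8 by apply: near8; move: budget nn1 nn2 nn4; clear; lra.
have ye2 : en (y2 - c) < 1 / 8 by apply: near8; move: budget nn1 nn2 nn3; clear; lra.
have small8 (e : R) : 0 <= e -> P / 2 * e ^+ 2 <= r * C3 -> e < 1 / 8.
  move=> e0 h1; have h2 : e ^+ 2 <= 4 * r ^+ 3 * (r * C3).
    have -> : e ^+ 2 = 4 * r ^+ 3 * (P / 2 * e ^+ 2).
      have -> : 4 * r ^+ 3 * (P / 2 * e ^+ 2) = (2 * P * r ^+ 3) * e ^+ 2 by field.
      by rewrite Pr3 mul1r.
    by rewrite ler_pM2l //; pos.
  have h3 : 4 * r ^+ 3 * (r * C3) <= 4 * r ^+ 3 * (1 / 16).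
    by rewrite ler_pM2l; [move: rC r0; clear; lra | pos].
  rewrite ltNge; apply/negP => h4; have : (1 / 8) ^+ 2 <= e ^+ 2.
    by rewrite lerXn2r ?nnegrE //; nng.
  by move: h2 h3 r3r r8; clear; lra.
have x1e : e1 < 1 / 8 by apply: small8 => //; move: budget nn2 nn3 nn4; clear; lra.
have x2e : e2 < 1 / 8 by apply: small8 => //; move: budget nn1 nn3 nn4; clear; lra.
have cr : en c <= 1 / 8 by case: cb; rewrite subr0.
have y1r : en y1 < 1 / 4.
  by have := en_triangle (y1 - c) c; rewrite subrK; move: ye1 cr; clear; lra.
have y2r : en y2 < 1 / 4.
  by have := en_triangle (y2 - c) c; rewrite subrK; move: ye2 cr; clear; lra.
have xr (u v : V) : en (u - v - h) < 1 / 8 -> en v < 1 / 4 -> en u < 1 / 2.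
  have := en_triangle (u - v - h) (v + h); have := en_triangle v h.
  have -> : u - v - h + (v + h) = u by apply/rowP => i; rewrite !mxE; ring.
  by move: hr r8; clear; lra.
have x1r : en x1 < 1 / 2 by apply: (xr _ y1); rewrite -?e1E.
have x2r : en x2 < 1 / 2 by apply: (xr _ y2); rewrite -?e2E.
have {}y1r : en y1 < 1 / 2 by move: y1r; clear; lra.
have {}y2r : en y2 < 1 / 2 by move: y2r; clear; lra.
(* The penalty is not smooth at 0, so [y1 = y2] must be excluded. In that case [x1 - x2] is a
   difference of the two link errors, and the Lipschitz bound together with the links already keeps
   [Phi] small. *)
have y12 : 0 < en (y1 - y2).
  rewrite lt_neqAle en_ge0 andbT eq_sym; apply/eqP => /en_eq0 y0.
  have h1 : w x1 - w x2 <= L * (e1 + e2) + 6 * th.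
    apply: (le_trans (hL _ _ (S1 _ x1S) x2S)); rewrite lerD2r ler_pM2l //.
    have -> : x1 - x2 = (x1 - y1 - h) - (x2 - y2 - h).
      have -> : y1 = y2 by apply/eqP; rewrite -subr_eq0 y0.
      by apply/rowP => i; rewrite !mxE; ring.
    by rewrite e1E e2E (le_trans (en_triangle _ _)) // enN.
  have h2 : w y2 - w y1 = 0.
    by rewrite (_ : y1 = y2) ?subrr //; apply/eqP; rewrite -subr_eq0 y0.
  have h3 : L * (e1 + e2) <= L ^+ 2 * r ^+ 3 + P * (e1 ^+ 2 + e2 ^+ 2).
    apply: (le_trans (amgm _)); rewrite lerD2l.
    have : 0 <= P / 2 * (e1 - e2) ^+ 2 by rewrite mulr_ge0 ?sqr_ge0 //; nng.
    by clear; lra.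
  have b3 := f0 (y1 - y2).
  move: gt; rewrite PhiE; move: h1 h2 h3 b3 nn3 nn4 tilt th3 r30; clear; lra.
have y12' : 0 < en (y1 - y2) <= 1.
  by rewrite y12 /=; have := en_triangle y1 (- y2); rewrite enN; move: y1r y2r; clear; lra.
have slS (x : V) : S x -> en x < 1 / 2 -> exists2 rr : R, 0 < rr &
    forall z, en z < rr -> 0 <= dot (x + z) n -> S (x + z).
  move=> _ xl; exists (1 / 2 - en x); first by rewrite subr_gt0.
  move=> z zr xz; split => //; rewrite subr0 (le_trans (en_triangle _ _)) //.
  by move: zr; clear; lra.

(* One-variable test functions and exclusion of the hyperplane *)
have Kr0 : 0 < K * r by pos.
have [d [c2 [Hf [jf d0 pfb c2K [HfU [e ee1 HfL]]]]]] := radial_penalty Kr0 y12'.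
pose Qx (a x : V) := P * sq (x - (a + h)) - 2 * th * dot n x.
pose Qy (b a y : V) := f (y - b) + P * sq (y - (a - h)) + r * La * sq (y - c) - 2 * th * dot n y.
have sqN (u : V) : sq (- u) = sq u by rewrite /sq dotNl dotNr opprK.
have sqx (u v : V) : sq (u - v - h) = sq (u - (v + h)) by rewrite opprD addrA.
have sqy (u v : V) : sq (u - v - h) = sq (v - (u - h)).
  by rewrite -sqN !opprB addrCA addrA.
have fC (u v : V) : f (u - v) = f (v - u) by rewrite -fN opprB.
have m1 x : S x -> 1 * w x - Qx y1 x <= 1 * w x1 - Qx y1 x1.
  move=> xS; have := mx ((x, y1), (x2, y2)) (conj (conj xS y1S) (conj x2S y2S)).
  by rewrite /Phi /T /T' /Qx /= !sqx !dotDr !mul1r; clear; lra.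
have m3 x : S x -> -1 * w x - Qx y2 x <= -1 * w x2 - Qx y2 x2.
  move=> xS; have := mx ((x1, y1), (x, y2)) (conj (conj x1S y1S) (conj xS y2S)).
  by rewrite /Phi /T /T' /Qx /= !sqx !dotDr !mulN1r; clear; lra.
have m2 x : S x -> -1 * w x - Qy y2 x1 x <= -1 * w y1 - Qy y2 x1 y1.
  move=> xS; have := mx ((x1, x), (x2, y2)) (conj (conj x1S xS) (conj x2S y2S)).
  rewrite /Phi /T /T' /Qy /= !sqy !dotDr !mulN1r; set v1 := f _; set v2 := f _.
  by clearbody v1 v2; clear; lra.
have m4 x : S x -> 1 * w x - Qy y1 x2 x <= 1 * w y2 - Qy y1 x2 y2.
  move=> xS; have := mx ((x1, y1), (x2, x)) (conj (conj x1S y1S) (conj x2S xS)).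
  rewrite /Phi /T /T' /Qy /= !sqy !dotDr !mul1r (fC y1 x) (fC y1 y2).
  by set v1 := f _; set v2 := f _; clearbody v1 v2; clear; lra.
pose px (a x : V) := P *: (2 *: (x - (a + h))) - (2 * th) *: n.
pose py (d : R) (b a y : V) := d *: (y - b) + P *: (2 *: (y - (a - h))) +
   (r * La) *: (2 *: (y - c)) - (2 * th) *: n.
have jx a x : exists H, jet (Qx a) x (px a x) H.
  by eexists; exact: (jetB (jetZ P (jet_sqdist (a + h) x)) (jetZ (2 * th) (jet_dot n x))).
have jy b a y' H' : jet f (y' - b) (d *: (y' - b)) H' -> exists H, jet (Qy b a) y' (py d b a y') H.
  move=> jf'; eexists; exact: (jetB (jetD (jetD (jet_shift jf') (jetZ P (jet_sqdist (a - h) y')))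
    (jetZ (r * La) (jet_sqdist c y'))) (jetZ (2 * th) (jet_dot n y'))).
have jf2 : jet f (y2 - y1) (d *: (y2 - y1)) Hf.
  have j := @jet_shift_opp _ _ f 0 (y2 - y1) _ _ (_ : jet f (0 - (y2 - y1)) _ _).
  rewrite sub0r opprB in j; have {}j := j _ _ jf.
  refine (jet_eq j _ _ erefl) => [u|]; first by rewrite sub0r fN.
  by rewrite -scalerN opprB.
have [Hx1 jx1] := jx y1 x1; have [Hx2 jx2] := jx y2 x2.
have [Hy1 jy1] := jy y2 x1 y1 _ jf; have [Hy2 jy2] := jy y1 x2 y2 _ jf2.
have [lw1 lw2 lw3] := lw.
have s0 (u : V) : S u -> 0 <= dot u n by case.
(* As [h] and the hyperplane directions are orthogonal to [n] and the other points lie in the half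
   space, every penalty has nonpositive slope along [n]; the tilt then contributes [- 2 th], beyond
   the Neumann bound [th]. *)
have slx (a x : V) : S a -> dot x n = 0 -> dot (px a x) n < - th.
  move=> /s0 sa x0; rewrite /px !dotE n1 hn x0.
  have : 0 <= P * dot a n by nng.
  by move: t0; clear; lra.
have sly (b a y' : V) : S b -> S a -> dot y' n = 0 -> dot (py d b a y') n < - th.
  move=> /s0 sb /s0 sa y'0; rewrite /py !dotE n1 hn y'0.
  have q1 : 0 <= P * dot a n by nng.
  have q2 : 0 <= d * dot b n by nng.
  have q3 : 0 <= r * La * dot c n by case: cb => _ ?; nng.
  by move: t0 q1 q2 q3; clear; lra.
have lt1 (u : V) : en u < 1 / 2 -> en (u - 0) < 1 by rewrite subr0; clear; lra.
have ipos (x : V) Q p H (s : R) : S x -> en x < 1 / 2 -> s = 1 \/ s = -1 -> jet Q x p H ->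
    (dot x n = 0 -> dot p n < - th) ->
    (forall y, S y -> s * w y - Q y <= s * w x - Q x) -> 0 < dot x n.
  move=> xS xl s1 jQ pn hm; rewrite lt_neqAle (s0 _ xS) andbT eq_sym; apply/eqP => x0.
  have [rr rr0 hr'] := slS _ xS xl.
  exact: (flat_side_excluded n1 rr0 hr' x0 (pn x0) s1 (lw3 _ (lt1 _ xl) x0) jQ hm).
have i1 := ipos _ _ _ _ 1 x1S x1r (or_introl erefl) jx1 (slx _ _ y1S) m1.
have i3 := ipos _ _ _ _ (-1) x2S x2r (or_intror erefl) jx2 (slx _ _ y2S) m3.
have i2 := ipos _ _ _ _ (-1) y1S y1r (or_intror erefl) jy1 (sly _ _ _ y2S x1S) m2.
have i4 := ipos _ _ _ _ 1 y2S y2r (or_introl erefl) jy2 (sly _ _ _ y1S x2S) m4.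

(* Interior maximum: gradients, Hessians and the contradiction *)
have rad (x : V) : en x < 1 / 2 -> 0 < dot x n -> exists2 rr : R, 0 < rr &
    forall z, en z < rr -> S (x + z).
  move=> xl xn; exists (Num.min (1 / 2 - en x) (dot x n)).
    by rewrite lt_min xn subr_gt0 xl.
  move=> z; rewrite lt_min => /andP[z1 z2]; split.
    by rewrite subr0 (le_trans (en_triangle _ _)) //; move: z1; clear; lra.
  rewrite dotDl; have := dot_le_en z n; rewrite (en_n n1) mulr1 ler_norml => /andP[h1 _].
  by move: h1 z2; clear; lra.
have [rr1' rr10 R1] := rad _ x1r i1; have [rr2 rr20 R2] := rad _ y1r i2.
have [rr3 rr30 R3] := rad _ x2r i3; have [rr4 rr40 R4] := rad _ y2r i4.
have [b1 b1t [p1 [X1 [j1 E1]]]] := lw2 _ (lt1 _ x1r) i1.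
have [b2 b2t [q1 [Y1 [j2 E2]]]] := lw2 _ (lt1 _ y1r) i2.
have [b3 b3t [p2 [X2 [j3 E3]]]] := lw2 _ (lt1 _ x2r) i3.
have [b4 b4t [q2 [Y2 [j4 E4]]]] := lw2 _ (lt1 _ y2r) i4.
have g1 : en p1 = en (px y1 x1).
  by apply: (max_grad rr10 (or_introl erefl) j1 jx1) => z /R1; exact: m1.
have g2 : en q1 = en (py d y2 x1 y1).
  by apply: (max_grad rr20 (or_intror erefl) j2 jy1) => z /R2; exact: m2.
have g3 : en p2 = en (px y2 x2).
  by apply: (max_grad rr30 (or_intror erefl) j3 jx2) => z /R3; exact: m3.
have g4 : en q2 = en (py d y1 x2 y2).
  by apply: (max_grad rr40 (or_introl erefl) j4 jy2) => z /R4; exact: m4.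
have enP (k : R) (u : V) : 0 <= k -> en u <= 1 / 8 -> en (k *: (2 *: u)) <= k.
  move=> k0 ul; rewrite scalerA enZ ger0_norm; last by nng.
  have : k * 2 * en u <= k * 2 * (1 / 8) by apply: ler_wpM2l => //; nng.
  by move: k0; clear; lra.
have enT : en ((2 * th) *: n) <= 2.
  by rewrite enZ (en_n n1) mulr1 ger0_norm; [move: th4; clear; lra | nng].
have gx (a x : V) : en (x - a - h) < 1 / 8 -> en (px a x) <= P + 2.
  move=> hx; rewrite /px (le_trans (en_triangle _ _)) // enN lerD //.
  by apply: enP; [exact: ltW | rewrite opprD addrA ltW].
have gy (b a y' : V) : en (d *: (y' - b)) <= 8 * c2 -> en (a - y' - h) < 1 / 8 ->
   en (y' - c) < 1 / 8 -> en (py d b a y') <= 8 * c2 + P + r * La + 2.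
  move=> h1 h2 h3; rewrite /py (le_trans (en_triangle _ _)) // enN lerD //.
  rewrite (le_trans (en_triangle _ _)) // lerD //; last first.
    by apply: enP; [nng | exact: ltW].
  rewrite (le_trans (en_triangle _ _)) // lerD //.
  apply: enP; [exact: ltW | apply: ltW]; rewrite -enN.
  by have -> : - (y' - (a - h)) = a - y' - h by apply/rowP => i; rewrite !mxE; ring.
have pfb2 : en (d *: (y2 - y1)) <= 8 * c2.
  by rewrite -enN -scalerN opprB.
have G1 := gx _ _ (_ : en (x1 - y1 - h) < 1 / 8); rewrite -e1E in G1; have {}G1 := G1 x1e.
have G3 := gx _ _ (_ : en (x2 - y2 - h) < 1 / 8); rewrite -e2E in G3; have {}G3 := G3 x2e.
have G2 := gy _ x1 _ pfb (_ : en (x1 - y1 - h) < 1 / 8) ye1; rewrite -e1E in G2; have {}G2 := G2 x1e.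
have G4 := gy _ x2 _ pfb2 (_ : en (x2 - y2 - h) < 1 / 8) ye2; rewrite -e2E in G4; have {}G4 := G4 x2e.
have rrm0 : 0 < Num.min (Num.min rr1' rr2) (Num.min rr3 rr4) by rewrite !lt_min rr10 rr20 rr30.
have sec := @four_point_second _ _ w f x1 y1 x2 y2 h c n P (r * La) (2 * th) _ p1 X1 q1 Y1 p2 X2
   q2 Y2 _ Hf rrm0 j1 j2 j3 j4 jf.
have {}sec : forall a b a' b', qf X1 a - qf Y1 b - qf X2 a' + qf Y2 b' <=
     qf Hf (b - b') + 2 * P * (dot (a - b) (a - b) + dot (a' - b') (a' - b')) +
     2 * (r * La) * (dot b b + dot b' b').
  apply: sec => /= z1 z2 z3 z4.
  rewrite !lt_min => /andP[/andP[h1 _] _] /andP[/andP[_ h2] _] /andP[_ /andP[h3 _]] /andP[_ /andP[_ h4]].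
  have := mx ((x1 + z1, y1 + z2), (x2 + z3, y2 + z4))
    (conj (conj (R1 _ h1) (R2 _ h2)) (conj (R3 _ h3) (R4 _ h4))).
  have sqE (u : V) : dot u u = sq u by [].
  rewrite /Phi /T /T' /= !(sqE (_ - _)) !dotDr.
  set v1 := f _; set v2 := f _; clearbody v1 v2.
  by clear; lra.
have hA4 A' : A' \in [:: A x1; A y1; A x2; A y2] -> A'^T = A' /\
    forall z, `|qf A' z - qf A0 z| <= th * dot z z.
  have hAx (x : V) : S x -> (A x)^T = A x /\ forall z, `|qf (A x) z - qf A0 z| <= th * dot z z.
    by move=> /S1 /hA0 [_ hx]; split => //; case: hAB => /(_ x) [[]].
  by rewrite !inE => /or4P[] /eqP ->; exact: hAx.
have Psi0 : qf Hf 0 <= 0 by have := HfU 0; rewrite dot0l mulr0.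
have c20 : 0 < c2 by apply: lt_le_trans c2K; apply: mulr_gt0 => //; pos.
have tr := four_point_trace lam0 t0 th1' ee1 eA0 hA4 _ _ _ sec Psi0 HfU HfL.
have {}tr := tr (_ : 0 <= 2 * P) (_ : 0 <= 2 * (r * La)) (_ : 0 <= 8 * c2).
have {}tr : tr2 (A x1) X1 - tr2 (A y1) Y1 - tr2 (A x2) X2 + tr2 (A y2) Y2 <=
     2 * (2 * (r * La)) * (D%:R * Lam) - lam * c2 + lam * (2 * (r * La)) / 2 +
     12 * (2 * P) * th * D%:R + 6 * (8 * c2 + 2 * (r * La)) * th * D%:R.
  by apply: tr; nng.
have Bp (x p : V) : S x -> `|dot (B x) p| <= th * en p.
  move=> /S1 /hA0 [hx _]; apply: (le_trans (dot_le_en _ _)).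
  by rewrite ler_wpM2r ?en_ge0.
have trN : - (tr2 (A x1) X1 - tr2 (A y1) Y1 - tr2 (A x2) X2 + tr2 (A y2) Y2) <=
    4 * th + th * (en p1 + en q1 + en p2 + en q2).
  move: (Bp _ p1 x1S) (Bp _ q1 y1S) (Bp _ p2 x2S) (Bp _ q2 y2S) b1t b2t b3t b4t.
  rewrite -E1 -E2 -E3 -E4 !ler_norml.
  clear => /andP[? ?] /andP[? ?] /andP[? ?] /andP[? ?] /andP[? ?] /andP[? ?] /andP[? ?] /andP[? ?].
  by lra.
have gsum : en p1 + en q1 + en p2 + en q2 <= 4 * P + 16 * c2 + 4 * (r * La) + 8.
  rewrite g1 g2 g3 g4; have : 0 <= r * La by nng.
  by move: G1 G2 G3 G4 P0; clear; lra.
have := four_point_numeric lam0 Lam0 r0 t0 (ltW La0) (ltW P0) Dr0 th4 c20 c2K tr trN gsum th1 th2.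
by rewrite leNgt KE'.
Qed.
End FourPointMain.

Section Flatness.
Context {R : realType} {D : nat}.
Set Implicit Arguments. Unset Strict Implicit.
Local Notation V := 'rV[R]_D.
Implicit Types (w v : V -> R) (x y z p : V).

(* Stability of the Cauchy equation (Hyers-Ulam) on an interval. *)
Lemma hyers_interval (phi : R -> R) (r e M : R) : 0 < r -> 0 < e ->
  (forall t, 0 <= t <= r -> `|phi t| <= M) ->
  (forall s t, 0 <= s -> 0 <= t -> s + t <= r -> `|phi (s + t) - phi s - phi t| <= e) ->
  forall t, 0 <= t <= r -> `|phi t - t / r * phi r| <= 4 * e.
Proof.
move=> r0 e0 hM hadd.
pose g t := phi t - t / r * phi r.
have gadd s t : 0 <= s -> 0 <= t -> s + t <= r -> `|g (s + t) - g s - g t| <= e.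
  move=> s0 t0 st; apply: le_trans (hadd s t s0 t0 st).
  by rewrite le_eqVlt; apply/orP; left; apply/eqP; congr (`| _ |); rewrite /g; ring.
have gr : g r = 0 by rewrite /g divff ?gt_eqF // mul1r subrr.
(* A bound [b] for [g] improves to [e / 2 + b / 2] on the lower half of the interval, and to
   [3 e / 2 + b / 2] on the upper half, which is reflected by means of [g r = 0]; the fixed point is
   [3 e]. *)
have bound (k : nat) : forall t, 0 <= t <= r -> `|g t| <= 3 * e + 2 * M / 2 ^+ k.
  elim: k => [|k IH] t /andP[t0 tr].
    rewrite expr0 divr1; have h1 := hM t; rewrite t0 tr in h1; have {}h1 := h1 isT.
    have h2 := hM r; rewrite (ltW r0) lexx in h2; have {}h2 := h2 isT.
    have h3 : `|t / r * phi r| <= M.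
      rewrite normrM; apply: le_trans h2; rewrite ler_piMl // ger0_norm ?divr_ge0 ?(ltW r0) //.
      by rewrite ler_pdivrMr // mul1r.
    by have := ler_normB (phi t) (t / r * phi r); rewrite -/(g t); move: h1 h3 e0; clear; lra.
  have half u : 0 <= u -> u + u <= r -> `|g u| <= e / 2 + (3 * e + 2 * M / 2 ^+ k) / 2.
    move=> u0 ur; have h1 := gadd u u u0 u0 ur.
    have h2 := IH (u + u); rewrite addr_ge0 // ur in h2; have {}h2 := h2 isT.
    by move: h1 h2; rewrite !ler_norml => /andP[? ?] /andP[? ?]; apply/andP; split; lra.
  have E : 2 * M / 2 ^+ k.+1 = 2 * M / 2 ^+ k / 2.
    by rewrite exprSr; field; rewrite gt_eqF // exprn_gt0.
  rewrite E; have [tt|tt] := leP (t + t) r.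
    by have := half t t0 tt; move: e0; clear; lra.
  have h1 := gadd t (r - t) t0; rewrite subr_ge0 subrKC lexx gr in h1.
  have {}h1 := h1 tr isT; have h2 := half (r - t).
  rewrite subr_ge0 in h2; have {}h2 := h2 tr (_ : _).
  have {}h2 : `|g (r - t)| <= e / 2 + (3 * e + 2 * M / 2 ^+ k) / 2.
    by apply: h2; move: tt; clear; lra.
  by move: h1 h2; rewrite !ler_norml => /andP[? ?] /andP[? ?]; apply/andP; split; lra.
move=> t ht; have M0 : 0 <= M by apply: le_trans (hM t ht).
have [k hk] : exists k : nat, 2 * M / 2 ^+ k <= e.
  exists (Num.bound (2 * M / e)); rewrite ler_pdivrMr ?exprn_gt0 //.
  rewrite [X in _ <= X]mulrC -ler_pdivrMr //; apply: (@le_trans _ _ (Num.bound (2 * M / e))%:R).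
    by apply: ltW; apply: archi_boundP; nng.
  by rewrite -natrX ler_nat ltnW // ltn_expl.
by have := bound k t ht; rewrite -/(g t); move: hk; clear; lra.
Qed.

(** Cauchy stability is applied along the projections [tau i] of the coordinate vectors onto the
    hyperplane. A tangential vector is the combination of the [tau i] with its own coordinates, and
    almost additivity is then used once per coordinate. *)
Lemma tangential_linear (n : V) (f : V -> R) (r e M : R) : dot n n = 1 -> 0 < r -> 0 < e ->
  (forall h, dot h n = 0 -> en h <= r -> `|f h| <= M) ->
  (forall h h', dot h n = 0 -> dot h' n = 0 -> en h <= r -> en h' <= r ->
     `|f (h + h') - f h - f h'| <= e) ->
  exists2 p : V, dot p n = 0 /\ en p <= 2 * (D%:R * (M / r)) &
    forall x, dot x n = 0 -> (D%:R + 1) * en x <= r ->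
      `|f x - dot p x| <= (7 * D%:R + 1) * e.
Proof.
move=> n1 r0 e0 hM hadd.
pose tau (i : 'I_D) : V := evec R i - n 0 i *: n.
have taun i : dot (tau i) n = 0.
  by rewrite dotDl dotNl dotZl n1 mulr1 dotC dot_evec subrr.
have taul i : en (tau i) <= 1.
  rewrite en_le // expr1n /tau !dotE n1 evec_unit (dotC (evec R i)) dot_evec.
  by have := sqr_ge0 (n 0 i); clear; nra.
have M0 : 0 <= M by apply: le_trans (hM 0 (dot0l _) _) => //; rewrite en0 ltW.
have f0 : `|f 0| <= e.
  have := hadd 0 0 (dot0l _) (dot0l _); rewrite en0 addr0 => /(_ (ltW r0) (ltW r0)).
  by rewrite subrr sub0r normrN.
have tn i (t : R) : dot (t *: tau i) n = 0 by rewrite dotZl taun mulr0.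
have tl i (t : R) : `|t| <= r -> en (t *: tau i) <= r.
  by move=> tr; rewrite enZ; apply: le_trans tr; rewrite ler_piMr.
have pos1 i (t : R) : 0 <= t <= r -> `|f (t *: tau i) - t / r * f (r *: tau i)| <= 4 * e.
  apply: (@hyers_interval (fun t => f (t *: tau i)) r e M) => //.
    by move=> s /andP[s0 sr]; apply: hM; [exact: tn | apply: tl; rewrite ger0_norm].
  move=> s s' s0 s'0 ss; rewrite scalerDl; apply: hadd; rewrite ?tn //; apply: tl;
    rewrite ger0_norm //; move: s0 s'0 ss; clear; lra.
have lin1 i (t : R) : `|t| <= r -> `|f (t *: tau i) - t / r * f (r *: tau i)| <= 6 * e.
  move=> tr; have [t0|t0] := leP 0 t.
    rewrite ger0_norm // in tr; have := pos1 i t; rewrite t0 tr => /(_ isT).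
    by move: e0; clear; lra.
  rewrite ltr0_norm // in tr; have := pos1 i (- t); rewrite oppr_ge0 (ltW t0) tr => /(_ isT).
  have := hadd (t *: tau i) (- t *: tau i) (tn _ _) (tn _ _) (tl _ _ _) (tl _ _ _).
  rewrite normrN ltr0_norm // => /(_ tr tr); rewrite scaleNr subrr.
  rewrite !mulNr; move: f0; rewrite !ler_norml => /andP[? ?] /andP[? ?] /andP[? ?].
  by apply/andP; split; lra.
pose c i := f (r *: tau i) / r.
pose p' : V := \row_i c i.
have cl i : `|c i| <= M / r.
  rewrite /c normrM normfV (gtr0_norm r0) ler_pM2r ?invr_gt0 //.
  by apply: hM; [exact: tn | apply: tl; rewrite gtr0_norm].
have p'l : en p' <= D%:R * (M / r).
  have -> : p' = \sum_(i < D) c i *: evec R i.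
    by rewrite [LHS]rV_sum_evec; apply: eq_bigr => i _; rewrite mxE.
  apply: (@le_trans _ _ (\sum_(i < D) M / r)); last first.
    by rewrite sumr_const card_ord mulr_natl.
  elim/big_rec2: _ => [|i y x _ h]; first by rewrite en0.
  rewrite (le_trans (en_triangle _ _)) // lerD // enZ.
  by rewrite [en (evec R i)](_ : _ = 1) ?mulr1 // /en evec_unit sqrtr1.
exists (p' - dot p' n *: n); first split.
- by rewrite dotDl dotNl dotZl n1 mulr1 subrr.
- rewrite (le_trans (en_triangle _ _)) // enN enZ (en_n n1) mulr1.
  have := dot_le_en p' n; rewrite (en_n n1) mulr1; move: p'l; clear; lra.
move=> x xn xr.
have pE : dot (p' - dot p' n *: n) x = \sum_(i <- index_enum 'I_D) x 0 i * c i.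
  rewrite dotDl dotNl dotZl (dotC n x) xn mulr0 subr0 dotC.
  by apply: eq_bigr => i _; rewrite mxE.
have xE : x = \sum_(i <- index_enum 'I_D) x 0 i *: tau i.
  rewrite /tau; under eq_bigr do rewrite scalerBr scalerA.
  rewrite sumrB -scaler_suml -rV_sum_evec.
  by rewrite [X in X *: n](_ : _ = dot x n) ?xn ?scale0r ?subr0.
have sz : (size (index_enum 'I_D) <= D)%N by rewrite [index_enum _]unlock -enumT size_enum_ord.
rewrite pE {1}xE.
suff gen (s : seq 'I_D) : (size s <= D)%N ->
    `|f (\sum_(i <- s) x 0 i *: tau i) - \sum_(i <- s) x 0 i * c i| <= (7 * (size s)%:R + 1) * e.
  apply: (le_trans (gen _ sz)); rewrite ler_pM2r // lerD2r ler_pM2l // ler_nat //.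
have D1 : 0 < D%:R + 1 :> R by rewrite ltr_wpDl.
have xr' : en x <= r by apply: le_trans xr; rewrite ler_peMl ?en_ge0 // lerDr.
have xi i : `|x 0 i| <= en x by exact: coord_le_en.
have tan l : dot (\sum_(i <- l) x 0 i *: tau i) n = 0.
  elim/big_rec: _ => [|i y _ h]; first by rewrite dot0l.
  by rewrite dotDl tn h addr0.
have nrm l : en (\sum_(i <- l) x 0 i *: tau i) <= (size l)%:R * en x.
  elim: l => [|i l IH]; first by rewrite big_nil en0 mul0r.
  rewrite big_cons (le_trans (en_triangle _ _)) //= -natr1 mulrDl mul1r addrC lerD //.
  by rewrite enZ; apply: (le_trans (ler_piMr _ (taul i))).
elim: s => [|i s IH] ss; first by rewrite !big_nil subr0 mulr0 add0r mul1r.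
rewrite !big_cons.
have h1 := hadd (x 0 i *: tau i) (\sum_(i <- s) x 0 i *: tau i) (tn _ _) (tan _) (tl _ _ _) _.
have {}h1 := h1 (le_trans (xi i) xr') (_ : _).
have {}h1 : `|f (x 0 i *: tau i + \sum_(i <- s) x 0 i *: tau i) - f (x 0 i *: tau i) -
    f (\sum_(i <- s) x 0 i *: tau i)| <= e.
  apply: h1; apply: (le_trans (nrm s)); apply: le_trans xr.
  rewrite ler_wpM2r ?en_ge0 // ler_wpDr // ler_nat; exact: ltnW.
have h2 := lin1 i _ (le_trans (xi i) xr'); have h3 := IH (ltnW ss).
have -> : x 0 i * c i = x 0 i / r * f (r *: tau i) by rewrite /c; field; rewrite gt_eqF.
rewrite /= -natr1; move: h1 h2 h3; set F1 := f (_ + _); set F2 := f (_ *: _); set F3 := f (\sum_(i <- s) _).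
set F4 := f (r *: _); set sg := \sum_(i <- s) _.
rewrite !ler_norml => /andP[? ?] /andP[? ?] /andP[? ?].
by apply/andP; split; lra.
Qed.
End Flatness.

Section NormalBound.
Context {R : realType} {D : nat}.
Set Implicit Arguments. Unset Strict Implicit.
Local Notation V := 'rV[R]_D.
Implicit Types (w v : V -> R) (x y z p : V).

Lemma jet_sq_dot (n x : V) :
  jet (fun x => dot n x ^+ 2) x ((2 * dot n x) *: n) (2 *: (n^T *m n)).
Proof.
by refine (jet_eq (jet_comp (jet_dot n x) (peano_sqr (dot n x))) _ _ _);
  rewrite ?scaler0 ?add0r.
Qed.

(** If [a] has the value [H] at [s2 n], compare it with a barrier of slope [H / (4 s2)] in the
    cylinder below. When this slope exceeds [th] the maximum of barrier minus [a] is not on the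
    hyperplane; it is not interior since [L Q > F], nor on the lateral side because of [ka]. At the
    top the barrier is worth only about [H / 2], which bounds [H]. *)
Lemma normal_bound (n : V) (lam Lam th rho F tau : R) A B (a : V -> R) :
  dot n n = 1 -> 0 < lam -> 0 <= Lam -> 0 < th -> th <= lam / 2 -> th <= 1 / 4 ->
  0 < rho <= 1 -> 0 <= F -> 0 < tau ->
  (forall x, hball n 0 1 x -> elliptic lam Lam (A x) /\ en (B x) <= th) ->
  lsol n A B a 0 rho F th -> a 0 = 0 ->
  (forall x, hball n 0 rho x -> `|a x - a (dot x n *: n)| <= tau) ->
  forall s : R, 0 <= s <= rho / 2 ->
    a (s *: n) <= 4 * th + 2 * tau + (F + 8 * (2 * D%:R * Lam + 3) * tau) / lam.
Proof.
move=> n1 lam0 Lam0 th0 thl th4 /andP[rho0 rho1] F0 tau0 hAB [ca La na] a0 ha s2 /andP[].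
rewrite le_eqVlt => /orP[/eqP <- _|s20 s2r]; first by rewrite scale0r a0; nng.
(* [mu] offsets the drift acting on the slope, [ka] lowers the barrier by [2 tau] on the lateral
   side, and [La'] compensates the right-hand side and the curvature introduced by [ka]. *)
have [mu [mu0 muE]] : exists mu, 0 < mu /\ mu * lam = th.
  by exists (th / lam); split; [pos | rewrite divfK // gt_eqF].
have [ka [ka0 kaE]] : exists ka, 0 < ka /\ ka * rho ^+ 2 = 8 * tau.
  by exists (8 * tau / rho ^+ 2); split; [pos | rewrite divfK // gt_eqF // exprn_gt0].
have [La' [La'0 La'E]] : exists La', 0 < La' /\ La' * lam = F + ka * (2 * D%:R * Lam + 3).
  exists ((F + ka * (2 * D%:R * Lam + 3)) / lam); split; last by rewrite divfK // gt_eqF.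
  by apply: divr_gt0 => //; apply: ltr_wpDl => //; apply: mulr_gt0 => //; apply: ltr_wpDl; nng; pos.
have [H HE] : exists H, H = a (s2 *: n) by eexists.
have [sg sgE] : exists sg, sg = H / (4 * s2) by eexists.
have Hsg : H = 4 * sg * s2 by rewrite sgE; field; rewrite gt_eqF.
have s2h : s2 <= 1 / 2 by move: s2r rho1; clear; lra.
rewrite -HE; have [sgt|sgt] := leP sg th.
  have h1 : sg * s2 <= th * s2 by rewrite ler_pM2r.
  have h2 : th * s2 <= th by rewrite ler_piMr ?(ltW th0) //; move: s2h; clear; lra.
  have h3 : 0 <= 2 * tau + (F + 8 * (2 * D%:R * Lam + 3) * tau) / lam by nng.
  by rewrite Hsg -addrA; move: h1 h2 h3; clear; lra.
have sg0 : 0 < sg by apply: lt_trans sgt.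
pose Q x := sg * (dot n x + mu * dot n x ^+ 2) - ka * (dot (x - 0) (x - 0) - dot n x ^+ 2)
  + La' * dot n x ^+ 2.
pose S := hball n 0 rho `&` [set x | dot n x <= s2] `&`
  [set x | dot (x - 0) (x - 0) - dot n x ^+ 2 <= (rho / 2) ^+ 2].
have csq : continuous (fun x => dot n x ^+ 2).
  by apply: (@comp_continuous _ _ _ (dot n) (fun t => t ^+ 2)); [exact: dot_continuous | exact: exprn_continuous].
have cc : continuous (fun y : V => dot (y - 0) (y - 0) - dot n y ^+ 2).
  move=> y; apply: (@continuousB _ _ _ (fun y => dot (y - 0) (y - 0)) (fun y => dot n y ^+ 2)).
    exact: sqdist_continuous.
  exact: csq.
have cS : compact S.
  apply: (@compact_closed_en _ _ _ 0 rho) => [|x [[[]]]] //.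
  apply: closedI; first apply: closedI; first exact: hball_closed.
    by apply: closed_le_ctn; [exact: dot_continuous | exact: cst_continuous].
  apply: closed_le_ctn; last exact: cst_continuous.
  exact: cc.
have jQ x : jet Q x (sg *: (n + mu *: ((2 * dot n x) *: n)) -
     ka *: (2 *: (x - 0) - (2 * dot n x) *: n) + La' *: ((2 * dot n x) *: n))
   (sg *: (0 + mu *: (2 *: (n^T *m n))) - ka *: (2 *: 1%:M - 2 *: (n^T *m n)) +
     La' *: (2 *: (n^T *m n))).
  exact: (jetD (jetB (jetZ sg (jetD (jet_dot n x) (jetZ mu (jet_sq_dot n x))))
    (jetZ ka (jetB (jet_sqdist 0 x) (jet_sq_dot n x)))) (jetZ La' (jet_sq_dot n x))).
have cQ : continuous Q.
  by apply: continuous_eps => x e e0; have [dl dl0 h] := jet_eps (jQ x) e0; exists dl.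
have cW : ctn S (fun x => Q x - a x).
  apply: ctnB; first exact: ctn_continuous.
  by apply: (@ctn_sub _ _ _ (hball n 0 rho)) => // x [[]].
have S0 : S 0.
  split; first split.
  - by split; rewrite ?subrr ?en0 ?dot0l // ltW.
  - by rewrite /= dot0r ltW.
  - by rewrite /= subrr dot0l dot0r expr0n subr0 exprn_ge0 //; nng.
have [x [[[xr xs] /= xs2] /= xt] mx] := ctn_max cS (ex_intro _ 0 S0) cW.
have mx0 : 0 <= Q x - a x.
  have Q0 : Q 0 = 0 by rewrite /Q subrr dot0l dot0r expr0n /= !(mulr0, addr0, subr0).
  by have := mx 0 S0; rewrite Q0 a0 subrr.
set s := dot n x in xs2 xt; have sE : dot n x = s by [].
have s0 : 0 <= s by rewrite /s dotC.
have xb : hball n 0 rho x by split.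
have hax := ha x xb; rewrite (dotC x n) sE in hax.
have qt : 0 <= dot (x - 0) (x - 0) - s ^+ 2.
  by rewrite subr_ge0 /s subr0 (le_trans (dot_CS _ _)) // n1 mul1r.
have QE : Q x = sg * (s + mu * s ^+ 2) - ka * (dot (x - 0) (x - 0) - s ^+ 2) + La' * s ^+ 2 by [].
clearbody s.
have mus : mu <= 1 / 2.
  have : mu * lam <= 1 / 2 * lam by rewrite muE; move: thl; clear; lra.
  by rewrite ler_pM2r.
have La'r : La' * s2 ^+ 2 <= (F + 8 * (2 * D%:R * Lam + 3) * tau) / (4 * lam).
  have h1 : La' * s2 ^+ 2 <= La' * (rho / 2) ^+ 2.
    by rewrite ler_pM2l // lerXn2r ?nnegrE //; nng.
  apply: (le_trans h1).
  have -> : La' * (rho / 2) ^+ 2 = (La' * lam) * rho ^+ 2 / (4 * lam) by field; rewrite gt_eqF.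
  rewrite La'E mulrDl (mulrAC ka) kaE ler_pM2r ?invr_gt0; last by pos.
  have : F * rho ^+ 2 <= F by rewrite ler_piMr // exprn_ile1 // ltW.
  by clear; lra.
have big : F / (4 * lam) <= F / lam by rewrite ler_wpM2l // lef_pV2 ?posrE; [rewrite ler_peMl //; [nng | lra] | pos | pos].
have bigq : (F + 8 * (2 * D%:R * Lam + 3) * tau) / (4 * lam) = (F + 8 * (2 * D%:R * Lam + 3) * tau) / lam / 4.
  by field; rewrite gt_eqF.
have bigq0 : 0 <= (F + 8 * (2 * D%:R * Lam + 3) * tau) / lam by nng.
have [stop|stop] := eqVneq s s2.
  move: mx0 hax; rewrite QE stop -HE ler_norml => h1 /andP[h2 _].
  have h3 : mu * s2 ^+ 2 <= s2.
    have : mu * s2 ^+ 2 <= 1 / 2 * s2 ^+ 2 by rewrite ler_pM2r // exprn_gt0.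
    have : s2 ^+ 2 <= s2 by rewrite expr2 ler_piMl ?(ltW s20) //; move: s2h; clear; lra.
    by move: s20; clear; lra.
  have h4 : sg * (s2 + mu * s2 ^+ 2) <= sg * (s2 + s2) by rewrite ler_pM2l // lerD2l.
  have h5 : 0 <= ka * (dot (x - 0) (x - 0) - s2 ^+ 2) by rewrite -stop mulr_ge0 // ltW.
  move: La'r; rewrite bigq Hsg; rewrite Hsg in h2; move: h1 h2 h4 h5 th0 bigq0 tau0; clear; lra.
have ss2 : s < s2 by rewrite lt_neqAle stop xs2.
have [xside|xside] := eqVneq (dot (x - 0) (x - 0) - s ^+ 2) ((rho / 2) ^+ 2).
  have Ssn : S (s *: n).
    split; first split; first split.
    - rewrite subr0 enZ (en_n n1) mulr1 ger0_norm //; move: xs2 s2r rho0; clear; lra.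
    - by rewrite dotZl n1 mulr1.
    - by rewrite /= dotZr n1 mulr1.
    - by rewrite /= subr0 !dotZl !dotZr n1 !mulr1 -expr2 subrr exprn_ge0 //; nng.
  have := mx _ Ssn; rewrite QE xside /Q subr0 !dotZl !dotZr n1 !mulr1 -expr2 subrr mulr0 subr0.
  move: hax; rewrite ler_norml => /andP[h1 _] h2.
  have h3 : ka * (rho / 2) ^+ 2 = 2 * tau.
    by have -> : ka * (rho / 2) ^+ 2 = (ka * rho ^+ 2) / 4 by [field]; rewrite kaE; field.
  by move: h1 h2 tau0; rewrite h3; clear; lra.
have xlt : dot (x - 0) (x - 0) - s ^+ 2 < (rho / 2) ^+ 2 by rewrite lt_neqAle xside xt.
have xin : en x < rho.
  rewrite en_lt; last exact: ltW.
  have h1 : s ^+ 2 <= (rho / 2) ^+ 2 by rewrite lerXn2r ?nnegrE //; [nng | exact: le_trans s2r].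
  have h2 : 0 < rho ^+ 2 by pos.
  by move: xlt h1 h2; rewrite subr0 !expr_div_n; clear; lra.
have [rr rr0 hr] : exists2 rr : R, 0 < rr & forall z, en z < rr -> 0 <= dot (x + z) n -> S (x + z).
  have e0 : 0 < ((rho / 2) ^+ 2 - (dot (x - 0) (x - 0) - s ^+ 2)) / 1.
    by rewrite divr1 subr_gt0.
  have [dl dl0 hd] := (ctn_eps setT _).1 (@ctn_continuous _ _ setT _ cc) x I _ e0.
  exists (Num.min dl (Num.min (rho - en x) (s2 - s))); first by rewrite !lt_min dl0 !subr_gt0 xin.
  move=> z; rewrite !lt_min => /andP[z1 /andP[z2 z3]] zn; split; first split; first split => //.
  - by rewrite subr0 (le_trans (en_triangle _ _)) //; move: z2; clear; lra.
  - rewrite /= dotDr sE; have := dot_le_en n z; rewrite (en_n n1) mul1r ler_norml => /andP[_].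
    by move: z3; clear; lra.
  have := hd (x + z) I; rewrite addrAC subrr add0r => /(_ z1); rewrite ler_norml sE => /andP[_] /=.
  by clear; lra.
have [sz|sz] := eqVneq s 0.
  have xn : dot x n = 0 by rewrite dotC sE.
  exfalso; apply: (@flat_side_excluded _ _ n a (fun x => -1 * Q x) x _ _ th (-1) S rr n1 rr0 hr xn
     _ (or_intror erefl) (na _ _ xn) (jetZ (-1) (jQ x))).
  - rewrite sE sz !mulr0 !scale0r scaler0 addr0 subr0 scaler0 addr0 scaleN1r dotNl dotDl dotNl !dotZl.
    by rewrite subr0 n1 xn !mulr0 subr0 mulr1 ltrN2.
  - by rewrite subr0.
  - by move=> y /mx; clear; lra.
have spos : 0 < s by rewrite lt_neqAle eq_sym sz.
have xn : 0 < dot x n by rewrite dotC sE.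
have [b bF [p [Ha [ja Ea]]]] : exists2 b, `|b| <= F & genL A B a x b.
  by apply: La => //; rewrite subr0.
have [eA Bx] := hAB x (conj (le_trans xr rho1) xs).
have rr1 : 0 < Num.min rr s by rewrite lt_min rr0.
have := genL_max lam0 eA rr1 _ (ex_intro _ _ (ex_intro _ _ (conj (jetB (jQ x) ja) erefl))).
have hmax z : en z < Num.min rr s -> Q (x + z) - a (x + z) <= Q x - a x.
  rewrite lt_min => /andP[z1 z2]; apply: mx; apply: hr => //; rewrite dotC dotDr sE.
  have := dot_le_en n z; rewrite (en_n n1) mul1r ler_norml => /andP[h _].
  by move: h z2; clear; lra.
move=> /(_ B hmax); rewrite sE !(dotDr, dotNr, dotZr, tr2Dr, tr2Nr, tr2Zr, tr20r).
rewrite !(subr0, dot0r, oppr0, addr0) (tr2C (A x) (n^T *m n)) tr2_outer.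
have trA : tr2 (A x) 1%:M <= D%:R * Lam.
  by apply: tr2_1r_le => z; case: eA => _ /(_ z) /andP[].
have qn : lam <= qf (A x) n by case: eA => _ /(_ n); rewrite n1 mulr1 => /andP[].
have Bn : `|dot (B x) n| <= th.
  by rewrite (le_trans (dot_le_en _ _)) // (en_n n1) mulr1.
have Bxx : `|dot (B x) x| <= th.
  rewrite (le_trans (dot_le_en _ _)) // -[th]mulr1; apply: ler_pM; rewrite ?en_ge0 //.
  by apply: le_trans rho1; exact: ltW.
move: Ea bF; set tH := tr2 _ Ha; set dp := dot _ p; set q := qf _ _ in qn *.
set T := tr2 _ _ in trA *; set bn := dot _ n in Bn *; set bx := dot _ x in Bxx *.
move=> Ea; rewrite ler_norml => /andP[_ bF] hle.
have s1 : s <= 1 / 2 by apply: le_trans s2h.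
move: Bn Bxx; rewrite !ler_norml => /andP[bn1 bn2] /andP[bx1 bx2].
have sbn : - th <= s * bn by move: bn1 s0 s1 th0; clear; nra.
have i1 : 0 <= sg * (bn + mu * (2 * q) + mu * (2 * s * bn)).
  rewrite mulr_ge0 ?(ltW sg0) //.
  have : mu * (lam - 2 * th + lam) <= mu * (2 * q + 2 * (s * bn)).
    by rewrite ler_pM2l //; move: qn sbn; clear; lra.
  have : 0 <= mu * (lam - 2 * th) by rewrite mulr_ge0 ?(ltW mu0) //; move: thl; clear; lra.
  by move: muE bn1; clear; lra.
have i2 : ka * (2 * T - 2 * q + (2 * bx - 2 * s * bn)) <= ka * (2 * D%:R * Lam + 1).
  rewrite ler_pM2l //; move: trA qn lam0 bx2 sbn th4; clear; lra.
have i3 : La' * lam <= La' * (2 * q + 2 * s * bn).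
  by rewrite ler_pM2l //; move: qn sbn thl; clear; lra.
move: hle i1 i2 i3 bF Ea ka0; rewrite La'E.
clear; lra.
Qed.
End NormalBound.

Section FlatStep.
Context {R : realType} {D : nat}.
Set Implicit Arguments. Unset Strict Implicit.
Local Notation V := 'rV[R]_D.
Implicit Types (w v : V -> R) (x y z p : V).

Lemma powR_78 (m Q : R) : 1 <= m -> 0 < Q -> (m * Q ^+ 8) `^ (7 / 8) <= m * Q ^+ 7.
Proof.
move=> m1 Q0; have m0 : 0 < m by apply: lt_le_trans m1.
rewrite powRM ?exprn_ge0 ?(ltW m0) ?(ltW Q0) // -powR_mulrn ?(ltW Q0) // -powRrM.
rewrite mulrCA divff ?mulr1 ?pnatr_eq0 // powR_mulrn ?(ltW Q0) //.
by apply: ler_wpM2r; [nng | apply: ler1_powR => //; lra].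
Qed.

Lemma affine_part (n p : V) A B w (c rho th Cp : R) : dot p n = 0 -> en p <= Cp -> 0 < th ->
  rho <= 1 -> (forall x, hball n 0 1 x -> en (B x) <= th) ->
  lsol n A B w 0 1 th th -> lsol n A B (fun x => w x - c - dot p x) 0 rho (th * (1 + Cp)) th.
Proof.
move=> pn pC th0 rho1 hB lw.
have [cw Lw nw] : lsol n A B w 0 rho th th by apply: lsol_sub lw; rewrite subrr en0 add0r.
split=> [|x xr xn|x xr xn e e0].
- apply: ctnB; first by apply: ctnB => //; exact: ctn_cst.
  by apply: ctn_continuous; exact: dot_continuous.
- have [b bt [q [H [j E]]]] := Lw x xr xn.
  exists (b - dot (B x) p).
    rewrite (le_trans (ler_normB _ _)) // mulrDr mulr1 lerD // (le_trans (dot_le_en _ _)) //.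
    apply: ler_pM; rewrite ?en_ge0 //; apply: hB; split; last exact: ltW.
    by apply: (le_trans (ltW xr)).
  exists (q - 0 - p), (H - 0 - 0); split.
    exact: (jetB (jetB j (jet_cst c x)) (jet_dot p x)).
  by rewrite !subr0 dotDr dotNr -E addrA.
have [dl dl0 h] := nw x xr xn e e0; exists dl => // t /h.
have -> // : w (x + t *: n) - c - dot p (x + t *: n) - (w x - c - dot p x) =
    w (x + t *: n) - w x by rewrite dotDr dotZr pn; ring.
Qed.

(** Improvement of flatness from radius 1 to [Q ^ 8], with error [(Q ^ 8) ^ (7 / 4)], that is
    gradient exponent [3 / 4]. [four_point] makes increments almost additive, hence tangentially
    linear, and [normal_bound] controls the normal direction; the errors add up to a constant times
    [Q ^ 15], and the spare factor [Q] absorbs the constant. The approximating slope is tangential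
    because the normal derivative is small. *)
Lemma flat_step (n : V) (lam Lam CB CA gam : R) :
  dot n n = 1 -> 0 < lam -> 0 <= Lam -> 0 <= CB -> 0 < CA -> 0 < gam < 1 ->
  exists Q th Cp : R, [/\ 0 < Q <= 1 / 2, 0 < th <= 1, 0 < Cp & forall A B w (A0 : 'M[R]_D),
    hcoefs lam Lam CB CA gam A B -> elliptic lam Lam A0 ->
    (forall x, hball n 0 1 x -> en (B x) <= th /\
       forall z, `|qf (A x) z - qf A0 z| <= th * dot z z) ->
    lsol n A B w 0 1 th th -> (forall x, hball n 0 1 x -> `|w x| <= 1) ->
    exists2 p : V, dot p n = 0 /\ en p <= Cp &
      forall x, hball n 0 (Q ^+ 8) x -> `|w x - w 0 - dot p x| <= Q ^+ 14].
Proof.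
move=> n1 lam0 Lam0 CB0 CA0 g01.
have [K [r1 [K0 r10 r18 hfp]]] := four_point n1 lam0 Lam0 CB0 CA0 g01.
have Dn0 : 0 <= D%:R :> R by [].
(* With [r = m Q ^ 8] the linear approximation, valid for [(D + 1) |x| <= r], covers radius
   [2 Q ^ 8], twice the final radius as [normal_bound] reaches only half of its height. *)
have [m [m2 mE]] : exists m : R, 2 <= m /\ m = 2 * (D%:R + 1).
  by exists (2 * (D%:R + 1)); split => //; move: Dn0; clear; lra.
have m0 : 0 < m by apply: lt_le_trans m2.
have [Ce [Ce0 CeE]] : exists Ce, 0 < Ce /\ Ce = K * m * (m + m ^+ 2).
  by exists (K * m * (m + m ^+ 2)); split => //; pos.
have [C7 [C70 C7E]] : exists C7, 0 < C7 /\
    C7 = (7 * D%:R + 2) * Ce * (3 + 8 * (2 * D%:R * Lam + 3) / lam) + 1.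
  by eexists; split; last reflexivity; apply: ltr_wpDl => //; nng.
pose Q := Num.min (1 / 2) (Num.min (r1 / m) C7^-1).
have Q0 : 0 < Q by rewrite !lt_min; apply/and3P; split; pos.
have Q12 : Q <= 1 / 2 by rewrite ge_min lexx.
have Qr : m * Q <= r1 by rewrite mulrC -ler_pdivlMr // !ge_min lexx ?orbT.
have QC : C7 * Q <= 1 by rewrite mulrC -ler_pdivlMr // div1r !ge_min lexx ?orbT.
clearbody Q.
have Q1 : Q <= 1 by move: Q12; clear; lra.
have Q7 : Q ^+ 8 <= Q by rewrite exprS ler_piMr ?(ltW Q0) // exprn_ile1 // ltW.
have Q8 : 0 < Q ^+ 8 by pos.
have [r [rE r0]] : exists r, r = m * Q ^+ 8 /\ 0 < r by eexists; split; [reflexivity | pos].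
have rr1 : r <= r1 by rewrite rE (le_trans _ Qr) // ler_pM2l.
have rr01 : 0 < r <= r1 by rewrite r0.
have [t0 /andP[t00 t01] {}hfp] := hfp r rr01.
have [Cp [Cp0 CpE]] : exists Cp, 0 < Cp /\ Cp = 2 * (D%:R * (2 / r)) + 1.
  by eexists; split; last reflexivity; apply: ltr_wpDl => //; nng.
pose th := Num.min t0 (Num.min (lam / 2) (Num.min (1 / 4) (Q ^+ 15 / (4 + (1 + Cp) / lam)))).
have k0 : 0 < 4 + (1 + Cp) / lam by pos.
have th0 : 0 < th by rewrite !lt_min; apply/and4P; split; pos.
have tht : th <= t0 by rewrite ge_min lexx.
have thl : th <= lam / 2 by rewrite !ge_min lexx ?orbT.
have th4 : th <= 1 / 4 by rewrite !ge_min lexx ?orbT.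
have thQ : th * (4 + (1 + Cp) / lam) <= Q ^+ 15 by rewrite -ler_pdivlMr // !ge_min lexx ?orbT.
clearbody th.
have th1 : th <= 1 by move: th4; clear; lra.
exists Q, th, Cp; split => //; [by rewrite Q0 | by rewrite th0 |].
move=> A B w A0 hAB eA0 hA0 lw w1.
have thth : 0 < th <= t0 by rewrite th0.
have {}hfp := hfp A B w A0 th thth hAB eA0 hA0 lw w1.
have [ep [ep0 epE]] : exists ep, 0 < ep /\ ep = Ce * Q ^+ 15.
  by eexists; split; last reflexivity; pos.
have r8 : r <= 1 / 8 by apply: le_trans r18.
have fp h c y : dot h n = 0 -> en h <= r -> hball n 0 (1 / 8) c -> hball n 0 (1 / 8) y ->
    en (y - c) <= r -> w (y + h) - w y - (w (c + h) - w c) <= ep.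
  move=> hn hr cb yb yc; apply: (le_trans (hfp h c y hn hr cb yb)).
  have -> : ep = K * r * (m * Q ^+ 7 + m ^+ 2 * Q ^+ 7) by rewrite epE CeE rE; ring.
  rewrite ler_pM2l; last by pos.
  apply: lerD.
    have m1 : 1 <= m by move: m2; clear; lra.
    apply: (le_trans _ (powR_78 m1 Q0)); rewrite -rE.
    by apply: ge0_ler_powR; rewrite ?nnegrE ?en_ge0 ?(ltW r0) //; lra.
  rewrite rE exprMn ler_pM2l; last by pos.
  by rewrite -exprM ler_wiXn2l // ltW.
have fp2 h c y : dot h n = 0 -> en h <= r -> hball n 0 (1 / 8) c -> hball n 0 (1 / 8) y ->
    en (y - c) <= r -> `|w (y + h) - w y - (w (c + h) - w c)| <= ep.
  move=> hn hr cb yb yc; rewrite ler_norml fp // andbT lerNl opprB; apply: fp => //.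
  by rewrite en_subC.
have tanb h : dot h n = 0 -> en h <= r -> hball n 0 (1 / 8) h.
  by move=> hn hr; split; rewrite ?subr0 ?hn //; apply: le_trans r8.
have b0 : hball n (0 : V) (1 / 8) 0 by apply: tanb; rewrite ?dot0l // en0 ltW.
have hb1 (x : V) : hball n 0 (1 / 8) x -> hball n 0 1 x.
  by apply: hball_sub; rewrite subrr en0; clear; lra.
have fM h : dot h n = 0 -> en h <= r -> `|w h - w 0| <= 2.
  move=> hn hr; have := w1 _ (hb1 _ (tanb _ hn hr)); have := w1 _ (hb1 _ b0).
  by have := ler_normB (w h) (w 0); clear; lra.
have fadd h h' : dot h n = 0 -> dot h' n = 0 -> en h <= r -> en h' <= r ->
    `|w (h + h') - w 0 - (w h - w 0) - (w h' - w 0)| <= ep.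
  move=> hn hn' hr hr'; have := fp2 h 0 h' hn hr b0 (tanb _ hn' hr'); rewrite subr0 => /(_ hr').
  rewrite add0r (addrC h' h); congr (`| _ | <= _); ring.
have [p [pn pl] hp] := @tangential_linear R D n (fun h => w h - w 0) r ep 2 n1 r0 ep0 fM fadd.
have pC : en p <= Cp by rewrite CpE; move: pl; clear; lra.
exists p => //.
have [rho [rhoE rho0 rho1]] : exists rho, [/\ rho = 2 * Q ^+ 8, 0 < rho & rho <= 1].
  by eexists; split; [reflexivity | pos | move: Q7 Q12; clear; lra].
have rhor : (D%:R + 1) * rho = r by rewrite rhoE rE mE; ring.
have rho_r : rho <= r.
  by rewrite -rhor ler_peMl ?(ltW rho0) //; move: Dn0; clear; lra.
pose a x := w x - w 0 - dot p x.
have a0 : a 0 = 0 by rewrite /a dot0r !subrr.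
have hB x : hball n 0 1 x -> en (B x) <= th by case/hA0.
have la : lsol n A B a 0 rho (th * (1 + Cp)) th.
  have la := @affine_part n p A B w (w 0) rho th Cp pn pC th0 rho1 hB lw.
  exact: la.
have [tau [tau0 tauE]] : exists tau, 0 < tau /\ tau = (7 * D%:R + 2) * ep.
  by eexists; split; last reflexivity; apply: mulr_gt0 => //; apply: ltr_wpDl; nng; pos.
have axn (x : V) : hball n 0 rho x -> `|a x - a (dot x n *: n)| <= tau.
  move=> [xr xs]; rewrite subr0 in xr; pose s := dot x n; pose xt := x - s *: n.
  have sx : s <= en x.
    by have := dot_le_en x n; rewrite (en_n n1) mulr1 ler_norml => /andP[].
  have xtn : dot xt n = 0 by rewrite /xt dotDl dotNl dotZl n1 mulr1 subrr.
  have xtl : en xt <= en x.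
    rewrite en_le ?en_ge0 // en_sq /xt !dotE n1 (dotC n x) -/s.
    by have := sqr_ge0 s; rewrite expr2; clear; lra.
  have h1 : (D%:R + 1) * en xt <= r.
    by rewrite -rhor; apply: ler_wpM2l; [nng | apply: le_trans xr].
  have h2 := hp xt xtn h1.
  have xtr : en xt <= r by apply: (le_trans xtl); apply: le_trans rho_r.
  have sr : en (s *: n - 0) <= r.
    rewrite subr0 enZ (en_n n1) mulr1 ger0_norm //.
    by apply: (le_trans sx); apply: le_trans rho_r.
  have snb : hball n 0 (1 / 8) (s *: n).
    by split; [apply: le_trans r8 | rewrite dotZl n1 mulr1].
  have h3 := fp2 xt 0 (s *: n) xtn xtr b0 snb sr.
  have xE : s *: n + xt = x by rewrite /xt addrC subrK.
  rewrite add0r xE in h3; rewrite tauE /a -/s.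
  have -> : dot p x = dot p xt by rewrite -xE dotDr dotZr pn mulr0 add0r.
  rewrite dotZr pn mulr0 subr0.
  by move: h2 h3; rewrite !ler_norml; clear => /andP[? ?] /andP[? ?]; apply/andP; split; lra.
have hAB1 (x : V) : hball n 0 1 x -> elliptic lam Lam (A x) /\ en (B x) <= th.
  by move=> /hB h; split => //; case: hAB => /(_ x) [].
have F0 : 0 <= th * (1 + Cp) by nng.
have rho01 : 0 < rho <= 1 by rewrite rho0.
have up := normal_bound n1 lam0 Lam0 th0 thl th4 rho01 F0 tau0 hAB1 la a0 axn.
have dn := normal_bound n1 lam0 Lam0 th0 thl th4 rho01 F0 tau0 hAB1 (lsolN la) _ _.
have {}dn : forall s : R, 0 <= s <= rho / 2 -> - a (s *: n) <= 4 * th + 2 * tau +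
    (th * (1 + Cp) + 8 * (2 * D%:R * Lam + 3) * tau) / lam.
  apply: dn; first by rewrite a0 oppr0.
  by move=> x /axn; rewrite -opprD normrN.
move=> x xb; have xb2 : hball n 0 rho x.
  by apply: hball_sub xb; rewrite subrr en0 add0r rhoE ler_peMl ?(ltW Q8) //; move: Q7 Q12 Dn0; clear; lra.
have h1 := axn _ xb2; rewrite -/(a x); case: xb => xr xs; rewrite subr0 in xr.
have sx : dot x n <= en x.
  by have := dot_le_en x n; rewrite (en_n n1) mulr1 ler_norml => /andP[].
have sr : 0 <= dot x n <= rho / 2.
  by rewrite xs /= (le_trans sx) // rhoE; move: xr; clear; lra.
have h2 := up _ sr; have h3 := dn _ sr.
have h4 : tau + (4 * th + 2 * tau + (th * (1 + Cp) + 8 * (2 * D%:R * Lam + 3) * tau) / lam)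
     <= C7 * Q ^+ 15.
  have -> : C7 * Q ^+ 15 = tau * (3 + 8 * (2 * D%:R * Lam + 3) / lam) + Q ^+ 15.
    by rewrite C7E tauE epE; ring.
  by move: thQ; clear; lra.
have h5 : C7 * Q ^+ 15 <= Q ^+ 14.
  by rewrite (exprS Q 14) mulrA ler_piMl //; nng.
by move: h1 h2 h3 h4 h5; rewrite !ler_norml; clear => /andP[? ?] ? ? ? ?; apply/andP; split; lra.
Qed.
End FlatStep.

Section FlatIteration.
Context {R : realType} {D : nat}.
Set Implicit Arguments. Unset Strict Implicit.
Local Notation V := 'rV[R]_D.
Implicit Types (w v : V -> R) (x y z p : V).

Lemma lsol_le (n : V) A B w y (rho F F' G G' : R) : F <= F' -> G <= G' ->
  lsol n A B w y rho F G -> lsol n A B w y rho F' G'.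
Proof.
move=> hF hG [c1 c2 c3]; split => //.
  by move=> x h1 h2; have [a aF La] := c2 x h1 h2; exists a => //; apply: le_trans hF.
move=> x h1 h2 e e0; have [dl dl0 h] := c3 x h1 h2 e e0; exists dl => // t ht.
apply: (le_trans (h t ht)); rewrite ler_wpM2r ?lerD2r //.
by case/andP: ht => /ltW.
Qed.

Lemma genL_affine A B w (c : R) p y0 x b : genL A B w x b ->
  genL A B (fun x => w x - c - dot p (x - y0)) x (b - dot (B x) p).
Proof.
move=> [q [H [j E]]]; exists (q - 0 - p), (H - 0 - 0); split.
  exact: (jetB (jetB j (jet_cst c x)) (jet_shift (jet_dot p (x - y0)))).
by rewrite !subr0 dotDr dotNr -E addrA.
Qed.

Lemma lsol_affine (n p : V) A B w y0 (c rho F G CB Cp : R) : dot p n = 0 -> en p <= Cp ->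
  (forall x, en (B x) <= CB) -> lsol n A B w y0 rho F G ->
  lsol n A B (fun x => w x - c - dot p (x - y0)) y0 rho (F + CB * Cp) G.
Proof.
move=> pn pC hB [cw Lw nw]; split=> [|x xr xn|x xr xn e e0].
- apply: ctnB; first by apply: ctnB => //; exact: ctn_cst.
  apply: ctn_continuous; apply: (@comp_continuous _ _ _ (fun x : V => x - y0) (dot p)).
    by apply: sub_continuous; [move=> ?; exact: cvg_id | exact: cst_continuous].
  exact: dot_continuous.
- have [b bt Lb] := Lw x xr xn; exists (b - dot (B x) p); last exact: genL_affine.
  rewrite (le_trans (ler_normB _ _)) // lerD // (le_trans (dot_le_en _ _)) //.
  by apply: ler_pM; rewrite ?en_ge0.
have [dl dl0 h] := nw x xr xn e e0; exists dl => // t /h.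
have -> // : w (x + t *: n) - c - dot p (x + t *: n - y0) - (w x - c - dot p (x - y0)) =
    w (x + t *: n) - w x by rewrite (addrAC x) (dotDr p (x - y0)) dotZr pn; ring.
Qed.

Lemma genL_rescale A B w y0 (rho E : R) x b : genL A B w (y0 + rho *: x) b ->
  genL (fun x => A (y0 + rho *: x)) (fun x => rho *: B (y0 + rho *: x))
    (fun x => E^-1 * w (y0 + rho *: x)) x (rho ^+ 2 / E * b).
Proof.
move=> [p [H [j E1]]]; exists (E^-1 *: (rho *: p)), (E^-1 *: (rho ^+ 2 *: H)); split.
  exact: jetZ (jet_subst j).
by rewrite -E1 !tr2Zr !dotZr dotZl; ring.
Qed.

Lemma lsol_rescale (n : V) A B w y0 (rho E F G : R) : 0 < rho -> 0 < E -> dot y0 n = 0 ->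
  lsol n A B w y0 rho F G ->
  lsol n (fun x => A (y0 + rho *: x)) (fun x => rho *: B (y0 + rho *: x))
    (fun x => E^-1 * w (y0 + rho *: x)) 0 1 (rho ^+ 2 / E * F) (rho / E * G).
Proof.
move=> rho0 E0 y0n [cw Lw nw].
have er x : en (y0 + rho *: x - y0) = rho * en (x - 0).
  by rewrite addrAC subrr add0r subr0 enZ gtr0_norm.
have dr x : dot (y0 + rho *: x) n = rho * dot x n by rewrite dotDl dotZl y0n add0r.
have lt1 x : en (x - 0) < 1 -> en (y0 + rho *: x - y0) < rho.
  by move=> h; rewrite er gtr_pMr.
split=> [|x x1 xn|x x1 xn e e0].
- apply: ctnM; first exact: ctn_cst.
  apply: (@ctn_pre _ _ _ (hball n 0 1) (hball n y0 rho) (fun x => y0 + rho *: x) w) => //.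
    by move=> x; apply: continuousD; [exact: cst_continuous | apply: continuousZr; exact: cvg_id].
  move=> x [x1 xn]; split; first by rewrite er ger_pMr.
  by rewrite dr mulr_ge0 // ltW.
- have xp : 0 < dot (y0 + rho *: x) n by rewrite dr mulr_gt0.
  have [b bF Lb] := Lw _ (lt1 _ x1) xp.
  exists (rho ^+ 2 / E * b); last exact: genL_rescale.
  have k0 : 0 <= rho ^+ 2 / E by nng.
  by rewrite normrM ger0_norm // ler_wpM2l.
have e1 : 0 < E / rho * e by pos.
have xp : dot (y0 + rho *: x) n = 0 by rewrite dr xn mulr0.
have [dl dl0 h] := nw _ (lt1 _ x1) xp _ e1.
exists (dl / rho); first by pos.
move=> t /andP[t0]; rewrite ltr_pdivlMr // => td.
have := h (t * rho); rewrite mulr_gt0 // td => /(_ isT).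
rewrite -mulrBr normrM gtr0_norm ?invr_gt0 // scalerDr scalerA addrA (mulrC rho t) => h2.
apply: (@le_trans _ _ (E^-1 * ((G + E / rho * e) * (t * rho)))).
  by rewrite ler_pM2l ?invr_gt0.
by rewrite le_eqVlt; apply/orP; left; apply/eqP; field; rewrite !gt_eqF.
Qed.

Lemma hcoefs_rescale (lam Lam CB CA gam rho : R) A B y0 : 0 < gam -> 0 < rho <= 1 -> 0 <= CA ->
  hcoefs lam Lam CB CA gam A B ->
  hcoefs lam Lam CB CA gam (fun x => A (y0 + rho *: x)) (fun x => rho *: B (y0 + rho *: x)).
Proof.
move=> gam0 /andP[rho0 rho1] CA0 [h1 h2]; split=> [x|x y z].
  have [eA bB] := h1 (y0 + rho *: x); split => //.
  by rewrite enZ gtr0_norm // (le_trans _ bB) // ler_piMl ?en_ge0.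
apply: (le_trans (h2 _ _ z)); apply: ler_wpM2r; [exact: dotxx_ge0 | apply: ler_wpM2l => //].
apply: ge0_ler_powR; rewrite ?nnegrE ?en_ge0 ?(ltW gam0) //.
have -> : y0 + rho *: x - (y0 + rho *: y) = rho *: (x - y).
  by rewrite scalerBr opprD addrACA subrr add0r.
by rewrite enZ gtr0_norm // ler_piMl ?en_ge0.
Qed.

(** Rescaling and iterating [flat_step] as long as the boundary datum is small against the gradient
    size [N Q ^ (6 K)] of the current error; this is how [K] enters the condition on [eta].
    Subtracting an affine function with tangential slope leaves the normal derivative unchanged. *)
Lemma flat_iterate (n : V) (lam Lam CB CA gam : R) :
  dot n n = 1 -> 0 < lam -> 0 <= Lam -> 0 <= CB -> 0 < CA -> 0 < gam < 1 ->
  exists Q rho1 th Cp : R, [/\ 0 < Q <= 1 / 2, 0 < rho1 <= 1, 0 < th <= 1, 0 < Cp &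
    forall rh : R, 0 < rh <= rho1 ->
    forall A B v y0 (F eta N : R), hcoefs lam Lam CB CA gam A B -> dot y0 n = 0 ->
      0 < N -> F <= N -> lsol n A B v y0 rh F eta ->
      (forall x, hball n y0 rh x -> `|v x - v y0| <= N) ->
      forall K : nat, rh * eta <= th * N * Q ^+ (6 * K) ->
      exists2 p : V, dot p n = 0 /\ en p <= Cp / rh * N &
        forall x, hball n y0 (rh * Q ^+ (8 * K)) x ->
          `|v x - v y0 - dot p (x - y0)| <= N * Q ^+ (14 * K)].
Proof.
move=> n1 lam0 Lam0 CB0 CA0 g01.
have [Q [th [Cp [/andP[Q0 Q12] /andP[th0 th1] Cp0 hstep]]]] :=
  flat_step n1 lam0 Lam0 CB0 CA0 g01.
have g0 : 0 < gam by case/andP: g01.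
pose rho1 := Num.min 1 (Num.min (th / (1 + 2 * CB * Cp)) (Num.min (th / (CB + 1)) ((th / CA) `^ gam^-1))).
have q1 : 0 < 1 + 2 * CB * Cp by apply: ltr_wpDr => //; nng.
have q2 : 0 < CB + 1 by apply: ltr_wpDl.
have tc : 0 < th / CA by pos.
have rho10 : 0 < rho1 by rewrite !lt_min ltr01 /=; apply/and3P; split; [pos | pos | exact: powR_gt0].
have rho11 : rho1 <= 1 by rewrite ge_min lexx.
have rhoa : rho1 * (1 + 2 * CB * Cp) <= th by rewrite -ler_pdivlMr // !ge_min lexx ?orbT.
have rhob : rho1 * (CB + 1) <= th by rewrite -ler_pdivlMr // !ge_min lexx ?orbT.
have rhoc : CA * rho1 `^ gam <= th.
  rewrite mulrC -ler_pdivlMr //.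
  apply: (@le_trans _ _ (((th / CA) `^ gam^-1) `^ gam)).
    apply: ge0_ler_powR; rewrite ?nnegrE ?(ltW g0) ?(ltW rho10) ?powR_ge0 //.
    by rewrite !ge_min lexx ?orbT.
  by rewrite -powRrM mulVf ?gt_eqF // powRr1 // ltW.
clearbody rho1.
exists Q, rho1, th, (2 * Cp); split; rewrite ?Q0 ?rho10 ?th0 //; first by pos.
move=> rh /andP[rh0 rh1] A B v y0 F eta N hAB y0n N0 FN lv vN K hK.
have rh11 : rh <= 1 by apply: le_trans rho11.
have {}rhoa : rh * (1 + 2 * CB * Cp) <= th by apply: le_trans rhoa; rewrite ler_pM2r.
have {}rhob : rh * (CB + 1) <= th by apply: le_trans rhob; rewrite ler_pM2r.
have {}rhoc : CA * rh `^ gam <= th.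
  apply: le_trans rhoc; rewrite ler_pM2l //.
  by apply: ge0_ler_powR; rewrite ?nnegrE ?(ltW g0) ?(ltW rho10) ?(ltW rh0).
have [C2 [C20 C2E]] : exists C2, 0 < C2 /\ C2 = 2 * Cp / rh.
  by eexists; split; last reflexivity; pos.
rewrite -C2E => {rho10 rho11 rh1}.
have hB x : en (B x) <= CB by case: hAB => /(_ x) [].
(* The induction carries the geometric sum: passing from [K] to [K + 1] corrects the slope by at
   most [C2 N / 2 ^ (K + 1)], thanks to [Q ^ 6 <= 1 / 2]. *)
suff [p [pn pC] hp] : exists2 p : V, dot p n = 0 /\ en p <= C2 * N * (1 - 2^-1 ^+ K) &
    forall x, hball n y0 (rh * Q ^+ (8 * K)) x ->
      `|v x - v y0 - dot p (x - y0)| <= N * Q ^+ (14 * K).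
  exists p => //; split => //; apply: (le_trans pC); apply: ler_piMr; first by nng.
  by rewrite gerBl exprn_ge0 // invr_ge0.
have Q1 : Q <= 1 by move: Q12; clear; lra.
have Qn k : 0 < Q ^+ k by pos.
elim: K hK => [|K IH] hK.
  exists 0 => [|x]; first by rewrite dot0l en0 expr0 subrr mulr0.
  by rewrite !muln0 !expr0 !mulr1 dot0l subr0; exact: vN.
have [|p [pn pC] hp] := IH.
  apply: (le_trans hK); rewrite ler_pM2l; last by pos.
  by rewrite ler_wiXn2l ?(ltW Q0) // leq_mul2l leqnSn.
have pC' : en p <= C2 * N.
  apply: (le_trans pC); apply: ler_piMr; first by nng.
  by rewrite gerBl exprn_ge0 // invr_ge0.
have [rho [rhoE rho0 rhol]] : exists rho, [/\ rho = rh * Q ^+ (8 * K), 0 < rho & rho <= rh].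
  eexists; split; [reflexivity | by apply: mulr_gt0 |].
  by rewrite ler_piMr ?(ltW rh0) // exprn_ile1 // ltW.
have [E [EE E0]] : exists E, E = N * Q ^+ (14 * K) /\ 0 < E.
  by eexists; split; [reflexivity | apply: mulr_gt0].
rewrite -rhoE -EE in hp.
have rho01 : 0 < rho <= 1 by rewrite rho0 (le_trans rhol).
have lW : lsol n A B (fun x => v x - v y0 - dot p (x - y0)) y0 rho (F + CB * (C2 * N)) eta.
  apply: lsol_affine => //; apply: lsol_sub lv; by rewrite subrr en0 add0r.
have lw := lsol_rescale rho0 E0 y0n lW.
have rE : rh ^+ 2 * Q ^+ (2 * K) = rho ^+ 2 / E * N.
  rewrite rhoE EE exprMn -exprM.
  have -> : (8 * K * 2 = 14 * K + 2 * K)%N by rewrite mulnAC -mulnDl.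
  by rewrite exprD; field; rewrite !gt_eqF.
have F1 : rho ^+ 2 / E * (F + CB * (C2 * N)) <= th.
  apply: (@le_trans _ _ (rho ^+ 2 / E * N * (1 + CB * C2))).
    rewrite -[X in _ <= X]mulrA; apply: ler_wpM2l; [by nng | move: FN; clear; lra].
  rewrite -rE; apply: (@le_trans _ _ (rh ^+ 2 * (1 + CB * C2))).
    apply: ler_wpM2r; first by nng.
    by rewrite ler_piMr // ?exprn_ile1 ?exprn_ge0 // ltW.
  apply: le_trans rhoa; have -> : rh ^+ 2 * (1 + CB * C2) = rh * (rh + 2 * CB * Cp).
    by rewrite C2E; field; rewrite gt_eqF.
  by rewrite ler_pM2l // lerD2r.
have G1 : rho / E * eta <= th.
  have h1 : rh * eta <= th * N * Q ^+ (6 * K).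
    apply: (le_trans hK); rewrite ler_pM2l; last by pos.
    by rewrite ler_wiXn2l ?(ltW Q0) // leq_mul2l leqnSn.
  have -> : rho / E * eta = Q ^+ (8 * K) / E * (rh * eta) by rewrite rhoE; ring.
  apply: (@le_trans _ _ (Q ^+ (8 * K) / E * (th * N * Q ^+ (6 * K)))).
    by apply: ler_wpM2l; [nng; exact: ltW | exact: h1].
  have -> // : Q ^+ (8 * K) / E * (th * N * Q ^+ (6 * K)) = th.
    rewrite EE (_ : 14 * K = 8 * K + 6 * K)%N; last by rewrite -mulnDl.
    by rewrite exprD; field; rewrite !gt_eqF.
have {}lw := lsol_le F1 G1 lw.
have hAB' := hcoefs_rescale y0 g0 rho01 (ltW CA0) hAB.
have eA0 : elliptic lam Lam (A y0) by case: hAB => /(_ y0) [].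
have hyp (x : V) : hball n 0 1 x -> en (rho *: B (y0 + rho *: x)) <= th /\
    forall z, `|qf (A (y0 + rho *: x)) z - qf (A y0) z| <= th * dot z z.
  move=> [x1 _]; rewrite subr0 in x1; split=> [|z].
    rewrite enZ gtr0_norm //; apply: le_trans rhob; apply: ler_pM; rewrite ?en_ge0 ?(ltW rho0) //.
    by apply: (le_trans (hB _)); rewrite lerDl.
  have hh (u : V) : en u <= rh -> CA * en u `^ gam * dot z z <= th * dot z z.
    move=> ul; rewrite ler_wpM2r ?dotxx_ge0 // (le_trans _ rhoc) // ler_pM2l //.
    by apply: ge0_ler_powR; rewrite ?nnegrE ?en_ge0 ?(ltW g0) ?(ltW rh0).
  have ul : en (rho *: x) <= rh.
    rewrite enZ gtr0_norm // (le_trans _ rhol) // ler_piMr // ltW //.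
  case: hAB => _ hol; rewrite ler_norml lerNl opprB; apply/andP; split.
    apply: (le_trans (hol _ _ z)); apply: hh; by rewrite en_subC addrAC subrr add0r.
  apply: (le_trans (hol _ _ z)); apply: hh; by rewrite addrAC subrr add0r.
have er (x : V) : en (y0 + rho *: x - y0) = rho * en (x - 0).
  by rewrite addrAC subrr add0r subr0 enZ gtr0_norm.
have w1 (x : V) : hball n 0 1 x ->
    `|E^-1 * (v (y0 + rho *: x) - v y0 - dot p (y0 + rho *: x - y0))| <= 1.
  move=> [x1 xn]; rewrite normrM gtr0_norm ?invr_gt0 // ler_pdivrMl // mulr1; apply: hp.
  split; first by rewrite er ger_pMr.
  by rewrite dotDl y0n add0r dotZl mulr_ge0 // ltW.
have [p' [p'n p'C] hp'] := hstep _ _ _ _ hAB' eA0 hyp lw w1.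
exists (p + (E / rho) *: p'); first split.
- by rewrite dotDl dotZl pn p'n mulr0 addr0.
- apply: (le_trans (en_triangle _ _)).
  have h1 : en ((E / rho) *: p') <= C2 * N * (2^-1 ^+ K - 2^-1 ^+ K.+1).
    rewrite enZ gtr0_norm; last by pos.
    apply: (@le_trans _ _ (E / rho * Cp)); first by rewrite ler_pM2l //; pos.
    have -> : E / rho * Cp = C2 * N * (Q ^+ (6 * K) / 2).
      rewrite rhoE EE (_ : 14 * K = 8 * K + 6 * K)%N; last by rewrite -mulnDl.
      by rewrite exprD C2E; field; rewrite !gt_eqF.
    rewrite ler_pM2l; last by pos.
    have -> : 2^-1 ^+ K - 2^-1 ^+ K.+1 = 2^-1 ^+ K / 2 :> R by rewrite exprS; field.
    rewrite ler_pM2r ?invr_gt0 // exprM lerXn2r ?nnegrE ?invr_ge0 // ?(ltW (Qn _)) //.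
    apply: (@le_trans _ _ Q); first by rewrite exprS ler_piMr ?(ltW Q0) // exprn_ile1 // ltW.
    by move: Q12; clear; lra.
  by move: pC h1; clear; lra.
move=> x [xr xn]; pose x' := rho^-1 *: (x - y0).
have xE : y0 + rho *: x' = x by rewrite /x' scalerA divff ?gt_eqF // scale1r addrC subrK.
have x'b : hball n 0 (Q ^+ 8) x'.
  split; last by rewrite /x' dotZl dotDl dotNl y0n subr0 mulr_ge0 // invr_ge0 ltW.
  rewrite subr0 /x' enZ gtr0_norm ?invr_gt0 // ler_pdivrMl //; apply: (le_trans xr).
  by rewrite rhoE -mulrA -exprD mulnS addnC.
have := hp' x' x'b; rewrite xE scaler0 addr0 !subrr dot0r subr0 mulr0 subr0.
have -> : dot p' x' = E^-1 * (dot ((E / rho) *: p') (x - y0)).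
  by rewrite /x' !dotZl dotZr; field; rewrite !gt_eqF.
rewrite -mulrBr normrM gtr0_norm ?invr_gt0 // ler_pdivrMl // dotDl.
rewrite mulnS addnC exprD mulrA -EE.
by rewrite opprD addrA.
Qed.
End FlatIteration.

Section HeightDerivative.
Context {R : realType} {D : nat}.
Set Implicit Arguments. Unset Strict Implicit.
Local Notation V := 'rV[R]_D.
Implicit Types (w v : V -> R) (x y z p : V).

Lemma le_add_small (a b c : R) : 0 <= c -> (forall G : R, 0 < G -> a <= b + G * c) -> a <= b.
Proof.
move=> c0 h; rewrite leNgt; apply/negP => ab.
have c1 : 0 < c + 1 by rewrite ltr_wpDl.
have G0 : 0 < (a - b) / (c + 1) by rewrite divr_gt0 // subr_gt0.
have := h _ G0; have : (a - b) / (c + 1) * c < a - b.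
  by rewrite mulrAC ltr_pdivrMr // ltr_pM2l ?subr_gt0 // ltrDl.
by clear; lra.
Qed.

(** A zero Neumann bound allows every [G > 0] in [lipschitz_estimate]; letting [G] tend to 0 removes
    its additive term. *)
Lemma interior_lipschitz (n : V) (lam Lam CB CA gam : R) :
  dot n n = 1 -> 0 < lam -> 0 <= Lam -> 0 <= CB -> 0 < CA -> 0 < gam < 1 ->
  exists rho0 C : R, [/\ 0 < rho0, rho0 <= 1, 0 < C &
    forall A B w y (rho F W : R), hcoefs lam Lam CB CA gam A B ->
      0 < rho <= rho0 -> 0 <= F -> 0 <= W -> rho <= dot y n ->
      lsol n A B w y rho F 0 ->
      (forall x, en (x - y) <= rho -> `|w x - w y| <= W) ->
      forall x, en (x - y) <= rho -> `|w x - w y| <= C * (W / rho + F * rho) * en (x - y)].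
Proof.
move=> n1 lam0 Lam0 CB0 CA0 g01.
have [rho0 [C [rho00 rho01 C0 hL]]] := lipschitz_estimate n1 lam0 Lam0 CB0 CA0 g01.
exists rho0, C; split => // A B w y rho F W hAB /andP[rho_gt0 rhol] F0 W0 yn lw wW x xr.
have rr : 0 < rho <= rho0 by rewrite rho_gt0.
have y00 : 0 <= dot y n by apply: le_trans yn; exact: ltW.
have hb z : en (z - y) <= rho -> hball n y rho z.
  move=> zr; split => //; have := dot_le_en (y - z) n.
  rewrite (en_n n1) mulr1 en_subC dotDl dotNl ler_norml => /andP[_ h].
  by move: h zr yn; clear; lra.
have osc s : s = 1 \/ s = -1 -> forall x z, hball n y rho x -> hball n y rho z ->
    s * w x - s * w z <= 2 * W.
  move=> s1 a b [/wW + _] [/wW + _]; rewrite !ler_norml => /andP[? ?] /andP[? ?].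
  by case: s1 => ->; lra.
have l0 (G : R) : 0 < G -> lsol n A B w y rho F G by move=> /ltW G0; exact: lsol_le lw.
have cc : 0 <= C * rho * en (x - y) + 6 * rho by nng.
rewrite ler_norml; apply/andP; split; last first.
  apply: (le_add_small cc) => G G0.
  have o1 : forall x z, hball n y rho x -> hball n y rho z -> w x - w z <= 2 * W.
    by move=> a b ha hb'; have := osc 1 (or_introl erefl) a b ha hb'; rewrite !mul1r.
  by have := hL A B w y rho F G W hAB rr F0 G0 W0 y00 (l0 _ G0) o1 x (hb _ xr); clear; lra.
rewrite lerNl opprB; apply: (le_add_small cc) => G G0.
have o1 : forall x z, hball n y rho x -> hball n y rho z -> - w x - - w z <= 2 * W.
  by move=> a b ha hb'; have := osc (-1) (or_intror erefl) a b ha hb'; rewrite !mulN1r.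
have := hL A B (fun x => - w x) y rho F G W hAB rr F0 G0 W0 y00 (lsolN (l0 _ G0)) o1 x (hb _ xr).
by clear; lra.
Qed.

Lemma lsol_interior (n : V) A B w y (rho F G : R) : dot n n = 1 -> rho <= dot y n ->
  lsol n A B w y rho F G -> lsol n A B w y rho F 0.
Proof.
move=> n1 yn [c1 c2 _]; split => // x xr xn; exfalso.
have := dot_le_en (y - x) n; rewrite (en_n n1) mulr1 en_subC dotDl dotNl xn ler_norml.
by move=> /andP[_ h]; move: h xr yn; clear; lra.
Qed.

(** When the height [dl] is comparable with the scale [rh Q ^ (8 K)], the interior estimate applies
    to [v] minus its affine approximation. The slope of the latter is tangential, so it does not
    contribute to the derivative along [n]. *)
Lemma height_derivative (n : V) (lam Lam CB CA gam : R) :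
  dot n n = 1 -> 0 < lam -> 0 <= Lam -> 0 <= CB -> 0 < CA -> 0 < gam < 1 ->
  exists Q rho1 th C : R, [/\ 0 < Q <= 1 / 2, 0 < rho1 <= 1, 0 < th <= 1, 0 < C &
    forall rh : R, 0 < rh <= rho1 ->
    forall A B v y0 (F eta N : R), hcoefs lam Lam CB CA gam A B -> dot y0 n = 0 ->
      0 < N -> 0 <= F <= N -> lsol n A B v y0 rh F eta ->
      (forall x, hball n y0 rh x -> `|v x - v y0| <= N) ->
      forall (K : nat) (dl : R), rh * eta <= th * N * Q ^+ (6 * K) ->
        rh * Q ^+ (8 * K.+1) <= 2 * dl <= rh * Q ^+ (8 * K) ->
        nderiv_le n v (y0 + dl *: n) (C / rh * N * Q ^+ (6 * K))].
Proof.
move=> n1 lam0 Lam0 CB0 CA0 g01.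
have [Q [rho1 [th [Cp [/andP[Q0 Q12] /andP[rho10 rho11] th01 Cp0 hit]]]]] :=
  flat_iterate n1 lam0 Lam0 CB0 CA0 g01.
have [rho0 [CL [rho00 rho01 CL0 hL]]] := interior_lipschitz n1 lam0 Lam0 CB0 CA0 g01.
have [C [C0 CE]] : exists C, 0 < C /\
    C = CL * (8 / (rho0 * Q ^+ 8) + (1 + CB * Cp)).
  eexists; split; last reflexivity; apply: mulr_gt0 => //; apply: ltr_wpDr; last by pos.
  by nng.
exists Q, rho1, th, C; split; rewrite ?Q0 ?rho10 //.
move=> rh rh01; have /andP[rh0 rhr] := rh01; have rh1 : rh <= 1 by apply: le_trans rho11.
move=> A B v y0 F eta N hAB y0n N0 /andP[F0 FN] lv vN K dl hK /andP[dl1 dl2].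
have Qn k : 0 < Q ^+ k by pos.
have [p [pn pC] hp] := hit rh rh01 A B v y0 F eta N hAB y0n N0 FN lv vN K hK.
have dl0 : 0 < dl.
  by rewrite -(@pmulr_rgt0 _ 2) // (lt_le_trans _ dl1) //; apply: mulr_gt0.
have Q1 : Q <= 1 by move: Q12; clear; lra.
have dlQ : 2 * dl <= Q ^+ (6 * K).
  apply: (le_trans dl2); apply: (@le_trans _ _ (Q ^+ (8 * K))).
    by rewrite ler_piMl // ltW.
  by rewrite ler_wiXn2l ?(ltW Q0) // leq_mul2r orbT.
have dl11 : dl <= 1.
  by have : Q ^+ (6 * K) <= 1 by [rewrite exprn_ile1 // ltW]; move: dlQ dl0; clear; lra.
have hB x : en (B x) <= CB by case: hAB => /(_ x) [].
pose y := y0 + dl *: n; pose a x := v x - v y0 - dot p (x - y0).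
have yn : dot y n = dl by rewrite /y dotDl dotZl n1 y0n add0r mulr1.
have yy : en (y - y0) = dl.
  by rewrite /y addrAC subrr add0r enZ (en_n n1) mulr1 gtr0_norm.
have [rho [rhoE rho_gt0 rhor rhod]] : exists rho, [/\ rho = rho0 / 2 * dl, 0 < rho, rho <= rho0 & rho <= dl / 2].
  eexists; split; [reflexivity | by pos | |].
    by move: rho00 dl11 dl0; clear; nra.
  by rewrite mulrAC; move: rho01 dl0; clear; nra.
have rr : 0 < rho <= rho0 by rewrite rho_gt0.
have sub1 : en (y - y0) + rho <= rh * Q ^+ (8 * K).
  by rewrite yy; move: rhod dl2 dl0; clear; lra.
have sub2 : en (y - y0) + rho <= rh.
  by apply: (le_trans sub1); rewrite ler_piMr ?(ltW rh0) // exprn_ile1 // ltW.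
have rhoy : rho <= dot y n by rewrite yn; move: rhod dl0; clear; lra.
have la : lsol n A B a y rho (F + CB * (Cp / rh * N)) 0.
  apply: (@lsol_interior n A B a y rho _ eta n1 rhoy).
  exact: (lsol_sub sub2 (@lsol_affine _ _ n p A B v y0 (v y0) rh F eta CB (Cp / rh * N) pn pC hB lv)).
have Fp : 0 <= F + CB * (Cp / rh * N) by nng.
have W0 : 0 <= 2 * (N * Q ^+ (14 * K)) by nng.
have hb z : en (z - y) <= rho -> `|a z| <= N * Q ^+ (14 * K).
  move=> zr; apply: hp; apply: (hball_sub sub1); split => //; have := dot_le_en (y - z) n.
  rewrite (en_n n1) mulr1 en_subC dotDl dotNl ler_norml => /andP[_ h].
  by move: h zr rhoy; clear; lra.
have osc x : en (x - y) <= rho -> `|a x - a y| <= 2 * (N * Q ^+ (14 * K)).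
  move=> /hb h1; have := hb y; rewrite subrr en0 => /(_ (ltW rho_gt0)) h2.
  by rewrite (le_trans (ler_normB _ _)) //; move: h1 h2; clear; lra.
have main := hL A B a y rho _ _ hAB rr Fp W0 rhoy la osc.
have bnd : CL * (2 * (N * Q ^+ (14 * K)) / rho + (F + CB * (Cp / rh * N)) * rho) <= C / rh * N * Q ^+ (6 * K).
  have -> : C / rh * N * Q ^+ (6 * K) = CL * (8 / (rho0 * rh * Q ^+ 8) * N * Q ^+ (6 * K)
      + (1 + CB * Cp) / rh * N * Q ^+ (6 * K)) by rewrite CE; field; rewrite !gt_eqF.
  rewrite ler_pM2l //; apply: lerD.
    rewrite ler_pdivrMr // rhoE.
    have -> : 8 / (rho0 * rh * Q ^+ 8) * N * Q ^+ (6 * K) * (rho0 / 2 * dl) =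
      N * Q ^+ (6 * K) / (rh * Q ^+ 8) * (2 * (2 * dl)) by field; rewrite !gt_eqF.
    have -> : 2 * (N * Q ^+ (14 * K)) = N * Q ^+ (6 * K) / (rh * Q ^+ 8) *
        (2 * (rh * Q ^+ (8 * K.+1))).
      rewrite (_ : 14 * K = 8 * K + 6 * K)%N; last by rewrite -mulnDl.
      by rewrite mulnS !exprD; field; rewrite !gt_eqF.
    apply: ler_wpM2l; first by nng.
    by rewrite ler_pM2l.
  apply: (@le_trans _ _ ((1 + CB * Cp) / rh * N * (2 * dl))); last first.
    by apply: ler_wpM2l; [nng | exact: dlQ].
  apply: ler_pM; [exact: Fp | exact: ltW | |].
    have -> : (1 + CB * Cp) / rh * N = N / rh + CB * (Cp / rh * N) by ring.
    rewrite lerD2r (le_trans FN) // ler_pdivlMr // ler_piMr // ltW //.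
  by apply: (le_trans rhod); move: dlQ dl0; clear; lra.
move=> e e0; exists rho => // t /andP[t0 tr].
have tl : en (y + t *: n - y) = t.
  by rewrite addrAC subrr add0r enZ (en_n n1) mulr1 gtr0_norm.
have := main (y + t *: n); rewrite tl => /(_ (ltW tr)).
have -> : a (y + t *: n) - a y = v (y + t *: n) - v y.
  by rewrite /a (addrAC y) (dotDr p (y - y0)) dotZr pn; ring.
move=> h; apply: (le_trans h); rewrite ler_pM2r // (le_trans bnd) // lerDl ltW //.
Qed.
End HeightDerivative.

(** * Integer translations *)

Section DiscreteLipschitz.
Context {R : realType} {D : nat}.
Set Implicit Arguments. Unset Strict Implicit.
Local Notation V := 'rV[R]_D.
Implicit Types (w v : V -> R) (x y z p : V) (j : 'rV[int]_D).

Definition zv j : V := map_mx intr j.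

Lemma zvD j j' : zv (j + j') = zv j + zv j'.
Proof. by apply/rowP => i; rewrite !mxE intrD. Qed.

Lemma zvN j : zv (- j) = - zv j.
Proof. by apply/rowP => i; rewrite !mxE intrN. Qed.

Definition zper (T : Type) (f : V -> T) := forall x j, f (x + zv j) = f x.

Lemma genL_zper A B w x j b : zper A -> zper B -> genL A B w (x + zv j) b ->
  genL A B (fun x => w (x + zv j)) x b.
Proof.
move=> pA pB [p [H [jw E]]]; exists p, H; rewrite -(pA x j) -(pB x j); split => //.
have e1 : x - - zv j = x + zv j by rewrite opprK.
rewrite -e1 in jw; refine (jet_eq (jet_shift jw) _ _ _) => // y; by rewrite opprK.
Qed.

Lemma approx_sup (T : Type) (P : T -> Prop) (f : T -> R) (M e : R) t0 : P t0 -> 0 < e ->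
  (forall t, P t -> f t <= M) ->
  exists S : R, (forall t, P t -> f t <= S) /\ exists t, P t /\ S - e < f t.
Proof.
move=> Pt0 e0 hM; pose E := [set r | exists2 t, P t & f t = r].
have hE : has_sup E.
  by split; [exists (f t0), t0 | exists M => r [t Pt <-]; exact: hM].
exists (sup E); split=> [t Pt|]; first by apply: sup_upper_bound => //; exists t.
by have [r [t Pt <-] h] := sup_adherent e0 hE; exists t.
Qed.

Lemma genL_lincomb A B (X : 'I_D -> V -> R) (b : 'I_D -> R) x :
  (forall l, genL A B (X l) x 0) -> genL A B (fun y => \sum_l b l * X l y) x 0.
Proof.
move=> hX; have : forall s : seq 'I_D, genL A B (fun y => \sum_(l <- s) b l * X l y) x 0.
  elim=> [|l s IH].
    have [p [H [j E]]] := genL_cst A B (0 : R) x; exists p, H; split => //.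
    by refine (jet_eq j _ _ _) => // y; rewrite big_nil.
  have := genLD (genLZ (b l) (hX l)) IH; rewrite mulr0 addr0 => -[p [H [j E]]].
  by exists p, H; split => //; refine (jet_eq j _ _ _) => // y; rewrite big_cons.
by move=> h; exact: h.
Qed.

Lemma lincomb_continuous (X : 'I_D -> V -> R) (b : 'I_D -> R) :
  (forall l, continuous (X l)) -> continuous (fun y => \sum_l b l * X l y).
Proof.
move=> hX; have : forall s : seq 'I_D, continuous (fun y => \sum_(l <- s) b l * X l y).
  elim=> [|l s IH].
    have -> : (fun y : V => \sum_(l <- [::]) b l * X l y) = fun=> 0.
      by apply/funext => y; rewrite big_nil.
    exact: cst_continuous.
  have -> : (fun y : V => \sum_(l0 <- l :: s) b l0 * X l0 y) =
      (fun y => b l * X l y + \sum_(l <- s) b l * X l y).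
    by apply/funext => y; rewrite big_cons.
  move=> x; apply: (@continuousD _ _ _ (fun y => b l * X l y)); last exact: IH.
  by apply: (@continuousM _ _ (fun=> b l) (X l)); [exact: cst_continuous | exact: hX].
by move=> h; exact: h.
Qed.

(** Penalty for one integer coordinate, concave on each side of 0 and with a corner at 0: it behaves
    like [2 J |t|] near 0, which gives the linear estimate, and has constant discrete second
    difference elsewhere. *)
Definition psi (J t : R) := 2 * J * `|t| - t ^+ 2.

Lemma psi_second (J : R) (t : int) : t != 0 ->
  psi J (t + 1)%:~R + psi J (t - 1)%:~R = 2 * psi J t%:~R - 2.
Proof.
move=> t0; rewrite /psi !intrD intrN.
have h : `|t%:~R + 1| + `|t%:~R - 1| = 2 * `|t%:~R| :> R.
  have [tp|tn] := leP 1 t.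
    have t1 : 1 <= t%:~R :> R by rewrite -[1]/(1%:~R) ler_int.
    by rewrite !ger0_norm; move: t1; clear; lra.
  have t1 : t%:~R <= -1 :> R.
    by rewrite -[-1]/((-1)%:~R) ler_int; move: t0 tn; clear; lia.
  by rewrite !ler0_norm; move: t1; clear; lra.
have -> : 1%:~R = 1 :> R by [].
by move: h; set a := `|_ + 1|; set b := `|_ - 1|; set c := `|_|; clearbody a b c; clear; nra.
Qed.

Lemma psi_ge0 (J t : R) : `|t| <= J -> 0 <= psi J t.
Proof. by move=> h; rewrite /psi -(real_normK (num_real t)); have := normr_ge0 t; move: h; clear; nra. Qed.

Lemma psi_le (J t : R) : 0 <= J -> psi J t <= 2 * J * `|t|.
Proof. by move=> J0; rewrite /psi; have := sqr_ge0 t; clear; lra. Qed.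

Lemma psi_edge (J t : R) : `|t| <= J -> J - 1 < `|t| -> J ^+ 2 - 1 <= psi J t.
Proof. by move=> h h'; rewrite /psi -(real_normK (num_real t)); move: h h'; clear; nra. Qed.

Lemma en_le_sum x : en x <= \sum_(i < D) `|x 0 i|.
Proof.
rewrite {1}[x]rV_sum_evec; elim/big_rec2: _ => [|i y z _ h]; first by rewrite en0.
rewrite (le_trans (en_triangle _ _)) // lerD // enZ.
by rewrite [en (evec R i)](_ : _ = 1) ?mulr1 // /en evec_unit sqrtr1.
Qed.

Lemma en_le_coord x (J : R) : (forall i, `|x 0 i| <= J) -> en x <= D%:R * J.
Proof.
move=> h; apply: (le_trans (en_le_sum x)).
apply: (@le_trans _ _ (\sum_(i < D) J)); first by apply: ler_sum => i _.
by rewrite sumr_const card_ord mulr_natl.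
Qed.
End DiscreteLipschitz.
Arguments zv R {D} j.

Section DiscreteLipschitz2.
Context {R : realType} {D : nat}.
Set Implicit Arguments. Unset Strict Implicit.
Local Notation V := 'rV[R]_D.
Implicit Types (w v : V -> R) (x y z p : V) (j : 'rV[int]_D).

(* Doubling with a discrete second variable: [Psi (y, j)] is [w (y + j) - w y] minus penalties.
   Since [Psi (y, j) + Psi (y + e, j) = Psi (y, j + e) + Psi (y + e, j - e) - 2 K], at an almost
   maximal [(y, j)] the value at [(y + e, j)] is lower by about [2 K], contradicting Harnack. *)
Lemma discrete_lipschitz (n : V) (lam Lam CB CA gam cX : R) :
  dot n n = 1 -> 0 < lam -> 0 <= Lam -> 0 <= CB -> 0 < CA -> 0 < gam < 1 -> 0 <= cX ->
  exists s0 C : R, [/\ 0 < s0, 0 < C &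
    forall A B (X : 'I_D -> V -> R), hcoefs lam Lam CB CA gam A B -> zper A -> zper B ->
      (forall l x, genL A B (X l) x 0) -> (forall l, continuous (X l)) ->
      (forall l x, `|X l x - x 0 l| <= cX) ->
    forall w z (s W : R), s0 <= s -> s <= dot z n -> 0 < W -> lsol n A B w z s 0 0 ->
      (forall x, en (x - z) <= s -> `|w x| <= W) ->
      forall j, (forall i, `|(j 0 i)%:~R| <= s / (4 * (D%:R + 1))) ->
        w (z + zv R j) - w z <= C * W / s * \sum_i `|(j 0 i)%:~R|].
Proof.
move=> n1 lam0 Lam0 CB0 CA0 g01 cX0.
have [R0 [Ch [R01 Ch0 hH]]] := harnack n1 lam0 Lam0 CB0 CA0 g01 (@ltr01 R).
have Dn0 : 0 <= D%:R :> R by [].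
have Dp : 0 < D%:R + 1 :> R by rewrite ltr_wpDl.
have [C1 [C10 C1E]] : exists C1, 0 <= C1 /\ C1 = D%:R * (R0 + 2 * cX) ^+ 2.
  by eexists; split; last reflexivity; rewrite mulr_ge0 // sqr_ge0.
have [C2 [C20 C2E]] : exists C2, 0 < C2 /\ C2 = (D%:R + 1) ^+ 2 + 1 + Ch * (C1 + 2).
  by eexists; split; last reflexivity; apply: addr_gt0; [pos | apply: mulr_gt0 => //; lra].
exists (8 * (D%:R + 1) + 8 * (R0 + 2 * D%:R * cX)), (C2 * 64); split; [|by pos|].
  by apply: ltr_wpDr; [move: R01 cX0 Dn0 => ? ? ?; nng; lra | pos].
move=> A B X hAB pA pB hX cX' hcX w z s W ss sz W0 [cw Lw _] wW j jb.
have R00 : 0 <= R0 by move: R01; clear; lra.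
have Dc : 0 <= 2 * D%:R * cX by nng.
have s8 : 8 * (D%:R + 1) <= s by move: ss R00 Dc; clear; lra.
have sR : R0 + 2 * D%:R * cX <= s / 8 by move: ss Dn0; clear; lra.
have s0 : 0 < s by move: s8 Dn0; clear; lra.
have [J [JE J2 J0]] : exists J, [/\ J * (4 * (D%:R + 1)) = s, 2 <= J & 0 < J].
  exists (s / (4 * (D%:R + 1))); have q : 0 < 4 * (D%:R + 1) :> R by pos.
  split; [by rewrite divfK // gt_eqF | | by pos].
  by rewrite ler_pdivlMr //; move: s8; clear; lra.
have {}jb i : `|(j 0 i)%:~R : R| <= J.
  by apply: (le_trans (jb i)); rewrite -JE mulfK // gt_eqF //; pos.
(* Of order [W / s^2]: at an almost maximal point the localization is below [2 W], which confines
   the corrected coordinates of [y0] to distance [s / 8] from those of [z]. *)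
have [La [La0 LaE]] : exists La, 0 < La /\ La * s ^+ 2 = 128 * W.
  by exists (128 * W / s ^+ 2); split; [pos | rewrite divfK // gt_eqF // exprn_gt0].
pose K := C2 * La; have K0 : 0 < K by pos.
have KJ : 2 * W < K * (J ^+ 2 - 1).
  have h1 : 3 / 4 * J ^+ 2 <= J ^+ 2 - 1 by move: J2; clear; nra.
  have h2 : La * J ^+ 2 * (16 * (D%:R + 1) ^+ 2) = 128 * W by rewrite -LaE -JE; ring.
  have h3 : La * J ^+ 2 * (D%:R + 1) ^+ 2 < La * J ^+ 2 * C2.
    rewrite ltr_pM2l; last by pos.
    rewrite C2E -addrA ltrDl; apply: addr_gt0 => //; apply: mulr_gt0 => //.
    by move: C10; clear; lra.
  have h4 : K * (3 / 4 * J ^+ 2) <= K * (J ^+ 2 - 1) by rewrite ler_pM2l.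
  by move: h2 h3 h4 W0; rewrite /K; clear; lra.
(* Quadratic in the solutions [X l] rather than in the coordinates: once the squares around [y0] are
   split off, a combination of exact solutions remains. *)
pose loc y := \sum_l (X l y - X l z) ^+ 2.
pose pn j := \sum_i psi J (j 0 i)%:~R.
pose box j := forall i, `|(j 0 i)%:~R : R| <= J.
pose Psi (q : V * 'rV[int]_D) := w (q.1 + zv R q.2) - w q.1 - K * pn q.2 - La * loc q.1.
pose dom (q : V * 'rV[int]_D) := en (q.1 - z) <= s / 2 /\ box q.2.
have loc0 y : 0 <= loc y by apply: sumr_ge0 => l _; exact: sqr_ge0.
have pn0 j' : box j' -> 0 <= pn j' by move=> bj; apply: sumr_ge0 => i _; exact: psi_ge0.
have zvJ j' : box j' -> en (zv R j') <= s / 4.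
  move=> bj; apply: (@le_trans _ _ (D%:R * J)).
    by apply: en_le_coord => i; rewrite mxE.
  by move: JE J0; clear; lra.
have inb y j' (t : R) : en (y - z) <= t -> box j' -> t <= s * 3 / 4 -> en (y + zv R j' - z) <= s.
  move=> yt /zvJ h1 h2; rewrite addrAC (le_trans (en_triangle _ _)) //.
  by move: yt h1 h2; clear; lra.
have PsiM q : dom q -> Psi q <= 2 * W.
  case: q => y j' [/= h1 h2]; rewrite /Psi /=.
  have e1 : en (y + zv R j' - z) <= s by apply: (inb _ _ (s / 2)) => //; move: s0; clear; lra.
  have e2 : en (y - z) <= s by move: h1 s0; clear; lra.
  move: (mulr_ge0 (ltW K0) (pn0 _ h2)) (mulr_ge0 (ltW La0) (loc0 y)) (wW _ e1) (wW _ e2).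
  by rewrite !ler_norml; clear => ? ? /andP[? ?] /andP[? ?]; lra.
suff Psij : Psi (z, j) <= 0.
  move: Psij; rewrite /Psi /=.
  have -> : loc z = 0 by rewrite /loc big1 // => l _; rewrite subrr expr0n.
  rewrite mulr0 subr0 => h1.
  have h2 : K * pn j <= K * (2 * J * \sum_i `|(j 0 i)%:~R|).
    rewrite ler_pM2l // mulr_sumr; apply: ler_sum => i _; apply: psi_le; exact: ltW.
  have h3 : K * (2 * J * \sum_i `|(j 0 i)%:~R|) <= C2 * 64 * W / s * \sum_i `|(j 0 i)%:~R|.
    rewrite !mulrA; apply: ler_wpM2r; first by apply: sumr_ge0.
    have -> : C2 * 64 * W / s = C2 * La * (s / 2).
      have -> : W = La * s ^+ 2 / 128 by rewrite LaE; field.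
      by field; rewrite gt_eqF.
    rewrite /K -mulrA ler_pM2l; last by pos.
    by move: JE J0 Dn0; clear; nra.
  by move: h1 h2 h3; clear; lra.
rewrite leNgt; apply/negP => Pj0.
have domj : dom (z, j) by split => //=; rewrite subrr en0; nng.
have e0 : 0 < Num.min La (Psi (z, j) / 2) by rewrite lt_min La0 divr_gt0.
have [S [Sub [[y0 j0] [[/= y0b j0b] ]]]] := approx_sup domj e0 PsiM.
set ee := Num.min _ _ => Sap.
have eLa : ee <= La by rewrite ge_min lexx.
have Pq0 : 0 < Psi (y0, j0).
  have h1 := Sub _ domj; have h2 : ee <= Psi (z, j) / 2 by rewrite ge_min lexx orbT.
  by move: Sap h1 h2 Pj0; clear; lra.
clearbody ee.
have bw : w (y0 + zv R j0) - w y0 <= 2 * W.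
  have e1 : en (y0 + zv R j0 - z) <= s by apply: (inb _ _ (s / 2)) => //; move: s0; clear; lra.
  have e2 : en (y0 - z) <= s by move: y0b s0; clear; lra.
  by move: (wW _ e1) (wW _ e2); rewrite !ler_norml; clear => /andP[? ?] /andP[? ?]; lra.
have [PK PL] : K * pn j0 < 2 * W /\ La * loc y0 < 2 * W.
  move: Pq0; rewrite /Psi /=; have := mulr_ge0 (ltW K0) (pn0 _ j0b).
  by have := mulr_ge0 (ltW La0) (loc0 y0); move: bw; clear; lra.
have jin i : `|(j0 0 i)%:~R : R| <= J - 1.
  rewrite leNgt; apply/negP => h; move: PK; apply/negP; rewrite -leNgt.
  apply: (le_trans (ltW KJ)); rewrite ler_pM2l //.
  rewrite /pn (bigD1 i) //= -[X in X <= _]addr0; apply: lerD; first exact: psi_edge.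
  by apply: sumr_ge0 => k _; exact: psi_ge0.
have y0s : en (y0 - z) <= s / 4.
  pose v : V := \row_l (X l y0 - X l z).
  have vE : dot v v = loc y0 by apply: eq_bigr => l _; rewrite !mxE expr2.
  have vs : en v <= s / 8.
    rewrite en_le; last by nng.
    rewrite vE; apply: ltW; rewrite -(ltr_pM2l La0) (lt_le_trans PL) //.
    by have -> : La * (s / 8) ^+ 2 = La * s ^+ 2 / 64 by [field]; rewrite LaE; move: W0; clear; lra.
  have dv : en (y0 - z - v) <= D%:R * (2 * cX).
    apply: en_le_coord => i; rewrite !mxE.
    move: (hcX i y0) (hcX i z); rewrite !ler_norml => /andP[a1 a2] /andP[a3 a4].
    by apply/andP; move: a1 a2 a3 a4; clear; split; lra.
  have := en_triangle (y0 - z - v) v; rewrite subrK; move: dv vs sR R00; clear; lra.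
(* The second difference of [psi] is [-2] only off 0, so a nonzero coordinate is required; [j0 = 0]
   would make [Psi] nonpositive. *)
have j0n : exists i, j0 0 i != 0.
  apply: contrapT => h; have jz : j0 = 0.
    by apply/rowP => i; rewrite mxE; apply/eqP; apply: contrapT => hi; apply: h; exists i; apply/negP.
  move: Pq0; apply/negP; rewrite -leNgt /Psi /= jz.
  have -> : zv R (0 : 'rV[int]_D) = 0 by apply/rowP => i; rewrite !mxE.
  rewrite addr0 subrr sub0r; have h1 : 0 <= K * pn 0.
    by apply: mulr_ge0; [exact: ltW | apply: pn0 => i; rewrite mxE normr0 ltW].
  by have := mulr_ge0 (ltW La0) (loc0 y0); move: h1; clear; lra.
case: j0n => i0 ji0.
pose e : 'rV[int]_D := delta_mx 0 i0.
have zve : zv R e = evec R i0 by apply/rowP => i; rewrite !mxE; case: (_ && _).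
have ene : en (evec R i0) = 1 by rewrite /en evec_unit sqrtr1.
have ei i : `|(e 0 i)%:~R : R| <= 1 by rewrite mxE; case: (_ && _); rewrite ?normr1 ?normr0.
have bp : box (j0 + e).
  by move=> i; rewrite mxE intrD (le_trans (ler_normD _ _)) //; have := jin i; have := ei i; clear; lra.
have bm : box (j0 - e).
  by move=> i; rewrite !mxE intrB (le_trans (ler_normB _ _)) //; have := jin i; have := ei i; rewrite mxE; clear; lra.
have pn2 : pn (j0 + e) + pn (j0 - e) = 2 * pn j0 - 2.
  rewrite /pn -big_split /= (bigD1 i0) //= [in RHS](bigD1 i0) //=.
  have -> : \sum_(i < D | i != i0) (psi J ((j0 + e)%R 0 i)%:~R + psi J ((j0 - e)%R 0 i)%:~R) =
      2 * \sum_(i < D | i != i0) psi J (j0 0 i)%:~R.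
    rewrite mulr_sumr; apply: eq_bigr => i ii.
    by rewrite !mxE (negbTE ii) andbF oppr0 addr0; ring.
  by rewrite !mxE !eqxx /= psi_second //; ring.
pose y1 := y0 + evec R i0.
have y1z : en (y1 - z) <= s / 2.
  rewrite /y1 addrAC (le_trans (en_triangle _ _)) // ene.
  by move: y0s s8 Dn0; clear; lra.
have step : Psi (y1, j0) <= S - 2 * K + ee.
  have d1 := Sub (y0, j0 + e) (conj y0b bp); have d2 := Sub (y1, j0 - e) (conj y1z bm).
  have E1 : Psi (y0, j0) + Psi (y1, j0) = Psi (y0, j0 + e) + Psi (y1, j0 - e) - 2 * K.
    rewrite /Psi /= !zvD zvN zve.
    have -> : y1 + zv R j0 = y0 + (zv R j0 + evec R i0) by rewrite /y1; apply/rowP => i; rewrite !mxE; ring.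
    have -> : y1 + (zv R j0 - evec R i0) = y0 + zv R j0.
      by rewrite /y1; apply/rowP => i; rewrite !mxE; ring.
    have E2 : K * pn (j0 + e) + K * pn (j0 - e) = 2 * (K * pn j0) - 2 * K.
      by rewrite -mulrDr pn2; ring.
    by move: E2; clear; lra.
  by move: d1 d2 E1 Sap; clear; lra.
pose bl l := La * (2 * (X l y0 - X l z)).
pose c0 := S + K * pn j0 + C1 * La + La * \sum_l ((X l y0 - X l z) ^+ 2 - 2 * X l y0 * (X l y0 - X l z)).
(* The slack [S - Psi] corrected into an exact solution: the squares [(X l y - X l y0)^2] are
   removed and replaced by their bound [C1] on the Harnack ball, which keeps [U] nonnegative
   there. *)
pose U y := c0 - (w (y + zv R j0) - w y) + \sum_l bl l * X l y.
have UE y : U y = S - Psi (y, j0) + La * (C1 - \sum_l (X l y - X l y0) ^+ 2).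
  rewrite /U /c0 /Psi /= /bl /loc.
  have -> : \sum_l La * (2 * (X l y0 - X l z)) * X l y = La * \sum_l 2 * (X l y0 - X l z) * X l y.
    by rewrite mulr_sumr; apply: eq_bigr => l _; rewrite !mulrA.
  have -> : \sum_l (X l y - X l z) ^+ 2 = \sum_l (X l y - X l y0) ^+ 2 +
      \sum_l 2 * (X l y0 - X l z) * X l y +
      \sum_l ((X l y0 - X l z) ^+ 2 - 2 * X l y0 * (X l y0 - X l z)).
    by rewrite -!big_split; apply: eq_bigr => l _ /=; ring.
  ring.
have nearS y : en (y - y0) <= R0 -> en (y - z) <= s / 2.
  have := en_sub_triangle y y0 z; move: y0s sR Dc s0; clear; lra.
have U0 x : hball n y0 R0 x -> 0 <= U x.
  move=> [xr _]; rewrite UE; have := Sub (x, j0) (conj (nearS _ xr) j0b).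
  have : \sum_l (X l x - X l y0) ^+ 2 <= C1.
    rewrite C1E mulr_natl -[D in X in _ <= X]card_ord -sumr_const; apply: ler_sum => l _.
    rewrite -(real_normK (num_real (_ - _))) lerXn2r ?nnegrE //; first by nng.
    have := hcX l x; have := hcX l y0; have := le_trans (coord_le_en (x - y0) l) xr.
    rewrite !mxE !ler_norml => /andP[a1 a2] /andP[a3 a4] /andP[a5 a6].
    by apply/andP; move: a1 a2 a3 a4 a5 a6; clear; split; lra.
  move=> h1 h2; have : 0 <= La * (C1 - \sum_l (X l x - X l y0) ^+ 2).
    by rewrite mulr_ge0 ?subr_ge0 // ltW.
  by move: h2; clear; lra.
have Uy0 : U y0 <= La + La * C1.
  rewrite UE big1 ?subr0; last by move=> l _; rewrite subrr expr0n.
  by move: Sap eLa; clear; lra.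
have dpos (x y : V) (t : R) : en (x - y) <= t -> t < dot y n -> 0 < dot x n.
  move=> h1 h2; have := dot_le_en (y - x) n.
  rewrite (en_n n1) mulr1 en_subC dotDl dotNl ler_norml => /andP[_ h].
  by move: h h1 h2; clear; lra.
have half : s / 2 < dot z n by move: sz s0; clear; lra.
have y0n : 0 <= dot y0 n by apply: ltW; apply: (dpos _ z (s / 2)).
have inw x : en (x - y0) <= R0 -> en (x - z) < s /\ en (x + zv R j0 - z) < s.
  move=> xr; have h := nearS _ xr; split; first by move: h s0; clear; lra.
  have h1 : en (x - z) <= s * 3 / 8.
    by have := en_sub_triangle x y0 z; move: xr y0s sR Dc; clear; lra.
  have := zvJ _ j0b; have := en_triangle (x - z) (zv R j0); rewrite addrAC.
  by move: h1 s0; clear; lra.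
have q34 x : en (x - z) < s -> 0 <= dot x n.
  move=> h; rewrite leNgt; apply/negP => xn; have := dot_le_en (z - x) n.
  rewrite (en_n n1) mulr1 en_subC dotDl dotNl ler_norml => /andP[_ h2].
  by move: h2 h xn sz; clear; lra.
have q35 x : en (x - z) < s -> 0 < dot x n.
  move=> h; rewrite ltNge; apply/negP => xn; have := dot_le_en (z - x) n.
  rewrite (en_n n1) mulr1 en_subC dotDl dotNl ler_norml => /andP[_ h2].
  by move: h2 h xn sz; clear; lra.
have lU : lsol n A B U y0 R0 0 La.
  split=> [|x xr xn|x xr xn].
  - apply: ctnD; last by apply: ctn_continuous; exact: lincomb_continuous.
    apply: ctnB; first exact: ctn_cst.
    apply: ctnB.
      apply: (@ctn_pre _ _ _ (hball n y0 R0) (hball n z s) (fun x => x + zv R j0) w) => //.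
        by move=> x; apply: continuousD; [exact: cvg_id | exact: cst_continuous].
      by move=> x [/inw [_ h] _]; split; [exact: ltW | exact: q34].
    apply: ctn_sub cw => x [/inw [h _] _]; split; [exact: ltW | exact: q34].
  - have [h1 h2] := inw x (ltW xr).
    have [a1 a1E L1] := Lw _ h1 (q35 _ h1); have [a2 a2E L2] := Lw _ h2 (q35 _ h2).
    exists 0; first by rewrite normr0.
    have := genLD (genLB (genL_cst A B c0 x) (genLB (genL_zper pA pB L2) L1))
      (genL_lincomb bl (fun l => hX l x)).
    move: a1E a2E; rewrite !normr_le0 => /eqP -> /eqP ->.
    by rewrite !subr0 addr0.
  have h := dpos x z (s / 2) (nearS _ (ltW xr)) half.
  by rewrite xn ltxx in h.
have y1b : hball n y0 1 y1.
  split; first by rewrite /y1 addrAC subrr add0r ene.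
  by apply: ltW; apply: (dpos _ z (s / 2)).
have hfin := hH A B U y0 La hAB y0n La0 lU U0 y1 y1b.
(* [U] is of order [La] at [y0] but at least about [2 K] at the neighbour [y1]; [K = C2 La] was
   chosen beyond what Harnack permits. *)
have lowU : 2 * K - ee <= U y1.
  have hR : hball n y0 R0 y1 by case: y1b => h1 h2; split => //; apply: le_trans R01.
  rewrite UE; have : \sum_l (X l y1 - X l y0) ^+ 2 <= C1.
    rewrite C1E mulr_natl -[D in X in _ <= X]card_ord -sumr_const; apply: ler_sum => l _.
    rewrite -(real_normK (num_real (_ - _))) lerXn2r ?nnegrE //; first by nng.
    have := hcX l y1; have := hcX l y0; have := le_trans (coord_le_en (y1 - y0) l) (proj1 hR).
    rewrite !mxE !ler_norml => /andP[a1 a2] /andP[a3 a4] /andP[a5 a6].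
    by apply/andP; move: a1 a2 a3 a4 a5 a6; clear; split; lra.
  move=> h1; have : 0 <= La * (C1 - \sum_l (X l y1 - X l y0) ^+ 2).
    by rewrite mulr_ge0 ?subr_ge0 // ltW.
  by move: step; clear; lra.
have h1 : Ch * (U y0 + La) <= Ch * (La * (C1 + 2)).
  by rewrite ler_pM2l //; move: Uy0; clear; lra.
have h2 : 0 < La * ((D%:R + 1) ^+ 2 + 1) by pos.
have h3 : 0 <= Ch * (La * (C1 + 2)) by nng.
have h4 : La <= La * ((D%:R + 1) ^+ 2 + 1) by rewrite ler_peMr ?(ltW La0) // lerDr sqr_ge0.
by move: hfin lowU h1 h2 h3 h4 eLa; rewrite /K C2E; clear; lra.
Qed.
End DiscreteLipschitz2.

Section InteriorOscillation.
Context {R : realType} {D : nat}.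
Set Implicit Arguments. Unset Strict Implicit.
Local Notation V := 'rV[R]_D.
Implicit Types (w v : V -> R) (x y z p : V) (j : 'rV[int]_D).

Lemma integer_part y z : exists j, en (y - zv R j - z) <= D%:R /\
  forall i, `|(j 0 i)%:~R| <= en (y - z) + 1.
Proof.
pose j : 'rV[int]_D := \row_i Num.floor ((y - z) 0 i).
have jE i : (j 0 i)%:~R <= (y - z) 0 i < (j 0 i)%:~R + 1.
  rewrite [j 0 i]mxE; have := real_floor_itv (num_real ((y - z) 0 i)).
  by rewrite intrD.
exists j; split=> [|i].
  rewrite -[D%:R]mulr1; apply: en_le_coord => i.
  have := jE i; rewrite !mxE => /andP[? ?]; rewrite ger0_norm; lra.
have := coord_le_en (y - z) i; have := jE i => /andP[? ?].
by rewrite !ler_norml => /andP[? ?]; apply/andP; split; lra.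
Qed.

Lemma lsol_ball_sub (n : V) A B w y z (r s : R) : dot n n = 1 -> s <= dot z n ->
  en (y - z) + r <= s -> lsol n A B w z s 0 0 -> lsol n A B w y r 0 0 /\ r <= dot y n.
Proof.
move=> n1 sz h lw; split; first exact: lsol_sub h lw.
have := dot_le_en (z - y) n; rewrite (en_n n1) mulr1 en_subC dotDl dotNl ler_norml => /andP[_ h2].
by move: h h2 sz; clear; lra.
Qed.

(** An integer translation brings [x] within bounded distance of [z], at the cost given by
    [discrete_lipschitz]. The bounded displacement left over is treated by Harnack for
    [w xs + sg - w], where [xs] maximizes [w] on a ball about [z]. *)
Lemma interior_osc (n : V) (lam Lam CB CA gam cX : R) :
  dot n n = 1 -> 0 < lam -> 0 <= Lam -> 0 <= CB -> 0 < CA -> 0 < gam < 1 -> 0 <= cX ->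
  exists s0 C : R, [/\ 0 < s0, 0 < C &
    forall A B (X : 'I_D -> V -> R), hcoefs lam Lam CB CA gam A B -> zper A -> zper B ->
      (forall l x, genL A B (X l) x 0) -> (forall l, continuous (X l)) ->
      (forall l x, `|X l x - x 0 l| <= cX) ->
    forall w z (s W : R), s0 <= s -> s <= dot z n -> 0 < W -> lsol n A B w z s 0 0 ->
      (forall x, en (x - z) <= s -> `|w x| <= W) ->
      forall x, en (x - z) + 1 <= s / (8 * (D%:R + 1)) ->
        w x - w z <= C * W / s * (en (x - z) + 1)].
Proof.
move=> n1 lam0 Lam0 CB0 CA0 g01 cX0.
have [s1 [C1 [s10 C10 hD]]] := discrete_lipschitz n1 lam0 Lam0 CB0 CA0 g01 cX0.
have Dn0 : 0 <= D%:R :> R by [].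
pose Rb : R := D%:R + 1; have Rb0 : 0 < Rb by rewrite ltr_wpDl.
have Rb20 : 0 < 2 * Rb by pos.
have [R0 [Ch [R01 Ch0 hH]]] := harnack n1 lam0 Lam0 CB0 CA0 g01 Rb20.
have R00 : 0 < R0 by apply: lt_le_trans R01.
pose q := R0 + Rb + 1; have q0 : 0 < q by pos.
exists (2 * s1 + 8 * Rb * q + 4 * (R0 + 2 * Rb)), (2 * C1 * D%:R + 4 * C1 * (D%:R + 1) * q * Ch + 1); split.
- by pos.
- by apply: ltr_wpDl => //; nng.
move=> A B X hAB pA pB hX cX' hcX w z s W ss sz W0 lw wW.
have rq : 0 < 8 * Rb * q by pos.
have s0 : 0 < s by move: ss s10 rq R00 Rb0; clear; lra.
have s12 : s1 <= s / 2 by move: ss rq R00 Rb0; clear; lra.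
have sR : R0 + 2 * Rb <= s / 4 by move: ss rq s10; clear; lra.
have sq : q <= s / 2 / (4 * Rb).
  rewrite ler_pdivlMr; last by pos.
  by move: ss s10 R00 Rb0; clear; lra.
have [sg [sgE sg0]] : exists sg, sg = C1 * W / (s / 2) * (Rb * q) /\ 0 < sg.
  by eexists; split; [reflexivity | pos].
have dl y j : en (y - z) <= s / 2 -> (forall i, `|(j 0 i)%:~R : R| <= s / 2 / (4 * Rb)) ->
    w (y + zv R j) - w y <= C1 * W / (s / 2) * \sum_i `|(j 0 i)%:~R|.
  move=> yz jb; have hh : en (y - z) + s / 2 <= s by move: yz; clear; lra.
  have [ly yn] := lsol_ball_sub n1 sz hh lw.
  apply: (hD A B X hAB pA pB hX cX' hcX w y (s / 2) W s12 yn W0 ly) => // x xy.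
  by apply: wW; have := en_sub_triangle x y z; move: xy yz; clear; lra.
have sumq j (t : R) : (forall i, `|(j 0 i)%:~R : R| <= t) -> \sum_i `|(j 0 i)%:~R| <= D%:R * t.
  move=> h; apply: (@le_trans _ _ (\sum_(i < D) t)); first by apply: ler_sum => i _.
  by rewrite sumr_const card_ord mulr_natl.
have inn y : en (y - z) < s -> 0 < dot y n.
  move=> h; have := dot_le_en (z - y) n; rewrite (en_n n1) mulr1 en_subC dotDl dotNl ler_norml.
  by move=> /andP[_ h2]; move: h h2 sz; clear; lra.
have DRb : D%:R <= Rb by rewrite lerDl.
have cell x : en (x - z) <= Rb -> w x - w z <= 2 * Ch * sg.
  move=> xz.
  have sub1 : hball n z Rb `<=` hball n z s.
    by apply: hball_sub; rewrite subrr en0; move: sR R00 s0 Rb0; clear; lra.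
  have zb : hball n z Rb z by split; [rewrite subrr en0 ltW | move: sz s0; clear; lra].
  have cw : ctn (hball n z Rb) w by case: lw => cw _ _; exact: ctn_sub sub1 cw.
  have [xs [xsr xsn] mx] := ctn_max (@compact_hball _ _ n z Rb) (ex_intro _ z zb) cw.
  have inb y : en (y - z) <= Rb -> hball n z Rb y.
    by move=> h; split => //; apply: ltW; apply: inn; move: h sR R00 s0 Rb0; clear; lra.
  (* Points outside the ball are brought back into it by an integer translation, whose cost is at
     most [sg]; so [xs] is an almost maximum on the whole Harnack ball. *)
  have wle y : en (y - xs) <= R0 -> w y <= w xs + sg.
    move=> yx; have yz : en (y - z) <= R0 + Rb.
      by have := en_sub_triangle y xs z; move: yx xsr; clear; lra.
    have [j [h1 h2]] := integer_part y z.
    have h3 i : `|(j 0 i)%:~R : R| <= q by apply: (le_trans (h2 i)); rewrite lerD2r.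
    have := dl (y - zv R j) j _ _; rewrite subrK => h4.
    have h5 : w y - w (y - zv R j) <= C1 * W / (s / 2) * \sum_i `|(j 0 i)%:~R|.
      apply: h4; first by move: h1 DRb sR R00 Rb0; clear; lra.
      by move=> i; apply: le_trans sq.
    have h6 : C1 * W / (s / 2) * \sum_i `|(j 0 i)%:~R| <= sg.
      rewrite sgE; apply: ler_wpM2l; first by nng.
      by apply: (le_trans (sumq _ _ h3)); rewrite ler_pM2r.
    have := mx _ (inb _ (le_trans h1 DRb)); move: h5 h6; clear; lra.
  have hh : en (xs - z) + R0 <= s by move: xsr sR R00 Rb0 s0; clear; lra.
  have [lx _] := lsol_ball_sub n1 sz hh lw.
  have lU : lsol n A B (fun y => w xs + sg - w y) xs R0 0 sg.
    case: lx => c1 c2 c3; split.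
    - by apply: ctnB => //; exact: ctn_cst.
    - move=> y h1 h2; have [a a0 La] := c2 y h1 h2; exists (0 - a); last exact: genLB (genL_cst _ _ _ _) La.
      by rewrite sub0r normrN.
    move=> y yr yn; have h : 0 < dot y n.
      by apply: inn; have := en_sub_triangle y xs z; move: yr xsr hh sR; clear; lra.
    by rewrite yn ltxx in h.
  have U0 y : hball n xs R0 y -> 0 <= w xs + sg - w y by move=> [/wle h _]; rewrite subr_ge0.
  have zb2 : hball n xs (2 * Rb) z.
    by split; [rewrite en_subC; move: xsr Rb0; clear; lra | move: sz s0; clear; lra].
  have := hH A B _ xs sg hAB xsn sg0 lU U0 z zb2.
  have := mx _ (inb _ xz); move: sg0 => /=; clear; lra.
move=> x xr; have [j [h1 h2]] := integer_part x z.
have h3 i : `|(j 0 i)%:~R : R| <= s / 2 / (4 * Rb).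
  apply: (le_trans (h2 i)); apply: (le_trans xr); rewrite le_eqVlt; apply/orP; left; apply/eqP.
  by rewrite /Rb; field; rewrite gt_eqF // -/Rb.
have h4 := dl (x - zv R j) j _ h3; rewrite subrK in h4.
have h5 : w x - w (x - zv R j) <= C1 * W / (s / 2) * \sum_i `|(j 0 i)%:~R|.
  by apply: h4; move: h1 DRb sR R00 Rb0; clear; lra.
have h6 : C1 * W / (s / 2) * \sum_i `|(j 0 i)%:~R| <= C1 * W / (s / 2) * (D%:R * (en (x - z) + 1)).
  by apply: ler_wpM2l; [nng | exact: sumq].
have h7 := cell _ (le_trans h1 DRb).
have e1 : 1 <= en (x - z) + 1 by rewrite lerDr en_ge0.
have -> : (2 * C1 * D%:R + 4 * C1 * (D%:R + 1) * q * Ch + 1) * W / s * (en (x - z) + 1) =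
   C1 * W / (s / 2) * (D%:R * (en (x - z) + 1)) + (2 * Ch * sg + W / s) * (en (x - z) + 1).
  by rewrite sgE /Rb; field; rewrite gt_eqF.
have h8 : 2 * Ch * sg + W / s <= (2 * Ch * sg + W / s) * (en (x - z) + 1).
  by rewrite ler_peMr //; nng.
have h9 : 0 < W / s by pos.
by move: h5 h6 h7 h8 h9; clear; lra.
Qed.
End InteriorOscillation.

(** * Diophantine approximation of an irrational direction *)

Section Diophantine.
Context {R : realType}.
Set Implicit Arguments. Unset Strict Implicit.

Definition irrational_real (a : R) := forall (q : nat) (p : int), (0 < q)%N -> q%:R * a != p%:~R.

Lemma dist_int_pos (a : R) : irrational_real a -> forall Q : nat,
  exists2 e : R, 0 < e & forall q p, (0 < q <= Q)%N -> e <= `|q%:R * a - p%:~R|.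
Proof.
move=> ia; elim=> [|Q [e e0 he]].
  by exists 1 => // q p; case: q.
pose x := Q.+1%:R * a; have /andP[f1 f2] := real_floor_itv (num_real x).
rewrite intrD in f2; set m := (Num.floor x)%:~R in f1 f2.
have f3 : m < x by rewrite lt_neqAle f1 andbT eq_sym; exact: ia.
exists (Num.min e (Num.min (x - m) (m + 1 - x))).
  by rewrite !lt_min e0 !subr_gt0 f3.
move=> q p /andP[q0]; rewrite leq_eqVlt => /orP[/eqP ->|qQ]; last first.
  by apply: (@le_trans _ _ e); [rewrite ge_min lexx | apply: he; rewrite q0].
rewrite !ge_min -/x; have [pm|pm] := leP p (Num.floor x).
  have h : p%:~R <= m by rewrite ler_int.
  apply/orP; right; apply/orP; left; rewrite ger0_norm; move: h f3; clear; lra.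
have h : m + 1 <= p%:~R :> R by rewrite /m -[1]/(1%:~R) -intrD ler_int; move: pm; clear; lia.
apply/orP; right; apply/orP; right; rewrite ler0_norm; move: h f2; clear; lra.
Qed.

(** Pigeonhole: the [M + 1] fractional parts of [i a], [0 <= i <= M], fall into [M] intervals of
    length [1 / M]. *)
Lemma dirichlet (a : R) (M : nat) : (0 < M)%N ->
  exists (q : nat) (p : int), (0 < q <= M)%N /\ `|q%:R * a - p%:~R| < M%:R^-1.
Proof.
move=> M0; pose fr (i : nat) := i%:R * a - (Num.floor (i%:R * a))%:~R.
have fr01 i : 0 <= fr i < 1.
  have /andP[f1 f2] := real_floor_itv (num_real (i%:R * a)); rewrite intrD in f2.
  by rewrite /fr; apply/andP; split; lra.
have M0' : 0 < M%:R :> R by rewrite ltr0n.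
have lt (i : 'I_M.+1) : (Num.truncn (M%:R * fr i) < M)%N.
  have /andP[f1 f2] := fr01 i.
  rewrite truncn_lt_nat ?mulr_ge0 //.
  by rewrite -[X in _ < X]mulr1 ltr_pM2l.
pose f (i : 'I_M.+1) : 'I_M := Ordinal (lt i).
have /injectivePn : ~~ injectiveb f.
  by apply/negP => /injectiveP /leq_card; rewrite !card_ord ltnn.
case=> i [i' ii' /(congr1 val) /= E].
have key (k k' : 'I_M.+1) : (k < k')%N -> Num.truncn (M%:R * fr k) = Num.truncn (M%:R * fr k') ->
    exists (q : nat) (p : int), (0 < q <= M)%N /\ `|q%:R * a - p%:~R| < M%:R^-1.
  move=> kk E'.
  exists (k' - k)%N, (Num.floor (k'%:R * a) - Num.floor (k%:R * a)); split.
    by rewrite subn_gt0 kk (leq_trans (leq_subr _ _)) // -ltnS.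
  rewrite natrB; last exact: ltnW.
  have -> : (k'%:R - k%:R) * a - (Num.floor (k'%:R * a) - Num.floor (k%:R * a))%:~R = fr k' - fr k.
    by rewrite intrB /fr; ring.
  have b (l : nat) : (Num.truncn (M%:R * fr l))%:R <= M%:R * fr l < (Num.truncn (M%:R * fr l))%:R + 1.
    by rewrite natr1; apply: truncn_itv; rewrite mulr_ge0 //; case/andP: (fr01 l).
  have := b k; have := b k'; rewrite -E' => /andP[? ?] /andP[? ?].
  rewrite -(ltr_pM2l M0') divff ?gt_eqF // -[X in X * _](ger0_norm (ltW M0')) -normrM.
  by rewrite ltr_norml; apply/andP; split; lra.
have : (i < i')%N || (i' < i)%N by rewrite -neq_ltn.
by case/orP => h; [exact: (key _ _ h) | exact: (key _ _ h (esym E))].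
Qed.

(** Dividing by the gcd only improves the approximation, and [dist_int_pos] keeps the reduced
    denominator above [Q0]. *)
Lemma good_approx (a : R) (Q0 : nat) : irrational_real a ->
  exists (q : nat) (p : int), [/\ (Q0 < q)%N, coprimez q p & `|q%:R * a - p%:~R| <= q%:R^-1].
Proof.
move=> ia; have [e e0 he] := dist_int_pos ia Q0.
pose M := (Num.bound e^-1).+1.
have Me : M%:R^-1 < e.
  rewrite -[e]invrK ltf_pV2 ?posrE ?invr_gt0 ?ltr0n //.
  apply: (@lt_trans _ _ (Num.bound e^-1)%:R); last by rewrite ltr_nat.
  by apply: archi_boundP; rewrite invr_ge0 ltW.
have [q [p [/andP[q0 qM] h]]] := dirichlet a (ltn0Sn (Num.bound e^-1)).
pose g := gcdz q p; have g0 : g != 0 by rewrite gcdz_eq0 negb_and; apply/orP; left; lia.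
have [q' qE] : exists q' : nat, q = (q' * `|g|)%N.
  by have /dvdnP := dvdn_gcdl q `|p|%N; case=> q' E; exists q'.
have [p' pE] : exists p' : int, p = p' * g by have /dvdzP := dvdz_gcdr q p.
have gp : (0 < `|g|)%N by rewrite absz_gt0.
have gE : g = `|g|%N by [].
have q'0 : (0 < q')%N by move: q0; rewrite qE muln_gt0 => /andP[].
have le1 : `|q'%:R * a - p'%:~R| <= `|q%:R * a - p%:~R|.
  have -> : q%:R * a - p%:~R = (`|g|%N)%:R * (q'%:R * a - p'%:~R).
    by rewrite pE {2}gE qE natrM intrM; ring.
  by rewrite normrM ger0_norm // ler_peMl // ler1n.
have q'q : (q' <= q)%N by rewrite qE leq_pmulr.
exists q', p'; split.
- rewrite ltnNge; apply/negP => qQ; have := he q' p'; rewrite q'0 qQ => /(_ isT) h2.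
  by move: (le_trans h2 le1) (lt_trans h Me); clear; lra.
- have gn : gcdn q `|p| = `|g|%N by [].
  have : (gcdn q' `|p'| * `|g| == 1 * `|g|)%N.
    by rewrite muln_gcdl -qE -abszM -pE gn mul1n.
  by rewrite eqn_pmul2r.
apply: (le_trans le1); apply: (le_trans (ltW h)); rewrite lef_pV2 ?posrE ?ltr0n //.
by rewrite ler_nat (leq_trans q'q).
Qed.
End Diophantine.

Section Diophantine2.
Context {R : realType}.
Set Implicit Arguments. Unset Strict Implicit.

(** If all ratios to a nonzero coordinate were rational, a common denominator would exhibit [n] as a
    multiple of an integer vector. *)
Lemma irrational_ratio (D : nat) (n : 'rV[R]_D) :
  ~ (exists (c : R) (k : 'rV[int]_D), n = c *: map_mx intr k) ->
  exists i j, n 0 j != 0 /\ irrational_real (n 0 i / n 0 j).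
Proof.
move=> irr.
have [j nj] : exists j, n 0 j != 0.
  apply: contrapT => hj; apply: irr; exists 0, 0; rewrite scale0r.
  by apply/rowP => i; rewrite mxE; apply/eqP; apply: contrapT => hi; apply: hj; exists i; apply/negP.
apply: contrapT => h; apply: irr.
have hq i : exists qp : nat * int, (0 < qp.1)%N /\ qp.1%:R * (n 0 i / n 0 j) = qp.2%:~R.
  apply: contrapT => hi; apply: h; exists i, j; split=> // q p q0.
  by apply/negP => /eqP e; apply: hi; exists (q, p).
have [f hf] := choice hq.
pose Q := (\prod_i (f i).1)%N.
pose k : 'rV[int]_D := \row_i ((f i).2 * (\prod_(l | l != i) (f l).1)%N%:Z).
exists (n 0 j / Q%:R), k; apply/rowP => i; rewrite !mxE.
have Q0 : Q%:R != 0 :> R.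
  by rewrite pnatr_eq0 -lt0n prodn_gt0 // => l; case: (hf l).
have [q0 E] := hf i.
have q0' : (f i).1%:R != 0 :> R by rewrite pnatr_eq0 -lt0n.
have QE : Q%:R = (f i).1%:R * (\prod_(l | l != i) (f l).1)%N%:R :> R.
  by rewrite -natrM /Q (bigD1 i).
have P0 : (\prod_(l | l != i) (f l).1)%N%:R != 0 :> R.
  by move: Q0; rewrite QE mulf_eq0 negb_or => /andP[].
rewrite intrM -E -pmulrn QE; set P := (\prod_(l | l != i) _)%N%:R in P0 *.
by field; rewrite nj q0' P0.
Qed.

Lemma residue (p : int) (q : nat) (m : int) : (0 < q)%N -> coprimez q p ->
  exists (a : nat) (b : int), (a < q)%N /\ a%:Z * p + b * q%:Z = m.
Proof.
move=> q0 /eqP cop; have [u [v uv]] := Bezoutz q p; rewrite cop in uv.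
have q0z : q%:Z != 0 by lia.
pose a := ((v * m) %% q%:Z)%Z.
have a0 : 0 <= a by apply: modz_ge0.
have aq : a < q%:Z by apply: ltz_pmod; lia.
have aE : v * m = (v * m %/ q%:Z)%Z * q%:Z + a by exact: divz_eq.
exists `|a|%N, (u * m + (v * m %/ q%:Z)%Z * p); split; first by lia.
rewrite gez0_abs //; move: aE; set X := (_ %/ _)%Z => aE.
have -> : a = v * m - X * q%:Z by rewrite aE addrAC subrr add0r.
transitivity ((u * q%:Z + v * p) * m); first by ring.
by rewrite uv mul1r.
Qed.

(** Two coordinates suffice to adjust the height. For [0 <= a < q], replacing [al] by [p / q] in
    [a al + b] costs at most [1 / q], and the numbers [(a p + b q) / q] run over all multiples of
    [1 / q] as [p] and [q] are coprime. Thus every height is met up to order [1 / q] by coefficients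
    of order [q], and [T = q]. *)
Lemma dio (D : nat) (n : 'rV[R]_D) : dot n n = 1 ->
  ~ (exists (c : R) (k : 'rV[int]_D), n = c *: map_mx intr k) ->
  exists2 C : R, 0 < C & forall T0 : R, exists2 T : R, T0 <= T /\ 1 <= T &
    forall z : 'rV[R]_D, exists k : 'rV[int]_D, en (zv R k - z) <= C * T /\
      0 < dot (zv R k) n - dot z n <= C / T.
Proof.
move=> n1 irr; have [i [j [nj ia]]] := irrational_ratio irr.
set nn := n 0 j in nj ia; have nj0 : 0 < `|nn| by rewrite normr_gt0.
set al := n 0 i / nn in ia.
have Dn0 : 0 <= D%:R :> R by [].
pose C := 2 * D%:R + 2 * D%:R / `|nn| + `|al| + 10 + 5 * `|nn|.
have C0 : 0 < C by apply: ltr_wpDr => //; apply: ltr_wpDl => //; nng.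
exists C => // T0.
have [q [p [qb cop ap]]] := good_approx (Num.bound `|T0|) ia.
have q0 : (0 < q)%N by apply: leq_ltn_trans qb.
have q1 : 1 <= q%:R :> R by rewrite ler1n.
have q0R : 0 < q%:R :> R by rewrite ltr0n.
exists q%:R; first split => //.
  apply: (le_trans (ler_norm _)); apply: ltW; apply: (lt_trans (archi_boundP (normr_ge0 _))).
  by rewrite ltr_nat.
move=> z; have [k0 [h1 _]] := integer_part z 0; rewrite subr0 in h1.
(* The target is raised by [3 |n_j| / q], more than the error [2 |n_j| / q], to make the excess
   height strictly positive. *)
pose be := (dot z n - dot (zv R k0) n) / nn + 3 * `|nn| / (q%:R * nn).
have /andP[m1 m2] := real_floor_itv (num_real (q%:R * be)); rewrite intrD in m2.
have [a [b [aq ab]]] := residue (Num.floor (q%:R * be)) q0 cop.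
pose k := k0 + a%:Z *: delta_mx 0 i + b *: delta_mx 0 j.
have zk : zv R k = zv R k0 + a%:R *: evec R i + b%:~R *: evec R j.
  by rewrite /k !zvD; congr (_ + _ + _); apply/rowP => l; rewrite !mxE intrM; case: (_ && _).
have qn0 : q%:R != 0 :> R by rewrite gt_eqF.
have sE : dot (zv R k) n = dot (zv R k0) n + nn * (a%:R * al + b%:~R).
  by rewrite zk !dotDl !dotZl !(dotC (evec R _)) !dot_evec -/nn /al; field.
have abR : a%:R * p%:~R + b%:~R * q%:R = (Num.floor (q%:R * be))%:~R :> R.
  by rewrite -ab intrD !intrM.
have err : `|a%:R * al + b%:~R - be| <= 2 / q%:R.
  have e1 : `|a%:R * (q%:R * al - p%:~R)| <= 1.
    rewrite normrM ger0_norm //; apply: (@le_trans _ _ (q%:R * q%:R^-1)).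
      by apply: ler_pM => //; rewrite ler_nat ltnW.
    by rewrite divff.
  rewrite ler_pdivlMr // -[X in _ * X](ger0_norm (ltW q0R)) -normrM.
  have -> : (a%:R * al + b%:~R - be) * q%:R =
     a%:R * (q%:R * al - p%:~R) + ((Num.floor (q%:R * be))%:~R - q%:R * be).
    by rewrite -abR; ring.
  by move: e1; rewrite !ler_norml => /andP[? ?]; apply/andP; split; lra.
exists k; split; last first.
  have -> : dot (zv R k) n - dot z n = nn * (a%:R * al + b%:~R - be) + 3 * (`|nn| / q%:R).
    by rewrite sE /be; field; rewrite qn0 nj.
  have e2 : `|nn * (a%:R * al + b%:~R - be)| <= 2 * (`|nn| / q%:R).
    by rewrite normrM [X in _ <= X]mulrCA; apply: ler_wpM2l.
  have e3 : 0 < `|nn| / q%:R by pos.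
  have e4 : 5 * (`|nn| / q%:R) <= C / q%:R.
    rewrite mulrA ler_wpM2r ?invr_ge0 // /C lerDr; nng.
  by move: e2; rewrite ler_norml => /andP[? ?]; apply/andP; split; lra.
have lz : `|dot z n - dot (zv R k0) n| <= D%:R.
  rewrite -dotNl -dotDl; apply: (le_trans (dot_le_en _ _)).
  by rewrite (en_n n1) mulr1.
have bel : `|be| <= D%:R / `|nn| + 3.
  apply: (le_trans (ler_normD _ _)); apply: lerD.
    by rewrite normrM normfV; apply: ler_wpM2r => //; rewrite invr_ge0.
  rewrite !normrM normfV !normrM normr_id (ger0_norm (ltW q0R)).
  have -> : `|3| * `|nn| / (q%:R * `|nn|) = 3 / q%:R :> R.
    by rewrite ger0_norm //; field; rewrite qn0 gt_eqF.
  by rewrite ler_pdivrMr //; move: q1; clear; lra.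
have bl : `|b%:~R : R| <= D%:R / `|nn| + 3 + q%:R * `|al| + 2.
  have -> : b%:~R = (a%:R * al + b%:~R - be) + be - a%:R * al :> R by ring.
  apply: (le_trans (ler_normB _ _)).
  have e5 : `|a%:R * al| <= q%:R * `|al|.
    by rewrite normrM ger0_norm // ler_wpM2r // ler_nat ltnW.
  have e6 := ler_normD (a%:R * al + b%:~R - be) be.
  have e7 : 2 / q%:R <= 2 :> R by rewrite ler_pdivrMr //; move: q1; clear; lra.
  by move: e5 e6 e7 err bel; clear; lra.
have ee l : en (evec R l) = 1 :> R by move=> *; rewrite /en evec_unit sqrtr1.
have kz : en (zv R k - z) <= D%:R + a%:R + `|b%:~R|.
  have -> : zv R k - z = (zv R k0 - z) + a%:R *: evec R i + b%:~R *: evec R j.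
    by rewrite zk !(addrAC _ _ (- z)).
  apply: (le_trans (en_triangle _ _)); rewrite enZ /en evec_unit sqrtr1 mulr1 lerD2r -/(en _).
  apply: (le_trans (en_triangle _ _)); rewrite enZ /en evec_unit sqrtr1 mulr1 ger0_norm // lerD2r -/(en _).
  by rewrite en_subC.
apply: (le_trans kz).
have aq' : a%:R <= q%:R :> R by rewrite ler_nat ltnW.
have d1 : D%:R <= D%:R * q%:R :> R by rewrite ler_peMr.
have d2 : D%:R / `|nn| <= D%:R / `|nn| * q%:R by rewrite ler_peMr //; nng.
have d3 : 0 <= (5 * `|nn| + D%:R + D%:R / `|nn|) * q%:R by nng.
by rewrite /C; move: bl aq' d1 d2 d3 q1; clear; lra.
Qed.
End Diophantine2.

(** * Solutions on long strips *)

Section StripSolutions.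
Context {R : realType} {D : nat}.
Set Implicit Arguments. Unset Strict Implicit.
Local Notation V := 'rV[R]_D.
Implicit Types (w v g : V -> R) (x y z p : V) (j : 'rV[int]_D).

Definition nderiv_eq (n : V) w x (a : R) := forall e : R, 0 < e -> exists2 dl : R, 0 < dl &
  forall t : R, 0 < t < dl -> `|w (x + t *: n) - w x - a * t| <= e * t.

(** The problem satisfied by [r u (1/r) (y / r)]: coefficients at unit scale in a strip of width
    [r]. Boundedness is kept apart in [bounded_on]. *)
Definition strip_sol (n : V) A B g (r : R) w :=
  [/\ ctn (cslab n r) w, forall x, slab n r x -> genL A B w x 0,
      forall x, dot x n = r -> w x = 0 & forall x, dot x n = 0 -> nderiv_eq n w x (g x)].

Lemma nderiv_eq_le (n : V) w x (a G : R) : `|a| <= G -> nderiv_eq n w x a -> nderiv_le n w x G.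
Proof.
move=> aG h e e0; have [dl dl0 hd] := h e e0; exists dl => // t ht.
have t0 : 0 < t by case/andP: ht.
have h1 := hd t ht; have h2 : `|a * t| <= G * t by rewrite normrM (gtr0_norm t0) ler_pM2r.
have -> : w (x + t *: n) - w x = (w (x + t *: n) - w x - a * t) + a * t by rewrite subrK.
by rewrite (le_trans (ler_normD _ _)) // mulrDl addrC lerD.
Qed.

Lemma genL_dot A B (n x : V) : genL A B (dot n) x (dot (B x) n).
Proof. by exists n, 0; split; [exact: jet_dot | rewrite tr20r add0r]. Qed.

Lemma hball_strip (n b x : V) (rh r : R) : dot n n = 1 -> dot b n + rh <= r -> hball n b rh x ->
  cslab n r x.
Proof.
move=> n1 h [xb xs]; rewrite /cslab /= xs /=; have := dot_lip n1 x b; rewrite ler_norml => /andP[_].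
by move: h xb; clear; lra.
Qed.

Lemma ball_strip (n b x : V) (rh r : R) : dot n n = 1 -> dot b n + rh <= r -> en (x - b) < rh ->
  dot x n < r.
Proof.
by move=> n1 h xb; have := dot_lip n1 x b; rewrite ler_norml => /andP[_]; move: h xb; clear; lra.
Qed.

Lemma strip_opp (n : V) A B g (r : R) w : strip_sol n A B g r w ->
  strip_sol n A B (fun x => - g x) r (fun x => - w x).
Proof.
move=> [c1 c2 c3 c4]; split.
- by move=> x hx; apply: cvgN; exact: c1.
- move=> x /c2 L; have [p [H [j e]]] := genLZ (-1) L; exists p, H; split; last by rewrite e mulr0.
  by refine (jet_eq j _ _ _) => // z; rewrite mulN1r.
- by move=> x /c3 ->; rewrite oppr0.
move=> x /c4 h e e0; have [dl dl0 hd] := h e e0; exists dl => // t /hd.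
have -> : - w (x + t *: n) - - w x - - g x * t = - (w (x + t *: n) - w x - g x * t) by ring.
by rewrite normrN.
Qed.

Lemma strip_lipschitz (n : V) (lam Lam CB CA gam : R) :
  dot n n = 1 -> 0 < lam -> 0 <= Lam -> 0 <= CB -> 0 < CA -> 0 < gam < 1 ->
  exists rho C : R, [/\ 0 < rho, rho <= 1, 0 < C &
    forall A B g w (r W Cg : R), hcoefs lam Lam CB CA gam A B -> strip_sol n A B g r w ->
      0 <= Cg -> (forall x, `|g x| <= Cg) -> 0 <= W -> (forall x, cslab n r x -> `|w x| <= W) ->
      forall x y, en (y - x) <= rho -> 0 <= dot x n -> dot x n + rho <= r -> 0 <= dot y n ->
        `|w y - w x| <= C * (W / rho + (Cg + 1)) * en (y - x) + 6 * (Cg + 1)].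
Proof.
move=> n1 lam0 Lam0 CB0 CA0 g01.
have [rho [C [rho0 rho1 C0 hL]]] := lipschitz_estimate n1 lam0 Lam0 CB0 CA0 g01.
exists rho, C; split => // A B g w r W Cg hAB [cw Lw tw nw] Cg0 hg W0 hW x y xy xn xr yn.
have rr : 0 < rho <= rho by rewrite rho0 lexx.
have G0 : 0 < Cg + 1 by rewrite ltr_wpDl.
have sub : hball n x rho `<=` cslab n r by move=> z; exact: hball_strip.
have lw : lsol n A B w x rho 0 (Cg + 1).
  split=> [|z zr zn|z zr zn]; first exact: ctn_sub sub cw.
    by exists 0; [rewrite normr0 | apply: Lw; rewrite /slab /= zn (ball_strip n1 xr zr)].
  by apply: nderiv_eq_le (nw z zn); rewrite (le_trans (hg z)) // lerDl.
have osc s : s = 1 \/ s = -1 -> forall a b, hball n x rho a -> hball n x rho b ->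
    s * w a - s * w b <= 2 * W.
  move=> s1 a b /sub/hW + /sub/hW; rewrite !ler_norml => /andP[? ?] /andP[? ?].
  by case: s1 => ->; lra.
have yb : hball n x rho y by split.
have fin : C * (W / rho + 0 * rho + (Cg + 1) * rho) * en (y - x) + 6 * (Cg + 1) * rho <=
    C * (W / rho + (Cg + 1)) * en (y - x) + 6 * (Cg + 1).
  apply: lerD; last by rewrite ler_piMr //; nng.
  rewrite ler_wpM2r ?en_ge0 // ler_pM2l // mul0r addr0 lerD2l ler_piMr //; nng.
have o1 : forall a b, hball n x rho a -> hball n x rho b -> w a - w b <= 2 * W.
  by move=> a b ha hb; have := osc 1 (or_introl erefl) a b ha hb; rewrite !mul1r.
have o2 : forall a b, hball n x rho a -> hball n x rho b -> - w a - - w b <= 2 * W.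
  by move=> a b ha hb; have := osc (-1) (or_intror erefl) a b ha hb; rewrite !mulN1r.
have h1 := hL A B w x rho 0 (Cg + 1) W hAB rr (lexx _) G0 W0 xn lw o1 y yb.
have h2 := hL A B _ x rho 0 (Cg + 1) W hAB rr (lexx _) G0 W0 xn (lsolN lw) o2 y yb.
by rewrite ler_norml; apply/andP; split; move: h1 h2 fin; clear; lra.
Qed.

Lemma power_scale (q y : R) : 0 < q <= 1 / 2 -> 0 < y <= 1 ->
  exists K : nat, q ^+ K.+1 <= y <= q ^+ K.
Proof.
move=> /andP[q0 q2] /andP[y0 y1].
have [K0 hK0] : exists K : nat, q ^+ K.+1 <= y.
  exists (Num.bound y^-1); apply: (@le_trans _ _ (2^-1 ^+ (Num.bound y^-1).+1)).
    by rewrite lerXn2r ?nnegrE ?invr_ge0 ?(ltW q0) //; move: q2; clear; lra.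
  rewrite exprVn -[X in _ <= X]invrK lef_pV2 ?posrE ?invr_gt0 ?exprn_gt0 //.
  apply: ltW; apply: (lt_trans (archi_boundP _)); first by rewrite invr_ge0 ltW.
  by rewrite -natrX ltr_nat; apply: ltnW; exact: (@ltn_expl 2 (Num.bound y^-1).+1).
have ex : exists K, q ^+ K.+1 <= y by exists K0.
case: (ex_minnP ex) => K hK hmin; exists K; rewrite hK /=.
case: K hK hmin => [|K] hK hmin; first by rewrite expr0.
by rewrite leNgt; apply/negP => /ltW /hmin; rewrite ltnn.
Qed.

(** [height_derivative] is applied to [w - g b (n.x)], whose normal derivative on the hyperplane is
    at most the oscillation [eta] of [g] around [b]. *)
Lemma strip_height (n : V) (lam Lam CB CA gam : R) :
  dot n n = 1 -> 0 < lam -> 0 <= Lam -> 0 <= CB -> 0 < CA -> 0 < gam < 1 ->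
  exists Q rho1 th C : R, [/\ 0 < Q <= 1 / 2, 0 < rho1 <= 1, 0 < th <= 1, 0 < C &
    forall (rh eta Cg dl : R) (K : nat), 0 < rh <= rho1 -> 0 <= eta -> 0 <= Cg -> 0 < dl ->
    rh * Q ^+ (8 * K.+1) <= 2 * dl <= rh * Q ^+ (8 * K) ->
    forall A B g w (r N : R) b, hcoefs lam Lam CB CA gam A B -> strip_sol n A B g r w ->
      rh <= r -> dot b n = 0 -> (forall x, `|g x| <= Cg) ->
      (forall x, en (x - b) <= rh -> `|g x - g b| <= eta) -> 0 < N -> CB * Cg <= N ->
      (forall x, hball n b rh x -> `|w x - w b - g b * dot x n| <= N) ->
      forall e : R, 0 < e -> exists2 d0 : R, 0 < d0 & forall t : R, 0 < t < d0 ->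
        `|w (b + dl *: n + t *: n) - w (b + dl *: n) - g b * t| <=
        (C / rh * N * Q ^+ (6 * K) + C * eta / th + e) * t].
Proof.
move=> n1 lam0 Lam0 CB0 CA0 g01.
have [Q [rho1 [th [C [Q01 rho01 /andP[th0 th1] C0 hH]]]]] :=
  height_derivative n1 lam0 Lam0 CB0 CA0 g01.
exists Q, rho1, th, C; split; rewrite ?th0 //.
move=> rh eta Cg dl K rh01 eta0 Cg0 dl0 hK A B g w r N b hAB [cw Lw tw nw] rhr bn hg gosc N0 NF hN e e0.
have [rh0 _] := andP rh01; have [Q0 _] := andP Q01.
have X0 : 0 < Q ^+ (6 * K) by pos.
pose v x := w x - g b * dot n x.
have bb : dot b n + rh <= r by rewrite bn add0r.
have lv : lsol n A B v b rh (CB * Cg) eta.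
  split=> [|x xr xn|x xr xn e' e'0].
  - apply: ctnB.
      by apply: ctn_sub cw => x; exact: hball_strip.
    by apply: ctnM; [exact: ctn_cst | apply: ctn_continuous; exact: dot_continuous].
  - exists (0 - g b * dot (B x) n).
      rewrite sub0r normrN normrM mulrC; apply: ler_pM => //.
      by rewrite (le_trans (dot_le_en _ _)) // (en_n n1) mulr1; case: hAB => /(_ x) [].
    apply: genLB; last by apply: genLZ; exact: genL_dot.
    by apply: Lw; rewrite /slab /= xn (ball_strip n1 bb xr).
  have [d1 d10 h] := nw x xn _ e'0; exists d1 => // t ht.
  have t0 : 0 < t by case/andP: ht.
  have -> : v (x + t *: n) - v x = (w (x + t *: n) - w x - g x * t) + (g x - g b) * t.
    by rewrite /v dotDr dotZr n1; ring.
  apply: (le_trans (ler_normD _ _)); rewrite [X in _ <= X]mulrDl [X in _ <= X]addrC; apply: lerD; first exact: h.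
  by rewrite normrM (gtr0_norm t0) ler_pM2r // gosc // ltW.
(* [K] is dictated by the height, and [eta] need not be small against [Q ^ (6 K)]. Enlarging [N]
   restores the relation between them and produces the term [C eta / th]. *)
have [N' [N'E N'0 NN']] : exists N', [/\ N' = N + rh * eta / (th * Q ^+ (6 * K)), 0 < N' & N <= N'].
  eexists; split; [reflexivity | |].
    by apply: ltr_wpDr => //; nng; exact: ltW.
  by rewrite lerDl; nng; exact: ltW.
have FN : 0 <= CB * Cg <= N' by rewrite mulr_ge0 //= (le_trans NF).
have vN x : hball n b rh x -> `|v x - v b| <= N'.
  move=> /hN h; apply: le_trans NN'; apply: le_trans h.
  by rewrite /v !(dotC n) bn mulr0 subr0 addrAC.
have eK : rh * eta <= th * N' * Q ^+ (6 * K).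
  have -> : th * N' * Q ^+ (6 * K) = th * N * Q ^+ (6 * K) + rh * eta.
    by rewrite N'E; field; rewrite !gt_eqF.
  by rewrite lerDr; nng; exact: ltW.
have := hH rh rh01 A B v b _ _ N' hAB bn N'0 FN lv vN K dl eK hK e e0.
case=> d0 d00 h; exists d0 => // t /h.
have -> : v (b + dl *: n + t *: n) - v (b + dl *: n) =
    w (b + dl *: n + t *: n) - w (b + dl *: n) - g b * t.
  by rewrite /v !dotDr !dotZr n1; ring.
have -> // : C / rh * N' * Q ^+ (6 * K) = C / rh * N * Q ^+ (6 * K) + C * eta / th.
by rewrite N'E; field; rewrite !gt_eqF.
Qed.
End StripSolutions.

Section ShiftBound.
Context {R : realType} {D : nat}.
Set Implicit Arguments. Unset Strict Implicit.
Local Notation V := 'rV[R]_D.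
Implicit Types (w v g : V -> R) (x y z p : V) (j : 'rV[int]_D).

Lemma genL_sq A B w x : (forall z, 0 <= qf (A x) z) -> genL A B w x 0 ->
  exists2 a, 0 <= a & genL A B (fun y => w y ^+ 2) x a.
Proof.
move=> hA [p [H [j E]]]; exists (2 * qf (A x) p); first by rewrite mulr_ge0.
exists ((2 * w x) *: p), ((2 * w x) *: H + 2 *: (p^T *m p)); split.
  exact: (jet_comp j (peano_sqr (w x))).
by rewrite tr2Dr !tr2Zr dotZr (tr2C (A x) (p^T *m p)) tr2_outer addrAC -mulrDr E mulr0 add0r.
Qed.

Lemma sqr_le_le (a b : R) : 0 <= b -> a ^+ 2 <= b ^+ 2 -> `|a| <= b.
Proof. by move=> b0 h; rewrite -(@ler_pXn2r R 2) ?nnegrE // real_normK ?num_real. Qed.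

(* At the contact point [y0] the function [U >= ka (w - w y0)^2] is harmonic and [U y0 = 1]:
   Harnack bounds the oscillation of [w] there far below its trivial size [r = z^8]. *)
Lemma contact_excluded (n : V) (lam Lam CB CA gam : R) :
  dot n n = 1 -> 0 < lam -> 0 <= Lam -> 0 <= CB -> 0 < CA -> 0 < gam < 1 ->
  exists2 R0 : R, 0 < R0 & forall Cg C0 Cd tau : R,
  0 <= Cg -> 1 <= C0 -> 0 < Cd -> 0 < tau <= 1 ->
  forall g, (forall e : R, 0 < e -> exists2 d : R, 0 < d &
     forall x y, en (x - y) <= d -> `|g x - g y| <= e) -> (forall x, `|g x| <= Cg) ->
  exists2 z0 : R, 1 <= z0 & forall A B w (z r : R) k y0,
    hcoefs lam Lam CB CA gam A B -> zper A -> zper B -> zper g ->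
    z0 <= z -> r = z ^+ 8 -> strip_sol n A B g r w ->
    (forall x, cslab n r x -> `|w x| <= C0 * r) -> 0 < dot (zv R k) n <= Cd / r ->
    let ka := tau / (8 * C0 * (Cg + 1)) / r in
    let Z x := w (x + zv R k) - w x + ka * w x ^+ 2 in
    dot y0 n = 0 ->
    (forall y, cslab n (r - dot (zv R k) n) y -> dot y n <= R0 -> Z y <= Z y0 + R0^-1 * en (y - y0)) ->
    ~ (exists2 t0 : R, 0 < t0 & forall t : R, 0 < t < t0 -> Z (y0 + t *: n) <= Z y0 - tau * t).
Proof.
move=> n1 lam0 Lam0 CB0 CA0 g01.
have [R0 [Ch [R02 Ch0 hH]]] := harnack n1 lam0 Lam0 CB0 CA0 g01 (@ltr0Sn R 1).
exists R0 => [|Cg C0 Cd tau Cg0 C01 Cd0 /andP[tau0 tau1] g gu hg]; first exact: lt_le_trans R02.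
have [rl [CL [rl0 rl1 CL0 hL]]] := strip_lipschitz n1 lam0 Lam0 CB0 CA0 g01.
have [Q [rho1 [th [CH [Q01 rho01 th01 CH0 hS]]]]] := strip_height n1 lam0 Lam0 CB0 CA0 g01.
have [th0 _] := andP th01; have [Q0 Q12] := andP Q01; have [rho10 rho11] := andP rho01.
have R00 : 0 < R0 by apply: lt_le_trans R02.
have C00 : 0 < C0 by apply: lt_le_trans C01.
have Cg1 : 0 < Cg + 1 by apply: ltr_wpDl.

(* Choice of the constants, all independent of [r] *)
have [eg [eg0 egt egh]] : exists eg : R, [/\ 0 < eg, eg <= tau / 16 & CH * eg / th <= tau / 16].
  exists (Num.min (tau / 16) (th * tau / (16 * CH))).
  have h2 : 0 < th * tau / (16 * CH) by pos.
  rewrite lt_min h2 divr_gt0 // ge_min lexx; split => //.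
  apply: (@le_trans _ _ (CH * (th * tau / (16 * CH)) / th)).
    by rewrite ler_pM2r ?invr_gt0 // ler_pM2l // ge_min lexx orbT.
  by rewrite le_eqVlt; apply/orP; left; apply/eqP; field; rewrite !gt_eqF.
have [dg dg0 hdg] := gu eg eg0.
have [rh [rh0 rhr rhd]] : exists rh : R, [/\ 0 < rh, rh <= rho1 & rh <= dg].
  by exists (Num.min rho1 dg); rewrite lt_min rho10 !ge_min !lexx orbT.
have rh1 : rh <= 1 by apply: le_trans rho11.
have Q80 : 0 < Q ^+ 8 by pos.
have [C5 [C5E C50]] : exists C5, C5 = 3 * C0 + Cg + CB * Cg + 1 /\ 0 < C5.
  by eexists; split; [reflexivity | apply: ltr_wpDl => //; nng].
have [c6 [c6E c60 c61]] : exists c6, [/\ c6 = 2 * Cd / (rh * Q ^+ 8) + 1, 0 < c6 & 1 <= c6].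
  eexists; split; [reflexivity | apply: ltr_wpDl => //; nng | rewrite lerDr; nng].
have [C8 [C8E C80]] : exists C8, C8 = CH / rh * C5 * c6 ^+ 3 + 1 /\ 0 < C8.
  by eexists; split; [reflexivity | apply: ltr_wpDl => //; nng].
have [C9 [C9E C90]] : exists C9, C9 = C8 + 3 * Cg + 1 /\ 0 < C9.
  by eexists; split; [reflexivity | apply: ltr_wpDl => //; nng].
have [C10 [C10E C100]] : exists C10, C10 = Ch * (1 + C9) /\ 0 < C10.
  by eexists; split; [reflexivity | pos].
have [et [etE et0]] : exists et, et = tau / (8 * C0 * (Cg + 1)) /\ 0 < et.
  by eexists; split; [reflexivity | pos].
have [c11 [c11E c110 c111]] : exists c11, [/\ c11 = C10 / et + 1, 0 < c11 & 1 <= c11].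
  eexists; split; [reflexivity | apply: ltr_wpDl => //; nng | rewrite lerDr; nng].
have [Ct [CtE Ct0]] : exists Ct, Ct = CL * (C0 * Cd / rl + (Cg + 1)) + 6 * (Cg + 1) /\ 0 < Ct.
  by eexists; split; [reflexivity | pos].
have [C13 [C13E C130]] : exists C13, C13 = 2 * (1 + C10 + 2 * c11) + 2 * Ct + Cg + CB * Cg + 1 /\ 0 < C13.
  by eexists; split; [reflexivity | apply: ltr_wpDl => //; nng].
have [C14 [C14E C140]] : exists C14, C14 = CH / rh * C13 * c6 ^+ 3 /\ 0 < C14.
  by eexists; split; [reflexivity | pos].
have [z0 [z01 z0a]] : exists z0 : R, 1 <= z0 /\
    forall z : R, z0 <= z -> [/\ 2 * Cd <= z * rh, Cd <= z * rl, R0 + 3 + Cd <= z, 16 * C14 <= z * tau & 1 <= z].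
  exists (2 * Cd / rh + Cd / rl + (R0 + 3 + Cd) + 16 * C14 / tau); split.
    have : 0 <= 2 * Cd / rh + Cd / rl + 16 * C14 / tau by nng.
    by move: R00 Cd0; clear; lra.
  move=> z hz.
  have a1 : 0 <= 2 * Cd / rh by nng.
  have a2 : 0 <= Cd / rl by nng.
  have a3 : 0 <= 16 * C14 / tau by nng.
  split.
  - by rewrite -ler_pdivrMr //; move: hz a2 a3 R00 Cd0; clear; lra.
  - by rewrite -ler_pdivrMr //; move: hz a1 a3 R00 Cd0; clear; lra.
  - by move: hz a1 a2 a3; clear; lra.
  - by rewrite -ler_pdivrMr //; move: hz a1 a2 R00 Cd0; clear; lra.
  - by move: hz a1 a2 a3 R00 Cd0; clear; lra.
exists z0 => // A B w z r k y0 hAB pA pB pg /z0a [z1 z2 z3 z4 z5] rE sw wW.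
set dl := dot (zv R k) n => /andP[dl0 dlr] ka Z y0n cont [t0 t00 dec].
have [cw Lw tw nw] := sw.
have z_gt0 : 0 < z by apply: lt_le_trans z5.
have r0 : 0 < r by rewrite rE exprn_gt0.
have zr : z <= r by rewrite rE exprS ler_peMr ?(ltW z_gt0) // exprn_ege1.
have r1 : 1 <= r by apply: le_trans zr.
have dlE : dl * r <= Cd by rewrite -ler_pdivlMr.
have dlz : dl * z <= Cd by apply: le_trans dlE; rewrite ler_pM2l.
have dlrh : 2 * dl <= rh.
  by rewrite -(ler_pM2r z_gt0) -mulrA [X in _ <= X]mulrC; move: dlz z1; clear; lra.
have dlrl : dl <= rl.
  by rewrite -(ler_pM2r z_gt0) [X in _ <= X]mulrC; move: dlz z2; clear; lra.
have dlC : dl <= Cd by apply: le_trans dlE; rewrite ler_peMr // ltW.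
have dl1 : dl <= 1 / 2 by move: dlrh rh1; clear; lra.
have kaE : ka = et / r by rewrite /ka etE.
have ka0 : 0 < ka by rewrite kaE; pos.
clearbody ka.
have kar : ka * r = et by rewrite kaE divfK // gt_eqF.
have ketC : 8 * C0 * (Cg + 1) * et = tau by rewrite etE; field; rewrite !gt_eqF.
(* The boundary estimate is used at the scale [rh * Q ^+ (8 * K)], comparable to the height [dl]
   of the shift. *)
have Q8h : 0 < Q ^+ 8 <= 1 / 2.
  rewrite Q80 /=; apply: (le_trans _ Q12); rewrite exprS ler_piMr ?(ltW Q0) // exprn_ile1 ?(ltW Q0) //.
  by move: Q12; clear; lra.
have y01 : 0 < 2 * dl / rh <= 1.
  by rewrite divr_gt0 ?mulr_gt0 //= ler_pdivrMr // mul1r.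
have [K /andP[K1 K2]] := power_scale Q8h y01.
rewrite -!exprM in K1 K2.
have hK : rh * Q ^+ (8 * K.+1) <= 2 * dl <= rh * Q ^+ (8 * K).
  by rewrite [rh * _]mulrC -ler_pdivlMr // K1 /= [rh * _]mulrC -ler_pdivrMr.
(* [Q ^ (8 K)] is comparable with the height [dl], which is at most of order [z ^ -8]. So [X] is at
   most of order [z ^ -2], and the factor [Q ^ (6 K)] of [strip_height] gains [z ^ -6]. *)
have [X [XE X0]] : exists X, X = Q ^+ (2 * K) /\ 0 < X.
  by eexists; split; [reflexivity | rewrite exprn_gt0].
have Xz : X * z ^+ 2 <= c6.
  have h4 : X ^+ 4 * z ^+ 8 <= c6 ^+ 4.
    have -> : X ^+ 4 = Q ^+ (8 * K) by rewrite XE -exprM mulnAC.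
    rewrite -rE; apply: (@le_trans _ _ c6).
      have -> : Q ^+ (8 * K) = Q ^+ (8 * K.+1) / Q ^+ 8.
        by rewrite mulnS exprD; field; rewrite gt_eqF.
      apply: (@le_trans _ _ (2 * dl / rh / Q ^+ 8 * r)).
        by rewrite ler_pM2r // ler_pM2r ?invr_gt0.
      have -> : 2 * dl / rh / Q ^+ 8 * r = 2 * (dl * r) / (rh * Q ^+ 8) by field; rewrite !gt_eqF.
      rewrite c6E; apply: (@le_trans _ _ (2 * Cd / (rh * Q ^+ 8))); last by rewrite lerDl.
      by rewrite ler_pM2r ?invr_gt0 ?mulr_gt0 // ler_pM2l.
    by rewrite exprS ler_peMr ?(ltW c60) // exprn_ege1.
  have h5 : (X * z ^+ 2) ^+ 4 <= c6 ^+ 4 by rewrite exprMn -exprM.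
  by rewrite -(@ler_pXn2r R 4) ?nnegrE //; nng.
have X3 : X ^+ 3 * z ^+ 6 <= c6 ^+ 3.
  have -> : X ^+ 3 * z ^+ 6 = (X * z ^+ 2) ^+ 3 by ring.
  by rewrite lerXn2r ?nnegrE //; nng.
have Q6 : Q ^+ (6 * K) = X ^+ 3 by rewrite XE -exprM mulnAC.
have rhr' : rh <= r by apply: (le_trans rh1).
have gosc b x : en (x - b) <= rh -> `|g x - g b| <= eg.
  by move=> h; apply: hdg; apply: le_trans rhd.
have rh01 : 0 < rh <= rho1 by rewrite rh0.
have hder (b : V) (N : R) := hS rh eg Cg dl K rh01 (ltW eg0) Cg0 dl0 hK A B g w r N b hAB sw rhr'.
have gb (b x : V) : hball n b rh x -> dot b n = 0 -> `|g b * dot x n| <= Cg.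
  move=> [xb xs] bn; rewrite normrM -[X in _ <= X]mulr1; apply: ler_pM => //.
  rewrite ger0_norm //; have := dot_lip n1 x b; rewrite bn subr0 ler_norml => /andP[_ h].
  by apply: (le_trans h); apply: (le_trans xb).
have z2_1 : 1 <= z ^+ 2 by rewrite exprn_ege1.
have z5_1 : 1 <= z ^+ 5 by rewrite exprn_ege1.
have z25 : z ^+ 2 <= z ^+ 5 by rewrite (exprD z 2 3) ler_peMr ?exprn_ege1 //; nng.
pose kn := zv R k.
have bE (y : V) : y + kn = y + kn - dl *: n + dl *: n by rewrite subrK.
have bn (y : V) : dot y n = 0 -> dot (y + kn - dl *: n) n = 0.
  by move=> h; rewrite !dotDl dotNl dotZl n1 h /kn -/dl; ring.
have hw2 (b x : V) : dot b n = 0 -> hball n b rh x -> `|w x| <= C0 * r.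
  by move=> b0 xb; apply: wW; apply: hball_strip xb; rewrite // b0 add0r.
have rX : CH / rh * (C5 * r) * X ^+ 3 <= CH / rh * C5 * c6 ^+ 3 * z ^+ 2.
  have -> : CH / rh * (C5 * r) * X ^+ 3 = CH / rh * C5 * z ^+ 2 * (X ^+ 3 * z ^+ 6) by rewrite rE; ring.
  rewrite [X in _ <= X]mulrAC; apply: ler_wpM2l => //; nng.

(* First bound, of order [z ^ 2], on the normal derivative of the shifted solution *)
have crude (y : V) : dot y n = 0 -> nderiv_le n (fun x => w (x + kn)) y (C8 * z ^+ 2 + Cg).
  move=> yn e e0.
  have N0 : 0 < C5 * r by pos.
  have NF : CB * Cg <= C5 * r.
    apply: (@le_trans _ _ C5); last by rewrite ler_peMr // ltW.
    by rewrite C5E; move: C00 Cg0; clear; lra.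
  have hN x : hball n (y + kn - dl *: n) rh x -> `|w x - w (y + kn - dl *: n)
      - g (y + kn - dl *: n) * dot x n| <= C5 * r.
    move=> xb; have h1 := hw2 _ _ (bn _ yn) xb.
    have h2 := hw2 _ (y + kn - dl *: n) (bn _ yn) _.
    have {}h2 : `|w (y + kn - dl *: n)| <= C0 * r.
      by apply: h2; split; [rewrite subrr en0 ltW | rewrite bn].
    have h3 := gb _ _ xb (bn _ yn).
    apply: (le_trans (ler_normB _ _)); apply: (@le_trans _ _ (2 * C0 * r + Cg)).
      apply: lerD => //; apply: (le_trans (ler_normB _ _)); move: h1 h2; clear; lra.
    have : Cg <= Cg * r by rewrite ler_peMr.
    have : 0 <= (CB * Cg + 1 + C0) * r by nng.
    by rewrite C5E; clear; lra.
  have [d0 d00 h] := hder _ _ (bn _ yn) hg (gosc _) N0 NF hN e e0.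
  exists d0 => // t ht; have t_0 : 0 < t by case/andP: ht.
  have := h t ht; rewrite -bE (addrAC y kn (t *: n)) => h1.
  have -> : w (y + t *: n + kn) - w (y + kn) =
    (w (y + t *: n + kn) - w (y + kn) - g (y + kn - dl *: n) * t) + g (y + kn - dl *: n) * t by ring.
  apply: (le_trans (ler_normD _ _)).
  have h2 : `|g (y + kn - dl *: n) * t| <= Cg * t by rewrite normrM (gtr0_norm t_0) ler_pM2r.
  have h3 : CH / rh * (C5 * r) * Q ^+ (6 * K) + CH * eg / th + e <= C8 * z ^+ 2 + e.
    rewrite lerD2r Q6 C8E mulrDl mul1r; apply: lerD => //.
    by apply: (le_trans egh); move: tau1 z2_1; clear; lra.
  have h4 := ler_wpM2r (ltW t_0) h3.
  by move: h1 h2 h4; clear; lra.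

(* Harnack inequality around the contact point *)
pose a := w y0.
have al : `|a| <= C0 * r.
  apply: wW; rewrite /cslab /= y0n lexx /=; exact: ltW.
(* This dictates the coefficient [ka]: since [|a| <= C0 r], the derivative of [ka w^2] along [n] at
   [y0] stays below a quarter of [tau]. *)
have kal : `|2 * ka * a| * (Cg + 1) <= tau / 4.
  apply: (@le_trans _ _ (2 * ka * (C0 * r) * (Cg + 1))).
    apply: ler_wpM2r; first exact: ltW.
    by rewrite normrM gtr0_norm ?mulr_gt0 // ler_pM2l ?mulr_gt0.
  have -> : 2 * ka * (C0 * r) * (Cg + 1) = 2 * C0 * (Cg + 1) * (ka * r) by ring.
  by rewrite kar; move: ketC; clear; lra.
have kal1 : `|2 * ka * a| <= 1.
  have : `|2 * ka * a| <= `|2 * ka * a| * (Cg + 1) by rewrite ler_peMr // lerDr.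
  by move: kal tau1; clear; lra.
(* Equal to [1 + Z y0 - Z y + ka (w y - a)^2]: adding the square back linearizes [ka w^2] at [y0].
   What is left is an exact solution, and the contact property makes it dominate [ka (w - a)^2] on
   the ball of radius [R0]. *)
pose U y := w (y0 + kn) - a - (w (y + kn) - w y) - 2 * ka * a * (w y - a) + 1.
have Rr : R0 <= r - dl by move: z3 zr dlC; clear; lra.
have sub1 : hball n y0 R0 `<=` cslab n (r - dl).
  by move=> y; apply: hball_strip => //; rewrite y0n add0r.
have sub2 : hball n y0 R0 `<=` cslab n r.
  by move=> y /sub1; rewrite /cslab /= => /andP[-> h] /=; move: h dl0; clear; lra.
have sub3 y : hball n y0 R0 y -> cslab n r (y + kn).
  move=> /sub1; rewrite /cslab /= dotDl -/dl => /andP[h1 h2].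
  by apply/andP; split; move: h1 h2 dl0; clear; lra.
have lU : lsol n A B U y0 R0 0 (C9 * z ^+ 2).
  have cwk : ctn (hball n y0 R0) (fun x => w (x + kn)).
    apply: (@ctn_pre _ _ _ (hball n y0 R0) (cslab n r) (fun x => x + kn) w) => //.
    by move=> x; apply: continuousD; [exact: cvg_id | exact: cst_continuous].
  have cw0 : ctn (hball n y0 R0) w by exact: ctn_sub sub2 cw.
  split=> [|x xr xn|x xr xn e e0].
  - apply: ctnD; last exact: ctn_cst.
    apply: ctnB; last by apply: ctnM; [exact: ctn_cst | apply: ctnB => //; exact: ctn_cst].
    by apply: ctnB; [exact: ctn_cst | exact: ctnB].
  - have xr2 : dot x n < r - dl.
      by apply: (ball_strip n1 _ xr); rewrite y0n add0r.
    have L1 : genL A B w x 0 by apply: Lw; rewrite /slab /= xn; move: xr2 dl0; clear; lra.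
    have L2 : genL A B w (x + kn) 0.
      apply: Lw; rewrite /slab /= dotDl -/dl; apply/andP; split; move: xn xr2 dl0; clear; lra.
    exists 0; first by rewrite normr0.
    have := genLD (genLB (genLB (genL_cst A B (w (y0 + kn) - a) x) (genLB (genL_zper pA pB L2) L1))
      (genLZ (2 * ka * a) (genLB L1 (genL_cst A B a x)))) (genL_cst A B 1 x).
    by rewrite !subr0 mulr0 subr0 addr0.
  have e3 : 0 < e / 3 by pos.
  have [d1 d10 hv] := crude x xn _ e3.
  have [d2 d20 hw] := nderiv_eq_le (hg x) (nw x xn) e3.
  exists (Num.min d1 d2) => [|t]; first by rewrite lt_min d10.
  rewrite lt_min => /andP[t_0 /andP[td1 td2]].
  have := hv t; rewrite t_0 td1 => /(_ isT) h1.
  have := hw t; rewrite t_0 td2 => /(_ isT) h2.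
  have -> : U (x + t *: n) - U x = - (w (x + t *: n + kn) - w (x + kn)) +
     (w (x + t *: n) - w x) - 2 * ka * a * (w (x + t *: n) - w x) by rewrite /U; ring.
  apply: (le_trans (ler_normB _ _)).
  have h3 : `|2 * ka * a * (w (x + t *: n) - w x)| <= `|w (x + t *: n) - w x|.
    by rewrite normrM ler_piMl.
  have h4 := ler_normD (- (w (x + t *: n + kn) - w (x + kn))) (w (x + t *: n) - w x).
  rewrite normrN in h4.
  have h5 : (C8 * z ^+ 2 + 3 * Cg) * t <= C9 * z ^+ 2 * t.
    rewrite ler_pM2r // C9E.
    have : Cg <= Cg * z ^+ 2 by rewrite ler_peMr.
    by move: z2_1; clear; lra.
  by move: h1 h2 h3 h4 h5; clear; lra.
have R0i : 0 < R0^-1 by rewrite invr_gt0.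
have Ulow y : hball n y0 R0 y -> ka * (w y - a) ^+ 2 <= U y.
  move=> yb; have yR : dot y n <= R0.
    case: yb => yr _; have := dot_lip n1 y y0; rewrite y0n subr0 ler_norml => /andP[_ h].
    exact: (le_trans h).
  have := cont y (sub1 _ yb) yR; rewrite /Z /U -/kn -/a.
  have : R0^-1 * en (y - y0) <= 1 by rewrite ler_pdivrMl // mulr1; case: yb.
  by clear; lra.
have U0 y : hball n y0 R0 y -> 0 <= U y.
  by move=> /Ulow; apply: le_trans; rewrite mulr_ge0 ?sqr_ge0 // ltW.
have Uy0 : U y0 = 1 by rewrite /U /a; ring.
have y0n' : 0 <= dot y0 n by rewrite y0n.
have GU : 0 < C9 * z ^+ 2 by pos.
have Uup y : hball n y0 2 y -> U y <= C10 * z ^+ 2.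
  move=> /(hH A B U y0 _ hAB y0n' GU lU U0) h; apply: (le_trans h).
  rewrite Uy0 C10E -mulrA ler_pM2l //; move: z2_1; clear; lra.
have hb2 y : hball n y0 2 y -> hball n y0 R0 y.
  by apply: hball_sub; rewrite subrr en0 add0r.
(* [z ^ 5] is the square root of [z ^ 2 / ka], as [ka] is of order [z ^ -8]. *)
have wosc y : hball n y0 2 y -> `|w y - a| <= c11 * z ^+ 5.
  move=> yb; apply: sqr_le_le; first by nng.
  have h1 := le_trans (Ulow _ (hb2 _ yb)) (Uup _ yb).
  have h2 : (w y - a) ^+ 2 <= C10 / et * z ^+ 10.
    rewrite -(ler_pM2l ka0); apply: (le_trans h1).
    have -> : ka * (C10 / et * z ^+ 10) = (ka * r) / et * (C10 * z ^+ 2) by rewrite rE; ring.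
    by rewrite kar divff ?gt_eqF // mul1r.
  apply: (le_trans h2); rewrite exprMn -exprM ler_pM2r; last by pos.
  apply: (@le_trans _ _ c11); first by rewrite c11E lerDl.
  by rewrite expr2 ler_peMr // ltW.
have vosc y : hball n y0 2 y -> `|w (y + kn) - w (y0 + kn)| <= (1 + C10 + 2 * c11) * z ^+ 5.
  move=> yb; have h1 := U0 _ (hb2 _ yb); have h2 := Uup _ yb; have h3 := wosc _ yb.
  have h4 : `|2 * ka * a * (w y - a)| <= c11 * z ^+ 5.
    by apply: le_trans h3; rewrite normrM ler_piMl.
  have -> : w (y + kn) - w (y0 + kn) = 1 - U y + (w y - a) - 2 * ka * a * (w y - a) by rewrite /U; ring.
  have h5 : C10 * z ^+ 2 <= C10 * z ^+ 5 by rewrite ler_pM2l.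
  move: h1 h2 h3 h4 h5 z5_1; set A1 := w y - a; set A2 := _ * A1.
  rewrite !ler_norml; clear => h1 h2 /andP[? ?] /andP[? ?] h5 h6.
  by apply/andP; split; lra.

(* Second bound on the normal derivative and contradiction *)
pose b0 := y0 + kn - dl *: n.
have b0n : dot b0 n = 0 by exact: bn.
have endl : en (dl *: n) = dl by rewrite enZ (en_n n1) mulr1 gtr0_norm.
(* A height of order [1 / r] against a Lipschitz constant of order [r]: the change is bounded, so
   the oscillation known around [y0 + kn] passes to its foot [b0] on the hyperplane. *)
have thin (x : V) : hball n b0 rh x -> `|w (x + dl *: n) - w x| <= Ct.
  move=> [xb xs].
  have C0r : 0 <= C0 * r by nng.
  have dE : x + dl *: n - x = dl *: n by rewrite addrAC subrr add0r.
  have h1 : en (x + dl *: n - x) <= rl by rewrite dE endl.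
  have h2 : dot x n + rl <= r.
    have := dot_lip n1 x b0; rewrite b0n subr0 ler_norml => /andP[_ h].
    by move: h xb rh1 rl1 z3 zr R00 Cd0; clear; lra.
  have h3 : 0 <= dot (x + dl *: n) n by rewrite dotDl dotZl n1 mulr1 addr_ge0 // ltW.
  apply: (le_trans (hL A B g w r (C0 * r) Cg hAB sw Cg0 hg C0r wW x _ h1 xs h2 h3)).
  rewrite dE endl CtE lerD2r -!mulrA ler_pM2l //.
  have h4 : C0 * (r * (rl^-1 * dl)) <= C0 * (Cd * rl^-1).
    rewrite ler_pM2l // mulrCA mulrC ler_pM2r ?invr_gt0 //.
    by rewrite mulrC.
  have h5 : (Cg + 1) * dl <= Cg + 1.
    by rewrite ler_piMr ?(ltW Cg1) //; move: dl1; clear; lra.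
  by rewrite mulrDl -!mulrA lerD.
have h13 x : hball n b0 rh x -> `|w x - w b0 - g b0 * dot x n| <= C13 * z ^+ 5.
  move=> xb; have bb : hball n b0 rh b0 by split; [rewrite subrr en0 ltW | rewrite b0n].
  have h1 := thin _ xb; have h2 := thin _ bb; have h3 := gb _ _ xb b0n.
  pose y := y0 + (x - b0).
  have yk : y + kn = x + dl *: n.
    by rewrite /y /b0; apply/rowP => i; rewrite !mxE; ring.
  have yb : hball n y0 2 y.
    case: xb => xb xs; rewrite /y; split.
      by rewrite addrAC subrr add0r; apply: (le_trans xb); move: rh1; clear; lra.
    by rewrite dotDl y0n add0r dotDl dotNl b0n subr0.
  have h4 := vosc _ yb; rewrite yk (bE y0) in h4.
  have h5 : (2 * Ct + Cg) <= (2 * Ct + Cg + CB * Cg + 1) * z ^+ 5.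
    apply: (@le_trans _ _ (2 * Ct + Cg + CB * Cg + 1)).
      have : 0 <= CB * Cg by nng.
      by clear; lra.
    by rewrite ler_peMr //; nng.
  have h6 : 0 <= (1 + C10 + 2 * c11) * z ^+ 5 by nng.
  have -> : w x - w b0 - g b0 * dot x n = (w (x + dl *: n) - w (b0 + dl *: n)) -
     (w (x + dl *: n) - w x) + (w (b0 + dl *: n) - w b0) - g b0 * dot x n by ring.
  move: h1 h2 h3 h4 h5 h6; rewrite -/b0 C13E.
  set B1 := w _ - w x; set B2 := _ - w b0; set B3 := g b0 * _; set B4 := _ - w (b0 + _).
  rewrite !ler_norml; clear => /andP[? ?] /andP[? ?] /andP[? ?] /andP[? ?] h5 h6.
  by apply/andP; split; lra.
have N0 : 0 < C13 * z ^+ 5 by pos.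
have NF : CB * Cg <= C13 * z ^+ 5.
  apply: (@le_trans _ _ C13); last by rewrite ler_peMr // ltW.
  have : 0 <= 2 * (1 + C10 + 2 * c11) + 2 * Ct + Cg + 1 by nng.
  by rewrite C13E; clear; lra.
have e16 : 0 < tau / 16 by pos.
have [d1 d10 hv] := hder _ _ b0n hg (gosc _) N0 NF h13 _ e16.
have [d2 d20 hw] := nw y0 y0n _ e16.
pose t := Num.min t0 (Num.min d1 d2) / 2.
have m0 : 0 < Num.min t0 (Num.min d1 d2) by rewrite !lt_min t00 d10.
have t_0 : 0 < t by rewrite divr_gt0.
have : t < Num.min t0 (Num.min d1 d2) by rewrite ltr_pdivrMr // ltr_pMr ?ltr1n.
rewrite !lt_min => /andP[tt0 /andP[td1 td2]].
have := dec t; rewrite t_0 tt0 => /(_ isT).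
have := hv t; rewrite t_0 td1 => /(_ isT).
have := hw t; rewrite t_0 td2 => /(_ isT).
rewrite Q6 /Z -/a -/kn.
have -> : y0 + t *: n + kn = b0 + dl *: n + t *: n by rewrite /b0 subrK addrAC.
have -> : y0 + kn = b0 + dl *: n by rewrite /b0 subrK.
(* The oscillation [z ^ 5] times the gain [z ^ -6] leaves [1 / z], below the slope [tau] for large
   [z]. *)
have small : CH / rh * (C13 * z ^+ 5) * X ^+ 3 <= tau / 16.
  rewrite -(ler_pM2r z_gt0).
  have -> : CH / rh * (C13 * z ^+ 5) * X ^+ 3 * z = CH / rh * C13 * (X ^+ 3 * z ^+ 6) by ring.
  apply: (@le_trans _ _ C14); last by move: z4; clear; lra.
  by rewrite C14E; apply: ler_wpM2l => //; nng.
(* By periodicity [g b0] is the value of [g] at [y0 - dl n], so the two normal derivatives being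
   compared almost cancel. *)
have gg : `|g b0 - g y0| <= eg.
  have -> : g b0 = g (y0 - dl *: n).
    by rewrite /b0 addrAC /kn pg.
  apply: hdg; rewrite addrAC subrr add0r enN endl.
  by apply: le_trans rhd; move: dlrh dl0; clear; lra.
set V1 := w (b0 + dl *: n + t *: n); set V0 := w (b0 + dl *: n).
set W1 := w (y0 + t *: n); set G0 := g y0; set GB := g b0.
move=> hw1 hv1 hd; rewrite -/GB -/G0 in gg.
have small2 : (CH / rh * (C13 * z ^+ 5) * X ^+ 3 + CH * eg / th + tau / 16) * t <= 3 * (tau / 16) * t.
  by rewrite ler_pM2r //; move: small egh; clear; lra.
have W1a : `|W1 - a| <= (Cg + 1) * t.
  have -> : W1 - a = (W1 - a - G0 * t) + G0 * t by ring.
  apply: (le_trans (ler_normD _ _)).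
  have : `|G0 * t| <= Cg * t by rewrite normrM (gtr0_norm t_0) ler_pM2r // hg.
  have : tau / 16 * t <= t by rewrite ler_piMl ?(ltW t_0) //; move: tau1; clear; lra.
  by move: hw1; clear; lra.
have kq : - (tau / 4 * t) <= 2 * ka * a * (W1 - a).
  have : `|2 * ka * a * (W1 - a)| <= tau / 4 * t.
    rewrite normrM; apply: (@le_trans _ _ (`|2 * ka * a| * ((Cg + 1) * t))).
      by rewrite ler_wpM2l.
    by rewrite mulrA ler_pM2r.
  by rewrite ler_norml => /andP[].
have sq0 : 0 <= ka * (W1 - a) ^+ 2 by rewrite mulr_ge0 ?sqr_ge0 // ltW.
have gt' : - (tau / 16 * t) <= (GB - G0) * t.
  rewrite -mulNr ler_pM2r //; move: gg egt; rewrite ler_norml => /andP[+ _]; clear; lra.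
have hv2 := le_trans hv1 small2.
have tt : 0 < tau * t by pos.
move: hw1 hv2 hd kq sq0 gt' tt; rewrite !ler_norml; clear.
move=> /andP[? ?] /andP[? ?] h1 h2 h3 h4 h5; lra.
Qed.
End ShiftBound.

Section ShiftBound2.
Context {R : realType} {D : nat}.
Set Implicit Arguments. Unset Strict Implicit.
Local Notation V := 'rV[R]_D.
Implicit Types (w v g : V -> R) (x y z p : V) (j : 'rV[int]_D).

Lemma eighth_root (r : R) : 0 <= r -> exists2 z : R, 0 <= z & r = z ^+ 8.
Proof.
move=> r0; exists (Num.sqrt (Num.sqrt (Num.sqrt r))); first exact: sqrtr_ge0.
by rewrite (exprM _ 2 4) sqr_sqrtr ?sqrtr_ge0 // (exprM _ 2 2) sqr_sqrtr ?sqrtr_ge0 // sqr_sqrtr.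
Qed.

(** [contact_or_bound] is applied to [w (. + k) - w + ka w^2] in the strip shortened by the height
    of [k]. Either the barrier bound holds, of order [tau r] up to constants, or there is a contact
    point, which [contact_excluded] rules out; [tau] is small against [eta]. *)
Lemma shift_bound (n : V) (lam Lam CB CA gam ch : R) A B (h : V -> R) :
  dot n n = 1 -> 0 < lam -> 0 <= Lam -> 0 <= CB -> 0 < CA -> 0 < gam < 1 ->
  hcoefs lam Lam CB CA gam A B -> zper A -> zper B ->
  0 <= ch -> continuous h -> (forall x, genL A B h x 0) -> (forall x, `|h x - dot x n| <= ch) ->
  forall Cg C0 Cd eta : R, 0 <= Cg -> 1 <= C0 -> 0 < Cd -> 0 < eta ->
  forall g, zper g -> (forall e : R, 0 < e -> exists2 d : R, 0 < d &
     forall x y, en (x - y) <= d -> `|g x - g y| <= e) -> (forall x, `|g x| <= Cg) ->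
  exists r0 : R, forall r w k, r0 <= r -> strip_sol n A B g r w ->
    (forall x, cslab n r x -> `|w x| <= C0 * r) ->
    (forall x, cslab n r x -> `|w x| <= C0 * (r - dot x n + 1)) ->
    0 < dot (zv R k) n <= Cd / r ->
    forall x, cslab n (r - dot (zv R k) n) x -> w (x + zv R k) - w x <= eta * r.
Proof.
move=> n1 lam0 Lam0 CB0 CA0 g01 hAB pA pB ch0 hc hL hs Cg C0 Cd eta Cg0 C01 Cd0 eta0 g pg gu hg.
have cAB : coefs lam Lam CB A B by case: hAB.
have [R0 R00 hcont] := contact_excluded n1 lam0 Lam0 CB0 CA0 g01.
have [C1 [c [C10 c0 hcob]]] := contact_or_bound n1 lam0 CB0 cAB ch0 hc hL hs (ltW R00).
have C00 : 0 < C0 by apply: lt_le_trans C01.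
pose tau := Num.min 1 (eta / (4 * (c + 1))).
have c1 : 0 < 4 * (c + 1) by apply: mulr_gt0 => //; rewrite ltr_wpDl.
have tau0 : 0 < tau by rewrite lt_min ltr01 divr_gt0.
have tau1 : tau <= 1 by rewrite ge_min lexx.
have tauc : tau * (4 * (c + 1)) <= eta by rewrite -ler_pdivlMr // ge_min lexx orbT.
clearbody tau.
have tau01 : 0 < tau <= 1 by rewrite tau0.
have [z0 z01 {}hcont] := hcont Cg C0 Cd tau Cg0 C01 Cd0 tau01 g gu hg.
have [kq [kq0 kqE kq1]] : exists kq, [/\ 0 < kq, kq = tau / (8 * C0 * (Cg + 1)) & kq <= 1].
  have d0 : 0 < 8 * C0 * (Cg + 1) by apply: mulr_gt0; [pos | rewrite ltr_wpDl].
  eexists; split; [|reflexivity|]; first by pos.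
  rewrite ler_pdivrMr // mul1r (le_trans tau1) //.
  have : 1 * 1 <= C0 * (Cg + 1) by apply: ler_pM => //; rewrite lerDr.
  by clear; lra.
(* Bound at the top of the shortened strip: there [w (x + k)] vanishes, and [|w|] is at most
   [C0 (Cd + 1)] by its linear decay towards the top; the square accounts for the term [ka w^2]. *)
pose m : R := C0 * (Cd + 1) + (C0 * (Cd + 1)) ^+ 2.
have m0 : 0 <= m by rewrite /m; nng.
exists (z0 ^+ 8 + Cd + 1 + 4 * m / eta + 4 * C1 / eta) => r w k rr sw wW wW2 /andP[dl0 dlr].
set dl := dot (zv R k) n in dl0 dlr *.
have q1 : 0 <= 4 * m / eta by nng.
have q2 : 0 <= 4 * C1 / eta by nng.
have q3 : 0 <= z0 ^+ 8 by rewrite exprn_ge0 // (le_trans ler01).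
have r1 : 1 <= r by move: rr q1 q2 q3 Cd0; clear; lra.
have r0 : 0 < r by apply: lt_le_trans r1.
have [z z_ge0 rE] := eighth_root (ltW r0).
have zz : z0 <= z.
  rewrite -(@ler_pXn2r R 8) ?nnegrE // ?(le_trans ler01) // -rE.
  by move: rr q1 q2 Cd0; clear; lra.
have dlE : dl * r <= Cd by rewrite -ler_pdivlMr.
have dlC : dl <= Cd by apply: le_trans dlE; rewrite ler_peMr // ltW.
have rd0 : 0 < r - dl by move: rr q1 q2 q3 dlC; clear; lra.
pose ka := tau / (8 * C0 * (Cg + 1)) / r.
have ka0 : 0 < ka by rewrite /ka -kqE; pos.
have kar : ka * r = kq by rewrite /ka -kqE divfK // gt_eqF.
have ka1 : ka <= 1.
  by rewrite -(ler_pM2r r0) kar mul1r (le_trans kq1).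
pose Z x := w (x + zv R k) - w x + ka * w x ^+ 2.
have [cw Lw tw nw] := sw.
have sub1 : cslab n (r - dl) `<=` cslab n r.
  by move=> y; rewrite /cslab /= => /andP[-> h2] /=; move: h2 dl0; clear; lra.
have sub2 y : cslab n (r - dl) y -> cslab n r (y + zv R k).
  rewrite /cslab /= dotDl -/dl => /andP[h1 h2].
  by apply/andP; split; move: h1 h2 dl0; clear; lra.
have cZ : ctn (cslab n (r - dl)) Z.
  have cw0 : ctn (cslab n (r - dl)) w by exact: ctn_sub sub1 cw.
  apply: ctnD; first apply: ctnB => //.
    apply: (@ctn_pre _ _ _ (cslab n (r - dl)) (cslab n r) (fun x => x + zv R k) w) => //.
    by move=> y; apply: continuousD; [exact: cvg_id | exact: cst_continuous].
  apply: ctnM; first exact: ctn_cst.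
  by apply: (@ctn_comp _ _ _ w (fun t => t ^+ 2)) => //; exact: exprn_continuous.
have Zb y : cslab n (r - dl) y -> Z y <= 2 * C0 * r + (C0 * r) ^+ 2.
  move=> hy; have h1 := wW _ (sub1 _ hy); have h2 := wW _ (sub2 _ hy).
  have h3 : ka * w y ^+ 2 <= (C0 * r) ^+ 2.
    apply: (@le_trans _ _ (w y ^+ 2)); first by rewrite ler_piMl ?sqr_ge0.
    by rewrite -(real_normK (num_real (w y))) lerXn2r ?nnegrE //; nng.
  move: h1 h2 h3; rewrite /Z !ler_norml => /andP[? ?] /andP[? ?]; lra.
have ZL y : slab n (r - dl) y -> exists2 a, 0 <= a & genL A B Z y a.
  rewrite /slab /= => /andP[h1 h2].
  have L1 : genL A B w y 0 by apply: Lw; rewrite /slab /= h1; move: h2 dl0; clear; lra.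
  have L2 : genL A B w (y + zv R k) 0.
    apply: Lw; rewrite /slab /= dotDl -/dl; apply/andP; split; move: h1 h2 dl0; clear; lra.
  have qA z' : 0 <= qf (A y) z'.
    case: (cAB y) => [[_ /(_ z') /andP[h3 _]] _]; apply: le_trans h3.
    by rewrite mulr_ge0 ?dotxx_ge0 // ltW.
  have [a a0 L3] := genL_sq qA L1; exists (0 - 0 + ka * a); first by rewrite subrr add0r; nng.
  exact: genLD (genLB (genL_zper pA pB L2) L1) (genLZ ka L3).
have Ztop y : dot y n = r - dl -> Z y <= m.
  move=> hy; have y1 : cslab n r y.
    by rewrite /cslab /= hy; apply/andP; split; move: rd0 dl0; clear; lra.
  have h1 := wW2 _ y1; rewrite hy in h1.
  have h2 : w (y + zv R k) = 0 by apply: tw; rewrite dotDl -/dl hy; ring.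
  have h3 : `|w y| <= C0 * (Cd + 1).
    by apply: (le_trans h1); rewrite ler_pM2l //; move: dlC; clear; lra.
  have h4 : ka * w y ^+ 2 <= (C0 * (Cd + 1)) ^+ 2.
    apply: (@le_trans _ _ (w y ^+ 2)); first by rewrite ler_piMl ?sqr_ge0.
    by rewrite -(real_normK (num_real (w y))) lerXn2r ?nnegrE //; nng.
  by move: h3 h4; rewrite /Z h2 /m ler_norml => /andP[? ?]; lra.
case: (hcob (r - dl) m _ tau Z rd0 tau0 cZ Zb ZL Ztop) => [hb x hx|hb].
  have h1 := hb x hx; have [hx1 _] := andP hx.
  have h2 : tau * (C1 + c * (r - dl - dot x n)) <= C1 + eta / 4 * r.
    rewrite mulrDr; apply: lerD; first by rewrite ler_piMl.
    apply: (@le_trans _ _ (tau * (c * r))).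
      by rewrite ler_pM2l // ler_wpM2l //; move: hx1 dl0; clear; lra.
    by rewrite mulrA ler_pM2r //; move: tauc tau0; clear; lra.
  have h3 : 0 <= ka * w x ^+ 2 by rewrite mulr_ge0 ?sqr_ge0 // ltW.
  have h4 : 4 * m + 4 * C1 <= eta * r.
    have -> : 4 * m + 4 * C1 = eta * (4 * m / eta + 4 * C1 / eta) by field; rewrite gt_eqF.
    by rewrite ler_pM2l //; move: rr q3 Cd0; clear; lra.
  have h5 : 0 < eta * r by pos.
  by move: h1 h2 h3 h4 h5; rewrite /Z; clear; lra.
have R0i : 0 < R0^-1 by rewrite invr_gt0.
have [y0 [y0n _ cont dec]] := hb _ R0i.
exfalso; apply: (hcont A B w z r k y0 hAB pA pB pg zz rE sw wW _ y0n cont dec).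
by rewrite dl0.
Qed.
End ShiftBound2.

Section StripOscillation.
Context {R : realType} {D : nat}.
Set Implicit Arguments. Unset Strict Implicit.
Local Notation V := 'rV[R]_D.
Variables (n : V) (lam Lam CB CA gam ch : R) (A : V -> 'M[R]_D) (B : V -> V) (h : V -> R).
Hypotheses (n1 : dot n n = 1) (lam0 : 0 < lam) (Lam0 : 0 <= Lam) (CB0 : 0 <= CB) (CA0 : 0 < CA)
  (g01 : 0 < gam < 1) (hAB : hcoefs lam Lam CB CA gam A B) (ch0 : 0 <= ch) (hc : continuous h)
  (hL : forall x, genL A B h x 0) (hs : forall x, `|h x - dot x n| <= ch).
Implicit Types (w v g : V -> R) (x y z p : V) (j : 'rV[int]_D).

Definition bounded_on (S : set V) w := exists M : R, forall x, S x -> `|w x| <= M.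

Lemma bounded_onN S w : bounded_on S w -> bounded_on S (fun x => - w x).
Proof. by move=> [M hM]; exists M => x /hM; rewrite normrN. Qed.

Lemma nderiv_eq_ge w x (a b : R) : b <= a -> nderiv_eq n w x a -> nderiv_ge n w x b.
Proof.
move=> ab hw e e0; have [dl dl0 hd] := hw e e0; exists dl => // t ht.
have t0 : 0 < t by case/andP: ht.
have := hd t ht; have : b * t <= a * t by rewrite ler_pM2r.
rewrite ler_norml mulrBl => h1 /andP[h2 _]; move: h1 h2; set u := w _; set v := w _; set q1 := a * t; lra.
Qed.

(** [strip_comparison] on a strip of smaller width [r']: it carries a bound known at an intermediate
    height down to the hyperplane. *)
Lemma strip_upper : exists C1 c : R, [/\ 0 <= C1, 0 <= c &
  forall g (r r' m b : R) w, 0 < r' <= r -> 0 <= b -> strip_sol n A B g r w ->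
    bounded_on (cslab n r) w -> (forall x, - b <= g x) -> (forall x, dot x n = r' -> w x <= m) ->
    forall x, cslab n r' x -> w x <= m + b * (C1 + c * (r' - dot x n))].
Proof.
have cAB : coefs lam Lam CB A B by case: hAB.
have [C1 [c [C10 c0 H]]] := strip_comparison n1 lam0 CB0 cAB ch0 hc hL hs.
exists C1, c; split => // g r r' m b w /andP[r'0 rr] b0 [cw Lw tw nw] [M hM] hb hm.
have sub : cslab n r' `<=` cslab n r.
  by move=> x; rewrite /cslab /= => /andP[-> h2]; exact: le_trans rr.
apply: (H r' m M b w r'0 b0) => //.
- exact: ctn_sub sub cw.
- by move=> x /sub /hM; rewrite ler_norml => /andP[].
- move=> x; rewrite /slab /= => /andP[h1 h2]; exists 0 => //; apply: Lw.
  by rewrite /slab /= h1 (lt_le_trans h2).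
- by move=> x x0; right; apply: nderiv_eq_ge (nw x x0).
Qed.

Lemma strip_bound (Cg : R) : 0 <= Cg -> exists2 C0 : R, 1 <= C0 &
  forall g (r : R) w, 0 < r -> strip_sol n A B g r w -> bounded_on (cslab n r) w ->
    (forall x, `|g x| <= Cg) -> forall x, cslab n r x -> `|w x| <= C0 * (r - dot x n + 1).
Proof.
move=> Cg0; have [C1 [c [C10 c0 H]]] := strip_upper.
exists (1 + Cg * (C1 + c)) => [|g r w r0 sw bw hg x xr]; first by rewrite lerDl; nng.
have r01 : 0 < r <= r by rewrite r0 lexx.
have [tw nw] : (forall x, dot x n = r -> w x <= 0) /\ (forall x, dot x n = r -> - w x <= 0).
  by case: sw => _ _ tw _; split=> y /tw ->; rewrite ?oppr0.
have g1 y : - Cg <= g y by have := hg y; rewrite ler_norml => /andP[].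
have g2 y : - Cg <= - g y by rewrite lerN2; have := hg y; rewrite ler_norml => /andP[].
have h1 := H g r r 0 Cg w r01 Cg0 sw bw g1 tw x xr.
have h2 := H _ r r 0 Cg _ r01 Cg0 (strip_opp sw) (bounded_onN bw) g2 nw x xr.
have s0 : 0 <= r - dot x n by case/andP: xr => _; rewrite subr_ge0.
have h3 : 0 <= Cg * C1 * (r - dot x n) by nng.
have h4 : 0 <= Cg * c by nng.
move: h1 h2 h3 h4 s0; set s := r - _ => h1 h2 h3 h4 s0.
rewrite ler_norml; apply/andP; split; lra.
Qed.

End StripOscillation.

(* With [r = N T], shifts almost parallel to the hyperplane cost [eta' r], and at height
   [sg T] the remaining displacement [C T] costs [(C / sg) r]. *)
Lemma boundary_osc {R : realType} {D : nat} (n : 'rV[R]_D) (lam Lam CB CA gam ch cX Cg eta : R) A B h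
    (X : 'I_D -> 'rV[R]_D -> R) g :
  dot n n = 1 -> 0 < lam -> 0 <= Lam -> 0 <= CB -> 0 < CA -> 0 < gam < 1 ->
  hcoefs lam Lam CB CA gam A B ->
  0 <= ch -> continuous h -> (forall x, genL A B h x 0) -> (forall x, `|h x - dot x n| <= ch) ->
  (forall l x, genL A B (X l) x 0) -> (forall l, continuous (X l)) ->
  (forall l x, `|X l x - x 0 l| <= cX) -> 0 <= cX ->
  zper A -> zper B -> zper g -> 0 <= Cg -> 0 < eta ->
  (forall e : R, 0 < e -> exists2 d : R, 0 < d & forall x y, en (x - y) <= d -> `|g x - g y| <= e) ->
  (forall x, `|g x| <= Cg) ->
  ~ (exists (c : R) (k : 'rV[int]_D), n = c *: map_mx intr k) ->
  forall r0 : R, exists2 r : R, r0 <= r & forall w, strip_sol n A B g r w ->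
    bounded_on (cslab n r) w ->
    forall x x', dot x n = 0 -> dot x' n = 0 -> w x - w x' <= eta * r.
Proof.
move=> n1 lam0 Lam0 CB0 CA0 g01 hAB ch0 hc hL hs hX hXc hcX cX0 pA pB pg Cg0 eta0 gu hg irr r0.
have [C0 C01 hbnd] := strip_bound n1 lam0 CB0 hAB ch0 hc hL hs Cg0.
have C00 : 0 < C0 by apply: lt_le_trans C01.
have [C1 [c [C10 c0 hup]]] := strip_upper n1 lam0 CB0 hAB ch0 hc hL hs.
have [Cd Cd0 hdio] := dio n1 irr.
have [si [Ci [si0 Ci0 hint]]] := interior_osc n1 lam0 Lam0 CB0 CA0 g01 cX0.
have Dn0 : 0 <= D%:R :> R by [].
(* [E1] makes the displacement [(Cd + 1) T] admissible in [interior_osc] at height [sg T], and [E2]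
   makes its cost at most [eta r / 16]. *)
pose E1 := 8 * (D%:R + 1) * (Cd + 1); have E10 : 0 < E1.
  by apply: mulr_gt0; [apply: mulr_gt0 => //; rewrite ltr_wpDl | rewrite addr_gt0].
pose E2 := 16 * Ci * (2 * C0) * (Cd + 1) / eta; have E20 : 0 < E2 by rewrite /E2; pos.
pose sg := E1 + E2 + 1; have sg0 : 0 < sg by rewrite /sg; pos.
have sgE1 : E1 <= sg by rewrite /sg; move: E20; clear; lra.
have sgE2 : E2 <= sg by rewrite /sg; move: E10; clear; lra.
have sg1 : 1 <= sg by rewrite /sg; move: E10 E20; clear; lra.
(* Large with respect to [sg]: descending from height [sg T] costs about [Cg c sg T], to be small
   against [eta r] with [r = N T]. *)
pose N := 8 * Cg * (C1 + c * sg) / eta + 2 * sg + 2 + Cd.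
have NE0 : 0 <= 8 * Cg * (C1 + c * sg) / eta by nng.
have N1 : 1 <= N by rewrite /N; move: NE0 sg0 Cd0; clear; lra.
have N0 : 0 < N by apply: lt_le_trans N1.
have CdN : 0 < Cd * N by pos.
have C02 : 1 <= 2 * C0 by move: C01; clear; lra.
have eta4 : 0 < eta / 8 by pos.
have gu' (e : R) : 0 < e -> exists2 d : R, 0 < d & forall x y, en (x - y) <= d -> `|- g x - - g y| <= e.
  move=> /gu [d d0 hd]; exists d => // x y /hd; by rewrite -opprD normrN.
have hg' x : `|- g x| <= Cg by rewrite normrN.
have pg' : zper (fun x => - g x) by move=> x j; rewrite pg.
have [ra hra] := shift_bound n1 lam0 Lam0 CB0 CA0 g01 hAB pA pB ch0 hc hL hs Cg0 C02 CdN eta4 pg gu hg.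
have [rb hrb] := shift_bound n1 lam0 Lam0 CB0 CA0 g01 hAB pA pB ch0 hc hL hs Cg0 C02 CdN eta4 pg' gu' hg'.
have [T [hT T1] hk] := hdio (`|r0| + `|ra| + `|rb| + si).
have T0 : 0 < T by apply: lt_le_trans T1.
have [a1 a2] : 0 <= `|r0| /\ 0 <= `|ra| by [].
have a3 : 0 <= `|rb| by [].
pose r := N * T; have r_gt0 : 0 < r by rewrite /r; pos.
have Tr : T <= r by rewrite /r ler_peMl // ltW.
have r1 : 1 <= r by apply: le_trans Tr.
have [rr0 rra rrb] : [/\ r0 <= r, ra <= r & rb <= r].
  by move: (ler_norm r0) (ler_norm ra) (ler_norm rb) hT Tr a1 a2 a3 si0; clear; split; lra.
have sT : si <= sg * T.
  apply: (@le_trans _ _ T); first by move: a1 a2 a3 hT; clear; lra.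
  by rewrite ler_peMl // ltW.
exists r => // w sw bw.
pose s1 := sg * T; have s10 : 0 < s1 by rewrite /s1; pos.
have s1r : 2 * s1 + Cd / T <= r.
  have h1 : Cd / T <= Cd * T.
    by rewrite ler_pdivrMr // -mulrA ler_peMr ?(ltW Cd0) // -[X in X <= _]mul1r; apply: ler_pM.
  have h2 : 0 <= 8 * Cg * (C1 + c * sg) / eta * T by nng.
  by rewrite /r /s1 /N; move: h1 h2 T0; clear; lra.
have s1r' : 0 < s1 <= r.
  rewrite s10 /=; have h1 : 0 < Cd / T by pos.
  by move: h1 s1r s10; clear; lra.
(* One-sided claim with a fixed reference point at height [s1]; used for [w] and for [- w], it
   compares any two points of the hyperplane. *)
suff half g' w' : strip_sol n A B g' r w' -> bounded_on (cslab n r) w' -> (forall x, `|g' x| <= Cg) ->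
   (forall k, 0 < dot (zv R k) n <= Cd * N / r -> forall x, cslab n (r - dot (zv R k) n) x ->
       w' (x + zv R k) - w' x <= eta / 8 * r) ->
   forall x, dot x n = 0 -> w' x - w' (s1 *: n) <= eta / 2 * r.
  move=> x x' xn x'n.
  have bb w2 g2 : strip_sol n A B g2 r w2 -> bounded_on (cslab n r) w2 -> (forall x, `|g2 x| <= Cg) ->
      (forall x, cslab n r x -> `|w2 x| <= 2 * C0 * r) /\
      (forall x, cslab n r x -> `|w2 x| <= 2 * C0 * (r - dot x n + 1)).
    move=> sw2 bw2 hg2; have hb := hbnd g2 r w2 r_gt0 sw2 bw2 hg2; split=> y yr.
      apply: (le_trans (hb y yr)); rewrite (mulrC 2) -mulrA ler_pM2l //.
      by case/andP: yr => yr _; move: yr r1; clear; lra.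
    apply: (le_trans (hb y yr)); rewrite (mulrC 2) -mulrA ler_pM2l //.
    by case/andP: yr => _ yr; move: yr; clear; lra.
  have [b1 b2] := bb _ _ sw bw hg.
  have [b1' b2'] := bb _ _ (strip_opp sw) (bounded_onN bw) hg'.
  have h1 := half g w sw bw hg (fun k hk y hy => hra r w k rra sw b1 b2 hk y hy) x xn.
  have h2 := half _ _ (strip_opp sw) (bounded_onN bw) hg'
    (fun k hk y hy => hrb r _ k rrb (strip_opp sw) b1' b2' hk y hy) x' x'n.
  by move: h1 h2; clear; lra.
move=> sw' bw' hg2 hsh x xn.
have hb := hbnd g' r w' r_gt0 sw' bw' hg2.
have [cw Lw _ _] := sw'.
(* An integer vector from [dio] takes the reference point near [z] with a tiny excess height: the
   shift estimate pays for the translation and [interior_osc] for the remaining distance. *)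
have heights z : dot z n = s1 -> w' z <= w' (s1 *: n) + eta / 4 * r.
  move=> zn; pose z' := s1 *: n.
  have z'n : dot z' n = s1 by rewrite /z' dotZl n1 mulr1.
  have [k [k1 k2]] := hk (z - z').
  rewrite dotDl dotNl zn z'n subrr subr0 in k2.
  have k3 : 0 < dot (zv R k) n <= Cd * N / r.
    by have -> : Cd * N / r = Cd / T by rewrite /r; field; rewrite !gt_eqF.
  have z'r : cslab n (r - dot (zv R k) n) z'.
    by case/andP: k2 => k4 k5; rewrite /cslab /= z'n; apply/andP; move: k4 k5 s1r s10 r_gt0; clear; split; lra.
  have h1 := hsh k k3 _ z'r.
  pose x1 := z' + zv R k.
  have x1z : en (x1 - z) <= Cd * T.
    have -> : x1 - z = zv R k - (z - z') by rewrite /x1; apply/rowP => i; rewrite !mxE; ring.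
    exact: k1.
  have lz : lsol n A B (fun x => - w' x) z s1 0 0.
    apply: lsolN; apply: (@lsol_interior _ _ n A B w' z s1 0 0 n1); first by rewrite zn.
    split=> [|y yr yn|y yr yn].
    - apply: ctn_sub cw => y; apply: hball_strip => //; rewrite zn.
      have h2 : 0 < Cd / T by pos.
      by move: h2 s1r s10; clear; lra.
    - exists 0; rewrite ?normr0 //; apply: Lw; rewrite /slab /= yn /=.
      apply: (ball_strip n1 _ yr); rewrite zn; have h2 : 0 < Cd / T by pos.
      by move: h2 s1r s10; clear; lra.
    have := dot_lip n1 z y; rewrite zn yn subr0 en_subC ler_norml => /andP[_ h2].
    by exfalso; move: h2 yr yn; clear; lra.
  have W0 : 0 < 2 * C0 * r by pos.
  have wW y : en (y - z) <= s1 -> `|- w' y| <= 2 * C0 * r.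
    move=> yz; have yr : cslab n r y.
      have h2 : 0 < Cd / T by pos.
      have := dot_lip n1 y z; rewrite zn ler_norml => /andP[h3 h4].
      by rewrite /cslab /=; apply/andP; move: h2 h3 h4 yz s1r s10; clear; split; lra.
    rewrite normrN; apply: (le_trans (hb y yr)); rewrite (mulrC 2) -mulrA ler_pM2l //.
    by case/andP: yr => yr _; move: yr r1; clear; lra.
  have x1s : en (x1 - z) + 1 <= s1 / (8 * (D%:R + 1)).
    have q : 0 < 8 * (D%:R + 1) :> R by apply: mulr_gt0 => //; rewrite ltr_wpDl.
    rewrite ler_pdivlMr //; apply: (@le_trans _ _ ((Cd + 1) * T * (8 * (D%:R + 1)))).
      by rewrite ler_pM2r //; move: x1z T1; clear; lra.
    have -> : (Cd + 1) * T * (8 * (D%:R + 1)) = E1 * T by rewrite /E1; ring.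
    by rewrite /s1 ler_pM2r.
  have s1z : s1 <= dot z n by rewrite zn.
  have := hint A B X hAB pA pB hX hXc hcX _ z s1 _ sT s1z W0 lz wW x1 x1s.
  have h3 : Ci * (2 * C0 * r) / s1 * (en (x1 - z) + 1) <= eta / 16 * r.
    apply: (@le_trans _ _ (Ci * (2 * C0 * r) / s1 * ((Cd + 1) * T))).
      by apply: ler_wpM2l; [nng | move: x1z T1; clear; lra].
    have -> : Ci * (2 * C0 * r) / s1 * ((Cd + 1) * T) = E2 * eta / 16 / sg * r.
      by rewrite /E2 /s1; field; rewrite !gt_eqF.
    have -> : eta / 16 * r = sg * eta / 16 / sg * r by field; rewrite gt_eqF.
    by rewrite ler_pM2r // ler_pM2r ?invr_gt0 // ler_pM2r ?invr_gt0 // ler_pM2r.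
  have h4 : 0 < eta * r by pos.
  by rewrite -/z'; move: h1; rewrite -/x1; move: h3 h4; clear; lra.
have g1 y : - Cg <= g' y by have := hg2 y; rewrite ler_norml => /andP[].
have x0 : cslab n s1 x by rewrite /cslab /= xn lexx ltW.
have := hup g' r s1 _ Cg w' s1r' Cg0 sw' bw' g1 heights x x0; rewrite xn subr0.
have h5 : Cg * (C1 + c * s1) <= eta / 8 * r.
  have -> : eta / 8 * r = (eta / 8 * N) * T by rewrite /r mulrA.
  apply: (@le_trans _ _ (Cg * (C1 + c * sg) * T)).
    rewrite -mulrA ler_wpM2l // mulrDl /s1 mulrA lerD2r ler_peMr //.
  rewrite ler_pM2r //; have -> : Cg * (C1 + c * sg) = eta / 8 * (8 * Cg * (C1 + c * sg) / eta).
    by field; rewrite gt_eqF.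
  by rewrite ler_pM2l //; rewrite /N; move: sg0 Cd0; clear; lra.
have h6 : 0 < eta * r by pos.
by move: h5 h6; clear; lra.
Qed.

Section StripConvergence.
Context {R : realType} {D : nat}.
Set Implicit Arguments. Unset Strict Implicit.
Local Notation V := 'rV[R]_D.
Implicit Types (w v g : V -> R) (x y z p : V) (j : 'rV[int]_D).

Lemma harmonic_le (n : V) (lam Lam CB CA gam ch : R) A B (h : V -> R) :
  dot n n = 1 -> 0 < lam -> 0 <= CB -> hcoefs lam Lam CB CA gam A B ->
  0 <= ch -> continuous h -> (forall x, genL A B h x 0) -> (forall x, `|h x - dot x n| <= ch) ->
  forall (r m : R) Z, 0 < r -> ctn (cslab n r) Z -> bounded_on (cslab n r) Z ->
    (forall x, slab n r x -> genL A B Z x 0) -> (forall x, dot x n = r -> Z x <= m) ->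
    (forall x, dot x n = 0 -> Z x <= m \/ nderiv_ge n Z x 0) ->
    forall x, cslab n r x -> Z x <= m.
Proof.
move=> n1 lam0 CB0 [cAB _] ch0 hc hL hs r m Z r0 cZ [M hM] LZ mZ nZ x xr.
have [C1 [c [_ _ H]]] := strip_comparison n1 lam0 CB0 cAB ch0 hc hL hs.
have := H r m M 0 Z r0 (lexx _) cZ _ _ mZ _ x xr; rewrite mul0r addr0; apply.
- by move=> y /hM; rewrite ler_norml => /andP[].
- by move=> y /LZ L; exists 0.
by move=> y /nZ; rewrite oppr0.
Qed.

(** Let [S] be the supremum of [w'] on the hyperplane. Comparison with [S (1 - h / r')] bounds [w']
    at height [r] by [S (1 - r / r')] up to a constant. As [w' - w] has zero normal derivative, this
    bound holds for it down to the hyperplane, and [S <= M r + S (1 - r / r') + C] is solved for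
    [S]. *)
Lemma scale_compare (n : V) (lam Lam CB CA gam ch Cg : R) A B (h : V -> R) g :
  dot n n = 1 -> 0 < lam -> 0 <= CB -> hcoefs lam Lam CB CA gam A B ->
  0 <= ch -> continuous h -> (forall x, genL A B h x 0) -> (forall x, `|h x - dot x n| <= ch) ->
  0 <= Cg -> (forall x, `|g x| <= Cg) ->
  exists2 C : R, 0 < C & forall (r r' M : R) w w', 1 <= r <= r' ->
    strip_sol n A B g r w -> bounded_on (cslab n r) w ->
    strip_sol n A B g r' w' -> bounded_on (cslab n r') w' ->
    (forall x, dot x n = 0 -> w x <= M * r) ->
    forall x, dot x n = 0 -> w' x <= (M + C / r) * r'.
Proof.
move=> n1 lam0 CB0 hAB ch0 hc hL hs Cg0 hg.
have [C0 C01 hbnd] := strip_bound n1 lam0 CB0 hAB ch0 hc hL hs Cg0.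
have C00 : 0 < C0 by apply: lt_le_trans C01.
exists (6 * C0 * ch + 1); first by apply: ltr_wpDl => //; nng.
move=> r r' M w w' /andP[r1 rr'] sw bw sw' bw' hM.
have r0 : 0 < r by apply: lt_le_trans r1.
have r'0 : 0 < r' by apply: lt_le_trans rr'.
have [cw Lw tw nw] := sw; have [cw' Lw' tw' nw'] := sw'.
have hb' := hbnd g r' w' r'0 sw' bw' hg.
pose E := [set u | exists2 x, dot x n = 0 & w' x = u].
have E0 : E (w' 0) by exists 0 => //; rewrite dot0l.
have on0 x : dot x n = 0 -> `|w' x| <= 2 * C0 * r'.
  move=> xn; have xr : cslab n r' x by rewrite /cslab /= xn lexx ltW.
  apply: (le_trans (hb' x xr)); rewrite xn subr0 (mulrC 2) -mulrA ler_pM2l //.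
  by move: r1 rr'; clear; lra.
have hE : has_sup E.
  split; first by exists (w' 0).
  by exists (2 * C0 * r') => u [x xn <-]; have := on0 x xn; rewrite ler_norml => /andP[].
pose S := sup E.
have wS x : dot x n = 0 -> w' x <= S by move=> xn; apply: sup_upper_bound => //; exists x.
have Sb : `|S| <= 2 * C0 * r'.
  rewrite ler_norml; apply/andP; split.
    by apply: le_trans (wS 0 (dot0l _)); have := on0 0 (dot0l _); rewrite ler_norml => /andP[].
  apply: sup_le_ub; first by exists (w' 0).
  by move=> u [x xn <-]; have := on0 x xn; rewrite ler_norml => /andP[].
have Sch (u : R) : `|u| <= ch -> `|S / r' * u| <= 2 * C0 * ch.
  move=> uc; rewrite normrM; apply: ler_pM => //.
  by rewrite normrM normfV (gtr0_norm r'0) ler_pdivrMr.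
have hsc (r2 : R) : continuous (fun x => S / r' * h x).
  move=> x; apply: (@continuousM _ _ (fun=> S / r') h); last exact: hc.
  exact: cst_continuous.
have hbd (r2 : R) : bounded_on (cslab n r2) (fun x => S / r' * h x).
  exists (`|S / r'| * (ch + `|r2|)) => x; rewrite /cslab /= => /andP[x1 x2].
  rewrite normrM ler_wpM2l //; have := hs x; have := ler_norm r2.
  by rewrite !ler_norml => h1 /andP[? ?]; apply/andP; split; lra.
pose Z x := w' x + S / r' * h x.
have Zle x : cslab n r' x -> Z x <= S + 2 * C0 * ch.
  apply: (harmonic_le n1 lam0 CB0 hAB ch0 hc hL hs r'0).
  - by apply: ctnD => //; apply: ctn_continuous; exact: hsc.
  - case: bw' => m1 h1; case: (hbd r') => m2 h2; exists (m1 + m2) => y yr.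
    by apply: (le_trans (ler_normD _ _)); apply: lerD; [exact: h1 | exact: h2].
  - by move=> y /Lw' L; have := genLD L (genLZ (S / r') (hL y)); rewrite mulr0 addr0.
  - move=> y yr; rewrite /Z (tw' _ yr) add0r.
    have -> : S / r' * h y = S + S / r' * (h y - dot y n) by rewrite yr; field; rewrite gt_eqF.
    by rewrite lerD2l; have := Sch _ (hs y); rewrite ler_norml => /andP[].
  move=> y y0; left; rewrite /Z; apply: lerD; first exact: wS.
  by have := Sch _ (hs y); rewrite y0 subr0 ler_norml => /andP[].
have low x : dot x n = r -> w' x <= S * (1 - r / r') + 4 * C0 * ch.
  move=> xn; have xr : cslab n r' x by rewrite /cslab /= xn rr' ltW.
  have := Zle x xr; rewrite /Z.
  have -> : S / r' * h x = S * (r / r') + S / r' * (h x - dot x n) by rewrite xn; field; rewrite gt_eqF.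
  by have := Sch _ (hs x); rewrite ler_norml => /andP[+ _]; clear; lra.
have sub : cslab n r `<=` cslab n r'.
  by move=> x; rewrite /cslab /= => /andP[-> h2]; exact: le_trans rr'.
have diff x : cslab n r x -> w' x - w x <= S * (1 - r / r') + 4 * C0 * ch.
  apply: (@harmonic_le n lam Lam CB CA gam ch A B h n1 lam0 CB0 hAB ch0 hc hL hs r _ (fun x => w' x - w x) r0).
  - by apply: ctnB => //; exact: ctn_sub sub cw'.
  - case: bw' => m1 h1; case: bw => m2 h2; exists (m1 + m2) => y yr.
    by apply: (le_trans (ler_normB _ _)); apply: lerD; [exact: h1 (sub _ yr) | exact: h2].
  - move=> y yr; have L : genL A B w' y 0.
      by apply: Lw'; case/andP: yr => y1 y2; rewrite /slab /= y1 (lt_le_trans y2).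
    by have := genLB L (Lw _ yr); rewrite subrr.
  - by move=> y yn; rewrite (tw _ yn) subr0; exact: low.
  move=> y y0; right => e e0; have e2 : 0 < e / 2 by pos.
  have [d1 d10 h1] := nw y y0 _ e2; have [d2 d20 h2] := nw' y y0 _ e2.
  exists (Num.min d1 d2) => [|t]; first by rewrite lt_min d10.
  rewrite lt_min => /andP[t0 /andP[t1 t2]].
  have := h1 t; rewrite t0 t1 => /(_ isT); have := h2 t; rewrite t0 t2 => /(_ isT).
  by rewrite !ler_norml; clear => /andP[? ?] /andP[? ?]; lra.
have Sle : S <= M * r + S * (1 - r / r') + 4 * C0 * ch.
  apply: sup_le_ub; first by exists (w' 0).
  move=> u [x xn <-]; have xr : cslab n r x by rewrite /cslab /= xn lexx ltW.
  by have := diff x xr; have := hM x xn; clear; lra.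
move=> x xn; apply: (le_trans (wS x xn)).
have -> : S = S * (r / r') * (r' / r) by field; rewrite !gt_eqF.
have -> : (M + (6 * C0 * ch + 1) / r) * r' = (M * r + (6 * C0 * ch + 1)) * (r' / r) by field; rewrite gt_eqF.
rewrite ler_pM2r; last by pos.
have : 0 <= C0 * ch by nng.
by move: Sle; clear; lra.
Qed.

(** A scale [r] with small boundary oscillation controls all larger scales through [scale_compare],
    applied to both signs, so the normalized boundary values converge. Inside the strip [W r] is
    compared with [L (r - h)]. *)
Lemma strip_limit (n : V) (lam Lam CB CA gam ch cX Cg : R) A B (X : 'I_D -> V -> R) (h : V -> R) g
    (W : R -> V -> R) :
  dot n n = 1 -> 0 < lam -> 0 <= Lam -> 0 <= CB -> 0 < CA -> 0 < gam < 1 ->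
  hcoefs lam Lam CB CA gam A B ->
  0 <= ch -> continuous h -> (forall x, genL A B h x 0) -> (forall x, `|h x - dot x n| <= ch) ->
  (forall l x, genL A B (X l) x 0) -> (forall l, continuous (X l)) ->
  (forall l x, `|X l x - x 0 l| <= cX) -> 0 <= cX ->
  zper A -> zper B -> zper g -> 0 <= Cg ->
  (forall e : R, 0 < e -> exists2 d : R, 0 < d & forall x y, en (x - y) <= d -> `|g x - g y| <= e) ->
  (forall x, `|g x| <= Cg) ->
  ~ (exists (c : R) (k : 'rV[int]_D), n = c *: map_mx intr k) ->
  (forall r, 0 < r -> strip_sol n A B g r (W r) /\ bounded_on (cslab n r) (W r)) ->
  exists L : R, forall eta : R, 0 < eta -> exists2 r0 : R, 0 < r0 & forall r, r0 <= r ->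
    forall x, cslab n r x -> `|W r x - L * (r - dot x n)| <= eta * r.
Proof.
move=> n1 lam0 Lam0 CB0 CA0 g01 hAB ch0 hc hL hs hX hXc hcX cX0 pA pB pg Cg0 gu hg irr hW.
have hg' x : `|- g x| <= Cg by rewrite normrN.
have [C C0 hcmp] := scale_compare n1 lam0 CB0 hAB ch0 hc hL hs Cg0 hg.
have [C' C'0 hcmp'] := scale_compare n1 lam0 CB0 hAB ch0 hc hL hs Cg0 hg'.
have close (eta : R) : 0 < eta -> exists2 r, 1 <= r & forall r', r <= r' ->
    forall x, dot x n = 0 -> `|W r' x / r' - W r 0 / r| <= eta.
  move=> eta0; have eta2 : 0 < eta / 2 by pos.
  have [r hr hosc] := boundary_osc n1 lam0 Lam0 CB0 CA0 g01 hAB ch0 hc hL hs hX hXc hcX cX0 pA pB pg Cg0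
    eta2 gu hg irr (1 + 2 * C / eta + 2 * C' / eta).
  have q1 : 0 <= 2 * C / eta by nng.
  have q2 : 0 <= 2 * C' / eta by nng.
  have r1 : 1 <= r by move: hr q1 q2; clear; lra.
  have r0 : 0 < r by apply: lt_le_trans r1.
  have [sw bw] := hW r r0.
  have Cr : C / r <= eta / 2.
    rewrite ler_pdivrMr //; have -> : C = eta / 2 * (2 * C / eta) by field; rewrite gt_eqF.
    by rewrite ler_pM2l //; move: hr q2; clear; lra.
  have C'r : C' / r <= eta / 2.
    rewrite ler_pdivrMr //; have -> : C' = eta / 2 * (2 * C' / eta) by field; rewrite gt_eqF.
    by rewrite ler_pM2l //; move: hr q1; clear; lra.
  exists r => // r' rr' x xn; have r'0 : 0 < r' by apply: lt_le_trans rr'.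
  have [sw' bw'] := hW r' r'0.
  have r01 : 1 <= r <= r' by rewrite r1.
  have up := hcmp r r' (W r 0 / r + eta / 2) _ _ r01 sw bw sw' bw' _ x xn.
  have dn := hcmp' r r' (- (W r 0 / r) + eta / 2) _ _ r01 (strip_opp sw) (bounded_onN bw)
    (strip_opp sw') (bounded_onN bw') _ x xn.
  have h1 : W r' x <= (W r 0 / r + eta / 2 + C / r) * r'.
    apply: up => y yn; have := hosc _ sw bw y 0 yn (dot0l _).
    have -> : (W r 0 / r + eta / 2) * r = W r 0 + eta / 2 * r by field; rewrite gt_eqF.
    by clear; lra.
  have h2 : - W r' x <= (- (W r 0 / r) + eta / 2 + C' / r) * r'.
    apply: dn => y yn; have := hosc _ sw bw 0 y (dot0l _) yn.
    have -> : (- (W r 0 / r) + eta / 2) * r = - W r 0 + eta / 2 * r by field; rewrite gt_eqF.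
    by clear; lra.
  rewrite -ler_pdivrMr // in h1; rewrite -ler_pdivrMr // mulNr in h2.
  rewrite ler_norml; apply/andP; split; move: h1 h2 Cr C'r; clear; lra.
(* The eventual lower bounds; their supremum is the lower limit of [W r 0 / r], which [close] turns
   into the limit. *)
pose E := [set l : R | exists r, forall r', r <= r' -> l <= W r' 0 / r'].
have d0 : dot (0 : V) n = 0 by exact: dot0l.
have Elow (eta r : R) : 0 < eta -> (forall r', r <= r' ->
    forall x, dot x n = 0 -> `|W r' x / r' - W r 0 / r| <= eta) ->
    E (W r 0 / r - eta) /\ ubound E (W r 0 / r + eta).
  move=> eta0 hr; split.
    by exists r => r' rr'; have := hr r' rr' 0 d0; rewrite ler_norml; clear => /andP[? ?]; lra.
  move=> l [r2 hl]; pose r3 := Num.max r r2.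
  have := hl r3; rewrite le_max lexx orbT => /(_ isT).
  have := hr r3; rewrite le_max lexx => /(_ isT 0 d0); rewrite ler_norml; clear => /andP[? ?] ?; lra.
have hE : has_sup E.
  have [r _ hr] := close 1 ltr01; have [h1 h2] := Elow 1 r ltr01 hr.
  by split; [exists (W r 0 / r - 1) | exists (W r 0 / r + 1)].
pose L := sup E; exists L => eta eta0.
have eta4 : 0 < eta / 4 by pos.
have [r r1 hr] := close _ eta4; have [h1 h2] := Elow _ r eta4 hr.
have L1 : W r 0 / r - eta / 4 <= L by apply: sup_upper_bound.
have L2 : L <= W r 0 / r + eta / 4 by apply: sup_le_ub => //; exists (W r 0 / r - eta / 4).
have q0 : 0 <= 4 * (`|L| * ch) / eta by nng.
exists (r + 4 * (`|L| * ch) / eta) => [|r' rr' x xr]; first by move: r1 q0; clear; lra.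
have r'r : r <= r' by move: rr' q0; clear; lra.
have r'0 : 0 < r' by move: r1 r'r; clear; lra.
have [sw bw] := hW r' r'0; have [cw Lw tw nw] := sw.
have Lch (y : V) : `|L * (h y - dot y n)| <= eta / 4 * r'.
  rewrite normrM; apply: (@le_trans _ _ (`|L| * ch)); first by apply: ler_wpM2l.
  have -> : `|L| * ch = eta / 4 * (4 * (`|L| * ch) / eta) by field; rewrite gt_eqF.
  by rewrite ler_pM2l //; move: rr' r1; clear; lra.
have bdry (y : V) : dot y n = 0 -> `|W r' y - L * r'| <= eta / 2 * r'.
  move=> yn; have h3 := hr r' r'r y yn.
  have -> : W r' y - L * r' = (W r' y / r' - L) * r' by field; rewrite gt_eqF.
  rewrite normrM (gtr0_norm r'0) ler_pM2r //.
  by move: h3 L1 L2; rewrite !ler_norml; clear => /andP[? ?] ? ?; apply/andP; split; lra.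
have hcl : continuous (fun y => L * (r' - h y)).
  move=> y; apply: (@continuousM _ _ (fun=> L) (fun y => r' - h y)); first exact: cst_continuous.
  by apply: (@continuousB _ _ _ (fun=> r') h); [exact: cst_continuous | exact: hc].
have bZ : bounded_on (cslab n r') (fun y => W r' y - L * (r' - h y)).
  case: bw => m1 hm; exists (m1 + `|L| * (r' + ch)) => y yr.
  apply: (le_trans (ler_normB _ _)); apply: lerD; first exact: hm.
  rewrite normrM; apply: ler_wpM2l => //; have := hs y; case/andP: yr => y1 y2.
  by move: y1 y2; rewrite !ler_norml; clear => ? ? /andP[? ?]; apply/andP; split; lra.
have cZ : ctn (cslab n r') (fun y => W r' y - L * (r' - h y)).
  by apply: ctnB => //; apply: ctn_continuous.
have LZ y : slab n r' y -> genL A B (fun y => W r' y - L * (r' - h y)) y 0.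
  move=> /Lw L3; have := genLB L3 (genLZ L (genLB (genL_cst A B r' y) (hL y))).
  by rewrite subr0 mulr0 subr0.
have eta34 : eta / 4 * r' <= 3 / 4 * eta * r' by rewrite ler_pM2r //; move: eta0; clear; lra.
have up := harmonic_le n1 lam0 CB0 hAB ch0 hc hL hs r'0 cZ bZ LZ.
have e1 y : dot y n = r' -> `|W r' y - L * (r' - h y)| <= 3 / 4 * eta * r'.
  move=> yn; rewrite (tw _ yn) sub0r normrN; apply: le_trans eta34.
  by have := Lch y; rewrite yn -normrN -mulrN opprB.
have e2 y : dot y n = 0 -> `|W r' y - L * (r' - h y)| <= 3 / 4 * eta * r'.
  move=> yn; have := Lch y; have := bdry y yn; rewrite yn subr0.
  have -> : W r' y - L * (r' - h y) = (W r' y - L * r') + L * h y by ring.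
  move=> h3 h4; apply: (le_trans (ler_normD _ _)); move: h3 h4; clear; lra.
have h3 : W r' x - L * (r' - h x) <= 3 / 4 * eta * r'.
  apply: up => // y yn; first by have := e1 y yn; rewrite ler_norml => /andP[].
  by left; have := e2 y yn; rewrite ler_norml => /andP[].
have h4 : - (W r' x - L * (r' - h x)) <= 3 / 4 * eta * r'.
  apply: (@harmonic_le n lam Lam CB CA gam ch A B h n1 lam0 CB0 hAB ch0 hc hL hs r' _
    (fun y => - (W r' y - L * (r' - h y))) r'0) => //.
  - by move=> y hy; apply: cvgN; exact: cZ.
  - exact: bounded_onN.
  - move=> y /LZ L3; have [p [H [j e]]] := genLZ (-1) L3; exists p, H; split; last by rewrite e mulr0.
    by refine (jet_eq j _ _ _) => // z; rewrite mulN1r.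
  - by move=> y yn; have := e1 y yn; rewrite ler_norml lerNl => /andP[].
  by move=> y yn; left; have := e2 y yn; rewrite ler_norml lerNl => /andP[].
have := Lch x; have -> : W r' x - L * (r' - dot x n) = (W r' x - L * (r' - h x)) - L * (h x - dot x n) by ring.
move: h3 h4; set P1 := W r' x - _; set P2 := L * _; clear.
by rewrite !ler_norml => ? ? /andP[? ?]; apply/andP; split; lra.
Qed.
End StripConvergence.

(** * Periodic data and rescaling *)

Section PeriodicData.
Context {R : realType} {D : nat}.
Set Implicit Arguments. Unset Strict Implicit.
Local Notation V := 'rV[R]_D.
Implicit Types (f w : V -> R) (x y z p : V) (j : 'rV[int]_D).

Lemma zperiodic_zper (T : Type) (f : V -> T) : zperiodic f -> zper f.
Proof.
move=> pf.
have pn (k : nat) x i : f (x + k%:R *: evec R i) = f x.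
  elim: k x => [|k IH] x; first by rewrite scale0r addr0.
  by rewrite mulrSr scalerDl scale1r addrA pf IH.
have pz (k : int) x i : f (x + k%:~R *: evec R i) = f x.
  case: k => k; first exact: pn.
  by rewrite NegzE mulrNz scaleNr -(pn k.+1 _ i) subrK.
move=> x j; have -> : zv R j = \sum_(i < D) (j 0 i)%:~R *: evec R i.
  by rewrite {1}[zv R j]rV_sum_evec; apply: eq_bigr => i _; rewrite mxE.
elim: (index_enum _) x => [|i s IH] x; first by rewrite big_nil addr0.
by rewrite big_cons addrA IH pz.
Qed.

Lemma zper_bounded f : zper f -> continuous f -> exists2 M : R, 0 <= M & forall x, `|f x| <= M.
Proof.
move=> pf cf; pose K : set V := [set y | en y <= D%:R].
have cK : compact K.
  apply: (@compact_closed_en _ _ _ 0 D%:R); last by move=> y; rewrite subr0.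
  by apply: closed_le_ctn; [exact: en_continuous | exact: cst_continuous].
have [||c _ hc] := @ctn_max R _ K (fun y => `|f y|) cK.
- by exists 0; rewrite /K /= en0.
- apply: ctn_comp; first exact: norm_continuous.
  exact: ctn_continuous.
exists `|f c| => // x; have [j [h _]] := integer_part x 0.
have -> : f x = f (x - zv R j) by rewrite -zvN pf.
by apply: hc; move: h; rewrite subr0.
Qed.

Lemma holder_en (gam : R) f : 0 < gam -> holder gam f ->
  exists2 C : R, 0 < C & forall x y, `|f x - f y| <= C * en (x - y) `^ gam.
Proof.
move=> g0 [C hC]; exists (`|C| + 1); first by rewrite ltr_wpDl.
move=> x y; apply: le_trans (hC x y) _.
have h1 : C <= `|C| + 1 by have := ler_norm C; lra.
apply: (@le_trans _ _ ((`|C| + 1) * `|x - y| `^ gam)).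
  by rewrite ler_wpM2r ?powR_ge0.
rewrite ler_wpM2l ?addr_ge0 //; apply: ge0_ler_powR; rewrite ?nnegrE ?en_ge0 ?(ltW g0) //.
exact: norm_le_en.
Qed.

Lemma holder_uniform (gam : R) f : 0 < gam -> holder gam f -> forall e : R, 0 < e ->
  exists2 d : R, 0 < d & forall x y, en (x - y) <= d -> `|f x - f y| <= e.
Proof.
move=> g0 /(holder_en g0) [C C0 hC] e e0.
exists ((e / C) `^ gam^-1); first by rewrite powR_gt0 // divr_gt0.
move=> x y h; apply: le_trans (hC x y) _; rewrite mulrC -ler_pdivlMr //.
have -> : e / C = ((e / C) `^ gam^-1) `^ gam.
  by rewrite -powRrM mulVf ?gt_eqF // powRr1 // divr_ge0 // ltW.
by apply: ge0_ler_powR; rewrite ?nnegrE ?en_ge0 ?powR_ge0 ?(ltW g0).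
Qed.

Lemma holder_continuous (gam : R) f : 0 < gam -> holder gam f -> continuous f.
Proof.
move=> g0 hf; apply: continuous_eps => x e e0.
have [d d0 h] := holder_uniform g0 hf e0.
by exists d => // y yx; apply: h; exact: ltW.
Qed.

Lemma finite_common_bound (T : finType) (P : T -> R -> Prop) :
  (forall i, exists2 C : R, 0 <= C & P i C) ->
  (forall i C C', P i C -> C <= C' -> P i C') ->
  exists2 C : R, 0 <= C & forall i, P i C.
Proof.
move=> h mono; have h' i : exists C : R, 0 <= C /\ P i C by have [C ? ?] := h i; exists C.
have [c hc] := choice h'; exists (\sum_i c i).
  by apply: sumr_ge0 => i _; case: (hc i).
move=> i; apply: mono (hc i).2 _; rewrite (bigD1 i) //= lerDl.
by apply: sumr_ge0 => k _; case: (hc k).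
Qed.

Lemma C2_jet (U : set V) w x : open U -> C2_on U w -> U x ->
  jet w x (grad w x) (\matrix_(i, j) pd j (pd i w) x).
Proof.
move=> oU [dw _] Ux; have /nbhs_enP [r r0 hr] : nbhs x U by apply: open_nbhs_nbhs.
have h1 y : en (y - x) < r -> differentiable w y by move=> /hr /dw [].
exact: jet_differentiable r0 h1 (dw x Ux).2.
Qed.

(** [Lop] and the Hessian of the jet take the partial derivatives in opposite orders; the symmetry
    of [A] absorbs the exchange. *)
Lemma Lop_tr2 (A : V -> 'M[R]_D) (B : V -> V) w x : (A x)^T = A x ->
  Lop A B w x = tr2 (A x) (\matrix_(i, j) pd j (pd i w) x) + dot (B x) (grad w x).
Proof.
move=> sA; rewrite /Lop /tr2 exchange_big /=; congr (_ + _).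
  apply: eq_bigr => i _; apply: eq_bigr => k _; rewrite mxE.
  by rewrite -{1}sA mxE.
by apply: eq_bigr => i _; rewrite mxE.
Qed.

Lemma genL_Lop (U : set V) (A : V -> 'M[R]_D) (B : V -> V) w x : open U -> C2_on U w -> U x ->
  (A x)^T = A x -> genL A B w x (Lop A B w x).
Proof.
move=> oU hw Ux sA; exists (grad w x), (\matrix_(i, j) pd j (pd i w) x).
by rewrite Lop_tr2 //; split => //; exact: (C2_jet oU).
Qed.

Lemma C2_continuous w : C2_on setT w -> continuous w.
Proof. by move=> [dw _] x; apply: differentiable_continuous; exact: (dw x I).1. Qed.

Lemma slab_open (n : V) (r : R) : open (slab n r).
Proof.
have -> : slab n r = dot n @^-1` `]0, r[%classic.
  by apply/seteqP; split => x; rewrite /slab /= in_itv /= dotC.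
by apply: open_comp => // x _; exact: dot_continuous.
Qed.

Lemma normal_deriv_eqP (n : V) w x (a : R) : normal_deriv_eq n w x a <-> nderiv_eq n w x a.
Proof.
split.
  move=> /cvgrPdist_le h e e0; have [dl dl0 hd] := h e e0; exists dl => // t /andP[t0 td].
  have := hd t; rewrite /= sub0r normrN gtr0_norm // => /(_ td t0).
  have -> : a - (w (x + t *: n) - w x) / t = - ((w (x + t *: n) - w x - a * t) / t).
    by field; rewrite gt_eqF.
  by rewrite normrN normrM normfV (gtr0_norm t0) ler_pdivrMr.
move=> h; apply/cvgrPdist_le => e e0; have [dl dl0 hd] := h e e0.
exists dl => //= t; rewrite /= sub0r normrN => td t0; rewrite gtr0_norm // in td.
have -> : a - (w (x + t *: n) - w x) / t = - ((w (x + t *: n) - w x - a * t) / t).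
  by field; rewrite gt_eqF.
by rewrite normrN normrM normfV (gtr0_norm t0) ler_pdivrMr //; apply: hd; rewrite t0.
Qed.

End PeriodicData.

Section Rescaling.
Context {R : realType} {D : nat}.
Set Implicit Arguments. Unset Strict Implicit.
Local Notation V := 'rV[R]_D.
Implicit Types (w : V -> R) (x y z p : V).

Lemma rescaled_strip_sol (n : V) (A : V -> 'M[R]_D) (B : V -> V) (g u : V -> R) (r : R) : 0 < r ->
  (forall y, (A y)^T = A y) ->
  bdd_classical_sol n (fun x => A (r *: x)) (fun x => r *: B (r *: x)) (fun x => g (r *: x)) u ->
  strip_sol n A B g r (fun y => r * u (r^-1 *: y)) /\
  bounded_on (cslab n r) (fun y => r * u (r^-1 *: y)).
Proof.
move=> r0 sA [C2u [cu [[M hM] [Lu [u1 u0]]]]]; have ri0 : 0 < r^-1 by rewrite invr_gt0.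
have rr y : r *: (r^-1 *: y) = y by rewrite scalerA divff ?gt_eqF // scale1r.
have dr y : dot (r^-1 *: y) n = dot y n / r by rewrite dotZl mulrC.
have cs y : cslab n r y -> cslab n 1 (r^-1 *: y).
  move=> /andP[y0 y1]; rewrite /cslab /= dr ler_pdivrMr // mul1r y1 andbT.
  by rewrite divr_ge0 // ltW.
split; last first.
  exists (r * M) => y /cs /hM h; rewrite normrM gtr0_norm // ler_pM2l //.
split.
- apply: (@ctnM _ _ _ (fun=> r)); first exact: ctn_cst.
  apply: (@ctn_pre _ _ _ _ (cslab n 1) (fun y => r^-1 *: y)) => //; last exact/ctnP.
  exact: scaler_continuous.
- move=> y /andP[y0 y1]; have sy : slab n 1 (r^-1 *: y).
    by rewrite /slab /= dr divr_gt0 //= ltr_pdivrMr // mul1r.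
  have := genL_Lop (A := fun x => A (r *: x)) (fun x => r *: B (r *: x)) (@slab_open _ _ n 1) C2u sy (sA _).
  rewrite Lu // => -[p [H [jp]]]; rewrite rr => E.
  rewrite -[_ *: y]add0r in jp.
  exists (r *: (r^-1 *: p)), (r *: (r^-1 ^+ 2 *: H)); split.
    have := jetZ r (jet_subst jp); set F := fun _ => _; set G := fun _ => _.
    by rewrite (_ : F = G) // /F /G; apply/funext => z; rewrite add0r.
  rewrite rr tr2Zr tr2Zr -[RHS](mulr0 r^-1) -[in RHS]E dotZl.
  by field; rewrite gt_eqF.
- move=> y yr; rewrite u1 ?mulr0 // /hplane /= dr yr divff // gt_eqF //.
move=> y y0; have h0 : hplane n 0 (r^-1 *: y) by rewrite /hplane /= dr y0 mul0r.
have /normal_deriv_eqP := u0 _ h0; rewrite rr => hd e e0.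
have [dl dl0 h] := hd e e0; exists (r * dl); first exact: mulr_gt0.
move=> t /andP[t0 td]; have tr : 0 < t / r < dl.
  by rewrite divr_gt0 //= ltr_pdivrMr // mulrC.
have := h _ tr; rewrite scalerDr scalerA (mulrC _ t) => h1.
have -> : r * u (r^-1 *: y + t / r *: n) - r * u (r^-1 *: y) - g y * t =
   r * (u (r^-1 *: y + t / r *: n) - u (r^-1 *: y) - g y * (t / r)).
  by field; rewrite gt_eqF.
rewrite normrM gtr0_norm // (le_trans (ler_wpM2l (ltW r0) h1)) //.
by rewrite (_ : r * _ = e * t) //; field; rewrite gt_eqF.
Qed.

Lemma holder_hcoefs (lam Lam gam : R) (A : V -> 'M[R]_D) (B : V -> V) : 0 < gam ->
  zperiodic B -> (forall y, (A y)^T = A y) ->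
  (forall i j, holder gam (fun y => A y i j)) -> (forall i, holder gam (fun y => B y 0 i)) ->
  (forall y (xi : V), lam * dot xi xi <= (xi *m A y *m xi^T) 0 0 <= Lam * dot xi xi) ->
  exists CB CA : R, [/\ 0 <= CB, 0 < CA & hcoefs lam Lam CB CA gam A B].
Proof.
move=> g0 pB sA hA hB eA.
have [CB CB0 hCB] : exists2 C : R, 0 <= C & forall i x, `|B x 0 i| <= C.
  apply: (@finite_common_bound _ _ (fun (i : 'I_D) C => forall x, `|B x 0 i| <= C)) => [i | i C C' h CC x].
    apply: zper_bounded (holder_continuous g0 (hB i)).
    by apply: zperiodic_zper => x k; rewrite pB.
  exact: le_trans CC.
have [CA CA0 hCA] : exists2 C : R, 0 <= C & forall ij x y,
    `|A x ij.1 ij.2 - A y ij.1 ij.2| <= C * en (x - y) `^ gam.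
  apply: (@finite_common_bound _ ('I_D * 'I_D)%type (fun ij C => forall x y,
    `|A x ij.1 ij.2 - A y ij.1 ij.2| <= C * en (x - y) `^ gam)) => [ij | ij C C' h CC x y].
    by have [C C0 h] := holder_en g0 (hA ij.1 ij.2); exists C => //; exact: ltW.
  by apply: (le_trans (h x y)); rewrite ler_wpM2r ?powR_ge0.
have D0 : 0 <= D%:R :> R by [].
exists (D%:R * CB), (D%:R * (D%:R * CA) + 1); split; [by nng | by apply: ltr_wpDl; nng | ].
split.
  move=> x; split; last by apply: en_le_coord => i.
  split; [exact: sA | exact: eA].
move=> x y z; rewrite -qfNl -qfDl qfE.
apply: (@le_trans _ _ (\sum_(i < D) \sum_(j < D) CA * en (x - y) `^ gam * dot z z)).
  apply: ler_sum => i _; apply: ler_sum => j _; rewrite (le_trans (ler_norm _)) // normrM.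
  apply: ler_pM; rewrite ?normr_ge0 //.
    by rewrite !mxE; exact: (hCA (i, j)).
  by rewrite normrM -en_sq expr2 ler_pM ?coord_le_en.
have Pz := mulr_ge0 (powR_ge0 (en (x - y)) gam) (dotxx_ge0 z).
rewrite sumr_const sumr_const card_ord -[leLHS]mulr_natl -[X in _ * X <= _]mulr_natl mulrA.
rewrite [leRHS](_ : _ = D%:R * D%:R * (CA * en (x - y) `^ gam * dot z z) +
  en (x - y) `^ gam * dot z z); last by ring.
by rewrite !mulrA lerDl.
Qed.

(** An affine function vanishing on [x.n = 1] depends on the height alone, and its slope is read off
    the normal derivative at the origin. *)
Lemma affine_dot (n : V) (ubar : V -> R) (a : R) : dot n n = 1 -> affine ubar ->
  (forall x, hplane n 1 x -> ubar x = 0) ->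
  (forall x, hplane n 0 x -> normal_deriv_eq n ubar x a) ->
  ubar = fun x => a * (dot x n - 1).
Proof.
move=> n1 [c [p hp]] u1 u0.
have Eu x : ubar x = c + dot p n * dot x n.
  pose q := x - dot x n *: n + n.
  have : ubar q = 0.
    by apply: u1; rewrite /hplane /q /= !dotE n1 mulr1 subrr add0r.
  have : ubar n = 0 by apply: u1; rewrite /hplane /= n1.
  rewrite !hp /q !dotE; lra.
have pn : dot p n = a.
  have /normal_deriv_eqP h : normal_deriv_eq n ubar 0 a by apply: u0; rewrite /hplane /= dot0l.
  apply/eqP; rewrite -subr_eq0 -normr_le0; apply/ler_addgt0Pr => e e0; rewrite add0r.
  have [dl dl0 hd] := h e e0.
  have t0 : 0 < dl / 2 by rewrite divr_gt0.
  have td : 0 < dl / 2 < dl by rewrite t0 /=; lra.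
  have := hd _ td; rewrite !Eu !dotE n1.
  have -> : c + dot p n * (0 + dl / 2 * 1) - (c + dot p n * 0) - a * (dl / 2) =
    (dot p n - a) * (dl / 2) by lra.
  by rewrite normrM (gtr0_norm t0) ler_pM2r.
apply/funext => x; have := u1 n; rewrite /hplane /= => /(_ n1).
rewrite !Eu pn n1; lra.
Qed.

Lemma nderiv_eq_affine (n : V) (a x : _) : dot n n = 1 ->
  nderiv_eq n (fun x : V => a * (dot x n - 1)) x a.
Proof.
move=> n1 e e0; exists 1 => // t /andP[t0 _].
have -> : a * (dot (x + t *: n) n - 1) - a * (dot x n - 1) - a * t = 0.
  by rewrite !dotE n1; lra.
by rewrite normr0 mulr_ge0 // ltW.
Qed.

Lemma pd_affine (n : V) (a : R) (i j : 'I_D) x :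
  pd i (pd j (fun x : V => a * (dot x n - 1))) x = 0.
Proof.
have -> : pd j (fun x : V => a * (dot x n - 1)) = fun=> a * n 0 j.
  apply/funext => y; rewrite /pd /derive; apply: cvg_lim => //.
  apply: (@cvg_trans _ ((fun=> a * n 0 j) @ 0^')); last exact: cvg_cst.
  apply: near_eq_cvg; near=> h.
  have h0 : h != 0 by near: h; exact: nbhs_dnbhs_neq.
  rewrite /= /GRing.scale /= !dotE (dotC (evec R j)) dot_evec; field; exact: h0.
by rewrite /pd derive_cst.
Unshelve. all: by end_near.
Qed.

End Rescaling.

(** The operator sends the coordinate [y_l] to [B^l], which the corrector equation cancels. *)
Lemma corrector_coordinate {R : realType} {D : nat} (A : 'rV[R]_D -> 'M[R]_D) B (l : 'I_D) chi :
  (forall y, (A y)^T = A y) -> C2_on setT chi -> (forall y, Lop A B chi y = - B y 0 l) ->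
  forall x, genL A B (fun y => y 0 l + chi y) x 0.
Proof.
move=> sA hc hL x.
have := genLD (genL_dot A B (evec R l) x) (genL_Lop (A := A) B openT hc I (sA x)).
rewrite hL dot_evec subrr => -[p [H [j E]]]; exists p, H; split => //.
by refine (jet_eq j _ _ _) => // y; rewrite dotC dot_evec.
Qed.

Theorem theorem1p1 (R : realType) (d : nat) (hd : (1 <= d)%N)
  (n : 'rV[R]_d.+1)
  (hn_unit : dot n n = 1)
  (hn_irr : ~ exists (c : R) (k : 'rV[int]_d.+1), n = c *: map_mx intr k)
  (gam lam Lam : R) (hgam : 0 < gam < 1) (hlam : 0 < lam) (hlamLam : lam <= Lam)
  (A : 'rV[R]_d.+1 -> 'M[R]_d.+1) (B : 'rV[R]_d.+1 -> 'rV[R]_d.+1)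
  (g : 'rV[R]_d.+1 -> R)
  (hA_per : zperiodic A) (hA_sym : forall y, (A y)^T = A y)
  (hA_hol : forall i j, holder gam (fun y => A y i j))
  (hA_ell : forall y (xi : 'rV[R]_d.+1),
     lam * dot xi xi <= (xi *m A y *m xi^T) 0 0 <= Lam * dot xi xi)
  (hB_per : zperiodic B) (hB_hol : forall i, holder gam (fun y => B y 0 i))
  (hg_per : zperiodic g) (hg_hol : holder gam g)
  (* (d+1)-dimensional Lebesgue measure *)
  (lebm : {measure set (RnB R d.+1) -> \bar R}) (hleb : is_lebesgue lebm)
  (* the invariant measure m *)
  (m : 'rV[R]_d.+1 -> R)
  (hm_per : zperiodic m) (hm_pos : forall y, 0 < m y)
  (hm_meas : measurable_fun (@cube R d.+1 : set (RnB R d.+1)) m)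
  (hm_L2 : (\int[lebm]_(y in (@cube R d.+1 : set (RnB R d.+1))) ((m y) ^+ 2)%:E
             < +oo)%E)
  (hm_int : Rintegral lebm (@cube R d.+1 : set (RnB R d.+1)) m = 1)
  (hm_inv : forall phi : 'rV[R]_d.+1 -> R,
     zperiodic phi -> C2_on setT phi -> (exists M, forall y, `|phi y| <= M) ->
     Rintegral lebm (@cube R d.+1 : set (RnB R d.+1))
       (fun y => m y * Lop A B phi y) = 0)
  (* centering condition *)
  (hcenter : forall l, Rintegral lebm (@cube R d.+1 : set (RnB R d.+1))
       (fun y => B y 0 l * m y) = 0)
  (* correctors chi^l : zperiodic solutions of L chi^l = - B^l *)
  (chi : 'I_d.+1 -> 'rV[R]_d.+1 -> R)
  (hchi_per : forall l, zperiodic (chi l))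
  (hchi_C2 : forall l, C2_on setT (chi l))
  (hchi_eq : forall l y, Lop A B (chi l) y = - B y 0 l)
  (* the homogenized matrix *)
  (Abar : 'M[R]_d.+1)
  (hAbar : forall a b, Abar a b =
     Rintegral lebm (@cube R d.+1 : set (RnB R d.+1))
       (fun y => (A y a b
          + \sum_(p < d.+1) (A y p a * pd p (chi b) y + A y p b * pd p (chi a) y)
          + 2^-1 * (B y 0 a * chi b y + B y 0 b * chi a y)) * m y))
  (* u^eps : the bounded classical solutions *)
  (u : R -> 'rV[R]_d.+1 -> R)
  (hu : forall eps : R, 0 < eps ->
     bdd_classical_sol n (fun x => A (eps^-1 *: x)) (fun x => eps^-1 *: B (eps^-1 *: x))
       (fun x => g (eps^-1 *: x)) (u eps)) :
  exists! gbar : R,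
    let is_ubar := fun ubar : 'rV[R]_d.+1 -> R =>
      affine ubar /\
      (forall x, slab n 1 x ->
         \sum_(i < d.+1) \sum_(j < d.+1) Abar i j * pd i (pd j ubar) x = 0) /\
      (forall x, hplane n 1 x -> ubar x = 0) /\
      (forall x, hplane n 0 x -> normal_deriv_eq n ubar x gbar) in
    (exists! ubar, is_ubar ubar) /\
    forall ubar, is_ubar ubar ->
      forall eta : R, 0 < eta -> exists delta : R, 0 < delta /\
        forall eps : R, 0 < eps < delta ->
          forall x, cslab n 1 x -> `|u eps x - ubar x| < eta.

Proof.
have n1 := hn_unit.
have g0 : 0 < gam by case/andP: hgam.
have Lam0 : 0 <= Lam by apply: le_trans hlamLam; exact: ltW.
have [CB [CA [CB0 CA0 hAB]]] := holder_hcoefs g0 hB_per hA_sym hA_hol hB_hol hA_ell.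
have pchi l := zperiodic_zper (hchi_per l).
have cchi l := C2_continuous (hchi_C2 l).
have [cX cX0 hcX] : exists2 C : R, 0 <= C & forall l x, `|chi l x| <= C.
  apply: (@finite_common_bound _ _ (fun l C => forall x, `|chi l x| <= C)) => [l | l C C' h CC x].
    exact: zper_bounded (pchi l) (cchi l).
  exact: le_trans CC.
pose X (l : 'I_d.+1) (x : 'rV[R]_d.+1) : R := x 0 l + chi l x.
have LX l x : genL A B (X l) x 0 by apply: corrector_coordinate (hchi_C2 l) (hchi_eq l) x.
have cXc l : continuous (X l).
  have -> : X l = fun x => dot (evec R l) x + chi l x.
    by apply/funext => x; rewrite dotC dot_evec.
  move=> x; apply: (@continuousD _ _ _ (dot (evec R l))); [exact: dot_continuous | exact: cchi].
have hX l x : `|X l x - x 0 l| <= cX by rewrite /X addrC addKr.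
pose h (x : 'rV[R]_d.+1) : R := \sum_l n 0 l * X l x.
have Lh x : genL A B h x 0 by apply: genL_lincomb.
have ch : continuous h by apply: lincomb_continuous.
pose c := \sum_l `|n 0 l| * cX.
have hh x : `|h x - dot x n| <= c.
  rewrite /h dotC /dot -sumrB (le_trans (ler_norm_sum _ _ _)) //; apply: ler_sum => l _.
  by rewrite -mulrBr normrM ler_wpM2l.
have c0 : 0 <= c by apply: sumr_ge0 => l _; rewrite mulr_ge0.
have [Cg Cg0 hCg] := zper_bounded (zperiodic_zper hg_per) (holder_continuous g0 hg_hol).
pose W (r : R) (y : 'rV[R]_d.+1) : R := r * u r^-1 (r^-1 *: y).
have hW r : 0 < r -> strip_sol n A B g r (W r) /\ bounded_on (cslab n r) (W r).
  move=> r0; have := hu r^-1; rewrite invr_gt0 invrK => /(_ r0).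
  exact: rescaled_strip_sol.
have [L hL] := strip_limit n1 hlam Lam0 CB0 CA0 hgam hAB c0 ch Lh hh LX cXc hX cX0
  (zperiodic_zper hA_per) (zperiodic_zper hB_per) (zperiodic_zper hg_per) Cg0
  (holder_uniform g0 hg_hol) hCg hn_irr hW.
pose U (a : R) (x : 'rV[R]_d.+1) : R := a * (dot x n - 1).
have hU a : [/\ affine (U a),
    forall x, slab n 1 x -> \sum_(i < d.+1) \sum_(j < d.+1) Abar i j * pd i (pd j (U a)) x = 0,
    forall x, hplane n 1 x -> U a x = 0 &
    forall x, hplane n 0 x -> normal_deriv_eq n (U a) x a].
  split.
  - by exists (- a), (a *: n) => x; rewrite /U dotZl (dotC n); ring.
  - move=> x _; apply: big1 => i _; apply: big1 => j _.
    by rewrite pd_affine mulr0.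
  - by move=> x xn; rewrite /U xn subrr mulr0.
  by move=> x _; apply/normal_deriv_eqP; exact: nderiv_eq_affine.
(* Scaling [L (r - y.n)] back with [r = 1 / eps] gives [L (1 - x.n)], whose normal derivative is
   [- L]; hence the value of [gbar]. *)
have uU (eta : R) : 0 < eta -> exists delta : R, 0 < delta /\ forall eps : R, 0 < eps < delta ->
    forall x, cslab n 1 x -> `|u eps x - U (- L) x| < eta.
  move=> eta0; have [|r0 r00 hr] := hL (eta / 2); first by rewrite divr_gt0.
  exists r0^-1; split; first by rewrite invr_gt0.
  move=> eps /andP[e0 er] x xn; have ei0 : 0 < eps^-1 by rewrite invr_gt0.
  have rle : r0 <= eps^-1 by rewrite -[r0]invrK lef_pV2 ?posrE ?invr_gt0 // ltW.
  have xe : cslab n eps^-1 (eps^-1 *: x).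
    move: xn => /andP[x0 x1]; rewrite /cslab /= dotZl mulr_ge0 ?(ltW ei0) //=.
    by rewrite ler_piMr ?(ltW ei0).
  have := hr _ rle _ xe; rewrite /W invrK scalerA divff ?gt_eqF // scale1r dotZl.
  have -> : eps^-1 * u eps x - L * (eps^-1 - eps^-1 * dot x n) = eps^-1 * (u eps x - U (- L) x).
    by rewrite /U; ring.
  rewrite normrM (gtr0_norm ei0) mulrC ler_pM2r // => hx; apply: le_lt_trans hx _; lra.
have huniq a ubar : affine ubar -> (forall x, hplane n 1 x -> ubar x = 0) ->
    (forall x, hplane n 0 x -> normal_deriv_eq n ubar x a) -> ubar = U a.
  exact: affine_dot.
exists (- L); split.
  have [hU1 hU2 hU3 hU4] := hU (- L); split.
    exists (U (- L)); split; first by do !split.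
    by move=> v [v1 [_ [v3 v4]]]; rewrite (huniq _ _ v1 v3 v4).
  by move=> v [v1 [_ [v3 v4]]]; rewrite (huniq _ _ v1 v3 v4).
(* Uniqueness: at the origin [u eps] would converge both to [L] and to [- a]. *)
move=> a [_ ha]; have [hU1 hU2 hU3 hU4] := hU a.
have {}ha := ha (U a) (conj hU1 (conj hU2 (conj hU3 hU4))).
have s0 : cslab n 1 0 by rewrite /cslab /= dot0l lexx ler01.
apply/eqP; rewrite -subr_eq0 -normr_le0; apply/ler_addgt0Pr => e e0; rewrite add0r.
have e2 : 0 < e / 2 by rewrite divr_gt0.
have [d1 [d10 h1]] := uU _ e2; have [d2 [d20 h2]] := ha _ e2.
have [eps heps] : exists eps, 0 < eps /\ eps < d1 /\ eps < d2.
  exists (Num.min d1 d2 / 2); have m0 : 0 < Num.min d1 d2 by rewrite lt_min d10.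
  have hm : Num.min d1 d2 / 2 < Num.min d1 d2 by lra.
  by rewrite divr_gt0 //; split=> //; split; apply: (lt_le_trans hm); rewrite ge_min lexx ?orbT.
have [p0 [p1 p2]] := heps.
have := h1 eps _ 0 s0; rewrite p0 p1 => /(_ isT).
have := h2 eps _ 0 s0; rewrite p0 p2 => /(_ isT).
rewrite /U dot0l !ltr_norml => /andP[? ?] /andP[? ?].
by rewrite ler_norml; apply/andP; split; lra.
Qed.
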